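(* Let $k\ge 1$ be odd and let $\mathcal T$ be a triangulation of $\Omega$. There is a constant $C>0$ depending only on $k$ and the shape-regularity constant $\gamma_{\mathcal T}$ such that for every admissible refinement $\widehat{\mathcal T}\in\mathbb T(\mathcal T)$ and every $f\in L^2(\Omega)$ the following holds. Let $u_h\in \mathrm{CR}_{k,0}(\mathcal T)$ and $\widehat u_h\in \mathrm{CR}_{k,0}(\widehat{\mathcal T})$ be the discrete solutions of $$\int_\Omega \nabla_{\mathcal T}u_h\cdot\nabla_{\mathcal T}v_h=\int_\Omega f v_h\quad\forall v_h\in \mathrm{CR}_{k,0}(\mathcal T),\qquad \int_\Omega \nabla_{\widehat{\mathcal T}}\widehat u_h\cdot\nabla_{\widehat{\mathcal T}}\widehat v_h=\int_\Omega f\widehat v_h\quad\forall \widehat v_h\in \mathrm{CR}_{k,0}(\widehat{\mathcal T}).$$ Then $$\|\nabla_{\widehat{\mathcal T}}\widehat u_h-\nabla_{\mathcal T}u_h\|_{L^2(\Omega)}\le C\,\eta(u_h;\mathcal R^1,f),$$ where $\mathcal R:=\mathcal T\setminus\widehat{\mathcal T}$ and $\mathcal R^1:=\{K\in\mathcal T: K\cap K'\neq\emptyset\text{ for some }K'\in\mathcal R\}$.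
   Context: $\Omega\subseteq\mathbb R^2$ is a bounded open polygonal Lipschitz domain. A triangulation $\mathcal T$ of $\Omega$ is a finite set of closed triangles covering $\overline\Omega$ that is conforming: two distinct triangles intersect in a common edge, a common vertex, or not at all. $h_K$ is the diameter of $K$, $|K|$ its area, $\rho_K$ the diameter of its largest inscribed ball, and $\gamma_{\mathcal T}:=\max_{K\in\mathcal T}h_K/\rho_K$. $\mathcal E(K)$ is the set of edges of $K$, $\mathcal E(\mathcal T)$ the set of all edges, $\mathcal E_{\partial\Omega}(\mathcal T)$ the edges contained in $\partial\Omega$, $\mathcal E_\Omega(\mathcal T)$ the remaining (interior) edges, and $\mathcal E_\Omega(K)=\mathcal E(K)\cap\mathcal E_\Omega(\mathcal T)$. Each triangle of $\mathcal T$ has a designated newest vertex. Newest vertex bisection (NVB) of a triangle joins its newest vertex to the midpoint of the opposite edge; that midpoint becomes the newest vertex of both children. $\mathbb T(\mathcal T)$ is the set of (conforming) triangulations obtained from $\mathcal T$ by finitely many newest vertex bisections. Each edge $E$ has a fixed ordering $\mathbf z_0,\mathbf z_1$ of its endpoints; $\mathbf t_E=(\mathbf z_1-\mathbf z_0)/|E|$ and $\mathbf n_E=(-t_{E,2},t_{E,1})^T$; for boundary edges the ordering is such that $\mathbf n_E$ is exterior to $\Omega$. For an interior edge, $K_L,K_R$ are the two adjacent triangles with $\mathbf n_E$ pointing into $K_R$; for a boundary edge, $K_L$ is the adjacent triangle. The jump is $[v]_E=v|_{K_L}|_E-v|_{K_R}|_E$ for interior $E$ and $[v]_E=v|_{K_L}|_E$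 for boundary $E$ (componentwise for vector fields). $H^1(\mathcal T)$ is the space of $v\in L^2(\Omega)$ whose restriction to the interior of every $K\in\mathcal T$ is in $H^1$; $\nabla_{\mathcal T}$ is the piecewise gradient. $\mathbb P_k$ denotes polynomials of total degree at most $k$, and $\mathbb P_k(\mathcal T)$ the functions that are in $\mathbb P_k(K)$ on every $K\in\mathcal T$. $\mathrm{CR}_{k,0}(\mathcal T)$ is the space of $v\in\mathbb P_k(\mathcal T)$ such that $[v]_E$ is $L^2(E)$-orthogonal to $\mathbb P_{k-1}(E)$ for all $E\in\mathcal E(\mathcal T)$ (interior and boundary). For $v\in\mathbb P_k(\mathcal T)$, $f\in L^2(\Omega)$, $K\in\mathcal T$ and $\mathcal S\subseteq\mathcal T$: $$\mu(v;K,f)^2=|K|\,\|f+\Delta v\|_{L^2(K)}^2+|K|^{1/2}\sum_{E\in\mathcal E_\Omega(K)}\|[\nabla_{\mathcal T}v]_E\cdot\mathbf n_E\|_{L^2(E)}^2,$$ $$\nu(v;K)^2=|K|^{1/2}\sum_{E\in\mathcal E(K)}\|[\nabla_{\mathcal T}v]_E\cdot\mathbf t_E\|_{L^2(E)}^2,$$ $\eta(v;K,f)^2=\mu(v;K,f)^2+\nu(v;K)^2$ and $\eta(v;\mathcal S,f)^2=\sum_{K\in\mathcal S}\eta(v;K,f)^2$. *)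

(* Defs.v *)
From HB Require Import structures.
From mathcomp Require Import all_boot all_order all_algebra.
From mathcomp Require Import finmap.
From mathcomp Require Import all_classical all_reals all_analysis.
Import numFieldNormedType.Exports.
Import Order.TTheory GRing.Theory Num.Theory.

Set Implicit Arguments.
Unset Strict Implicit.
Unset Printing Implicit Defensive.

Local Open Scope classical_set_scope.
Local Open Scope ring_scope.

Section Plane.
Variable R : realType.

Definition pt : Type := (R * R)%type.

(* The library norm on a product is the maximum norm, hence an explicit
   Euclidean norm. *)
Definition dot (x y : pt) : R := x.1 * y.1 + x.2 * y.2.
Definition norm2 (x : pt) : R := Num.sqrt (dot x x).
Definition det2 (x y : pt) : R := x.1 * y.2 - x.2 * y.1.
Definition rot90 (x : pt) : pt := (- x.2, x.1).
Definition midpt (a b : pt) : pt := 2^-1 *: (a + b).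

Definition hull (V : {fset pt}) : set pt :=
  [set x | exists w : pt -> R, [/\ forall z, 0 <= w z,
     \sum_(z <- V) w z = 1 & x = \sum_(z <- V) w z *: z]].

Definition bdry (A : set pt) : set pt := closure A `\` A°.

Definition leb2 : {measure set (measurableTypeR R * measurableTypeR R) -> \bar R} :=
  (@lebesgue_measure R \x @lebesgue_measure R)%E.

Definition intg (A : set pt) (g : pt -> R) : R := Rintegral leb2 A g.

Definition area (A : set pt) : R := fine (leb2 A).

Definition diam (A : set pt) : R :=
  sup [set norm2 (xy.1 - xy.2) | xy in A `*` A].

(* Diameter of the largest disc contained in [A]. *)
Definition indiam (A : set pt) : R :=
  sup [set 2 * r | r in [set r | 0 <= r /\
    exists c, [set x | norm2 (x - c) <= r] `<=` A]].

(* [f] represents an element of L^2(A). *)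
Definition L2 (A : set pt) (f : pt -> R) : Prop :=
  measurable_fun (A : set (measurableTypeR R * measurableTypeR R)) f /\
  leb2.-integrable A (fun x => (f x ^+ 2)%:E).

(* Near each boundary point, in the orthonormal frame ([- rot90 e], [e]),
   the set is the strict epigraph of a Lipschitz function. *)
Definition lipschitz_bdry (Omega : set pt) : Prop :=
  forall x, bdry Omega x -> exists e : pt, exists r h L : R,
  exists phi : R -> R,
    [/\ norm2 e = 1, 0 < r, 0 < h, L.-lipschitz phi &
     forall s t, `|s| < r -> `|t| < h ->
       Omega (x - s *: rot90 e + t *: e) <-> phi s < t].

Definition polygonal (Omega : set pt) : Prop :=
  exists s : seq (pt * pt),
    bdry Omega = \bigcup_(ab in [set` s]) hull [fset ab.1; ab.2]%fset.

Record polygonal_lipschitz_domain (Omega : set pt) : Prop := {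
  domain_nonempty : Omega !=set0;
  domain_open : open Omega;
  domain_connected : connected Omega;
  domain_bounded : bounded_set Omega;
  domain_polygonal : polygonal Omega;
  domain_lipschitz : lipschitz_bdry Omega }.

(* A triangle with a designated newest vertex is the pair of that vertex and
   the set of the two endpoints of the opposite edge. *)
Definition tri : Type := (pt * {fset pt})%type.

Definition vertices (K : tri) : {fset pt} := (K.1 |` K.2)%fset.

Definition tset (K : tri) : set pt := hull (vertices K).

Definition nondegenerate (K : tri) : Prop :=
  exists a b, K.2 = [fset a; b]%fset /\ det2 (a - K.1) (b - K.1) != 0.

Definition edge : Type := {fset pt}.

Definition edges (K : tri) : {fset edge} :=
  [fset E in fpowerset (vertices K) | #|` E|%fset == 2%N]%fset.

Definition edges_of (T : {fset tri}) (E : edge) : Prop :=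
  exists2 K, K \in T & E \in edges K.

Definition meet_conformingly (K K' : tri) : Prop :=
  [\/ tset K `&` tset K' = set0,
      exists z, [/\ z \in vertices K, z \in vertices K' &
                    tset K `&` tset K' = [set z]] |
      exists E, [/\ E \in edges K, E \in edges K' &
                    tset K `&` tset K' = hull E]].

(* Conformity also excludes that the same triangle occurs in [T] with two
   different newest vertices. *)
Record triangulation (Omega : set pt) (T : {fset tri}) : Prop := {
  triang_nondeg : forall K, K \in T -> nondegenerate K;
  triang_cover : closure Omega = \bigcup_(K in [set` T]) tset K;
  triang_conforming : forall K K', K \in T -> K' \in T -> K != K' ->
    meet_conformingly K K' }.

(* Intermediate steps need not be conforming. *)
Inductive nvb (T : {fset tri}) : {fset tri} -> Prop :=
| nvb_refl : nvb T T
| nvb_step (T' : {fset tri}) (z a b : pt) :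
    nvb T T' -> (z, [fset a; b]%fset) \in T' ->
    nvb T ((T' `\ (z, [fset a; b])) `|`
           [fset (midpt a b, [fset z; a]); (midpt a b, [fset z; b])])%fset.

Definition admissible (Omega : set pt) (T That : {fset tri}) : Prop :=
  nvb T That /\ triangulation Omega That.

Definition shape_reg (T : {fset tri}) : R :=
  \big[Num.max/0]_(K <- T) (diam (tset K) / indiam (tset K)).

Definition bdry_edge (Omega : set pt) (E : edge) : Prop :=
  hull E `<=` bdry Omega.

(* An ordering of endpoints is a map [o] from edges to pairs of points. *)
Definition elen (o : edge -> pt * pt) (E : edge) : R :=
  norm2 ((o E).2 - (o E).1).
Definition tangent (o : edge -> pt * pt) (E : edge) : pt :=
  (elen o E)^-1 *: ((o E).2 - (o E).1).
Definition normal (o : edge -> pt * pt) (E : edge) : pt :=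
  rot90 (tangent o E).
Definition epoint (o : edge -> pt * pt) (E : edge) (t : R) : pt :=
  (o E).1 + t *: ((o E).2 - (o E).1).

Definition edge_intg (o : edge -> pt * pt) (E : edge) (g : pt -> R) : R :=
  elen o E *
  Rintegral (@lebesgue_measure R) `[0, 1] (fun t => g (epoint o E t)).

(* The normal at every relative interior point of [E] points into [A]. *)
Definition normal_into (o : edge -> pt * pt) (E : edge) (A : set pt) : Prop :=
  forall t, 0 < t < 1 ->
    \forall s \near 0^'+, A (epoint o E t + s *: normal o E).

Definition edge_ordering (Omega : set pt) (T : {fset tri})
    (o : edge -> pt * pt) : Prop :=
  forall E, edges_of T E ->
    E = [fset (o E).1; (o E).2]%fset /\
    (bdry_edge Omega E -> normal_into o E (~` closure Omega)).

Definition no_tri : tri := (0, fset0).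

Definition K_R (T : {fset tri}) (o : edge -> pt * pt) (E : edge) : tri :=
  xget no_tri [set K | [/\ K \in T, E \in edges K &
                         normal_into o E (tset K)]].
(* For a boundary edge the normal is exterior, so that this is the only
   adjacent triangle. *)
Definition K_L (T : {fset tri}) (o : edge -> pt * pt) (E : edge) : tri :=
  xget no_tri [set K | [/\ K \in T, E \in edges K &
                         ~ normal_into o E (tset K)]].

(* Piecewise polynomial functions are families of polynomials indexed by the
   triangles; the trace of v|_K on an edge of K is thus the evaluation of
   [v K]. In [p.[x, y]] the outer variable is x and the inner one is y. *)
Definition poly2 : Type := {poly {poly R}}.
Definition peval (p : poly2) (x : pt) : R := p.[x.1, x.2].
Definition dx (p : poly2) : poly2 := p^`().
Definition dy (p : poly2) : poly2 := map_poly (@deriv R) p.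
Definition lapl (p : poly2) : poly2 := dx (dx p) + dy (dy p).

(* Total degree at most [k]. *)
Definition Pk (k : nat) (p : poly2) : Prop :=
  forall i j, p`_i`_j != 0 -> (i + j <= k)%N.

Definition PkT (k : nat) (T : {fset tri}) (v : tri -> poly2) : Prop :=
  forall K, K \in T -> Pk k (v K).

(* Values on the skeleton, a null set, are set to 0. *)
Definition pw (T : {fset tri}) (v : tri -> poly2) (x : pt) : R :=
  \sum_(K <- T | `[< (tset K)° x >]) peval (v K) x.
Definition pwgrad (T : {fset tri}) (v : tri -> poly2) (x : pt) : pt :=
  (pw T (fun K => dx (v K)) x, pw T (fun K => dy (v K)) x).

Section Jumps.
Variables (Omega : set pt) (T : {fset tri}) (o : edge -> pt * pt).

Definition jump (v : tri -> poly2) (E : edge) : poly2 :=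
  if `[< bdry_edge Omega E >] then v (K_L T o E)
  else v (K_L T o E) - v (K_R T o E).

Definition grad_jump (v : tri -> poly2) (E : edge) (x : pt) : pt :=
  (peval (jump (fun K => dx (v K)) E) x,
   peval (jump (fun K => dy (v K)) E) x).

(* The condition on [k.-1] is the intended one for k >= 1 only. *)
Definition CR0 (k : nat) (v : tri -> poly2) : Prop :=
  PkT k T v /\
  forall E, edges_of T E -> forall q : poly2, Pk k.-1 q ->
    edge_intg o E (fun x => peval (jump v E) x * peval q x) = 0.

Definition discrete_solution (k : nat) (f : pt -> R) (u : tri -> poly2) :
    Prop :=
  CR0 k u /\
  forall v, CR0 k v ->
    intg Omega (fun x => dot (pwgrad T u x) (pwgrad T v x)) =
    intg Omega (fun x => f x * pw T v x).

(* The squares of the quantities mu, nu and eta. The L^2(K) norm is computed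
   on the interior of K, since f is only given on the open set Omega. *)
Definition mu2 (v : tri -> poly2) (K : tri) (f : pt -> R) : R :=
  area (tset K) *
    intg (tset K)° (fun x => (f x + peval (lapl (v K)) x) ^+ 2) +
  Num.sqrt (area (tset K)) *
    \sum_(E <- edges K | ~~ `[< bdry_edge Omega E >])
      edge_intg o E (fun x => dot (grad_jump v E x) (normal o E) ^+ 2).

Definition nu2 (v : tri -> poly2) (K : tri) : R :=
  Num.sqrt (area (tset K)) *
    \sum_(E <- edges K)
      edge_intg o E (fun x => dot (grad_jump v E x) (tangent o E) ^+ 2).

Definition eta2 (v : tri -> poly2) (K : tri) (f : pt -> R) : R :=
  mu2 v K f + nu2 v K.

Definition eta (v : tri -> poly2) (S : {fset tri}) (f : pt -> R) : R :=
  Num.sqrt (\sum_(K <- S) eta2 v K f).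

End Jumps.

(* Triangles that survive newest vertex bisection keep their newest vertex,
   so that this difference is that of the sets of closed triangles. *)
Definition refined (T That : {fset tri}) : {fset tri} := (T `\` That)%fset.

Definition meets (K K' : tri) : Prop := tset K `&` tset K' !=set0.

Definition refined1 (T That : {fset tri}) : {fset tri} :=
  [fset K in T | `[< exists2 K', K' \in refined T That & meets K K' >]]%fset.

End Plane.

(* Main.v *)
(* Let w be the difference of the fine solution and of a function us of the fine space. For odd k
   the moments of degree < k over the three edges of a coarse triangle can be prescribed
   independently for polynomials of degree k, so that there is p in the coarse space with the edge
   moments of w. By a Poincare inequality for broken functions on bisection trees, whose constant
   does not see the depth of the tree, w - p is bounded by the energy of w, and p = w on
   triangles that are not refined. Integration by parts on coarse triangles leaves no edge terms in
   int grad u . grad (w - p), hence the two discrete equations bound the energy of w by the volume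
   residual on refined triangles and by the distance of us to u.

   The function us equals u on unrefined triangles. On refined ones, a correction of degree k + 1 gives
   u common values at the coarse vertices without changing its edge moments of degree < k. Since
   these data determine polynomials of degree k + 1 on an edge, the corrected functions agree along
   coarse edges, and us is their interpolation on the fine triangles. The correction is bounded by the
   vertex defects of u, and these by the tangential jumps around a vertex, because a jump in P_k
   that is orthogonal to P_(k-1) is a multiple of one polynomial. *)
From HB Require Import structures.
Require Import Defs.
From mathcomp Require Import all_boot all_order all_algebra.
From mathcomp Require Import finmap.
From mathcomp Require Import all_classical all_reals all_analysis.
From mathcomp Require Import measurable_realfun.
From mathcomp Require Import ring lra zify.
Import numFieldNormedType.Exports.
Import Order.TTheory GRing.Theory Num.Theory.

Set Implicit Arguments.
Unset Strict Implicit.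
Unset Printing Implicit Defensive.

Local Open Scope classical_set_scope.
Local Open Scope ring_scope.

(** * Bivariate polynomials *)

(** No shape regularity of the refined mesh is used. Estimates on a tree are written in the form
    [gr], the sum of the squared derivatives along the two sides of a triangle at its newest vertex.
    A bisection multiplies this form by exactly 1/2. In the Poincare inequality the halving pays for
    the difference of the means on the two halves, so that one constant passes through every
    bisection. Moreover the form of a leaf is a multiple of the form of the root, so that a local
    interpolation on a leaf can be measured in the frame of the coarse triangle. The shape of coarse
    triangles enters only when [gr] is compared with the gradient, when edge lengths are compared
    with areas, and in the number of triangles at a vertex.

    Traces are handled by the field w(x) (x - v): its flux misses the edges at the vertex v, so that
    edge moments become integrals over the triangle, and on a tree the fluxes through inner edges
    cancel as soon as the moments from both sides agree.

    The interpolation serves twice, on whole trees for a function of degree k and on single leaves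
    for the correction of degree k + 1. *)

Section Ev2.
Variables (R : realType).

Definition cst (c : R) : poly2 R := c%:P%:P.
Definition pX : poly2 R := 'X.
Definition pY : poly2 R := ('X)%:P.

(** This induction hides the nesting of [{poly {poly R}}]: sums and one factor [pX] or [pY] at a
    time reach every polynomial. *)
Lemma poly2_ind (P : poly2 R -> Prop) :
  (forall c, P (cst c)) -> (forall p q, P p -> P q -> P (p + q)) ->
  (forall p, P p -> P (p * pX)) -> (forall p, P p -> P (p * pY)) ->
  forall p, P p.
Proof.
move=> Pc PD PX PY p.
have Pr (r : {poly R}) : P r%:P.
  elim/poly_ind: r => [|r c IH]; first exact: (Pc 0).
  rewrite polyCD polyCM; apply: PD; last exact: Pc.
  exact: PY.
elim/poly_ind: p => [|p r IH]; first exact: (Pc 0).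
by apply: PD => //; apply: PX.
Qed.

Lemma cstD (c d : R) : cst (c + d) = cst c + cst d.
Proof. by rewrite /cst !polyCD. Qed.
Lemma cstM (c d : R) : cst (c * d) = cst c * cst d.
Proof. by rewrite /cst !polyCM. Qed.
Lemma cstN (c : R) : cst (- c) = - cst c.
Proof. by rewrite /cst !polyCN. Qed.
Lemma cst0 : cst 0 = 0. Proof. by []. Qed.
Lemma cst1 : cst 1 = 1. Proof. by []. Qed.

Variables (A : comNzRingType).

Lemma rmorph2_eq (f g : {rmorphism poly2 R -> A}) :
  (forall c, f (cst c) = g (cst c)) -> f pX = g pX -> f pY = g pY ->
  f =1 g.
Proof.
move=> fgc fgX fgY; elim/poly2_ind => // [p q IHp IHq|p IH|p IH].
- by rewrite !rmorphD IHp IHq.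
- by rewrite !rmorphM IH fgX.
- by rewrite !rmorphM IH fgY.
Qed.

Variables (phi : {rmorphism R -> A}) (u v : A).
Definition ev1 : {poly R} -> A := horner_eval v \o map_poly phi.
HB.instance Definition _ := GRing.RMorphism.on ev1.
(** The target is an arbitrary commutative ring, so that point values, traces on segments ([seg])
    and substitutions ([sub2], [psub]) are all instances, and their identities follow from
    [rmorph2_eq]. *)
Definition ev2 : poly2 R -> A := horner_eval u \o map_poly ev1.
HB.instance Definition _ := GRing.RMorphism.on ev2.

Lemma ev2_cst c : ev2 (cst c) = phi c.
Proof. by rewrite /ev2 /= map_polyC /= /horner_eval hornerC /ev1 /= map_polyC /horner_eval hornerC. Qed.
Lemma ev2_X : ev2 pX = u.
Proof. by rewrite /ev2 /= map_polyX /horner_eval hornerX. Qed.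
Lemma ev2_Y : ev2 pY = v.
Proof. by rewrite /ev2 /= map_polyC /= /horner_eval hornerC /ev1 /= map_polyX /horner_eval hornerX. Qed.
Definition ev2E := (ev2_cst, ev2_X, ev2_Y).

End Ev2.
Arguments ev2 {R A} phi u v p.
Arguments pX {R}.
Arguments pY {R}.

Section Derivations.
Variable R : realType.
Implicit Types p q : poly2 R.

Lemma dxD p q : dx (p + q) = dx p + dx q. Proof. exact: derivD. Qed.
Lemma dxM p q : dx (p * q) = dx p * q + p * dx q. Proof. exact: derivM. Qed.
Lemma dx_cst c : dx (cst c) = 0 :> poly2 R. Proof. exact: derivC. Qed.
Lemma dxX : dx pX = 1 :> poly2 R. Proof. exact: derivX. Qed.
Lemma dxY : dx pY = 0 :> poly2 R. Proof. exact: derivC. Qed.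
Lemma dyD p q : dy (p + q) = dy p + dy q. Proof. exact: raddfD. Qed.
Lemma dy_cst c : dy (cst c) = 0 :> poly2 R.
Proof. by rewrite /dy /cst map_polyC /= derivC. Qed.
Lemma dyX : dy pX = 0 :> poly2 R.
Proof. 
apply/polyP => i; rewrite /dy coef_map /= coefX coef0.
by case: (i == 1)%N; [exact: (derivC 1)|exact: (derivC 0)].
Qed.
Lemma dyY : dy pY = 1 :> poly2 R.
Proof. by rewrite /dy /pY map_polyC /= derivX. Qed.
Lemma dyM p q : dy (p * q) = dy p * q + p * dy q.
Proof.
apply/polyP => i; rewrite /dy coef_map /= coefD !coefM linear_sum -big_split /=.
by apply: eq_bigr => j _; rewrite !coef_map /= derivM.
Qed.

End Derivations.

Section Ev2Theory.
Variables (R : realType).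
Implicit Types (p q : poly2 R) (x : pt R).

Lemma rmorph_ev2 (A B : comNzRingType) (phi : {rmorphism R -> A}) u v
    (psi : {rmorphism A -> B}) p :
  psi (ev2 phi u v p) = ev2 (psi \o phi) (psi u) (psi v) p.
Proof.
by apply: (rmorph2_eq (f := psi \o ev2 phi u v)) => [a||] /=; rewrite ?ev2E.
Qed.

Lemma eq_ev2 (A : comNzRingType) (phi psi : {rmorphism R -> A}) u v p :
  phi =1 psi -> ev2 phi u v p = ev2 psi u v p.
Proof.
move=> e; apply: (rmorph2_eq (f := ev2 phi u v)) => [a||] /=; rewrite ?ev2E //.
Qed.

(** The chain rule for any derivation of the target ring that kills constants; it covers the
    derivatives of [seg], [sub2] and [psub]. *)
Lemma ev2_derivation (A : comNzRingType) (phi : {rmorphism R -> A}) u v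
  (del : A -> A) (delD : forall a b, del (a + b) = del a + del b)
  (delM : forall a b, del (a * b) = del a * b + a * del b)
  (del_phi : forall c, del (phi c) = 0) p :
  del (ev2 phi u v p) = ev2 phi u v (dx p) * del u + ev2 phi u v (dy p) * del v.
Proof.
elim/poly2_ind: p => [c|p q IHp IHq|p IH|p IH].
- by rewrite dx_cst dy_cst ev2_cst del_phi raddf0 !mul0r addr0.
- by rewrite dxD dyD !rmorphD delD IHp IHq /=; ring.
- by rewrite dxM dyM dxX dyX !(rmorphD, rmorphM, rmorph1, rmorph0) delM IH /= ev2_X; ring.
- by rewrite dxM dyM dxY dyY !(rmorphD, rmorphM, rmorph1, rmorph0) delM IH /= ev2_Y; ring.
Qed.

Lemma pevalE p x : peval p x = ev2 idfun x.1 x.2 p.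
Proof.
pose f := horner_eval x.2 \o horner_eval x.1%:P : {rmorphism poly2 R -> R}.
apply: (rmorph2_eq (f := f)) => [a||] /=; rewrite /horner_eval ?ev2E ?(hornerC, hornerX) //.
Qed.

Lemma pevalD p q x : peval (p + q) x = peval p x + peval q x.
Proof. by rewrite !pevalE rmorphD. Qed.
Lemma pevalM p q x : peval (p * q) x = peval p x * peval q x.
Proof. by rewrite !pevalE rmorphM. Qed.
Lemma pevalXn p n x : peval (p ^+ n) x = peval p x ^+ n.
Proof. by rewrite !pevalE rmorphXn. Qed.
Lemma peval0 x : peval 0 x = 0 :> R. Proof. by rewrite !pevalE rmorph0. Qed.
Lemma pevalN p x : peval (- p) x = - peval p x.
Proof. by apply: (addrI (peval p x)); rewrite -pevalD !subrr peval0. Qed.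
Lemma pevalB p q x : peval (p - q) x = peval p x - peval q x.
Proof. by rewrite pevalD pevalN. Qed.
Lemma peval1 x : peval 1 x = 1 :> R. Proof. by rewrite !pevalE rmorph1. Qed.
Lemma peval_cst c x : peval (cst c) x = c :> R.
Proof. by rewrite !pevalE ev2E. Qed.
Lemma pevalX x : peval pX x = x.1. Proof. by rewrite !pevalE ev2E. Qed.
Lemma pevalY x : peval pY x = x.2. Proof. by rewrite !pevalE ev2E. Qed.
Lemma peval_sum (I : Type) (r : seq I) (P : pred I) (F : I -> poly2 R) x :
  peval (\sum_(i <- r | P i) F i) x = \sum_(i <- r | P i) peval (F i) x.
Proof. by rewrite !pevalE rmorph_sum; apply: eq_bigr => i _; rewrite !pevalE. Qed.
Definition pevalsE := (pevalD, pevalN, pevalM, pevalXn, peval0, peval1,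
  peval_cst, pevalX, pevalY).

(** The trace in the parameter t of c + t (d - c). Integration over [0, 1] then drops the edge
    length from all moments. *)
Definition seg (c d : pt R) : poly2 R -> {poly R} :=
  ev2 (polyC : R -> {poly R}) (c.1%:P + (d.1 - c.1) *: 'X) (c.2%:P + (d.2 - c.2) *: 'X).
HB.instance Definition _ c d := GRing.RMorphism.on (seg c d).

Lemma horner_seg (c d : pt R) p t : (seg c d p).[t] = peval p (c + t *: (d - c)).
Proof.
rewrite pevalE -[LHS]/(horner_eval t (seg c d p)) rmorph_ev2 /= /horner_eval.
rewrite !(hornerD, hornerZ, hornerC, hornerX) ![_ * t]mulrC.
by apply: eq_ev2 => a /=; rewrite /horner_eval hornerC.
Qed.

End Ev2Theory.

Arguments peval : simpl never.
Arguments seg : simpl never.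

(** * Antiderivatives and integrals over [0, 1] of univariate polynomials *)

Section Primitive.
Variable R : realType.
Implicit Types p q r : {poly R}.

Lemma deriv_eq0 r : r^`() = 0 -> r = (r.[0])%:P.
Proof.
move=> r0; apply/polyP => -[|i]; first by rewrite coefC eqxx horner_coef0.
rewrite coefC /=; apply/eqP; move: (congr1 (fun s : {poly R} => s`_i) r0).
by rewrite coef_deriv coef0 => /eqP; rewrite mulrn_eq0.
Qed.

(** At i = 0 the quotient has denominator 0 and is 0 by convention, so that this primitive vanishes
    at 0. *)
Definition prim p : {poly R} := \poly_(i < (size p).+1) (p`_i.-1 / i%:R).

Lemma coef_prim p i : (prim p)`_i = p`_i.-1 / i%:R.
Proof.
rewrite coef_poly; case: ltnP => // ip.
by case: i ip => // i ip; rewrite (nth_default 0 (_ : (size p <= i)%N)) ?mul0r.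
Qed.

Lemma deriv_prim p : (prim p)^`() = p.
Proof.
apply/polyP => i; rewrite coef_deriv coef_prim /= -[_ / _ *+ _]mulr_natr mulfVK //.
Qed.

Lemma prim_horner0 p : (prim p).[0] = 0.
Proof. by rewrite horner_coef0 coef_prim invr0 mulr0. Qed.

Lemma primD p q : prim (p + q) = prim p + prim q.
Proof. by apply/polyP => i; rewrite coefD !coef_prim coefD mulrDl. Qed.

Lemma primZ c p : prim (c *: p) = c *: prim p.
Proof. by apply/polyP => i; rewrite coefZ !coef_prim coefZ mulrA. Qed.

Lemma prim_deriv p : prim p^`() = p - (p.[0])%:P.
Proof.
have /deriv_eq0 : (prim p^`() - p)^`() = 0 by rewrite derivB deriv_prim subrr.
by rewrite hornerD hornerN prim_horner0 sub0r polyCN => /(canRL (subrK _)); rewrite addrC.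
Qed.

Definition I01 p : R := (prim p).[1].

Lemma I01D p q : I01 (p + q) = I01 p + I01 q.
Proof. by rewrite /I01 primD hornerD. Qed.
Lemma I01Z c p : I01 (c *: p) = c * I01 p.
Proof. by rewrite /I01 primZ hornerZ. Qed.
Lemma I010 : I01 0 = 0.
Proof. by rewrite -[0 in LHS](scale0r 0) I01Z mul0r. Qed.
Lemma I01N p : I01 (- p) = - I01 p.
Proof. by rewrite -scaleN1r I01Z mulN1r. Qed.
Lemma I01B p q : I01 (p - q) = I01 p - I01 q.
Proof. by rewrite I01D I01N. Qed.
Lemma I01_sum (I : Type) (s : seq I) (P : pred I) (F : I -> {poly R}) :
  I01 (\sum_(i <- s | P i) F i) = \sum_(i <- s | P i) I01 (F i).
Proof. exact: (big_morph _ I01D I010). Qed.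
Lemma I01_deriv p : I01 p^`() = p.[1] - p.[0].
Proof. by rewrite /I01 prim_deriv hornerD hornerN hornerC. Qed.
Lemma I01C c : I01 c%:P = c.
Proof.
rewrite (_ : c%:P = (c *: 'X)^`()); last by rewrite derivZ derivX alg_polyC.
by rewrite I01_deriv !hornerZ !hornerX mulr1 mulr0 subr0.
Qed.

(** Substitution in the integral from a to a + s; with the factor s on the left the case s = 0 is
    covered. *)
Lemma I01_affine p a s :
  s * I01 (p \Po (a%:P + s *: 'X)) = (prim p).[a + s] - (prim p).[a].
Proof.
rewrite -I01Z; have -> : s *: (p \Po (a%:P + s *: 'X)) =
    (prim p \Po (a%:P + s *: 'X))^`().
  by rewrite deriv_comp deriv_prim derivD derivC add0r derivZ derivX alg_polyC
     mulrC -mul_polyC.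
by rewrite I01_deriv !horner_comp !(hornerE, mulr0, mulr1, addr0).
Qed.

Lemma I01_rev p : I01 (p \Po (1 - 'X)) = I01 p.
Proof.
have := I01_affine p 1 (-1); rewrite addrN prim_horner0 scaleN1r mulN1r sub0r.
by move=> /oppr_inj.
Qed.

Lemma I01_halves p : I01 p = 2^-1 * (I01 (p \Po (2^-1 *: 'X)) +
  I01 (p \Po (2^-1%:P + 2^-1 *: 'X))).
Proof.
have := I01_affine p 0 2^-1; rewrite !add0r prim_horner0 subr0 mulrDr => ->.
rewrite I01_affine /I01 (_ : 2^-1 + 2^-1 = 1); first by rewrite addrC subrK.
by field.
Qed.

Lemma integral_horner p :
  (\int[@lebesgue_measure R]_(t in `[0%R, 1%R]) (p.[t])%:E = (I01 p)%:E)%E.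
Proof.
rewrite (@continuous_FTC2 _ _ (horner (prim p)) 0 1) //.
- by rewrite prim_horner0 -EFinB subr0.
- by apply: continuous_subspaceT => x; exact: continuous_horner.
- split; first by move=> x _; exact: derivable_horner.
  + exact/cvg_at_right_filter/continuous_horner.
  + exact/cvg_at_left_filter/continuous_horner.
- by move=> x _; rewrite -derivE deriv_prim.
Qed.

Lemma Rintegral_horner p :
  Rintegral (@lebesgue_measure R) `[0, 1] (fun t => p.[t]) = I01 p.
Proof. by rewrite /Rintegral integral_horner. Qed.

Lemma I01_ge0 p : (forall t, 0 <= t <= 1 -> 0 <= p.[t]) -> 0 <= I01 p.
Proof.
by move=> p0; rewrite -Rintegral_horner; apply: Rintegral_ge0 => t /=; rewrite in_itv; exact: p0.
Qed.

Lemma poly_eq0_itv p : (forall t, 0 <= t <= 1 -> p.[t] = 0) -> p = 0.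
Proof.
move=> p0; apply/eqP; apply: contraT => pN0.
(* The points 1 / (i + 1) are [size p] distinct roots, one too many. *)
pose s := [seq (i.+1)%:R^-1 : R | i <- iota 0 (size p)].
have : (size s < size p)%N.
  apply: max_poly_roots => //.
    apply/allP => _ /mapP[i _ ->]; apply/eqP; apply: p0.
    by rewrite invr_ge0 ler0n invf_le1 ?ltr0n // ler1n.
  rewrite map_inj_uniq ?iota_uniq // => i j /invr_inj /eqP.
  by rewrite eqr_nat eqSS => /eqP.
by rewrite size_map size_iota ltnn.
Qed.

Lemma poly_ext p q : (forall t, p.[t] = q.[t]) -> p = q.
Proof.
move=> pq; apply/eqP; rewrite -subr_eq0; apply/eqP/poly_eq0_itv => t _.
by rewrite hornerD hornerN pq subrr.
Qed.

(** The integrals of p over [0, s] and over [s, 1] are nonnegative with sum 0, hence the primitive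
    vanishes on [0, 1]. *)
Lemma I01_eq0 p : (forall t, 0 <= t <= 1 -> 0 <= p.[t]) -> I01 p = 0 -> p = 0.
Proof.
move=> p0 Ip; suff P0 : prim p = 0 by rewrite -(deriv_prim p) P0 derivC.
apply: poly_eq0_itv => s /andP[s0 s1]; apply/eqP; rewrite eq_le; apply/andP; split.
  suff: 0 <= (prim p).[1] - (prim p).[s] by rewrite -/(I01 p) Ip sub0r oppr_ge0.
  have := I01_affine p s (1 - s); rewrite (addrC s) subrK => <-.
  rewrite mulr_ge0 ?subr_ge0 // I01_ge0 // => t /andP[t0 t1].
  rewrite horner_comp !(hornerD, hornerZ, hornerC, hornerX); apply: p0; nra.
have := I01_affine p 0 s; rewrite prim_horner0 subr0 [0 + s]add0r => <-.
rewrite mulr_ge0 // I01_ge0 // => t /andP[t0 t1].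
rewrite horner_comp !(hornerD, hornerZ, hornerC, hornerX); apply: p0; nra.
Qed.

(** The difference of the two sides is the variance of p. *)
Lemma I01_sqr p : I01 p ^+ 2 <= I01 (p ^+ 2).
Proof.
rewrite -subr_ge0; have : 0 <= I01 ((p - (I01 p)%:P) ^+ 2).
  by apply: I01_ge0 => t _; rewrite horner_exp sqr_ge0.
have -> : (p - (I01 p)%:P) ^+ 2 = p ^+ 2 - (2 * I01 p) *: p + (I01 p ^+ 2)%:P.
  by rewrite -mul_polyC polyCM polyC_exp polyC_natr; ring.
rewrite I01D I01B I01Z I01C; congr (0 <= _); ring.
Qed.

End Primitive.

(** * Integration over triangles *)

Section AffineMeasure.
Variable R : realType.
Local Notation mR := (measurableTypeR R).
Local Notation mP := (mR * mR)%type.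
Local Notation lam := (@lebesgue_measure R).

(** Uniqueness of Lebesgue measure, applied to |b| times the image measure of the affine map: both
    have the same values on half-open intervals. *)
Lemma lebesgue_affine (b d : R) (S : set mR) : b != 0 -> measurable S ->
  lam ((fun y : mR => b * y + d : mR) @^-1` S) = (`|b|^-1%:E * lam S)%E.
Proof.
move=> b0 mS; pose f : mR -> mR := fun y => b * y + d.
rewrite -[X in lam X]/(f @^-1` S).
have mf : measurable_fun setT f.
  by apply: measurable_funD => //; apply: measurable_funM => //; exact: measurable_cst.
unshelve epose (m1 := (pushforward lam f : {measure set mR -> \bar R})); first exact: mf.
have nb : 0 <= `|b| by [].
pose m2 := mscale (NngNum nb) m1.
have e : forall A, measurable A -> lam A = m2 A.
  apply: lebesgue_measure_unique => _ [[x y] _ <-] /=.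
  rewrite -[RHS]/(`|b|%:E * lam (f @^-1` `]x, y]))%E.
  have [b_gt0|b_lt0|] := ltrgtP 0 b; last by move=> bE; rewrite -bE eqxx in b0.
    have -> : f @^-1` `]x, y] = `](x - d) / b, (y - d) / b]%classic.
      by apply/seteqP; split=> t /=; rewrite !in_itv /= /f ltr_pdivrMr // ler_pdivlMr //
        ltrBlDr lerBrDr mulrC.
    rewrite !lebesgue_measure_itv /= !lte_fin ltr_pM2r ?invr_gt0 // ltrD2r.
    case: ifP => _; rewrite ?mule0 // -!EFinD -EFinM gtr0_norm //.
    by congr (_%:E); field.
  have -> : f @^-1` `]x, y] = `[(y - d) / b, (x - d) / b[%classic.
    by apply/seteqP; split=> t /=; rewrite !in_itv /= /f ltr_ndivlMr // ler_ndivrMr //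
        ltrBlDr lerBrDr mulrC andbC.
  rewrite !lebesgue_measure_itv /= !lte_fin ltr_nM2r ?invr_lt0 // ltrD2r.
  case: ifP => _; rewrite ?mule0 // -!EFinD -EFinM ltr0_norm //.
  by congr (_%:E); field.
by rewrite (e _ mS) /m2 /mscale /= muleA -EFinM mulVf ?normr_eq0 // mul1e.
Qed.

(** Stated for preimages because this form composes; affine maps then reduce to swaps and maps that
    change one coordinate. *)
Definition scaling (F : mP -> mP) (c : R) :=
  [/\ 0 < c, measurable_fun setT F &
   forall A, measurable A -> (leb2 R (F @^-1` A) = c%:E * leb2 R A)%E].

Lemma measurable_preim (F : mP -> mP) A : measurable_fun setT F ->
  measurable A -> measurable (F @^-1` A).
Proof. by move=> mF mA; rewrite -[X in measurable X]setTI; exact: mF. Qed.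

Lemma scaling_comp F G c d : scaling F c -> scaling G d ->
  scaling (F \o G) (c * d).
Proof.
move=> [c0 mF Fc] [d0 mG Gd]; split; first exact: mulr_gt0.
  exact: measurableT_comp.
move=> A mA; rewrite comp_preimage Gd ?Fc ?muleA -?EFinM 1?mulrC //.
exact: measurable_preim.
Qed.

Lemma scaling_swap : scaling (fun x => (x.2, x.1)) 1.
Proof.
set F := fun x : mP => _.
have mF : measurable_fun setT F.
  by apply: measurable_fun_pair; [exact: measurable_snd|exact: measurable_fst].
split=> // A mA; rewrite mul1e.
unshelve epose (m1 := (pushforward (leb2 R) F : {measure set mP -> \bar R})); first exact: mF.
apply/esym; rewrite -[RHS]/(m1 A); apply: product_measure_unique => // B C mB mC.
rewrite -[LHS]/(leb2 R (F @^-1` (B `*` C))).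
have -> : F @^-1` (B `*` C) = C `*` B.
  by apply/seteqP; split=> -[x y] /= [].
by rewrite -[LHS]/((lam \x lam)%E (C `*` B)) product_measure1E // muleC.
Qed.

Lemma scaling_fiber (b c d : R) : b != 0 ->
  scaling (fun x => (x.1, b * x.2 + (c * x.1 + d))) `|b|^-1.
Proof.
move=> b0; set F := fun x : mP => _.
have mF : measurable_fun setT F.
  apply: measurable_fun_pair; first exact: measurable_fst.
  apply: measurable_funD; last apply: measurable_funD => //; apply: measurable_funM => //.
split=> //; first by rewrite invr_gt0 normr_gt0.
move=> A mA; rewrite /leb2 /product_measure1 -ge0_integralZl //; last exact: measurable_fun_xsection.
apply: eq_integral => x _ /=.
rewrite -(@lebesgue_affine b (c * x + d)) //; last exact: measurable_xsection.
Qed.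

Definition aff (z p q : pt R) (x : pt R) : pt R := z + x.1 *: p + x.2 *: q.

(** Gaussian elimination: with pivot p.1 the map changes first one coordinate and then the other. If
    the pivot is 0, then q.1 is not, and a swap exchanges p and q. *)
Lemma scaling_aff z p q : det2 p q != 0 -> scaling (aff z p q) `|det2 p q|^-1.
Proof.
wlog p1 : p q / p.1 != 0.
  move=> hw D0; have [p10|/hw] := eqVneq p.1 0; last exact.
  have q1 : q.1 != 0 by apply: contraNneq D0 => q10; rewrite /det2 p10 q10; apply/eqP; ring.
  have e : det2 q p = - det2 p q by rewrite /det2; ring.
  have := scaling_comp (hw q p q1 _) scaling_swap.
  rewrite e oppr_eq0 normrN mulr1 => /(_ D0).
  by congr (scaling _ _); apply/funext => x; rewrite /aff /= addrAC.
move=> D0; pose D := det2 p q.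
have h1 := scaling_fiber q.1 z.1 p1.
have b0 : D / p.1 != 0 by rewrite mulf_neq0 // invr_neq0.
have h2 := scaling_fiber (p.2 / p.1) (z.2 - p.2 / p.1 * z.1) b0.
have := scaling_comp h2 (scaling_comp scaling_swap (scaling_comp h1 scaling_swap)).
rewrite mul1r mulr1 -invfM -normrM mulfVK // -/D; congr (scaling _ _).
apply/funext => x; rewrite /aff /=; congr pair; rewrite /= /D /det2; first by rewrite /GRing.scale /=; ring.
by rewrite /GRing.scale /=; field.
Qed.

Lemma scaling_integrable F c (D : set mP) (g : mP -> \bar R) : scaling F c ->
  measurable D -> measurable_fun setT g -> {in D, forall x, 0 <= g x}%E ->
  (\int[leb2 R]_(x in F @^-1` D) g (F x) = c%:E * \int[leb2 R]_(x in D) g x)%E.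
Proof.
move=> [c0 mF Fc] mD mg g0.
have nc : 0 <= c by exact: ltW.
rewrite -[LHS](@ge0_integral_pushforward _ _ _ _ _ F) //; last exact: measurable_funTS.
rewrite (@eq_measure_integral _ _ _ _ (mscale (NngNum nc) (leb2 R))) //.
  by rewrite ge0_integral_mscale //; [exact: measurable_funTS|move=> x Dx; apply: g0; rewrite inE].
move=> A mA _; rewrite -[LHS]/(leb2 R (F @^-1` A)).
by rewrite Fc.
Qed.

Lemma Rintegral_scaling F c (D : set mP) (g : mP -> R) : scaling F c ->
  measurable D -> measurable_fun setT g -> (leb2 R).-integrable D (EFin \o g) ->
  Rintegral (leb2 R) (F @^-1` D) (g \o F) = c * Rintegral (leb2 R) D g.
Proof.
move=> sF mD mg ig; have mEg : measurable_fun setT (EFin \o g) by exact/measurable_EFinP.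
rewrite /Rintegral integralE [in RHS]integralE.
have e1 := scaling_integrable sF mD (measurable_funepos mEg) (fun x _ => funepos_ge0 (EFin \o g) x).
have e2 := scaling_integrable sF mD (measurable_funeneg mEg) (fun x _ => funeneg_ge0 (EFin \o g) x).
transitivity (fine (c%:E * \int[leb2 R]_(x in D) (EFin \o g)^\+ x -
  c%:E * \int[leb2 R]_(x in D) (EFin \o g)^\- x)%E).
  rewrite -e1 -e2; congr (fine (_ - _)%E); apply: eq_integral => x _;
    by rewrite ?funeposE ?funenegE.
have fp := integrable_pos_fin_num mD ig; have fn := integrable_neg_fin_num mD ig.
have finZB (x y : \bar R) : x \is a fin_num -> y \is a fin_num ->
    fine (c%:E * x - c%:E * y)%E = c * fine (x - y)%E.
  by move: x y => [x||] [y||] //= _ _; rewrite mulrBr.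
exact: finZB fp fn.
Qed.

End AffineMeasure.

Section Triangles.
Variable R : realType.
Implicit Types (z a b x c d : pt R) (p q : poly2 R).
Local Notation mR := (measurableTypeR R).
Local Notation mP := (mR * mR)%type.
Local Notation lam := (@lebesgue_measure R).

Lemma pt_ext x c : x.1 = c.1 -> x.2 = c.2 -> x = c.
Proof. by case: x c => [x1 x2] [c1 c2] /= -> ->. Qed.

Definition T3 z a b : tri R := (z, [fset a; b]%fset).
Definition Det z a b : R := det2 (a - z) (b - z).
(* The barycentric coordinate of x that belongs to z; the others are bc a b z x and bc b z a x. *)
Definition bc z a b x : R := Det x a b / Det z a b.

Lemma Det_rot z a b : Det a b z = Det z a b.
Proof. by rewrite /Det /det2 /=; ring. Qed.
Lemma Det_rot2 z a b : Det b z a = Det z a b.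
Proof. by rewrite /Det /det2 /=; ring. Qed.
Lemma Det_flip z a b : Det z b a = - Det z a b.
Proof. by rewrite /Det /det2 /=; ring. Qed.
Lemma Det_neq z a b : Det z a b != 0 -> [/\ z != a, z != b & a != b].
Proof.
by move=> D0; split; apply: contraNneq D0 => ->; rewrite /Det /det2 /=; apply/eqP; ring.
Qed.

Lemma bc_sum z a b x : Det z a b != 0 -> bc z a b x + bc a b z x + bc b z a x = 1.
Proof.
move=> D0; rewrite /bc (Det_rot a b z) (Det_rot z a b) -!mulrDl.
by apply: (canLR (mulfK D0)); rewrite /Det /det2 /=; ring.
Qed.

Lemma bc_comb z a b x : Det z a b != 0 ->
  x = z + bc a b z x *: (a - z) + bc b z a x *: (b - z).
Proof.
move=> D0; rewrite /bc (Det_rot a b z) (Det_rot z a b).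
case: x z a b D0 => x1 x2 [z1 z2] [a1 a2] [b1 b2]; rewrite /Det /det2 /= => D0.
by congr pair; rewrite /= /GRing.scale /=; field.
Qed.

Lemma bc_line z a b x d (s : R) :
  bc z a b (x + s *: (d - x)) = (1 - s) * bc z a b x + s * bc z a b d.
Proof. by rewrite /bc /Det /det2 /= /GRing.scale /=; ring. Qed.

Lemma bc_vertex z a b s t : Det z a b != 0 ->
  bc z a b (z + s *: (a - z) + t *: (b - z)) = 1 - s - t /\
  bc a b z (z + s *: (a - z) + t *: (b - z)) = s /\
  bc b z a (z + s *: (a - z) + t *: (b - z)) = t.
Proof.
move=> D0; rewrite /bc (Det_rot a b z) (Det_rot z a b).
by split; [|split]; apply: (canLR (mulfK D0));
  rewrite /Det /det2 /= /GRing.scale /=; ring.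
Qed.

Lemma sum_vertices (f : pt R -> R) z a b : Det z a b != 0 ->
  \sum_(v <- vertices (T3 z a b)) f v = f z + f a + f b.
Proof.
move=> /Det_neq[za zb ab]; rewrite /vertices /= big_fsetU1 ?inE ?negb_or ?za ?zb //=.
by rewrite big_fsetU1 ?inE //= big_seq_fset1 addrA.
Qed.

Lemma sumv_vertices (f : pt R -> pt R) z a b : Det z a b != 0 ->
  \sum_(v <- vertices (T3 z a b)) f v = f z + f a + f b.
Proof.
move=> /Det_neq[za zb ab]; rewrite /vertices /= big_fsetU1 ?inE ?negb_or ?za ?zb //=.
by rewrite big_fsetU1 ?inE //= big_seq_fset1 addrA.
Qed.

Lemma tsetP z a b x : Det z a b != 0 -> tset (T3 z a b) x <->
  [/\ 0 <= bc z a b x, 0 <= bc a b z x & 0 <= bc b z a x].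
Proof.
move=> D0; split=> [[w [w0]]|[h1 h2 h3]].
  rewrite sum_vertices // sumv_vertices // => w1 ->.
  have -> : w z *: z + w a *: a + w b *: b = z + w a *: (a - z) + w b *: (b - z).
    have -> : w z = 1 - w a - w b by rewrite -w1; ring.
    by congr pair; rewrite /= /GRing.scale /=; ring.
  have [-> [-> ->]] := bc_vertex (w a) (w b) D0.
  by rewrite (_ : 1 - w a - w b = w z) // -w1; ring.
have [za zb ab] := Det_neq D0.
exists (fun v => if v == z then bc z a b x else if v == a then bc a b z x else
  if v == b then bc b z a x else 0); split.
- by move=> v; do 3! case: ifP => //.
- rewrite sum_vertices // !eqxx ![a == _]eq_sym ![b == _]eq_sym (negbTE za) (negbTE zb).
  by rewrite (negbTE ab) bc_sum.
- rewrite sumv_vertices // !eqxx ![a == _]eq_sym ![b == _]eq_sym (negbTE za) (negbTE zb).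
  rewrite (negbTE ab) [LHS](bc_comb x D0).
  have -> : bc z a b x = 1 - bc a b z x - bc b z a x by rewrite -(bc_sum x D0); ring.
  by congr pair; rewrite /= /GRing.scale /=; ring.
Qed.

Lemma hull2P c d x : hull [fset c; d]%fset x <->
  exists2 t, 0 <= t <= 1 & x = c + t *: (d - c).
Proof.
have [<-|cd] := eqVneq c d.
  rewrite fsetUid; split=> [[w [w0]]|[t _ ->]].
    by rewrite !big_seq_fset1 => -> ->; exists 0; rewrite ?lexx ?ler01 // scale1r scale0r addr0.
  by exists (fun=> 1); rewrite !big_seq_fset1 scale1r subrr scaler0 addr0.
split=> [[w [w0]]|[t /andP[t0 t1] ->]].
  rewrite !big_fsetU1 ?inE //= !big_seq_fset1 => w1 ->; exists (w d).
    by rewrite w0 -w1 lerDr w0.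
  have -> : w c = 1 - w d by rewrite -w1 addrK.
  by congr pair; rewrite /= /GRing.scale /=; ring.
exists (fun v => if v == c then 1 - t else if v == d then t else 0); split.
- by move=> v; case: ifP => _; [rewrite subr_ge0|case: ifP].
- by rewrite !big_fsetU1 ?inE //= !big_seq_fset1 !eqxx eq_sym (negbTE cd) subrK.
- rewrite !big_fsetU1 ?inE //= !big_seq_fset1 !eqxx eq_sym (negbTE cd).
  by congr pair; rewrite /= /GRing.scale /=; ring.
Qed.

Lemma continuous_peval p : continuous (peval p : pt R -> R).
Proof.
elim/poly2_ind: p => [c|p q IHp IHq|p IH|p IH] x.
- by rewrite (_ : peval _ = fun=> c); [exact: cvg_cst|apply/funext => y; rewrite peval_cst].
- rewrite (_ : peval _ = fun y => peval p y + peval q y); first by apply: cvgD; [exact: IHp|exact: IHq].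
  by apply/funext => y; rewrite pevalD.
- rewrite (_ : peval _ = fun y => peval p y * y.1); first by apply: cvgM; [exact: IH|exact: cvg_fst].
  by apply/funext => y; rewrite pevalM pevalX.
- rewrite (_ : peval _ = fun y => peval p y * y.2); first by apply: cvgM; [exact: IH|exact: cvg_snd].
  by apply/funext => y; rewrite pevalM pevalY.
Qed.

Lemma measurable_peval p : measurable_fun setT (peval p : mP -> mR).
Proof.
elim/poly2_ind: p => [c|p q IHp IHq|p IH|p IH].
- by rewrite (_ : peval _ = fun=> c) //; apply/funext => y; rewrite peval_cst.
- rewrite (_ : peval _ = fun y => peval p y + peval q y); first exact: measurable_funD.
  by apply/funext => y; rewrite pevalD.
- rewrite (_ : peval _ = fun y => peval p y * y.1).
    by apply: measurable_funM => //; exact: measurable_fst.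
  by apply/funext => y; rewrite pevalM pevalX.
- rewrite (_ : peval _ = fun y => peval p y * y.2).
    by apply: measurable_funM => //; exact: measurable_snd.
  by apply/funext => y; rewrite pevalM pevalY.
Qed.

Definition bcp z a b : poly2 R :=
  cst (Det z a b)^-1 * ((cst a.1 - pX) * (cst b.2 - pY) - (cst a.2 - pY) * (cst b.1 - pX)).

Lemma peval_bcp z a b x : peval (bcp z a b) x = bc z a b x.
Proof. by rewrite /bcp !pevalsE /bc /Det /det2 /= mulrC. Qed.

(** If the coordinate of a vertex v vanished at an interior point x, it would be -e at x + e (x -
    v), which still lies in the triangle for small e > 0. *)
Lemma tset_interior z a b x : Det z a b != 0 -> (tset (T3 z a b))° x <->
  [/\ 0 < bc z a b x, 0 < bc a b z x & 0 < bc b z a x].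
Proof.
move=> D0; split=> [Kx|[h1 h2 h3]]; last first.
  have opn v w y : 0 < bc v w y x -> \forall u \near x, 0 < bc v w y u.
    move=> h; have := @continuous_peval (bcp v w y) x.
    rewrite (_ : peval _ = bc v w y); last by apply/funext => u; rewrite peval_bcp.
    by move=> /(_ [set r | 0 < r]); apply; exact: lt_nbhsr.
  near=> u; apply/tsetP => //; split; apply: ltW; near: u; exact: opn.
have pos v w y : Det v w y != 0 -> tset (T3 z a b) `<=` [set u | 0 <= bc v w y u] ->
    0 < bc v w y x.
  move=> D1 sub; rewrite lt_neqAle eq_sym sub /= ?andbT; last exact: interior_subset.
  apply/eqP => bc0.
  have cg : (x + e *: (x - v)) @[e --> (0 : R)^'+] --> x.
    apply: cvg_at_right_filter.
    rewrite [X in _ --> X](_ : x = x + 0 *: (x - v)); last by rewrite scale0r addr0.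
    by apply: cvgD; [exact: cvg_cst|apply: cvgZ; [exact: cvg_id|exact: cvg_cst]].
  have /filter_ex [e] : \forall e \near (0 : R)^'+, 0 < e /\ 0 <= bc v w y (x + e *: (x - v)).
    have cK : \forall e \near (0 : R)^'+, tset (T3 z a b) (x + e *: (x - v)) := cg _ Kx.
    by near=> e; split; [near: e; exact: nbhs_right_gt|apply: sub; near: e; exact: cK].
  move=> [e0]; have -> : bc v w y (x + e *: (x - v)) = (1 + e) * bc v w y x - e.
    apply: (canLR (mulfK D1)); rewrite mulrBl -mulrA mulfVK //.
    by rewrite /Det /det2 /= /GRing.scale /=; ring.
  by rewrite bc0 mulr0 sub0r oppr_ge0 leNgt e0.
split; apply: pos; do ?by move=> u /(tsetP _ D0)[].
- by [].
- by rewrite Det_rot.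
- by rewrite Det_rot2.
Unshelve. all: by end_near.
Qed.

End Triangles.

Section PolyIntegral.
Variable R : realType.
Implicit Types (z a b x c d v : pt R) (p q : poly2 R).
Local Notation mR := (measurableTypeR R).
Local Notation mP := (mR * mR)%type.
Local Notation lam := (@lebesgue_measure R).

Definition box (M : R) : set mP := [set x | `|x.1| <= M /\ `|x.2| <= M].

Lemma peval_bounded p M : exists C, forall x, box M x -> `|peval p x| <= C.
Proof.
elim/poly2_ind: p => [c|p q [C hC] [D hD]|p [C hC]|p [C hC]].
- by exists `|c| => x _; rewrite peval_cst.
- exists (C + D) => x bx; rewrite pevalD (le_trans (ler_normD _ _)) // lerD ?hC ?hD //.
- exists (C * M) => x bx; rewrite pevalM pevalX normrM ler_pM ?hC //; by case: bx.
- exists (C * M) => x bx; rewrite pevalM pevalY normrM ler_pM ?hC //; by case: bx.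
Qed.

Lemma leb2_box M : (leb2 R (box M) < +oo)%E.
Proof.
have -> : box M = `[- M, M]%classic `*` `[- M, M]%classic.
  by apply/seteqP; split=> x /=; rewrite !in_itv /= -!ler_norml.
rewrite -[X in (X < _)%E]/((lam \x lam)%E _) product_measure1E //.
have L : (lam `[(- M)%R, M]%classic < +oo)%E.
  by rewrite lebesgue_measure_itv; case: ifP => _; rewrite -?EFinB ltry.
apply: lte_mul_pinfty => //; exact: (eqbRL (ge0_fin_numE (measure_ge0 lam _))).
Qed.

Lemma measurable_box M : measurable (box M).
Proof.
have -> : box M = `[- M, M]%classic `*` `[- M, M]%classic.
  by apply/seteqP; split=> x /=; rewrite !in_itv /= -!ler_norml.
exact: measurableX.
Qed.

Lemma integrable_peval (A : set mP) M p : measurable A -> A `<=` box M ->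
  (leb2 R).-integrable A (EFin \o peval p).
Proof.
move=> mA AM; apply: measurable_bounded_integrable => //.
- apply: le_lt_trans (leb2_box M); apply: le_measure => //; rewrite inE //.
  exact: measurable_box.
- apply: measurable_funTS; exact: measurable_peval.
- have [C hC] := peval_bounded p M.
  exists C; split=> [|D CD x /AM/hC h]; first exact: num_real.
  exact: le_trans h (ltW CD).
Qed.

Definition S0 : set mP := [set x | [/\ 0 < x.1, 0 < x.2 & x.1 + x.2 < 1]].

Lemma S0_box : S0 `<=` box 1.
Proof.
move=> x [x1 x2 x12]; split; rewrite gtr0_norm //; lra.
Qed.

Lemma measurable_S0 : measurable S0.
Proof.
have -> : S0 = (setT `&` ((fun x : mP => x.1 : mR) @^-1` `]0, +oo[)) `&`
   ((setT `&` (fun x : mP => x.2 : mR) @^-1` `]0, +oo[) `&`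
   (setT `&` (fun x : mP => x.1 + x.2 : mR) @^-1` `]-oo, 1[)).
  apply/seteqP; split=> x; rewrite /= !in_itv /= !andbT; first by move=> [? ? ?].
  by move=> [[_ ?]] [[_ ?] [_ ?]].
apply: measurableI; first by apply: measurable_fst.
apply: measurableI; first by apply: measurable_snd.
have mf : measurable_fun setT (fun x : mP => x.1 + x.2 : mR).
  by apply: measurable_funD; [exact: measurable_fst|exact: measurable_snd].
exact: mf.
Qed.

Definition Jr p : R := intg S0 (peval p).

Lemma integral_horner_itv (p : {poly R}) (c d : R) : c < d ->
  (\int[lam]_(t in `[c, d]) (p.[t])%:E = ((prim p).[d] - (prim p).[c])%:E)%E.
Proof.
move=> cd; rewrite (@continuous_FTC2 _ _ (horner (prim p)) c d) // ?EFinB //.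
- by apply: continuous_subspaceT => x; exact: continuous_horner.
- split; first by move=> x _; exact: derivable_horner.
  + exact/cvg_at_right_filter/continuous_horner.
  + exact/cvg_at_left_filter/continuous_horner.
- by move=> x _; rewrite -derivE deriv_prim.
Qed.

Lemma integral_horner_oo (p : {poly R}) (c d : R) : c < d ->
  (\int[lam]_(t in `]c, d[) (p.[t])%:E = ((prim p).[d] - (prim p).[c])%:E)%E.
Proof.
move=> cd; rewrite -integral_horner_itv //.
have mp : measurable_fun setT (horner p : mR -> mR).
  apply: continuous_measurable_fun; exact: continuous_horner.
rewrite integral_itv_obnd_cbnd; last exact/measurable_EFinP/measurable_funTS.
by rewrite integral_itv_bndo_bndc //; exact/measurable_EFinP/measurable_funTS.
Qed.

Definition primY p : poly2 R := map_poly (@prim R) p.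

Lemma prim0 : prim (0 : {poly R}) = 0.
Proof. by rewrite -[0 in LHS](scale0r 0) primZ scale0r. Qed.
Lemma primMn (p : {poly R}) n : prim (p *+ n) = prim p *+ n.
Proof. by elim: n => [|n IH]; rewrite ?mulr0n ?prim0 // !mulrS primD IH. Qed.
Lemma prim_sum (I : Type) (s : seq I) (P : pred I) (F : I -> {poly R}) :
  prim (\sum_(i <- s | P i) F i) = \sum_(i <- s | P i) prim (F i).
Proof. exact: (big_morph _ (@primD R) prim0). Qed.

Lemma coef_primY p i : (primY p)`_i = prim p`_i.
Proof. by rewrite /primY coef_map_id0 // prim0. Qed.

Lemma peval_primY p x : peval (primY p) x = (prim p.[x.1%:P]).[x.2].
Proof.
rewrite /peval (@horner_coef_wide _ (size p) (primY p)); last exact: size_poly.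
rewrite (horner_coef p) prim_sum; congr (horner _ _); apply: eq_bigr => i _.
by rewrite coef_primY -polyC_exp mulrC mul_polyC [in RHS]mulrC mul_polyC primZ.
Qed.

(** By Fubini: the integral over 0 < y < 1 - x is the value of [primY p] at (x, 1 - x), which is the
    point with parameter x on this segment. *)
Lemma Jr_primY p : Jr p = I01 (seg (0, 1) (1, 0) (primY p)).
Proof.
rewrite /Jr /intg /Rintegral integral_mkcond.
have ip : (leb2 R).-integrable setT ((EFin \o peval p) \_ S0).
  apply/(integrable_mkcond _ measurable_S0).
  exact: integrable_peval measurable_S0 S0_box.
rewrite -[LHS]/(fine (\int[(lam \x lam)%E]_x ((EFin \o peval p) \_ S0) x)%E).
rewrite -integral12_prod_meas1 //.
transitivity (fine (\int[lam]_(x in `[0%R, 1%R]) ((seg (0, 1) (1, 0) (primY p)).[x])%:E)%E);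
  last by rewrite integral_horner.
congr fine.
have mp : measurable_fun setT (horner (seg (0, 1) (1, 0) (primY p)) : mR -> mR).
  apply: continuous_measurable_fun; exact: continuous_horner.
rewrite -integral_itv_obnd_cbnd; last exact/measurable_EFinP/measurable_funTS.
rewrite -integral_itv_bndo_bndc; last exact/measurable_EFinP/measurable_funTS.
rewrite [RHS]integral_mkcond; apply: eq_integral => x _.
rewrite /fubini_F /patch [in RHS]mem_setE in_itv /=.
case: ifP => [/andP[x0 x1]|x01]; last first.
  apply: integral0_eq => y _; case: ifP => //; rewrite inE => -[/= h1 h2 h3].
  by move: x01; rewrite h1 /= (_ : x < 1) //; lra.
rewrite horner_seg peval_primY /=.
transitivity (\int[lam]_(y in `]0%R, (1 - x)%R[) ((p.[x%:P]).[y])%:E)%E.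
  rewrite [RHS]integral_mkcond; apply: eq_integral => y _; rewrite /patch.
  rewrite [in RHS]mem_setE in_itv /=; congr (if _ then _ else _).
  apply/idP/idP; first by rewrite inE => -[/= h1 h2 h3]; rewrite h2 /=; lra.
  by rewrite inE => /andP[h1 h2]; split => //=; lra.
rewrite integral_horner_oo ?subr_gt0 // prim_horner0 subr0; congr ((prim _.[_]).[_])%:E.
  by congr polyC; rewrite /GRing.scale /=; ring.
by rewrite /GRing.scale /=; ring.
Qed.

End PolyIntegral.

Section TriangleIntegral.
Variable R : realType.
Implicit Types (z a b x c d v w : pt R) (p q r : poly2 R).
Local Notation mR := (measurableTypeR R).
Local Notation mP := (mR * mR)%type.
Local Notation lam := (@lebesgue_measure R).

Definition cstm : R -> poly2 R := polyC \o polyC.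
HB.instance Definition _ := GRing.RMorphism.on cstm.

Definition affX z v w : poly2 R := cst z.1 + cst v.1 * pX + cst w.1 * pY.
Definition affY z v w : poly2 R := cst z.2 + cst v.2 * pX + cst w.2 * pY.
Definition sub2 z v w : poly2 R -> poly2 R := ev2 cstm (affX z v w) (affY z v w).
HB.instance Definition _ z v w := GRing.RMorphism.on (sub2 z v w).

Definition psub (u l : poly2 R) : poly2 R -> poly2 R := ev2 cstm u l.
HB.instance Definition _ u l := GRing.RMorphism.on (psub u l).

Lemma psub_cst u l (c : R) : psub u l (cst c) = cst c.
Proof. exact: ev2_cst. Qed.
Lemma psub_X u l : psub u l pX = u. Proof. exact: ev2_X. Qed.
Lemma psub_Y u l : psub u l pY = l. Proof. exact: ev2_Y. Qed.
Lemma psubM u l p q : psub u l (p * q) = psub u l p * psub u l q.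
Proof. exact: rmorphM. Qed.
Lemma psub_exp u l p n : psub u l (p ^+ n) = psub u l p ^+ n.
Proof. exact: rmorphXn. Qed.
Lemma psub_sum u l (I : Type) (s : seq I) (P : pred I) (F : I -> poly2 R) :
  psub u l (\sum_(i <- s | P i) F i) = \sum_(i <- s | P i) psub u l (F i).
Proof. exact: rmorph_sum. Qed.

Lemma peval_psub u l p x : peval (psub u l p) x = peval p (peval u x, peval l x).
Proof.
pose f := ev2 idfun x.1 x.2 : {rmorphism poly2 R -> R}.
rewrite !pevalE -[LHS]/(f (psub u l p)) rmorph_ev2 /=.
by apply: eq_ev2 => c; rewrite /f /= -[cstm c]/(cst c) -pevalE peval_cst.
Qed.

Lemma psub_derivation (del : poly2 R -> poly2 R) u l p :
  (forall p q, del (p + q) = del p + del q) ->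
  (forall p q, del (p * q) = del p * q + p * del q) ->
  (forall c : R, del (cst c) = 0) ->
  del (psub u l p) = psub u l (dx p) * del u + psub u l (dy p) * del l.
Proof. by move=> dD dM dc; apply: ev2_derivation. Qed.

Lemma peval_sub2 z v w p x : peval (sub2 z v w p) x = peval p (aff z v w x).
Proof.
pose f := ev2 idfun x.1 x.2 : {rmorphism poly2 R -> R}.
rewrite !pevalE -[LHS]/(f (sub2 z v w p)) rmorph_ev2 /=.
have -> : f (affX z v w) = (aff z v w x).1.
  by rewrite /f /= -pevalE /affX !pevalsE /aff /= /GRing.scale /=; ring.
have -> : f (affY z v w) = (aff z v w x).2.
  by rewrite /f /= -pevalE /affY !pevalsE /aff /= /GRing.scale /=; ring.
by apply: eq_ev2 => c; rewrite /f /= -[cstm c]/(cst c) -pevalE peval_cst.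
Qed.

Definition dirD v p : poly2 R := cst v.1 * dx p + cst v.2 * dy p.

Lemma dx_affX z v w : dx (affX z v w) = cst v.1.
Proof. by rewrite /affX !dxD !dxM !dx_cst dxX dxY; ring. Qed.
Lemma dx_affY z v w : dx (affY z v w) = cst v.2.
Proof. by rewrite /affY !dxD !dxM !dx_cst dxX dxY; ring. Qed.
Lemma dy_affX z v w : dy (affX z v w) = cst w.1.
Proof. by rewrite /affX !dyD !dyM !dy_cst dyX dyY; ring. Qed.
Lemma dy_affY z v w : dy (affY z v w) = cst w.2.
Proof. by rewrite /affY !dyD !dyM !dy_cst dyX dyY; ring. Qed.

Lemma sub2_cst z v w (c : R) : sub2 z v w (cst c) = cst c.
Proof. exact: ev2_cst. Qed.
Lemma sub2_X z v w : sub2 z v w pX = affX z v w. Proof. exact: ev2_X. Qed.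
Lemma sub2_Y z v w : sub2 z v w pY = affY z v w. Proof. exact: ev2_Y. Qed.

Lemma sub2D z v w p q : sub2 z v w (p + q) = sub2 z v w p + sub2 z v w q.
Proof. exact: rmorphD. Qed.
Lemma sub2M z v w p q : sub2 z v w (p * q) = sub2 z v w p * sub2 z v w q.
Proof. exact: rmorphM. Qed.
Lemma sub20 z v w : sub2 z v w 0 = 0. Proof. exact: rmorph0. Qed.
Lemma sub21 z v w : sub2 z v w 1 = 1. Proof. exact: rmorph1. Qed.
Lemma sub2N z v w p : sub2 z v w (- p) = - sub2 z v w p.
Proof. by apply: (addrI (sub2 z v w p)); rewrite -sub2D !subrr sub20. Qed.
Lemma sub2_exp z v w p n : sub2 z v w (p ^+ n) = sub2 z v w p ^+ n.
Proof. exact: rmorphXn. Qed.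
Definition sub2E := (sub20, sub21, sub2D, sub2N, sub2M, sub2_cst, sub2_X, sub2_Y, sub2_exp).

Lemma dx_sub2 z v w p : dx (sub2 z v w p) = sub2 z v w (dirD v p).
Proof.
rewrite (@ev2_derivation _ _ cstm _ _ (@dx R)); first last.
- by move=> c; exact: dx_cst.
- exact: dxM.
- exact: dxD.
by rewrite dx_affX dx_affY /dirD !sub2E !(mulrC (cst _)).
Qed.
Lemma dy_sub2 z v w p : dy (sub2 z v w p) = sub2 z v w (dirD w p).
Proof.
rewrite (@ev2_derivation _ _ cstm _ _ (@dy R)); first last.
- by move=> c; exact: dy_cst.
- exact: dyM.
- exact: dyD.
by rewrite dy_affX dy_affY /dirD !sub2E !(mulrC (cst _)).
Qed.

Definition J z a b p : R := intg (tset (T3 z a b))° (peval p).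
(* The vector field x |-> q(x) (x - v), whose divergence is 2 q + eul v q, has no flux through the
   edges at the vertex v. *)
Definition eul v q : poly2 R := (pX - cst v.1) * dx q + (pY - cst v.2) * dy q.

Lemma measurable_interior z a b : Det z a b != 0 -> measurable ((tset (T3 z a b))° : set mP).
Proof.
move=> D0; pose f v w y : mP -> mR := peval (bcp v w y).
have -> : ((tset (T3 z a b))° : set mP) =
   (setT `&` (f z a b @^-1` `]0, +oo[)) `&`
   ((setT `&` f a b z @^-1` `]0, +oo[) `&` (setT `&` f b z a @^-1` `]0, +oo[)).
  apply/seteqP; split=> x; rewrite /preimage /setI /mkset /f !peval_bcp !in_itv !andbT.
    by move=> /(tset_interior _ D0)[].
  by move=> [[_ ?]] [[_ ?] [_ ?]]; apply/(tset_interior _ D0).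
have mf v w y : measurable (setT `&` f v w y @^-1` `]0, +oo[).
  by apply: (measurable_peval (bcp v w y)).
by apply: measurableI => //; apply: measurableI.
Qed.

Lemma tset_box z a b : Det z a b != 0 -> exists M, tset (T3 z a b) `<=` box M.
Proof.
move=> D0; pose M := `|z.1| + `|a.1 - z.1| + `|b.1 - z.1| + (`|z.2| + `|a.2 - z.2| + `|b.2 - z.2|).
exists M => x Kx; have [h1 h2 h3] := (tsetP _ D0).1 Kx.
have bs := bc_sum x D0.
rewrite (bc_comb x D0) /box /=.
have k (y s t u v : R) : 0 <= s <= 1 -> 0 <= t <= 1 -> `|y + s * u + t * v| <= `|y| + `|u| + `|v|.
  move=> /andP[s0 s1] /andP[t0 t1].
  apply: le_trans (ler_normD _ _) _; apply: lerD; last first.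
    by rewrite normrM ger0_norm // ler_piMl.
  apply: le_trans (ler_normD _ _) _; apply: lerD => //.
  by rewrite normrM ger0_norm // ler_piMl.
have i1 : 0 <= bc a b z x <= 1 by lra.
have i2 : 0 <= bc b z a x <= 1 by lra.
have := k z.1 _ _ (a.1 - z.1) (b.1 - z.1) i1 i2.
have := k z.2 _ _ (a.2 - z.2) (b.2 - z.2) i1 i2.
have n1 : 0 <= `|z.1| + `|a.1 - z.1| + `|b.1 - z.1| by rewrite !addr_ge0.
have n2 : 0 <= `|z.2| + `|a.2 - z.2| + `|b.2 - z.2| by rewrite !addr_ge0.
by rewrite /GRing.scale /= => k2 k1; split; [apply: le_trans k1 _|apply: le_trans k2 _]; rewrite /M; lra.
Qed.

Lemma integrable_interior z a b p : Det z a b != 0 ->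
  (leb2 R).-integrable (tset (T3 z a b))° (EFin \o peval p).
Proof.
move=> D0; have [M hM] := tset_box D0.
apply: integrable_peval (measurable_interior D0) _ => x /interior_subset; exact: hM.
Qed.

Lemma preimage_aff z a b : Det z a b != 0 ->
  aff z (a - z) (b - z) @^-1` (tset (T3 z a b))° = @S0 R.
Proof.
move=> D0; apply/seteqP; split=> x.
  move=> /(tset_interior _ D0); rewrite /aff.
  by have [-> [-> ->]] := bc_vertex x.1 x.2 D0 => -[h1 h2 h3]; split => //; lra.
move=> [h1 h2 h3]; apply/(tset_interior _ D0); rewrite /aff.
by have [-> [-> ->]] := bc_vertex x.1 x.2 D0; split => //; lra.
Qed.

Lemma J_ref z a b p : Det z a b != 0 ->
  J z a b p = `|Det z a b| * Jr (sub2 z (a - z) (b - z) p).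
Proof.
move=> D0; have := Rintegral_scaling (scaling_aff z D0) (measurable_interior D0)
  (@measurable_peval _ p) (integrable_interior p D0).
rewrite preimage_aff // -/(Det z a b) => h.
rewrite /J /intg -[RHS](_ : `|Det z a b| * Rintegral (leb2 R) (@S0 R)
   (peval p \o aff z (a - z) (b - z)) = _).
  by rewrite h mulrA mulfV ?mul1r // normr_eq0.
congr (_ * Rintegral _ _ _); apply/funext => x.
by rewrite peval_sub2.
Qed.

Section Linearity.
Variables (z a b : pt R) (D0 : Det z a b != 0).
Let mK := measurable_interior D0.
Let iK p := integrable_interior p D0.

Lemma JD p q : J z a b (p + q) = J z a b p + J z a b q.
Proof.
rewrite /J /intg -(RintegralD mK (iK p) (iK q)).
by congr Rintegral; apply/funext => x; rewrite pevalD.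
Qed.
Lemma JZ (c : R) p : J z a b (cst c * p) = c * J z a b p.
Proof.
rewrite /J /intg -(RintegralZl _ mK (iK p)).
by congr Rintegral; apply/funext => x; rewrite pevalM peval_cst.
Qed.
Lemma J_le p q : (forall x, tset (T3 z a b) x -> peval p x <= peval q x) ->
  J z a b p <= J z a b q.
Proof.
move=> pq; apply: (le_Rintegral mK (iK p) (iK q)).
by move=> x /interior_subset /pq.
Qed.
End Linearity.

Lemma seg_cst c d (e : R) : seg c d (cst e) = e%:P.
Proof. exact: ev2_cst. Qed.
Lemma seg_X c d : seg c d pX = c.1%:P + (d.1 - c.1) *: 'X.
Proof. exact: ev2_X. Qed.
Lemma seg_Y c d : seg c d pY = c.2%:P + (d.2 - c.2) *: 'X.
Proof. exact: ev2_Y. Qed.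

Lemma segD c d p q : seg c d (p + q) = seg c d p + seg c d q.
Proof. exact: rmorphD. Qed.
Lemma segM c d p q : seg c d (p * q) = seg c d p * seg c d q.
Proof. exact: rmorphM. Qed.
Lemma seg0 c d : seg c d 0 = 0. Proof. exact: rmorph0. Qed.
Lemma seg1 c d : seg c d 1 = 1. Proof. exact: rmorph1. Qed.
Lemma segN c d p : seg c d (- p) = - seg c d p.
Proof. by apply: (addrI (seg c d p)); rewrite -segD !subrr seg0. Qed.
Lemma seg_exp c d p n : seg c d (p ^+ n) = seg c d p ^+ n.
Proof. exact: rmorphXn. Qed.
Definition segE := (seg0, seg1, segD, segN, segM, seg_cst, seg_X, seg_Y, seg_exp).

Lemma deriv_seg c d p : (seg c d p)^`() = seg c d (dirD (d - c) p).
Proof.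
rewrite (@ev2_derivation _ _ polyC _ _ (@deriv R)); first last.
- by move=> e; exact: derivC.
- exact: derivM.
- exact: derivD.
rewrite !derivD !derivC !derivZ derivX !alg_polyC !add0r -!/(seg c d _).
by rewrite /dirD !segE ![_ * _%:P]mulrC.
Qed.

Lemma seg_rev c d p : seg c d p \Po (1 - 'X) = seg d c p.
Proof.
apply: poly_ext => t; rewrite horner_comp !horner_seg !(hornerD, hornerN, hornerX, hornerC).
by congr peval; congr pair; rewrite /= /GRing.scale /=; ring.
Qed.

Lemma I01_seg_rev c d p : I01 (seg d c p) = I01 (seg c d p).
Proof. by rewrite -seg_rev I01_rev. Qed.

Lemma seg_sub2 z v w c d p :
  seg c d (sub2 z v w p) = seg (aff z v w c) (aff z v w d) p.
Proof.
apply: poly_ext => t; rewrite !horner_seg peval_sub2 /aff.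
by congr peval; congr pair; rewrite /= /GRing.scale /=; ring.
Qed.

Lemma I01_seg_halves c d p : I01 (seg c d p) =
  2^-1 * (I01 (seg c (midpt c d) p) + I01 (seg (midpt c d) d p)).
Proof.
rewrite I01_halves; congr (_ * (I01 _ + I01 _)); apply: poly_ext => t;
  rewrite horner_comp !horner_seg !(hornerD, hornerZ, hornerX, hornerC);
  by congr peval; congr pair; rewrite /= /GRing.scale /=; field.
Qed.

Lemma primY_mulX p : primY (pX * p) = pX * primY p.
Proof.
apply/polyP => i; rewrite coef_primY !coefXM.
by case: i => [|i]; rewrite ?eqxx ?prim0 //= coef_primY.
Qed.
Lemma primY_dx p : primY (dx p) = dx (primY p).
Proof. by apply/polyP => i; rewrite coef_primY !coef_deriv coef_primY primMn. Qed.
Lemma primYD p q : primY (p + q) = primY p + primY q.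
Proof. by apply/polyP => i; rewrite coefD !coef_primY coefD primD. Qed.
Lemma primY_eul p : primY (pY * dy p) = pY * p - primY p.
Proof.
apply/polyP => i; rewrite coefB coef_primY !coefCM coef_primY coef_map /=.
have -> : 'X * (p`_i)^`() = ('X * p`_i - prim p`_i)^`().
  by rewrite derivB derivM derivX deriv_prim mul1r [p`_i + _]addrC addrK.
by rewrite prim_deriv hornerD hornerN hornerM hornerX prim_horner0 mul0r subrr subr0.
Qed.
Lemma dy_primY p : dy (primY p) = p.
Proof. by apply/polyP => i; rewrite coef_map /= coef_primY deriv_prim. Qed.

(** The divergence theorem for the field q(x) x, which is tangential on both legs. With P =
    [primY q], Fubini turns the left side into the integral over the hypotenuse of an exact
    derivative plus q, and the end values of that derivative contribute 0 since P vanishes at (1,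
    0). *)
Lemma Jr_div q : Jr (cst 2 * q + (pX * dx q + pY * dy q)) = I01 (seg (1, 0) (0, 1) q).
Proof.
pose P := primY q.
have e : primY (cst 2 * q + (pX * dx q + pY * dy q)) = P + pX * dx P + pY * q.
  rewrite (_ : cst 2 = 1 + 1); last by rewrite /cst -polyCD -polyCD.
  by rewrite mulrDl mul1r !primYD primY_mulX primY_dx primY_eul /P; ring.
rewrite Jr_primY e; set s := seg (0, 1) (1, 0).
have dP : (s P)^`() = s (dx P) - s q.
  rewrite deriv_seg /dirD /= subr0 sub0r dy_primY !segE.
  by rewrite polyCN polyC1 mul1r mulN1r.
have sX : s pX = 'X by rewrite /s seg_X /= subr0 add0r scale1r.
have sY : s pY = 1 - 'X by rewrite /s seg_Y /= sub0r scaleN1r polyC1.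
have -> : s (P + pX * dx P + pY * q) = ('X * s P)^`() + s q.
  by rewrite derivM derivX dP /s !segD !segM -/s sX sY; ring.
rewrite I01D I01_deriv !hornerM !hornerX mul0r subr0 mul1r.
rewrite horner_seg peval_primY /= (_ : 1 + 1 *: (0 - 1) = 0); last by rewrite /GRing.scale /=; ring.
by rewrite prim_horner0 add0r I01_seg_rev.
Qed.

(** The affine image of [Jr_div]. On ab the normal component of x - z is the height over ab, and
    height times length is |Det|. *)
Lemma J_div_vertex z a b q : Det z a b != 0 ->
  J z a b (cst 2 * q + eul z q) = `|Det z a b| * I01 (seg a b q).
Proof.
move=> D0; rewrite J_ref //; set s := sub2 z (a - z) (b - z); congr (_ * _).
have -> : s (cst 2 * q + eul z q) = cst 2 * s q + (pX * dx (s q) + pY * dy (s q)).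
  rewrite /s dx_sub2 dy_sub2 /eul /dirD !sub2E /affX /affY /=; ring.
rewrite Jr_div seg_sub2 /aff; congr (I01 (seg _ _ _));
  by apply: pt_ext; rewrite /= /GRing.scale /=; ring.
Qed.

End TriangleIntegral.

(** * Broken functions on bisection trees *)

Section BisectionTrees.
Variable R : realType.
Implicit Types (z a b x c d v : pt R) (p q r : poly2 R) (L : tri R).

(* The bisection history of a triangle; every node is a bisection at the newest vertex. *)
Inductive btree := Lf | Nd of btree & btree.

Implicit Types t : btree.

(** The orders of the vertices give both children the orientation of the parent. The inner edge is
    then the third edge of the first child and the second edge of the second child. *)
Fixpoint leaves t z a b : seq (tri R) :=
  match t with
  | Lf => [:: T3 z a b]
  | Nd t1 t2 => leaves t1 (midpt a b) z a ++ leaves t2 (midpt a b) b z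
  end.

(** Defined along the tree, so that splitting into halves holds by computation; [J_tree] and
    [Jt_sum] relate it to integrals over sets. *)
Fixpoint Jt t z a b (G : tri R -> poly2 R) : R :=
  match t with
  | Lf => J z a b (G (T3 z a b))
  | Nd t1 t2 => Jt t1 (midpt a b) z a G + Jt t2 (midpt a b) b z G
  end.

(* The means of the piecewise polynomial w q over the edges ab, bz and za, in this order. *)
Fixpoint emean t z a b (w : tri R -> poly2 R) q : R * R * R :=
  match t with
  | Lf => let r := w (T3 z a b) * q in
     (I01 (seg a b r), I01 (seg b z r), I01 (seg z a r))
  | Nd t1 t2 =>
     let e := emean t1 (midpt a b) z a w q in
     let f := emean t2 (midpt a b) b z w q in
     (2^-1 * (e.1.2 + f.2), f.1.1, e.1.1)
  end.

(* On the inner edge that a bisection creates, the two sides have the same moments against Q. *)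
Fixpoint compat (Q : poly2 R -> Prop) t z a b (w : tri R -> poly2 R) : Prop :=
  match t with
  | Lf => True
  | Nd t1 t2 =>
     [/\ compat Q t1 (midpt a b) z a w, compat Q t2 (midpt a b) b z w &
      forall q, Q q -> (emean t1 (midpt a b) z a w q).2 =
                       (emean t2 (midpt a b) b z w q).1.2]
  end.

Lemma Det_child1 z a b : Det (midpt a b) z a = 2^-1 * Det z a b.
Proof. by rewrite /Det /det2 /midpt /= /GRing.scale /=; field. Qed.
Lemma Det_child2 z a b : Det (midpt a b) b z = 2^-1 * Det z a b.
Proof. by rewrite /Det /det2 /midpt /= /GRing.scale /=; field. Qed.
Lemma Det_child1_neq0 z a b : Det z a b != 0 -> Det (midpt a b) z a != 0.
Proof. by move=> D0; rewrite Det_child1 mulf_neq0 // invr_neq0. Qed.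
Lemma Det_child2_neq0 z a b : Det z a b != 0 -> Det (midpt a b) b z != 0.
Proof. by move=> D0; rewrite Det_child2 mulf_neq0 // invr_neq0. Qed.

Lemma vertices_rot z a b : vertices (T3 a b z) = vertices (T3 z a b).
Proof. by apply/fsetP => v; rewrite !inE; do 3! case: eqP => //=. Qed.
Lemma vertices_swap z a b : vertices (T3 z b a) = vertices (T3 z a b).
Proof. by apply/fsetP => v; rewrite !inE; do 3! case: eqP => //=. Qed.
Lemma J_rot z a b p : J a b z p = J z a b p.
Proof. by rewrite /J /tset vertices_rot. Qed.

Lemma J_const z a b (e : R) : Det z a b != 0 -> J z a b (cst e) = 2^-1 * `|Det z a b| * e.
Proof.
move=> D0; have := J_div_vertex (cst (2^-1 * e)) D0.
rewrite seg_cst I01C (_ : cst 2 * _ + _ = cst e); first by move=> ->; ring.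
rewrite /eul dx_cst dy_cst !mulr0 !addr0 /cst -polyCM -polyCM; congr (_%:P%:P); by field.
Qed.

(** The field is affine in v, so this is the combination of the identities at the three vertices,
    weighted by the barycentric coordinates of v. *)
Lemma J_div z a b v r : Det z a b != 0 ->
  J z a b (cst 2 * r + eul v r) = Num.sg (Det z a b) *
   (Det v a b * I01 (seg a b r) + Det v b z * I01 (seg b z r) + Det v z a * I01 (seg z a r)).
Proof.
move=> D0; pose m1 := bc z a b v; pose m2 := bc a b z v; pose m3 := bc b z a v.
have -> : cst 2 * r + eul v r = cst m1 * (cst 2 * r + eul z r) +
   (cst m2 * (cst 2 * r + eul a r) + cst m3 * (cst 2 * r + eul b r)).
  have c1 : cst m1 = 1 - cst m2 - cst m3.
    rewrite -[1]/(cst 1) /cst -!polyCB; congr (_%:P%:P).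
    by rewrite -(bc_sum v D0) /m1 /m2 /m3; ring.
  have e i : i = z.1 + m2 * (a.1 - z.1) + m3 * (b.1 - z.1) ->
     cst i = cst z.1 + cst m2 * (cst a.1 - cst z.1) + cst m3 * (cst b.1 - cst z.1).
    by move=> ->; rewrite /cst !(polyCD, polyCM, polyCN).
  have e' i : i = z.2 + m2 * (a.2 - z.2) + m3 * (b.2 - z.2) ->
     cst i = cst z.2 + cst m2 * (cst a.2 - cst z.2) + cst m3 * (cst b.2 - cst z.2).
    by move=> ->; rewrite /cst !(polyCD, polyCM, polyCN).
  have v1 : cst v.1 = cst z.1 + cst m2 * (cst a.1 - cst z.1) + cst m3 * (cst b.1 - cst z.1).
    by apply: e; rewrite {1}(bc_comb v D0).
  have v2 : cst v.2 = cst z.2 + cst m2 * (cst a.2 - cst z.2) + cst m3 * (cst b.2 - cst z.2).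
    by apply: e'; rewrite {1}(bc_comb v D0).
  by rewrite /eul v1 v2 c1; ring.
have D1 : Det a b z != 0 by rewrite Det_rot.
have D2 : Det b z a != 0 by rewrite Det_rot2.
have h1 := J_div_vertex r D0.
have h2 : J z a b (cst 2 * r + eul a r) = `|Det z a b| * I01 (seg b z r).
  by rewrite -(J_rot z a b) (J_div_vertex r D1) (Det_rot z a b).
have h3 : J z a b (cst 2 * r + eul b r) = `|Det z a b| * I01 (seg z a r).
  by rewrite -(J_rot z a b) -(J_rot a b z) (J_div_vertex r D2) (Det_rot2 z a b).
rewrite (JD D0) (JD D0) !(JZ D0) h1 h2 h3 /m1 /m2 /m3 /bc (Det_rot z a b) (Det_rot2 z a b).
rewrite (normrEsg (Det z a b)); move: (Det v a b) (Det v b z) (Det v z a) => e1 e2 e3.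
by move: D0; move: (Det z a b) => D D0; field.
Qed.

Lemma eq_Jt t z a b G G' : (forall L, L \in leaves t z a b -> G L = G' L) ->
  Jt t z a b G = Jt t z a b G'.
Proof.
elim: t z a b => [|t1 IH1 t2 IH2] z a b GG /=; first by rewrite GG ?inE.
by congr (_ + _); [apply: IH1|apply: IH2] => L hL; apply: GG; rewrite mem_cat hL ?orbT.
Qed.

Lemma JtD t z a b G G' : Det z a b != 0 ->
  Jt t z a b (fun L => G L + G' L) = Jt t z a b G + Jt t z a b G'.
Proof.
elim: t z a b => [|t1 IH1 t2 IH2] z a b D0 /=; first exact: JD.
by rewrite IH1 ?IH2 ?Det_child1_neq0 ?Det_child2_neq0 // addrACA.
Qed.

Lemma JtZ t z a b (e : R) G : Det z a b != 0 ->
  Jt t z a b (fun L => cst e * G L) = e * Jt t z a b G.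
Proof.
elim: t z a b => [|t1 IH1 t2 IH2] z a b D0 /=; first exact: JZ.
by rewrite IH1 ?IH2 ?Det_child1_neq0 ?Det_child2_neq0 // mulrDr.
Qed.

Lemma Jt_const t z a b (e : R) : Det z a b != 0 ->
  Jt t z a b (fun=> cst e) = 2^-1 * `|Det z a b| * e.
Proof.
elim: t z a b => [|t1 IH1 t2 IH2] z a b D0 /=; first exact: J_const.
rewrite IH1 ?IH2 ?Det_child1_neq0 ?Det_child2_neq0 // Det_child1 Det_child2.
have h2 : (0 : R) <= 2^-1 by rewrite invr_ge0 ler0n.
by rewrite normrM (ger0_norm h2); field.
Qed.

Lemma tset_DetP z a b x : Det z a b != 0 -> tset (T3 z a b) x <->
  [/\ 0 <= Det x a b / Det z a b, 0 <= Det x b z / Det z a b & 0 <= Det x z a / Det z a b].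
Proof. by move=> D0; rewrite tsetP // /bc (Det_rot z a b) (Det_rot2 z a b). Qed.

Lemma tset_child z a b x : Det z a b != 0 ->
  tset (T3 (midpt a b) z a) x \/ tset (T3 (midpt a b) b z) x -> tset (T3 z a b) x.
Proof.
move=> D0 h; apply/(tset_DetP _ D0).
have half (s : R) : s / (2^-1 * Det z a b) = 2 * (s / Det z a b).
  by rewrite invfM invrK mulrCA.
have e1 : Det x a b = 2 * Det x a (midpt a b).
  by rewrite /Det /det2 /midpt /= /GRing.scale /=; field.
have e2 : Det x b z = 2 * Det x (midpt a b) z + Det x z a.
  by rewrite /Det /det2 /midpt /= /GRing.scale /=; field.
have e3 : Det x a b = 2 * Det x (midpt a b) b.
  by rewrite /Det /det2 /midpt /= /GRing.scale /=; field.
have e4 : Det x z a = 2 * Det x z (midpt a b) + Det x b z.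
  by rewrite /Det /det2 /midpt /= /GRing.scale /=; field.
case: h => [/(tset_DetP _ (Det_child1_neq0 D0))|/(tset_DetP _ (Det_child2_neq0 D0))];
  rewrite ?Det_child1 ?Det_child2 !half => -[h1 h2 h3].
  by split; rewrite ?e1 ?e2; lra.
by split; [rewrite e3|idtac|rewrite e4]; lra.
Qed.

Lemma leaves_subset t z a b L : Det z a b != 0 -> L \in leaves t z a b ->
  tset L `<=` tset (T3 z a b).
Proof.
elim: t z a b => [|t1 IH1 t2 IH2] z a b D0 /=; first by rewrite inE => /eqP ->.
rewrite mem_cat => /orP[/IH1|/IH2] h x Lx; apply: tset_child => //.
  by left; apply: h => //; exact: Det_child1_neq0.
by right; apply: h => //; exact: Det_child2_neq0.
Qed.

Lemma Jt_le t z a b G G' : Det z a b != 0 ->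
  (forall L, L \in leaves t z a b -> forall x, tset L x -> tset (T3 z a b) x ->
     peval (G L) x <= peval (G' L) x) ->
  Jt t z a b G <= Jt t z a b G'.
Proof.
elim: t z a b => [|t1 IH1 t2 IH2] z a b D0 le /=.
  by apply: J_le => // x Kx; apply: le; rewrite ?inE.
apply: lerD; [apply: IH1; first exact: Det_child1_neq0|apply: IH2; first exact: Det_child2_neq0];
  move=> L hL x Lx Kx; apply: le => //; rewrite ?mem_cat ?hL ?orbT //; apply: tset_child => //.
  by left.
by right.
Qed.

(** Induction on the tree: [compat] cancels the two fluxes through the inner edge, and the halves of
    ab lie on one line, so that they share the factor [Det v a b] / 2. *)
Lemma Jt_div Q t z a b w q v : Det z a b != 0 -> compat Q t z a b w -> Q q ->
  Jt t z a b (fun L => cst 2 * (w L * q) + eul v (w L * q)) = Num.sg (Det z a b) *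
   (Det v a b * (emean t z a b w q).1.1 + Det v b z * (emean t z a b w q).1.2
    + Det v z a * (emean t z a b w q).2).
Proof.
move=> + + Qq; elim: t z a b => [|t1 IH1 t2 IH2] z a b D0 /=; first by rewrite J_div.
move=> [h1 h2 h3]; rewrite (IH1 _ _ _ (Det_child1_neq0 D0) h1).
rewrite (IH2 _ _ _ (Det_child2_neq0 D0) h2) (h3 _ Qq).
rewrite Det_child1 Det_child2 sgrM (_ : Num.sg 2^-1 = 1) ?mul1r; last first.
  by rewrite gtr0_sg // invr_gt0.
rewrite -mulrDr; congr (_ * _); rewrite /Det /det2 /midpt /= /GRing.scale /=.
by field.
Qed.

Lemma emean_poly t z a b p q : emean t z a b (fun=> p) q =
  (I01 (seg a b (p * q)), I01 (seg b z (p * q)), I01 (seg z a (p * q))).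
Proof.
elim: t z a b => [|t1 IH1 t2 IH2] z a b //=; rewrite IH1 IH2 /=.
by rewrite -I01_seg_halves.
Qed.

Lemma compat_poly Q t z a b p : compat Q t z a b (fun=> p).
Proof.
elim: t z a b => [|t1 IH1 t2 IH2] z a b //=; split=> // q _.
by rewrite !emean_poly /= I01_seg_rev.
Qed.

Lemma emeanD t z a b w w' q : emean t z a b (fun L => w L + w' L) q =
  emean t z a b w q + emean t z a b w' q.
Proof.
elim: t z a b => [|t1 IH1 t2 IH2] z a b /=; first by rewrite mulrDl !segD !I01D.
rewrite IH1 IH2 /=; congr (_, _, _); rewrite /=; ring.
Qed.

Lemma compatD Q t z a b w w' : compat Q t z a b w -> compat Q t z a b w' ->
  compat Q t z a b (fun L => w L + w' L).
Proof.
elim: t z a b => [|t1 IH1 t2 IH2] z a b //= -[h1 h2 h3] [k1 k2 k3]; split; [exact: IH1|exact: IH2|].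
by move=> q Qq; rewrite !emeanD /= h3 ?k3.
Qed.

End BisectionTrees.

(** * Finite-dimensional tools: dual bases and comparison of quadratic forms *)

Section LinearAlgebra.
Variable R : realType.

(** Unisolvence by duality: all values of the functionals j can be prescribed on combinations of the
    trial elements i if no nontrivial combination of the functionals vanishes on every trial
    element. *)
Lemma solve_dual (I J : finType) (M : I -> J -> R) :
  (forall c : J -> R, (forall i, \sum_j M i j * c j = 0) -> forall j, c j = 0) ->
  forall y : J -> R, exists x : I -> R, forall j, \sum_i x i * M i j = y j.
Proof.
move=> inj y.
pose A : 'M[R]_(#|I|, #|J|) := \matrix_(i, j) M (enum_val i) (enum_val j).
have full : row_full A.
  rewrite /row_full -mxrank_tr -/(row_free A^T) -kermx_eq0; apply/rowV0P => c /sub_kermxP cA.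
  apply/rowP => j; rewrite mxE -(enum_valK j).
  pose c' (v : J) := c 0 (enum_rank v).
  apply: (inj c') => i; have := congr1 (fun B : 'rV_(#|I|) => B 0 (enum_rank i)) cA.
  rewrite [_ 0 _]mxE [RHS]mxE => e0; rewrite -[RHS]e0 (reindex _ (onW_bij _ (@enum_val_bij J))) /=.
  by apply: eq_bigr => s _; rewrite !mxE /c' enum_rankK enum_valK mulrC.
have /submxP [x yx] : ((\row_j y (enum_val j) : 'rV_(#|J|)) <= A)%MS by rewrite submx_full.
exists (fun i => x 0 (enum_rank i)) => j.
have := congr1 (fun B : 'rV_(#|J|) => B 0 (enum_rank j)) yx.
rewrite !mxE enum_rankK => ->; rewrite (reindex _ (onW_bij _ (@enum_val_bij I))) /=.
by apply: eq_bigr => i _; rewrite !mxE enum_rankK enum_valK.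
Qed.

(** For b > 0 the choice s = b, t = - c gives b (a b - c^2); for b = 0 the form would be negative
    for a large multiple t unless c = 0. *)
Lemma quadratic_CS (a b c : R) :
  (forall s t, 0 <= s ^+ 2 * a + 2 * (s * t) * c + t ^+ 2 * b) -> c ^+ 2 <= a * b.
Proof.
move=> h; have b0 : 0 <= b by have := h 0 1; rewrite !(expr0n, mul0r, mulr0, add0r, expr1n, mul1r).
have a0 : 0 <= a by have := h 1 0; rewrite !(expr0n, mul0r, mulr0, addr0, expr1n, mul1r).
have [b00|bN0] := eqVneq b 0; last first.
  have bp : 0 < b by rewrite lt_neqAle eq_sym bN0.
  have := h b (- c); rewrite -[X in 0 <= X](_ : b * (a * b - c ^+ 2) = _); last by ring.
  by rewrite pmulr_rge0 // subr_ge0.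
rewrite b00 mulr0; have [->|cN0] := eqVneq c 0; first by rewrite expr0n.
have := h 1 (- (a + 1) / (2 * c)); rewrite b00 mulr0 addr0 expr1n !mul1r.
have -> : 2 * (- (a + 1) / (2 * c)) * c = - (a + 1) by field.
lra.
Qed.

(** The kernel inclusion factors A as B M B, so that the form of A is a quadratic expression in the
    entries of x B. Each entry is bounded by the form of B through Cauchy-Schwarz against a unit
    vector. *)
Lemma qform_le (N : nat) (A B : 'M[R]_N) : A^T = A -> B^T = B ->
  (forall x : 'rV_N, 0 <= (x *m B *m x^T) 0 0) ->
  (forall x : 'rV_N, x *m B = 0 -> x *m A = 0) ->
  exists2 C, 0 <= C & forall x : 'rV_N, (x *m A *m x^T) 0 0 <= C * (x *m B *m x^T) 0 0.
Proof.
move=> As Bs B0 kerBA.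
(* By symmetry the inclusion of kernels is an inclusion of row spaces. *)
have AB : (A <= B)%MS.
  rewrite submxE; apply/eqP; rewrite -[_ *m _]trmxK trmx_mul As.
  suff -> : (cokermx B)^T *m A = 0 by rewrite trmx0.
  apply/row_matrixP => i; rewrite row_mul row0; apply: kerBA.
  by rewrite -row_mul -{2}Bs -trmx_mul mulmx_coker trmx0 row0.
have /submxP [D AD] := AB.
pose M := D^T *m pinvmx B.
have A2 : A = B *m D^T by rewrite -{1}As AD trmx_mul Bs.
have AE : A = B *m M *m B by rewrite /M mulmxA -A2 mulmxKpV.
pose Q (x : 'rV_N) := (x *m B *m x^T) 0 0.
have CS (x : 'rV_N) i : ((x *m B) 0 i) ^+ 2 <= Q x * B i i.
  pose e : 'rV[R]_N := delta_mx 0 i.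
  have xBe : (x *m B *m e^T) 0 0 = (x *m B) 0 i by rewrite /e trmx_delta -colE mxE.
  have eBx : (e *m B *m x^T) 0 0 = (x *m B) 0 i.
    have -> : e *m B *m x^T = (x *m B *m e^T)^T by rewrite !trmx_mul trmxK Bs mulmxA.
    by rewrite mxE xBe.
  have eBe : (e *m B *m e^T) 0 0 = B i i by rewrite /e trmx_delta -colE -rowE !mxE.
  apply: quadratic_CS => s t; have := B0 (s *: x + t *: e).
  rewrite linearD !linearZ /= !mulmxDl !mulmxDr -!scalemxAl -!scalemxAr.
  have eD (X Y : 'M[R]_1) : (X + Y) 0 0 = X 0 0 + Y 0 0 by rewrite mxE.
  have eZ (k : R) (X : 'M[R]_1) : (k *: X) 0 0 = k * X 0 0 by rewrite mxE.
  by rewrite !(eD, eZ) -/(Q x) xBe eBx eBe; congr (0 <= _); ring.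
have Bii i : 0 <= B i i.
  by have := B0 (delta_mx 0 i); rewrite trmx_delta -colE -rowE !mxE.
exists (\sum_i \sum_j `|M i j| * (B i i + B j j)).
  by apply: sumr_ge0 => i _; apply: sumr_ge0 => j _; rewrite mulr_ge0 // addr_ge0.
move=> x; have -> : (x *m A *m x^T) 0 0 = \sum_i \sum_j (x *m B) 0 i * M i j * (x *m B) 0 j.
  have -> : x *m A *m x^T = x *m B *m M *m (x *m B)^T by rewrite AE trmx_mul Bs !mulmxA.
  rewrite mxE exchange_big /=; apply: eq_bigr => j _.
  by rewrite !mxE mulr_suml; apply: eq_bigr => i _; rewrite !mxE.
rewrite mulr_suml; apply: ler_sum => i _; rewrite mulr_suml; apply: ler_sum => j _.
have h1 := CS x i; have h2 := CS x j; move: ((x *m B) 0 i) ((x *m B) 0 j) h1 h2 => y1 y2 h1 h2.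
have h3 : y1 * M i j * y2 <= `|M i j| * (y1 ^+ 2 + y2 ^+ 2).
  apply: le_trans (ler_norm _) _.
  rewrite !normrM mulrAC mulrC ler_wpM2l // -(real_normK (num_real y1)) -(real_normK (num_real y2)).
  move: `|y1| `|y2| => s t; nra.
apply: le_trans h3 _; rewrite -mulrA ler_wpM2l //; rewrite -/(Q x); lra.
Qed.

End LinearAlgebra.

(** * Polynomials of bounded total degree *)

Section Degree.
Variable R : realType.
Implicit Types (p q : poly2 R) (m n : nat).

Lemma Pk_cst m (c : R) : Pk m (cst c).
Proof. by move=> i j; rewrite /cst coefC; case: i => [|i]; rewrite ?coef0 ?eqxx //= coefC; case: j => [|j]; rewrite ?eqxx. Qed.
Lemma Pk0 m : Pk m (0 : poly2 R). Proof. exact: (@Pk_cst m 0). Qed.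
Lemma PkD m p q : Pk m p -> Pk m q -> Pk m (p + q).
Proof.
move=> hp hq i j; rewrite !coefD => h.
have [p0|/hp//] := eqVneq (p`_i`_j) 0; have [q0|/hq//] := eqVneq (q`_i`_j) 0.
by rewrite p0 q0 addr0 eqxx in h.
Qed.
Lemma Pk_le m n p : (m <= n)%N -> Pk m p -> Pk n p.
Proof. by move=> mn hp i j /hp h; exact: leq_trans h mn. Qed.
Lemma PkM m n p q : Pk m p -> Pk n q -> Pk (m + n) (p * q).
Proof.
move=> hp hq i j; rewrite coefM coef_sum => h; apply: contraT => ij.
case/eqP: h; rewrite big1 // => a _; rewrite coefM big1 // => b _.
have [->|/hp h1] := eqVneq (p`_a`_b) 0; first by rewrite mul0r.
have [->|/hq h2] := eqVneq (q`_(i - a)`_(j - b)) 0; first by rewrite mulr0.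
case/negP: ij; have := ltn_ord a; have := ltn_ord b; lia.
Qed.
Lemma Pk_X : Pk 1 (pX : poly2 R).
Proof. by move=> i j; rewrite /pX coefX; case: i => [|[|i]] /=; rewrite ?coef0 ?eqxx // coef1; case: j => [|j]; rewrite ?eqxx. Qed.
Lemma Pk_Y : Pk 1 (pY : poly2 R).
Proof. by move=> i j; rewrite /pY coefC; case: i => [|i]; rewrite ?coef0 ?eqxx //= coefX; case: j => [|[|j]]; rewrite ?eqxx. Qed.
Lemma PkXn m p n : Pk m p -> Pk (m * n) (p ^+ n).
Proof.
move=> hp; elim: n => [|n IH]; first exact: (@Pk_cst _ 1).
by rewrite exprS mulnS; exact: PkM.
Qed.
Lemma Pk_sum m (I : Type) (s : seq I) (P : pred I) (F : I -> poly2 R) :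
  (forall i, P i -> Pk m (F i)) -> Pk m (\sum_(i <- s | P i) F i).
Proof. by move=> h; elim/big_ind: _ => //; [exact: Pk0|exact: PkD]. Qed.
Lemma Pk_cstM m (c : R) p : Pk m p -> Pk m (cst c * p).
Proof. exact: (@PkM 0 m _ _ (@Pk_cst 0 c)). Qed.
Lemma PkN m p : Pk m p -> Pk m (- p).
Proof. move=> hp i j h; apply: (hp i j); apply: contraNneq h => h.
by rewrite !coefN h oppr0. Qed.
Lemma PkB m p q : Pk m p -> Pk m q -> Pk m (p - q).
Proof. by move=> hp hq; apply: PkD => //; exact: PkN. Qed.
Lemma Pk_dx m p : Pk m p -> Pk m.-1 (dx p).
Proof.
move=> hp i j; rewrite /dx coef_deriv coefMn => h.
have /hp : p`_i.+1`_j != 0 by apply: contraNneq h => ->; rewrite mul0rn.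
by case: m hp.
Qed.
Lemma Pk_dy m p : Pk m p -> Pk m.-1 (dy p).
Proof.
move=> hp i j; rewrite /dy coef_map /= coef_deriv => h.
have /hp : p`_i`_j.+1 != 0 by apply: contraNneq h => ->; rewrite mul0rn.
by case: m hp => [|m] hp; rewrite addnS.
Qed.

Definition mon (i j : nat) : poly2 R := pX ^+ i * pY ^+ j.

Lemma Pk_mon i j : Pk (i + j) (mon i j).
Proof. by apply: PkM; [have := PkXn (n := i) Pk_X|have := PkXn (n := j) Pk_Y]; rewrite mul1n. Qed.

Lemma Pk_decomp m p : Pk m p ->
  p = \sum_(ij : 'I_m.+1 * 'I_m.+1 | (ij.1 + ij.2 <= m)%N) cst p`_(ij.1)`_(ij.2) * mon ij.1 ij.2.
Proof.
move=> hp; rewrite -(pair_big_dep xpredT (fun i j : 'I_m.+1 => (i + j <= m)%N)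
   (fun i j => cst p`_i`_j * mon i j)) /=.
have e1 : p = \sum_(i < m.+1) (p`_i)%:P * pX ^+ i.
  rewrite -{1}(coefK p); apply/polyP => s; rewrite coef_poly coef_sum.
  under eq_bigr do rewrite coefCM coefXn.
  case: (ltnP s m.+1) => sm; last first.
    rewrite big1 => [|i _]; last by rewrite gtn_eqF ?mulr0 // (leq_trans (ltn_ord i)).
    case: ifP => // _; apply/polyP => t; rewrite coef0; apply/eqP; apply: contraT => /hp; lia.
  rewrite (bigD1 (Ordinal sm)) //= eqxx mulr1 big1 ?addr0 => [|i si]; last first.
    by rewrite [s == i]eq_sym (_ : (i == s :> nat) = false) ?mulr0 //; apply/negbTE.
  by case: ltnP => // /(nth_default 0) ->.
rewrite {1}e1; apply: eq_bigr => i _.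
have -> : (p`_i)%:P = \sum_(j < m.+1 | (i + j <= m)%N) cst p`_i`_j * pY ^+ j.
  transitivity ((\sum_(j < m.+1 | (i + j <= m)%N) (p`_i`_j)%:P * 'X ^+ j)%:P : poly2 R).
    congr polyC; apply/polyP => s; rewrite coef_sum.
    under eq_bigr do rewrite coefCM coefXn.
    case: (leqP (i + s) m) => sm; last first.
      rewrite big1 => [|j ij]; last by rewrite gtn_eqF ?mulr0 //; lia.
      by apply/eqP; apply: contraT => /hp; lia.
    have sm' : (s < m.+1)%N by lia.
    rewrite (bigD1 (Ordinal sm')) //= eqxx mulr1 big1 ?addr0 => [//|j /andP[_ sj]].
    by rewrite [s == j]eq_sym (_ : (j == s :> nat) = false) ?mulr0 //; apply/negbTE.
  rewrite rmorph_sum /=; apply: eq_bigr => j _.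
  by rewrite polyCM polyC_exp.
by rewrite mulr_suml; apply: eq_bigr => j _; rewrite /mon -mulrA [pY ^+ j * _]mulrC.
Qed.

Lemma Pk_sub2 m z v w p : Pk m p -> Pk m (sub2 z v w p).
Proof.
move=> /Pk_decomp ->; rewrite /sub2 -/(sub2 z v w) rmorph_sum /=; apply: Pk_sum => ij ijm.
rewrite sub2M sub2_cst /mon sub2M !sub2_exp sub2_X sub2_Y; apply: Pk_cstM.
have h (c d e : R) : Pk 1 (cst c + cst d * pX + cst e * pY).
  by do 2?apply: PkD; [exact: Pk_cst|exact/Pk_cstM/Pk_X|exact/Pk_cstM/Pk_Y].
apply: Pk_le ijm _; apply: PkM.
  by have := PkXn (n := ij.1) (h z.1 v.1 w.1); rewrite mul1n.
by have := PkXn (n := ij.2) (h z.2 v.2 w.2); rewrite mul1n.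
Qed.

Lemma size_seg m c d p : Pk m p -> (size (seg c d p) <= m.+1)%N.
Proof.
move=> /Pk_decomp ->; rewrite /seg -/(seg c d) rmorph_sum /=.
apply: (leq_trans (size_sum _ _ _)); apply/bigmax_leqP => -[i j] /= ijm.
rewrite segM seg_cst mul_polyC; apply: leq_trans (size_scale_leq _ _) _.
rewrite /mon segM !seg_exp seg_X seg_Y.
have h (e f : R) n : (size ((e%:P + f *: 'X) ^+ n)%R <= n.+1)%N.
  have s2 : (size (e%:P + f *: 'X)%R <= 2)%N.
    apply: leq_trans (size_polyD _ _) _; rewrite geq_max (leq_trans (size_polyC_leq1 _)) //=.
    by apply: leq_trans (size_scale_leq _ _) _; rewrite size_polyX.
  apply: leq_trans (size_poly_exp_leq _ _) _; rewrite ltnS -[X in (_ <= X)%N]mul1n leq_mul2r.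
  by apply/orP; right; rewrite -subn1 leq_subLR.
apply: leq_trans (size_polyMleq _ _) _.
apply: (@leq_trans (i.+1 + j.+1).-1); last by lia.
by rewrite -!subn1 leq_sub2r // leq_add ?h.
Qed.

End Degree.
Arguments mon {R} i j.

(** * The Poincare inequality, first on the reference triangle and then on trees *)

Section ReferencePoincare.
Variable R : realType.
Implicit Types (p q r : poly2 R) (m n : nat).

Let z0 : pt R := (0, 0).
Let a0 : pt R := (1, 0).
Let b0 : pt R := (0, 1).

Lemma Det_ref : Det z0 a0 b0 = 1.
Proof. by rewrite /Det /det2 /=; ring. Qed.
Lemma Det_ref_neq0 : Det z0 a0 b0 != 0.
Proof. by rewrite Det_ref oner_neq0. Qed.

Lemma sub2_id p : sub2 z0 (a0 - z0) (b0 - z0) p = p.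
Proof.
elim/poly2_ind: p => [c|p q IHp IHq|p IH|p IH].
- exact: sub2_cst.
- by rewrite sub2D IHp IHq.
- by rewrite sub2M IH sub2_X /affX /= !subr0 /cst !polyC0 !polyC1 mul1r mul0r addr0 add0r.
- by rewrite sub2M IH sub2_Y /affY /= !subr0 /cst !polyC0 !polyC1 mul1r mul0r add0r add0r.
Qed.

Lemma Jr_J p : Jr p = J z0 a0 b0 p.
Proof. by rewrite (J_ref _ Det_ref_neq0) Det_ref normr1 mul1r sub2_id. Qed.

Lemma JrD p q : Jr (p + q) = Jr p + Jr q.
Proof. by rewrite !Jr_J JD // Det_ref_neq0. Qed.
Lemma JrZ (c : R) p : Jr (cst c * p) = c * Jr p.
Proof. by rewrite !Jr_J JZ // Det_ref_neq0. Qed.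
Lemma Jr_cst (c : R) : Jr (cst c) = 2^-1 * c.
Proof. by rewrite Jr_J J_const ?Det_ref_neq0 // Det_ref normr1 mulr1. Qed.
Lemma horner_seg_primY p x : 
  (seg (0, 1) (1, 0) (primY p)).[x] = (1 - x) * I01 (p.[x%:P] \Po ((1 - x) *: 'X)).
Proof.
rewrite horner_seg peval_primY /=.
have -> : 0 + x *: (1 - 0) = x :> R by rewrite /GRing.scale /=; ring.
have -> : 1 + x *: (0 - 1) = 1 - x :> R by rewrite /GRing.scale /=; ring.
by have := I01_affine p.[x%:P] 0 (1 - x); rewrite prim_horner0 subr0 [0 + (1 - x)]add0r => <-; rewrite add0r.
Qed.

Lemma Jr_sqr_ge0 p : 0 <= Jr (p ^+ 2).
Proof.
rewrite Jr_J -[0](_ : J z0 a0 b0 (cst 0) = 0); last by rewrite -Jr_J Jr_cst mulr0.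
by apply: J_le => [|x _]; [exact: Det_ref_neq0|rewrite peval_cst pevalXn sqr_ge0].
Qed.

(** By Fubini the slices of p at 0 <= x < 1 vanish as polynomials in y, so that p, seen as a
    polynomial in x, has too many roots. *)
Lemma Jr_sqr_eq0 p : Jr (p ^+ 2) = 0 -> p = 0.
Proof.
move=> J0; have G0 : seg (0, 1) (1, 0) (primY (p ^+ 2)) = 0.
  apply: I01_eq0; last by rewrite -Jr_primY.
  move=> x /andP[_ x1]; rewrite horner_seg_primY mulr_ge0 ?subr_ge0 //.
  by apply: I01_ge0 => t _; rewrite horner_comp horner_exp horner_exp sqr_ge0.
have px x : 0 <= x < 1 -> p.[x%:P] = 0.
  move=> /andP[x0 x1]; have := horner_seg_primY (p ^+ 2) x; rewrite G0 horner0.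
  have x2 : 1 - x != 0 by rewrite subr_eq0 eq_sym lt_eqF.
  move=> /esym/eqP; rewrite mulf_eq0 (negbTE x2) /= => /eqP I0.
  have : (p.[x%:P] \Po ((1 - x) *: 'X)) ^+ 2 = 0.
    apply: I01_eq0; first by move=> t _; rewrite horner_exp sqr_ge0.
    by rewrite -rmorphXn /= -horner_exp.
  move=> /eqP; rewrite expf_eq0 /= => /eqP s0; apply: poly_ext => t; rewrite horner0.
  have := congr1 (fun s : {poly R} => s.[t / (1 - x)]) s0.
  by rewrite horner_comp hornerZ hornerX horner0 mulrC divfK.
apply/eqP; apply: contraT => pN0.
(* The shift by 2 keeps the roots below 1, where the slice has positive length. *)
pose s := [seq ((i.+2)%:R^-1)%:P : {poly R} | i <- iota 0 (size p)].
have : (size s < size p)%N.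
  apply: max_poly_roots => //.
    apply/allP => _ /mapP[i _ ->]; apply/eqP; apply: px.
    by rewrite invr_ge0 ler0n invf_lt1 ?ltr0n // ltr1n.
  rewrite map_inj_uniq ?iota_uniq // => i j /polyC_inj /invr_inj /eqP.
  by rewrite eqr_nat !eqSS => /eqP.
by rewrite size_map size_iota ltnn.
Qed.

Lemma grad_eq0 p : dx p = 0 -> dy p = 0 -> exists c, p = cst c.
Proof.
move=> px py.
have pE : p = (p`_0)%:P.
  apply/polyP => -[|i]; rewrite coefC //=.
  have := congr1 (fun s : poly2 R => s`_i) px; rewrite /dx coef_deriv coef0 => h.
  apply/polyP => j; have := congr1 (fun s : {poly R} => s`_j) h.
  by rewrite coefMn coef0 => /eqP; rewrite mulrn_eq0 /= => /eqP.
have /deriv_eq0 h : (p`_0)^`() = 0.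
  by have := congr1 (fun s : poly2 R => s`_0) py; rewrite /dy coef_map coef0.
by exists (p`_0).[0]; rewrite /cst -h.
Qed.

Section Gram.
Variables (N : nat) (phi : 'I_N -> poly2 R) (b : poly2 R -> poly2 R -> R).
Hypotheses (bD : forall p q r, b (p + q) r = b p r + b q r)
  (bZ : forall c p r, b (cst c * p) r = c * b p r) (bC : forall p q, b p q = b q p).

Definition lcomb (x : 'rV[R]_N) : poly2 R := \sum_i cst (x 0 i) * phi i.
Definition gram : 'M[R]_N := \matrix_(i, j) b (phi i) (phi j).

Lemma lcombl x q : b (lcomb x) q = \sum_i x 0 i * b (phi i) q.
Proof.
have bb0 : b 0 q = 0 by have := bZ 0 0 q; rewrite mulr0 mul0r.
rewrite /lcomb (big_morph (b^~ q) (fun p r => bD p r q) bb0).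
by apply: eq_bigr => i _; rewrite bZ.
Qed.

Lemma gram_row x j : (x *m gram) 0 j = b (lcomb x) (phi j).
Proof. by rewrite lcombl mxE; apply: eq_bigr => i _; rewrite mxE. Qed.

Lemma gram_form x : (x *m gram *m x^T) 0 0 = b (lcomb x) (lcomb x).
Proof.
rewrite [in RHS]lcombl mxE; apply: eq_bigr => j _.
by rewrite gram_row mxE mulrC bC.
Qed.

Lemma gram_sym : gram^T = gram.
Proof. by apply/matrixP => i j; rewrite !mxE bC. Qed.

End Gram.

(** Apply [qform_le] to the Gram matrices of the covariance [bA] and the energy [bB]: the kernel of
    the energy consists of constants, on which the covariance vanishes. The factor 2 in the mean is
    the inverse of the area. *)
Lemma reference_poincare m : exists2 C, 0 <= C & forall p, Pk m p ->
  Jr ((p - cst (2 * Jr p)) ^+ 2) <= C * Jr (dx p ^+ 2 + dy p ^+ 2).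
Proof.
pose N := #|{: 'I_m.+1 * 'I_m.+1}|.
pose ev (i : 'I_N) : 'I_m.+1 * 'I_m.+1 := enum_val i.
pose phi (i : 'I_N) : poly2 R := mon (ev i).1 (ev i).2.
pose bA p q := Jr (p * q) - 2 * (Jr p * Jr q).
pose bB p q := Jr (dx p * dx q + dy p * dy q).
have AD p q r : bA (p + q) r = bA p r + bA q r by rewrite /bA mulrDl !JrD; ring.
have AZ c p r : bA (cst c * p) r = c * bA p r by rewrite /bA -mulrA !JrZ; ring.
have AC p q : bA p q = bA q p by rewrite /bA (mulrC p) (mulrC (Jr p)).
have BD p q r : bB (p + q) r = bB p r + bB q r.
  by rewrite /bB dxD dyD -JrD; congr Jr; ring.
have BZ c p r : bB (cst c * p) r = c * bB p r.
  by rewrite /bB -JrZ dxM dyM dx_cst dy_cst; congr Jr; ring.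
have BC p q : bB p q = bB q p by rewrite /bB (mulrC (dx p)) (mulrC (dy p)).
have B0 p : 0 <= bB p p by rewrite /bB -!expr2 JrD addr_ge0 ?Jr_sqr_ge0.
have [||x|x|C C0 hC] := @qform_le R N (gram phi bA) (gram phi bB).
- exact: gram_sym.
- exact: gram_sym.
- by rewrite gram_form.
- move=> xB0; have BB : bB (lcomb phi x) (lcomb phi x) = 0.
    by rewrite -(gram_form phi BD BZ BC) xB0 mul0mx mxE.
  have [c pE] : exists c, lcomb phi x = cst c.
    move: BB; rewrite /bB -!expr2 JrD => /eqP.
    rewrite paddr_eq0 ?Jr_sqr_ge0 // => /andP[/eqP/Jr_sqr_eq0 h1 /eqP/Jr_sqr_eq0 h2].
    exact: grad_eq0.
  apply/rowP => j; by rewrite (gram_row phi AD AZ) mxE pE /bA JrZ Jr_cst; field.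
exists C => // p /Pk_decomp pE.
pose x : 'rV[R]_N := \row_i (if ((ev i).1 + (ev i).2 <= m)%N
  then p`_(ev i).1`_(ev i).2 else 0).
have px : p = lcomb phi x.
  rewrite {1}pE /lcomb big_mkcond (reindex _ (onW_bij _ (@enum_val_bij _))) /=.
  apply: eq_bigr => i _; rewrite mxE; case: ifP => // _.
  by rewrite /cst !polyC0 mul0r.
have := hC x; rewrite !gram_form // -px /bA /bB -!expr2 => h.
apply: le_trans h; rewrite le_eqVlt; apply/orP; left; apply/eqP.
set s := 2 * Jr p; have -> : (p - cst s) ^+ 2 = p ^+ 2 + cst (- (s + s)) * p + cst (s * s).
  by rewrite cstN cstD cstM; ring.
by rewrite !JrD JrZ Jr_cst /s; field.
Qed.

End ReferencePoincare.

Section TreePoincare.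
Variable R : realType.
Implicit Types (z a b x c d v : pt R) (p q r : poly2 R) (L : tri R) (t : btree).

(** The squared gradient after pullback to the reference triangle. In this form inequalities on a
    triangle have constants that depend neither on its size nor on its shape. *)
Definition gr z a b p : poly2 R := dirD (a - z) p ^+ 2 + dirD (b - z) p ^+ 2.

Lemma peval_dirD v p x : peval (dirD v p) x = v.1 * peval (dx p) x + v.2 * peval (dy p) x.
Proof. by rewrite /dirD !pevalsE. Qed.

Lemma peval_gr z a b p x : peval (gr z a b p) x =
  peval (dirD (a - z) p) x ^+ 2 + peval (dirD (b - z) p) x ^+ 2.
Proof. by rewrite /gr pevalD !pevalXn. Qed.

Lemma peval_gr_ge0 z a b p x : 0 <= peval (gr z a b p) x.
Proof. by rewrite peval_gr addr_ge0 // sqr_ge0. Qed.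

(** For x in the triangle and a vertex v, the coefficients of x - v in the frame a - z, b - z lie in
    [-1, 1]. *)
Lemma eul_bound z a b v p x : Det z a b != 0 -> tset (T3 z a b) x ->
  v \in vertices (T3 z a b) -> peval (eul v p) x ^+ 2 <= 2 * peval (gr z a b p) x.
Proof.
move=> D0 /(tsetP _ D0)[h1 h2 h3] vK; have hs := bc_sum x D0.
have key (s t : R) : `|s| <= 1 -> `|t| <= 1 ->
    x.1 - v.1 = s * (a.1 - z.1) + t * (b.1 - z.1) ->
    x.2 - v.2 = s * (a.2 - z.2) + t * (b.2 - z.2) ->
    peval (eul v p) x ^+ 2 <= 2 * peval (gr z a b p) x.
  move=> s1 t1 e1 e2.
  have -> : peval (eul v p) x = s * peval (dirD (a - z) p) x + t * peval (dirD (b - z) p) x.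
    by rewrite /eul !peval_dirD !pevalsE e1 e2 /=; ring.
  rewrite peval_gr.
  move: (peval (dirD (a - z) p) x) (peval (dirD (b - z) p) x) => al be.
  have s2 : s ^+ 2 <= 1 by rewrite -[s ^+ 2]real_normK ?num_real // expr_le1.
  have t2 : t ^+ 2 <= 1 by rewrite -[t ^+ 2]real_normK ?num_real // expr_le1.
  have : 0 <= (s * be - t * al) ^+ 2 by exact: sqr_ge0.
  have : 0 <= (1 - s ^+ 2) * (al ^+ 2 + be ^+ 2) by rewrite mulr_ge0 ?subr_ge0 ?addr_ge0 ?sqr_ge0.
  have : 0 <= (1 - t ^+ 2) * (al ^+ 2 + be ^+ 2) by rewrite mulr_ge0 ?subr_ge0 ?addr_ge0 ?sqr_ge0.
  nra.
have xE1 : x.1 = z.1 + bc a b z x * (a.1 - z.1) + bc b z a x * (b.1 - z.1).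
  by rewrite {1}(bc_comb x D0).
have xE2 : x.2 = z.2 + bc a b z x * (a.2 - z.2) + bc b z a x * (b.2 - z.2).
  by rewrite {1}(bc_comb x D0).
move: vK; rewrite !inE => /or3P[] /eqP vE.
- by apply: (key (bc a b z x) (bc b z a x)); rewrite ?ger0_norm ?vE ?xE1 ?xE2 //; lra.
- apply: (key (bc a b z x - 1) (bc b z a x)); rewrite ?ler_norml ?vE ?xE1 ?xE2 //; try lra; ring.
- apply: (key (bc a b z x) (bc b z a x - 1)); rewrite ?ler_norml ?vE ?xE1 ?xE2 //; try lra; ring.
Qed.

Lemma dirD_comb (s t : R) v w p :
  dirD (s *: v + t *: w) p = cst s * dirD v p + cst t * dirD w p.
Proof. by rewrite /dirD /= /GRing.scale /= !(cstD, cstM); ring. Qed.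

(** Up to sign the sides of a child at its newest vertex are half the sum and half the difference of
    the sides of the parent, so that the parallelogram identity halves the form. *)
Lemma gr_comb z a b c d e p (h : R) : h + h = 1 ->
  c - e = (- h) *: (a - z) + (- h) *: (b - z) ->
  d - e = h *: (a - z) + (- h) *: (b - z) \/ d - e = (- h) *: (a - z) + h *: (b - z) ->
  gr e c d p = cst h * gr z a b p.
Proof.
move=> h1 ce de; have hh : cst h + cst h = 1 :> poly2 R by rewrite -cstD h1.
rewrite -[cst h]mul1r -hh /gr ce.
by case: de => ->; rewrite !dirD_comb !cstN; ring.
Qed.

Lemma gr_child1 z a b p : gr (midpt a b) z a p = cst 2^-1 * gr z a b p.
Proof.
apply: gr_comb; [by field| |left]; apply: pt_ext;
  by rewrite /midpt /= /GRing.scale /=; field.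
Qed.

Lemma gr_child2 z a b p : gr (midpt a b) b z p = cst 2^-1 * gr z a b p.
Proof.
have -> : gr (midpt a b) b z p = gr (midpt a b) z b p by rewrite /gr addrC.
apply: gr_comb; [by field| |right]; apply: pt_ext;
  by rewrite /midpt /= /GRing.scale /=; field.
Qed.

Lemma Jt_sqr_shift t z a b w (s : R) : Det z a b != 0 ->
  Jt t z a b (fun L => (w L - cst s) ^+ 2) =
  Jt t z a b (fun L => w L ^+ 2) - 2 * s * Jt t z a b w + 2^-1 * `|Det z a b| * s ^+ 2.
Proof.
move=> D0; rewrite -(Jt_const t _ D0) -mulNr -(JtZ t _ _ D0) -!(JtD t _ _ D0).
apply: eq_Jt => L _; rewrite expr2 cstM (_ : - (2 * s) = - s - s); last by ring.
by rewrite cstD cstN; ring.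
Qed.

(** Cauchy-Schwarz against 1, read off from the nonnegative square integral of w minus its mean. *)
Lemma Jt_CS t z a b w : Det z a b != 0 ->
  Jt t z a b w ^+ 2 <= 2^-1 * `|Det z a b| * Jt t z a b (fun L => w L ^+ 2).
Proof.
move=> D0; have Dp : 0 < `|Det z a b| by rewrite normr_gt0.
have := Jt_sqr_shift t w (2 / `|Det z a b| * Jt t z a b w) D0.
have : 0 <= Jt t z a b (fun L => (w L - cst (2 / `|Det z a b| * Jt t z a b w)) ^+ 2).
  have := Jt_const t (0 : R) D0; rewrite mulr0 => <-; apply: Jt_le => // L _ x _ _.
  by rewrite peval_cst pevalXn sqr_ge0.
move=> + e; rewrite e.
have -> : forall j j2 : R, j2 - 2 * (2 / `|Det z a b| * j) * j + 2^-1 * `|Det z a b| * (2 / `|Det z a b| * j) ^+ 2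
  = 2 / `|Det z a b| * (2^-1 * `|Det z a b| * j2 - j ^+ 2).
  by move=> j j2; field; rewrite gt_eqF.
by rewrite pmulr_rge0 ?divr_gt0 // subr_ge0.
Qed.

Lemma sub2B z v w p q : sub2 z v w (p - q) = sub2 z v w p - sub2 z v w q.
Proof. by rewrite sub2D sub2N. Qed.

Lemma leaf_poincare m : exists2 C, 0 <= C & forall z a b p, Det z a b != 0 -> Pk m p ->
  J z a b ((p - cst (2 / `|Det z a b| * J z a b p)) ^+ 2) <= C * J z a b (gr z a b p).
Proof.
have [C C0 hC] := reference_poincare R m; exists C => // z a b p D0 hp.
have Dp : 0 < `|Det z a b| by rewrite normr_gt0.
rewrite (J_ref (gr z a b p) D0) (J_ref ((p - _) ^+ 2) D0) mulrCA ler_pM2l //.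
rewrite sub2_exp sub2B sub2_cst (J_ref p D0) mulrA divfK ?gt_eqF //.
have hs := @Pk_sub2 R m z (a - z) (b - z) p hp.
by rewrite /gr sub2D !sub2_exp -dx_sub2 -dy_sub2; exact: hC hs.
Qed.

(** With centre v = a only the opposite edge bz has flux, so that its mean equals the mean over the
    triangle up to a term in the derivatives. *)
Lemma Jt_mean1 Q t z a b w : Det z a b != 0 -> compat Q t z a b w -> Q 1 ->
  (emean t z a b w 1).1.2 = 2 / `|Det z a b| * Jt t z a b w + `|Det z a b|^-1 * Jt t z a b (fun L => eul a (w L)).
Proof.
move=> D0 cw Q1; have Dp : `|Det z a b| != 0 by rewrite normr_eq0.
have := Jt_div a D0 cw Q1; rewrite (_ : Det a a b = 0); last by rewrite /Det /det2 /=; ring.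
rewrite (_ : Det a z a = 0); last by rewrite /Det /det2 /=; ring.
rewrite !mul0r add0r addr0 (Det_rot z a b) mulrA -normrEsg.
rewrite (eq_Jt (G' := fun L => cst 2 * w L + eul a (w L))); last by move=> L _; rewrite mulr1.
rewrite JtD // JtZ // => /esym/(canRL (mulKf Dp)) ->; ring.
Qed.

Lemma Jt_mean2 Q t z a b w : Det z a b != 0 -> compat Q t z a b w -> Q 1 ->
  (emean t z a b w 1).2 = 2 / `|Det z a b| * Jt t z a b w + `|Det z a b|^-1 * Jt t z a b (fun L => eul b (w L)).
Proof.
move=> D0 cw Q1; have Dp : `|Det z a b| != 0 by rewrite normr_eq0.
have := Jt_div b D0 cw Q1; rewrite (_ : Det b a b = 0); last by rewrite /Det /det2 /=; ring.
rewrite (_ : Det b b z = 0); last by rewrite /Det /det2 /=; ring.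
rewrite !mul0r !add0r (Det_rot2 z a b) mulrA -normrEsg.
rewrite (eq_Jt (G' := fun L => cst 2 * w L + eul b (w L))); last by move=> L _; rewrite mulr1.
rewrite JtD // JtZ // => /esym/(canRL (mulKf Dp)) ->; ring.
Qed.

Lemma Jt_eul_bound t z a b c d e v w : Det z a b != 0 -> Det c d e != 0 -> 
  tset (T3 c d e) `<=` tset (T3 z a b) -> v \in vertices (T3 z a b) ->
  Jt t c d e (fun L => eul v (w L)) ^+ 2 <=
  `|Det c d e| * Jt t c d e (fun L => gr z a b (w L)).
Proof.
move=> D0 D1 sub vK; apply: le_trans (Jt_CS _ _ D1) _.
have -> : `|Det c d e| * Jt t c d e (fun L => gr z a b (w L)) =
   2^-1 * `|Det c d e| * Jt t c d e (fun L => cst 2 * gr z a b (w L)).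
  by rewrite JtZ //; field.
rewrite ler_wpM2l ?mulr_ge0 ?invr_ge0 //; apply: Jt_le => // L _ x _ Kx.
by rewrite pevalXn pevalM peval_cst eul_bound //; exact: sub.
Qed.

(** The bisection step in numbers: j, s, g, e are the integrals of w, of its square, of [gr] and of
    [eul] over the halves. The variances of the halves cost half of the constant, since [gr] is
    halved. The equal means on the inner edge express j1 - j2 by e1 - e2, so that the variance
    between the halves is at most (g1 + g2) / 2, which the other half of C0 + 1 covers. *)
Lemma poincare_step (C0 D j1 j2 s1 s2 g1 g2 e1 e2 : R) : 0 <= C0 -> 0 < D ->
  s2 - 2 * (2 / (2^-1 * D) * j2) * j2 + 2^-1 * (2^-1 * D) * (2 / (2^-1 * D) * j2) ^+ 2 <=
    (C0 + 1) * (2^-1 * g2) ->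
  s1 - 2 * (2 / (2^-1 * D) * j1) * j1 + 2^-1 * (2^-1 * D) * (2 / (2^-1 * D) * j1) ^+ 2 <=
    (C0 + 1) * (2^-1 * g1) ->
  e2 ^+ 2 <= 2^-1 * D * g2 -> e1 ^+ 2 <= 2^-1 * D * g1 ->
  2 / (2^-1 * D) * j1 + (2^-1 * D)^-1 * e1 = 2 / (2^-1 * D) * j2 + (2^-1 * D)^-1 * e2 ->
  s1 + s2 - 2 * (2 / D * (j1 + j2)) * (j1 + j2) + 2^-1 * D * (2 / D * (j1 + j2)) ^+ 2 <=
    (C0 + 1) * (g1 + g2).
Proof.
move=> C0_ge0 D0; have D1 : D != 0 by rewrite gt_eqF.
have -> : s2 - 2 * (2 / (2^-1 * D) * j2) * j2 + 2^-1 * (2^-1 * D) * (2 / (2^-1 * D) * j2) ^+ 2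
   = s2 - 4 * (j2 ^+ 2 / D) by field.
have -> : s1 - 2 * (2 / (2^-1 * D) * j1) * j1 + 2^-1 * (2^-1 * D) * (2 / (2^-1 * D) * j1) ^+ 2
   = s1 - 4 * (j1 ^+ 2 / D) by field.
move=> k2 k1 h2 h1 he.
have {}he : j2 = j1 + (e1 - e2) / 2.
  have -> : j1 = D / 4 * (2 / (2^-1 * D) * j1 + (2^-1 * D)^-1 * e1) - e1 / 2 by field.
  by rewrite he; field.
have hg : (j1 ^+ 2 / D) * 4 + (j2 ^+ 2 / D) * 4 - 2 * ((j1 + j2) ^+ 2 / D) <= (g1 + g2) / 2.
  rewrite he (_ : _ - _ = (e1 - e2) ^+ 2 / 2 / D); last by field.
  by rewrite ler_pdivrMr //; have : 0 <= (e1 + e2) ^+ 2 := sqr_ge0 _; lra.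
have g1_ge0 : 0 <= g1.
  by have := le_trans (sqr_ge0 _) h1; rewrite pmulr_rge0 // mulr_gt0 // invr_gt0.
have g2_ge0 : 0 <= g2.
  by have := le_trans (sqr_ge0 _) h2; rewrite pmulr_rge0 // mulr_gt0 // invr_gt0.
have -> : s1 + s2 - 2 * (2 / D * (j1 + j2)) * (j1 + j2) + 2^-1 * D * (2 / D * (j1 + j2)) ^+ 2
   = s1 + s2 - 2 * ((j1 + j2) ^+ 2 / D) by field.
have := mulr_ge0 C0_ge0 g1_ge0; have := mulr_ge0 C0_ge0 g2_ge0; lra.
Qed.

(** The constant is that of a leaf plus 1, and [poincare_step] reproduces it at every node. The
    degree m matters on leaves only. *)
Lemma tree_poincare m Q : Q 1 -> exists2 C, 0 <= C & forall t z a b w, Det z a b != 0 ->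
  (forall L, L \in leaves t z a b -> Pk m (w L)) -> compat Q t z a b w ->
  Jt t z a b (fun L => (w L - cst (2 / `|Det z a b| * Jt t z a b w)) ^+ 2) <=
  C * Jt t z a b (fun L => gr z a b (w L)).
Proof.
move=> Q1; have [C0 C0_ge0 hC] := leaf_poincare m.
exists (C0 + 1); first by rewrite addr_ge0.
elim=> [|t1 IH1 t2 IH2] z a b w D0 hw cw.
  have g0 : 0 <= J z a b (gr z a b (w (T3 z a b))).
    have := J_const (0 : R) D0; rewrite mulr0 => <-; apply: J_le => // x _.
    by rewrite peval_cst peval_gr_ge0.
  have hL : Pk m (w (T3 z a b)) by apply: hw; rewrite inE.
  have h := hC _ _ _ _ D0 hL.
  by apply: (le_trans h); rewrite [leRHS]mulrDl mul1r lerDl.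
have D1 := Det_child1_neq0 D0; have D2 := Det_child2_neq0 D0.
have [c1 c2 c12] := cw; move: c12 => /(_ _ Q1).
rewrite (Jt_mean2 D1 c1 Q1) (Jt_mean1 D2 c2 Q1).
have sub1 : tset (T3 (midpt a b) z a) `<=` tset (T3 z a b).
  by move=> x hx; apply: tset_child => //; left.
have sub2 : tset (T3 (midpt a b) b z) `<=` tset (T3 z a b).
  by move=> x hx; apply: tset_child => //; right.
(* The vertices opposite to the inner edge in the two halves are a and b. They are also vertices of
   the parent, so that the [eul] terms are bounded in its frame. *)
have va : a \in vertices (T3 z a b) by rewrite !inE eqxx orbT.
have vb : b \in vertices (T3 z a b) by rewrite !inE eqxx !orbT.
have := Jt_eul_bound t1 w D0 D1 sub1 va.
have := Jt_eul_bound t2 w D0 D2 sub2 vb.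
have hw1 L : L \in leaves t1 (midpt a b) z a -> Pk m (w L).
  by move=> hL; apply: hw; rewrite /= mem_cat hL.
have hw2 L : L \in leaves t2 (midpt a b) b z -> Pk m (w L).
  by move=> hL; apply: hw; rewrite /= mem_cat hL orbT.
have := IH1 _ _ _ _ D1 hw1 c1; have := IH2 _ _ _ _ D2 hw2 c2.
rewrite (eq_Jt (G := fun L => gr (midpt a b) z a (w L)) (G' := fun L => cst 2^-1 * gr z a b (w L)));
  last by move=> L _; exact: gr_child1.
rewrite (eq_Jt (G := fun L => gr (midpt a b) b z (w L)) (G' := fun L => cst 2^-1 * gr z a b (w L)));
  last by move=> L _; exact: gr_child2.
rewrite !JtZ // !Jt_sqr_shift // /=.
have Dn1 : `|Det (midpt a b) z a| = 2^-1 * `|Det z a b|.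
  by rewrite Det_child1 normrM ger0_norm // invr_ge0.
have Dn2 : `|Det (midpt a b) b z| = 2^-1 * `|Det z a b|.
  by rewrite Det_child2 normrM ger0_norm // invr_ge0.
rewrite Dn1 Dn2; have Dp : 0 < `|Det z a b| by rewrite normr_gt0.
move: Dp; move: (`|Det z a b|) => D Dp.
move: (Jt t1 _ _ _ w) (Jt t2 _ _ _ w) => j1 j2.
move: (Jt t1 _ _ _ (fun L => w L ^+ 2)) (Jt t2 _ _ _ (fun L => w L ^+ 2)) => s1 s2.
move: (Jt t1 _ _ _ (fun L => gr z a b (w L))) (Jt t2 _ _ _ (fun L => gr z a b (w L))) => g1 g2.
move: (Jt t1 _ _ _ (fun L => eul a (w L))) (Jt t2 _ _ _ (fun L => eul b (w L))) => e1 e2.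
exact: poincare_step.
Qed.

End TreePoincare.

(** * Edge moments in odd degree *)

Section EdgeMoments.
Variable R : realType.
Implicit Types (p q r s : {poly R}).

Lemma I01_comp_sym p q : q \Po (1 - 'X) = q -> I01 ((p \Po (1 - 'X)) * q) = I01 (p * q).
Proof. by move=> qs; rewrite -[in RHS]I01_rev comp_polyM qs. Qed.

(** The coefficient of t^k in (1 - t)^k is -1 for odd k, so the leading terms cancel. *)
Lemma size_revB k q : odd k -> (size q <= k.+1)%N -> (size (q + (q \Po (1 - 'X)))%R <= k)%N.
Proof.
move=> ok sq; apply/leq_sizeP => j; rewrite leq_eqVlt => /orP[/eqP <-|kj]; last first.
  have h : (size (q \Po (1 - 'X))%R <= k.+1)%N.
    apply: leq_trans (size_comp_poly_leq _ _) _.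
    have -> : size (1 - 'X : {poly R}) = 2%N by rewrite -opprB size_polyN size_XsubC.
    by rewrite /= muln1; move: sq; case: (size q).
  by rewrite coefD !nth_default ?addr0 // (leq_trans _ kj).
rewrite coefD comp_polyE coef_sum.
under eq_bigr => i _ do rewrite coefZ.
have sz : (1 - 'X : {poly R}) = (-1)%:P * ('X - 1%:P) by rewrite polyCN polyC1; ring.
have top i : (i <= k)%N -> ((1 - 'X : {poly R}) ^+ i)`_k = if i == k then (-1) ^+ k else 0.
  move=> ik; rewrite sz exprMn -polyC_exp mul_polyC coefZ.
  case: eqP => [->|/eqP ni].
    have := monicP (monic_exp k (monicXsubC (1 : R))).
    by rewrite /lead_coef size_exp_XsubC /= => ->; rewrite mulr1.
  by rewrite [X in _ * X]nth_default ?mulr0 // size_exp_XsubC; lia.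
have -> : \sum_(i < size q) q`_i * ((1 - 'X : {poly R}) ^+ i)`_k =
    \sum_(i < k.+1) q`_i * ((1 - 'X : {poly R}) ^+ i)`_k.
  rewrite (big_ord_widen _ (fun i => q`_i * ((1 - 'X : {poly R}) ^+ i)`_k) sq) big_mkcond.
  by apply: eq_bigr => i _; case: ltnP => // /(nth_default 0) ->; rewrite mul0r.
rewrite (bigD1 ord_max) //= top // eqxx big1 ?addr0.
  by rewrite -signr_odd ok expr1 mulrN1 subrr.
by move=> i ni; rewrite top; [rewrite ifN ?mulr0|rewrite -ltnS ltn_ord].
Qed.

(** Such r are the multiples of the Legendre polynomial of odd degree k. The symmetric part s has
    degree below k, hence is orthogonal to r and therefore to itself. *)
Lemma odd_edge_antisym k r : odd k -> (size r <= k.+1)%N ->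
  (forall q, (size q <= k)%N -> I01 (r * q) = 0) -> r \Po (1 - 'X) = - r.
Proof.
move=> ok sr orth; set s := r + (r \Po (1 - 'X)).
have ss : (size s <= k)%N by exact: size_revB.
have sc : s \Po (1 - 'X) = s.
  rewrite /s comp_polyD -comp_polyA; have -> : (1 - 'X : {poly R}) \Po (1 - 'X) = 'X.
    by rewrite comp_polyB comp_polyX -[1]polyC1 comp_polyC; ring.
  by rewrite comp_polyXr addrC.
suff /eqP : s = 0 by rewrite /s addrC addr_eq0 => /eqP.
apply/eqP; rewrite -sqrf_eq0; apply/eqP/I01_eq0.
  by move=> t _; rewrite horner_exp sqr_ge0.
rewrite expr2 {1}/s mulrDl I01D orth // add0r (I01_comp_sym r sc); exact: orth.
Qed.

Definition wt : {poly R} := 'X * (1 - 'X).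
Lemma wtE t : wt.[t] = t * (1 - t).
Proof. by rewrite hornerM hornerD hornerN hornerX hornerC. Qed.
Lemma wt_ge0 t : 0 <= t <= 1 -> 0 <= wt.[t].
Proof. by move=> /andP[t0 t1]; rewrite wtE mulr_ge0 // subr_ge0. Qed.
Lemma wt_sym : wt \Po (1 - 'X) = wt.
Proof.
rewrite comp_polyM comp_polyB -[1]polyC1 comp_polyC comp_polyX /wt polyC1; ring.
Qed.

Lemma I01_weight_eq0 (v : {poly R}) q : v != 0 -> (forall t, 0 <= t <= 1 -> 0 <= v.[t]) ->
  I01 (v * (q * q)) = 0 -> q = 0.
Proof.
move=> v0 vp h; have /eqP : v * (q * q) = 0.
  by apply: I01_eq0 => // t /vp h0; rewrite !hornerM mulr_ge0 // -expr2 sqr_ge0.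
by rewrite mulf_eq0 (negbTE v0) -expr2 sqrf_eq0 => /eqP.
Qed.

Lemma wt_neq0 : wt != 0.
Proof.
apply/eqP => /(congr1 (fun s : {poly R} => s.[2])); rewrite wtE horner0 => h; lra.
Qed.

(** Such q are the multiples of the Jacobi polynomial of even degree k - 1 for the weight [wt]. The
    antisymmetric part s has degree at most k - 2, hence is orthogonal to q and therefore to
    itself. *)
Lemma even_edge_sym k q : odd k -> (size q <= k)%N ->
  (forall r, (size r <= k.-1)%N -> I01 (wt * r * q) = 0) -> q \Po (1 - 'X) = q.
Proof.
move=> ok sq orth; set s := q - (q \Po (1 - 'X)).
have sc : s \Po (1 - 'X) = - s.
  rewrite /s comp_polyB -comp_polyA; have -> : (1 - 'X : {poly R}) \Po (1 - 'X) = 'X.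
    by rewrite comp_polyB comp_polyX -[1]polyC1 comp_polyC; ring.
  by rewrite comp_polyXr opprB.
have ss : (size s <= k.-1)%N.
  (* The degree bound on s is read off from X s, which differs from the symmetrisation of X q by a
     reflection of q; this reuses the cancellation for odd degree. *)
  have := @size_revB k ('X * q) ok.
  have k0 : (0 < k)%N by case: (k) ok.
  have X0 : (size ('X * q)%R <= k.+1)%N.
    by have := size_polyMleq 'X q; rewrite size_polyX /= => h; exact: leq_trans h _.
  move=> /(_ X0); rewrite comp_polyM comp_polyX => h.
  have e : 'X * s = 'X * q + (1 - 'X) * (q \Po (1 - 'X)) - (q \Po (1 - 'X)) by rewrite /s; ring.
  have h2 : (size (q \Po (1 - 'X))%R <= k)%N.
    apply: leq_trans (size_comp_poly_leq _ _) _.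
    have -> : size (1 - 'X : {poly R}) = 2%N by rewrite -opprB size_polyN size_XsubC.
    by rewrite /= muln1; move: sq k0; case: (size q).
  have h3 : (size ('X * s)%R <= k)%N.
    rewrite e; apply: leq_trans (size_polyD _ _) _; rewrite size_polyN geq_max h //=.
  have [->|s0] := eqVneq s 0; first by rewrite size_poly0.
  by move: h3; rewrite mulrC size_mulX //; lia.
suff /eqP : s = 0 by rewrite /s subr_eq0 eq_sym => /eqP.
apply: (I01_weight_eq0 wt_neq0 wt_ge0).
have e1 : I01 (wt * s * q) = 0 by exact: orth.
have e2 : I01 (wt * s * (q \Po (1 - 'X))) = 0.
  rewrite -I01_rev comp_polyM (comp_polyM wt s) -comp_polyA wt_sym sc.
  have -> : (1 - 'X : {poly R}) \Po (1 - 'X) = 'X.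
    by rewrite comp_polyB comp_polyX -[1]polyC1 comp_polyC; ring.
  by rewrite comp_polyXr mulrN mulNr I01N e1 oppr0.
rewrite mulrA {2}/s mulrBr I01B e1 e2 subrr //.
Qed.

(** Subtracting q(1) X^(k-1) from q gives a root at 1, so that X q^2 is a weighted product of q with
    degree at most k - 2 plus a multiple of X^k q. Both integrate to 0, and X is a positive
    weight. *)
Lemma edge_functional_eq0 k q : (0 < k)%N -> (size q <= k)%N ->
  (forall r, (size r <= k.-1)%N -> I01 (wt * r * q) = 0) -> I01 ('X ^+ k * q) = 0 -> q = 0.
Proof.
move=> k0 sq orth orthk.
have X0 : ('X : {poly R}) != 0 by rewrite polyX_eq0.
apply: (I01_weight_eq0 X0) => [t /andP[t0 _]|]; first by rewrite hornerX.
have /factor_theorem [r re] : root (q - q.[1] *: 'X ^+ k.-1) 1.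
  by rewrite /root hornerD hornerN hornerZ hornerXn expr1n mulr1 subrr.
have -> : 'X * (q * q) = - (wt * r * q) + q.[1] *: ('X ^+ k * q).
  have -> : 'X ^+ k = 'X * 'X ^+ k.-1 :> {poly R} by rewrite -exprS prednK.
  have -> : wt * r = 'X * - (r * ('X - 1%:P)) by rewrite /wt polyC1; ring.
  by rewrite -re -!mul_polyC; ring.
rewrite I01D I01N I01Z orthk orth ?oppr0 ?mulr0 ?addr0 //.
have [->|r0] := eqVneq r 0; first by rewrite size_poly0.
have : (size (r * ('X - 1%:P))%R <= k)%N.
  rewrite -re; apply: leq_trans (size_polyD _ _) _; rewrite size_polyN geq_max sq /=.
  by apply: leq_trans (size_scale_leq _ _) _; rewrite size_polyXn prednK.
by rewrite size_Mmonic ?monicXsubC // size_XsubC addn2 /=; case: (k) k0.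
Qed.

End EdgeMoments.

Section UnivariateSubstitution.
Variable R : realType.
Implicit Types (z a b x c d v : pt R) (p q l : poly2 R) (r : {poly R}).

(** The composition of r with l. For a barycentric coordinate l that restricts to the parameter of
    an edge, it extends r from that edge to the plane. *)
Definition uni r l : poly2 R := (map_poly (@cstm R) r).[l].

Lemma uni_ind_step r (c : R) l : uni (r * 'X + c%:P) l = uni r l * l + cst c.
Proof.
by rewrite /uni rmorphD rmorphM /= map_polyX map_polyC hornerD hornerM hornerX hornerC.
Qed.
Lemma uni0 l : uni 0 l = 0.
Proof. by rewrite /uni rmorph0 horner0. Qed.

Lemma peval_uni r l x : peval (uni r l) x = r.[peval l x].
Proof.
elim/poly_ind: r => [|r c IH]; first by rewrite uni0 peval0 horner0.
by rewrite uni_ind_step !pevalsE IH hornerMXaddC.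
Qed.

Lemma seg_uni c d r l : seg c d (uni r l) = r \Po (seg c d l).
Proof. by apply: poly_ext => t; rewrite horner_comp !horner_seg peval_uni. Qed.

Lemma dirD_uni v r l : dirD v (uni r l) = uni r^`() l * dirD v l.
Proof.
elim/poly_ind: r => [|r c IH].
  by rewrite deriv0 !uni0 mul0r /dirD (dx_cst 0) (dy_cst 0) !mulr0 addr0.
have -> : (r * 'X + c%:P)^`() = r^`() * 'X + 0%:P + r.
  by rewrite derivD derivM derivX derivC mulr1; ring.
rewrite !uni_ind_step.
have uniD (s t : {poly R}) : uni (s + t) l = uni s l + uni t l by rewrite /uni rmorphD hornerD.
rewrite uniD uni_ind_step.
have dD p q : dirD v (p + q) = dirD v p + dirD v q by rewrite /dirD dxD dyD; ring.
have dM p q : dirD v (p * q) = dirD v p * q + p * dirD v q by rewrite /dirD dxM dyM; ring.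
have dc e : dirD v (cst e) = 0 by rewrite /dirD dx_cst dy_cst !mulr0 addr0.
by rewrite dD dM dc IH cst0; ring.
Qed.

Lemma Pk_uni m r l : (size r <= m.+1)%N -> Pk 1 l -> Pk m (uni r l).
Proof.
elim: m r => [|m IH] r sr l1.
  by rewrite (size1_polyC sr) /uni map_polyC hornerC; exact: Pk_cst.
have [s [c rE]] : exists (s : {poly R}) (c : R), r = s * 'X + c%:P.
  by elim/poly_ind: r {sr} => [|s c _]; [exists 0, 0; rewrite mul0r addr0|exists s, c].
rewrite rE uni_ind_step; apply: PkD; last exact: Pk_cst.
rewrite -addn1; apply: PkM => //; apply: IH => //.
have [->|s0] := eqVneq s 0; first by rewrite size_poly0.
by move: sr; rewrite rE size_MXaddC (negbTE s0).
Qed.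

Lemma Pk_bcp z a b : Pk 1 (bcp z a b).
Proof.
have -> : bcp z a b = cst ((Det z a b)^-1 * (a.1 * b.2 - a.2 * b.1)) +
   cst ((Det z a b)^-1 * (a.2 - b.2)) * pX + cst ((Det z a b)^-1 * (b.1 - a.1)) * pY.
  by rewrite /bcp !(cstD, cstM, cstN); ring.
by do 2?apply: PkD; [exact: Pk_cst|exact/Pk_cstM/Pk_X|exact/Pk_cstM/Pk_Y].
Qed.

Lemma dirD_bcp v z a b : dirD v (bcp z a b) =
  cst ((v.2 * (b.1 - a.1) - v.1 * (b.2 - a.2)) / Det z a b).
Proof.
rewrite /dirD /bcp !(dxM, dyM, dxD, dyD) !(dx_cst, dy_cst).
have dN p : dx (- p) = - dx p.
  by apply: (addrI (dx p)); rewrite -dxD !subrr; exact: (dx_cst 0).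
have dN' p : dy (- p) = - dy p.
  by apply: (addrI (dy p)); rewrite -dyD !subrr; exact: (dy_cst 0).
rewrite !(dN, dN') !(dxM, dyM, dxD, dyD) !(dN, dN') !(dx_cst, dy_cst) dxX dxY dyX dyY !(cstM, cstD, cstN); ring.
Qed.

Definition pull z a b p : poly2 R := psub (bcp a b z) (bcp b z a) p.

Lemma peval_pull z a b p x : peval (pull z a b p) x = peval p (bc a b z x, bc b z a x).
Proof. by rewrite /pull peval_psub !peval_bcp. Qed.

Lemma Pk_psub m u w p : Pk 1 u -> Pk 1 w -> Pk m p -> Pk m (psub u w p).
Proof.
move=> hu hw /Pk_decomp ->; rewrite psub_sum; apply: Pk_sum => ij ijm.
rewrite psubM psub_cst /mon psubM !psub_exp psub_X psub_Y; apply: Pk_cstM.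
apply: Pk_le ijm _; apply: PkM.
  by have := PkXn (n := ij.1) hu; rewrite mul1n.
by have := PkXn (n := ij.2) hw; rewrite mul1n.
Qed.

Lemma dirD_pull v z a b p : dirD v (pull z a b p) =
  pull z a b (dx p) * dirD v (bcp a b z) + pull z a b (dy p) * dirD v (bcp b z a).
Proof.
apply: (psub_derivation (del := dirD v)).
- by move=> p1 p2; rewrite /dirD dxD dyD; ring.
- by move=> p1 p2; rewrite /dirD dxM dyM; ring.
- by move=> c; rewrite /dirD dx_cst dy_cst !mulr0 addr0.
Qed.

Lemma dirD_pull1 z a b p : Det z a b != 0 -> dirD (a - z) (pull z a b p) = pull z a b (dx p).
Proof.
move=> D0; rewrite dirD_pull !dirD_bcp (Det_rot z a b) (Det_rot2 z a b).
have -> : ((a - z).2 * (z.1 - b.1) - (a - z).1 * (z.2 - b.2)) / Det z a b = 1.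
  by apply: (canLR (mulfK D0)); rewrite /Det /det2 /=; ring.
have -> : (a - z).2 * (a.1 - z.1) - (a - z).1 * (a.2 - z.2) = 0 by rewrite /=; ring.
by rewrite mul0r cst0 cst1 mulr0 mulr1 addr0.
Qed.

Lemma dirD_pull2 z a b p : Det z a b != 0 -> dirD (b - z) (pull z a b p) = pull z a b (dy p).
Proof.
move=> D0; rewrite dirD_pull !dirD_bcp (Det_rot z a b) (Det_rot2 z a b).
have -> : ((b - z).2 * (a.1 - z.1) - (b - z).1 * (a.2 - z.2)) / Det z a b = 1.
  by apply: (canLR (mulfK D0)); rewrite /Det /det2 /=; ring.
have -> : (b - z).2 * (z.1 - b.1) - (b - z).1 * (z.2 - b.2) = 0 by rewrite /=; ring.
by rewrite mul0r cst0 cst1 mulr0 mulr1 add0r.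
Qed.

Lemma bc_seg z a b c d s : bc z a b (c + s *: (d - c)) = bc z a b c + s * (bc z a b d - bc z a b c).
Proof. by rewrite bc_line; ring. Qed.

Lemma bc_at z a b : Det z a b != 0 -> [/\ bc z a b z = 1, bc z a b a = 0 & bc z a b b = 0].
Proof.
move=> D0; rewrite /bc; split; first by rewrite mulfV.
  by rewrite (_ : Det a a b = 0) ?mul0r // /Det /det2 /=; ring.
by rewrite (_ : Det b a b = 0) ?mul0r // /Det /det2 /=; ring.
Qed.

Lemma seg_bcp c d z a b : seg c d (bcp z a b) = (bc z a b c)%:P + (bc z a b d - bc z a b c) *: 'X.
Proof.
apply: poly_ext => s; rewrite horner_seg peval_bcp bc_seg !(hornerD, hornerZ, hornerX, hornerC); ring.
Qed.

Lemma seg_pull c d z a b p : seg c d (pull z a b p) =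
  seg (bc a b z c, bc b z a c) (bc a b z d, bc b z a d) p.
Proof.
apply: poly_ext => s; rewrite !horner_seg peval_pull !bc_seg.
by congr peval.
Qed.

End UnivariateSubstitution.

Section EdgeLifting.
Variable R : realType.
Implicit Types (p : poly2 R) (q r : {poly R}) (k : nat).

(** The order ab, bz, za of [emean] for z = (0, 0), a = (1, 0), b = (0, 1). *)
Definition redge (i : 'I_3) : poly2 R -> {poly R} :=
  match val i with
  | 0 => seg (1, 0) (0, 1)
  | 1 => seg (0, 1) (0, 0)
  | _ => seg (0, 0) (1, 0)
  end.

Lemma redgeD i p p' : redge i (p + p') = redge i p + redge i p'.
Proof. by rewrite /redge; case: (val i) => [|[|n]]; rewrite segD. Qed.
Lemma redge_cstM i (c : R) p : redge i (cst c * p) = c *: redge i p.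
Proof. by rewrite /redge; case: (val i) => [|[|n]]; rewrite segM seg_cst mul_polyC. Qed.
Lemma redge0 i : redge i 0 = 0.
Proof. by rewrite /redge; case: (val i) => [|[|n]]; rewrite seg0. Qed.
Lemma redge_sum i (I : Type) (s : seq I) (P : pred I) (F : I -> poly2 R) :
  redge i (\sum_(j <- s | P j) F j) = \sum_(j <- s | P j) redge i (F j).
Proof. exact: (big_morph _ (redgeD i) (redge0 i)). Qed.

Lemma coef_sum_Xn k (c : 'I_k -> R) (i : 'I_k) : (\sum_j c j *: 'X^j : {poly R})`_i = c i.
Proof.
rewrite coef_sum (bigD1 i) //= coefZ coefXn eqxx mulr1 big1 ?addr0 // => j ji.
by rewrite coefZ coefXn [_ == _]eq_sym (_ : (j == i :> nat) = false) ?mulr0 //; apply/negbTE.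
Qed.

Lemma size_sum_Xn k (c : 'I_k -> R) : (size (\sum_j c j *: 'X^j : {poly R})%R <= k)%N.
Proof.
apply: leq_trans (size_sum _ _ _) _; apply/bigmax_leqP => j _.
by apply: leq_trans (size_scale_leq _ _) _; rewrite size_polyXn.
Qed.

Let l1 : poly2 R := pX.
Let l2 : poly2 R := pY.
Let l0 : poly2 R := cst 1 + cst (-1) * pX + cst (-1) * pY.

Lemma edge_functional_inj k (q0 q1 q2 : {poly R}) : odd k ->
  (size q0 <= k)%N -> (size q1 <= k)%N -> (size q2 <= k)%N ->
  (forall p, Pk k p -> I01 (redge (inord 0) p * q0) + I01 (redge (inord 1) p * q1) +
     I01 (redge (inord 2) p * q2) = 0) ->
  [/\ q0 = 0, q1 = 0 & q2 = 0].
Proof.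
have r0 : redge (inord 0) = seg (1, 0) (0, 1) by rewrite /redge /= inordK.
have r1 : redge (inord 1) = seg (0, 1) (0, 0) by rewrite /redge /= inordK.
have r2 : redge (inord 2) = seg (0, 0) (1, 0) by rewrite /redge /= inordK.
move=> ok s0 s1 s2; rewrite r0 r1 r2 => F.
have k0 : (0 < k)%N by case: (k) ok.
have L1 : Pk 1 l1 := @Pk_X R.
have L2 : Pk 1 l2 := @Pk_Y R.
have L0 : Pk 1 l0.
  by do 2?apply: PkD; [exact: Pk_cst|exact/Pk_cstM/Pk_X|exact/Pk_cstM/Pk_Y].
have e01 : seg (1, 0) (0, 1) l1 = 1 - 'X by rewrite seg_X /= sub0r scaleN1r polyC1.
have e02 : seg (1, 0) (0, 1) l2 = 'X by rewrite seg_Y /= subr0 scale1r polyC0 add0r.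
have e00 : seg (1, 0) (0, 1) l0 = 0.
  by rewrite /l0 !segD !segM !seg_cst -/l1 -/l2 e01 e02 polyCN polyC1; ring.
have e11 : seg (0, 1) (0, 0) l1 = 0 by rewrite seg_X /= subr0 scale0r addr0.
have e12 : seg (0, 1) (0, 0) l2 = 1 - 'X by rewrite seg_Y /= sub0r scaleN1r polyC1.
have e10 : seg (0, 1) (0, 0) l0 = 'X.
  by rewrite /l0 !segD !segM !seg_cst -/l1 -/l2 e11 e12 polyCN polyC1; ring.
have e21 : seg (0, 0) (1, 0) l1 = 'X by rewrite seg_X /= subr0 scale1r polyC0 add0r.
have e22 : seg (0, 0) (1, 0) l2 = 0 by rewrite seg_Y /= subr0 scale0r addr0.
have e20 : seg (0, 0) (1, 0) l0 = 1 - 'X.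
  by rewrite /l0 !segD !segM !seg_cst -/l1 -/l2 e21 e22 polyCN polyC1; ring.
(* A product of two coordinates vanishes on two edges and is [wt] on the third, where [uni r l']
   supplies an arbitrary factor of degree at most k - 2. For k = 1 only r = 0 remains. *)
have Pb l l' r : Pk 1 l -> Pk 1 l' -> (size r <= k.-1)%N -> Pk k (l * l' * uni r l').
  move=> hl hl' sr; have [k1|k2] := leqP k 1.
    have -> : r = 0 by apply/eqP; rewrite -size_poly_leq0; lia.
    by rewrite uni0 mulr0; exact: Pk0.
  have sr' : (size r <= (k - 2).+1)%N by lia.
  have h := PkM (PkM hl hl') (Pk_uni sr' hl').
  by apply: Pk_le h; lia.
have o0 r : (size r <= k.-1)%N -> I01 (wt R * r * q0) = 0.
  move=> sr; have := F _ (Pb _ _ _ L1 L2 sr); rewrite !segM !seg_uni e01 e02 e11 e22.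
  rewrite !(mul0r, mulr0) I010 !addr0 comp_polyXr => h; rewrite -[RHS]h; congr I01.
  by rewrite /wt; ring.
have o1 r : (size r <= k.-1)%N -> I01 (wt R * r * q1) = 0.
  move=> sr; have := F _ (Pb _ _ _ L2 L0 sr); rewrite !segM !seg_uni e02 e00 e12 e10 e22.
  rewrite !(mul0r, mulr0) I010 add0r addr0 comp_polyXr => h; rewrite -[RHS]h; congr I01.
  by rewrite /wt; ring.
have o2 r : (size r <= k.-1)%N -> I01 (wt R * r * q2) = 0.
  move=> sr; have := F _ (Pb _ _ _ L0 L1 sr); rewrite !segM !seg_uni e00 e11 e20 e21.
  rewrite !(mul0r, mulr0) I010 !add0r comp_polyXr => h; rewrite -[RHS]h; congr I01.
  by rewrite /wt; ring.
have y0 := even_edge_sym ok s0 o0; have y1 := even_edge_sym ok s1 o1.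
have y2 := even_edge_sym ok s2 o2.
have Pp (l : poly2 R) : Pk 1 l -> Pk k (l ^+ k) by move=> /(@PkXn _ _ _ k); rewrite mul1n.
have rv q : q \Po (1 - 'X) = q -> I01 ((1 - 'X) ^+ k * q) = I01 ('X ^+ k * q).
  by move=> qs; rewrite -(I01_comp_sym _ qs) comp_Xn_poly.
have z0 : (0 : {poly R}) ^+ k = 0 by rewrite expr0n; case: (k) k0.
have := F _ (Pp _ L1); rewrite !seg_exp e01 e11 e21 z0 mul0r I010 addr0 (rv _ y0) => f1.
have := F _ (Pp _ L2); rewrite !seg_exp e02 e12 e22 z0 mul0r I010 addr0 (rv _ y1) => f2.
have := F _ (Pp _ L0); rewrite !seg_exp e00 e10 e20 z0 mul0r I010 add0r (rv _ y2) => f3.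
by split; apply: (@edge_functional_eq0 _ k) => //; lra.
Qed.

(* By duality it suffices that no functional p |-> sum_i int_(E_i) q_i p with deg q_i < k vanishes on
   P_k unless every q_i is 0. The edge bubbles in P_k force each q_i to be symmetric about the
   midpoint of its edge for odd k. The k-th powers of the barycentric coordinates then say that
   the three numbers int_(E_i) t^k q_i have pairwise sum 0, so that they and the q_i vanish. *)
Lemma edge_lifting k : odd k -> exists beta : 'I_3 * 'I_k -> poly2 R,
  (forall ij, Pk k (beta ij)) /\
  forall ij (ij' : 'I_3 * 'I_k), I01 (redge ij'.1 (beta ij) * 'X ^+ ij'.2) = (ij == ij')%:R.
Proof.
move=> ok.
(* A full square of exponents serves as the finite index type; exponents of total degree above k are
   given the polynomial 0. *)
pose phi (s : 'I_k.+1 * 'I_k.+1) : poly2 R :=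
  if (s.1 + s.2 <= k)%N then mon s.1 s.2 else 0.
have phiP s : Pk k (phi s).
  by rewrite /phi; case: leqP => // h; [apply: Pk_le h _; exact: Pk_mon|exact: Pk0].
have inj : forall c : 'I_3 * 'I_k -> R,
   (forall s, \sum_(j : 'I_3 * 'I_k) I01 (redge j.1 (phi s) * 'X ^+ j.2) * c j = 0) -> forall j, c j = 0.
  move=> c hc; pose q i : {poly R} := \sum_j c (i, j) *: 'X^j.
  have F s : I01 (redge (inord 0) (phi s) * q (inord 0)) + I01 (redge (inord 1) (phi s) * q (inord 1))
     + I01 (redge (inord 2) (phi s) * q (inord 2)) = 0.
    rewrite -[RHS](hc s).
    transitivity (\sum_(i < 3) \sum_(j < k) I01 (redge i (phi s) * 'X^j) * c (i, j)); last first.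
      by rewrite pair_bigA /=; apply: eq_bigr => -[i j] _.
    rewrite !big_ord_recl big_ord0 addr0 /=.
    have e i : \sum_(j < k) I01 (redge i (phi s) * 'X^j) * c (i, j) = I01 (redge i (phi s) * q i).
      rewrite /q mulr_sumr I01_sum; apply: eq_bigr => j _.
      by rewrite -scalerAr I01Z mulrC.
    rewrite !e addrA; congr (I01 (redge _ _ * q _) + I01 (redge _ _ * q _) + I01 (redge _ _ * q _));
      by apply: val_inj; rewrite /= inordK.
  have [h0 h1 h2] : [/\ q (inord 0) = 0, q (inord 1) = 0 & q (inord 2) = 0].
    apply: (edge_functional_inj ok); rewrite ?size_sum_Xn // => p /Pk_decomp pE.
    have -> : p = \sum_(s : 'I_k.+1 * 'I_k.+1) cst (if (s.1 + s.2 <= k)%N then p`_s.1`_s.2 else 0) * phi s.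
      rewrite {1}pE big_mkcond; apply: eq_bigr => s _; rewrite /phi.
      by case: ifP => // _; rewrite mulr0.
    rewrite !redge_sum !mulr_suml !I01_sum -!big_split /= big1 // => s _.
    rewrite !redge_cstM -!scalerAl !I01Z -!mulrDr F mulr0 //.
  move=> [i j]; have qi : q i = 0.
    case: i => -[|[|[|i]]] hi //.
    + by rewrite -[RHS]h0; congr q; apply: val_inj; rewrite /= inordK.
    + by rewrite -[RHS]h1; congr q; apply: val_inj; rewrite /= inordK.
    + by rewrite -[RHS]h2; congr q; apply: val_inj; rewrite /= inordK.
  by have := congr1 (fun s : {poly R} => s`_j) qi; rewrite /q coef_sum_Xn coef0.
have /choice [x hx] : forall ij : 'I_3 * 'I_k, exists x : 'I_k.+1 * 'I_k.+1 -> R,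
    forall ij' : 'I_3 * 'I_k, \sum_s x s * I01 (redge ij'.1 (phi s) * 'X ^+ ij'.2) = (ij == ij')%:R.
  by move=> ij; exact: (solve_dual inj (fun ij' => (ij == ij')%:R)).
exists (fun ij => \sum_s cst (x ij s) * phi s); split.
  by move=> ij; apply: Pk_sum => s _; exact: Pk_cstM.
move=> ij ij'; rewrite -hx redge_sum mulr_suml I01_sum; apply: eq_bigr => s _.
by rewrite redge_cstM -scalerAl I01Z.
Qed.

End EdgeLifting.

(** * Interpolation of edge moments on trees *)

Section Interpolation.
Variable R : realType.
Implicit Types (z a b x c d v : pt R) (p q : poly2 R) (L : tri R) (t : btree).

Lemma sqr_sum_le (I : finType) (f : I -> R) :
  (\sum_i f i) ^+ 2 <= #|I|%:R * \sum_i f i ^+ 2.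
Proof.
rewrite expr2 mulr_suml.
have -> : #|I|%:R * \sum_i f i ^+ 2 = \sum_i \sum_j 2^-1 * (f i ^+ 2 + f j ^+ 2).
  under [RHS]eq_bigr => i _ do rewrite -mulr_sumr big_split /= sumr_const.
  rewrite -mulr_sumr big_split /= sumr_const sumrMnl (_ : #|xpredT : pred I| = #|I|) //.
  by rewrite -mulr_natl; field.
apply: ler_sum => i _; rewrite mulr_sumr; apply: ler_sum => j _.
have := sqr_ge0 (f i - f j); nra.
Qed.

Definition tr3 (e : R * R * R) (i : 'I_3) : R :=
  match val i with 0 => e.1.1 | 1 => e.1.2 | _ => e.2 end.
Definition kedge z a b (i : 'I_3) : poly2 R -> {poly R} :=
  match val i with 0 => seg a b | 1 => seg b z | _ => seg z a end.
Definition vopp z a b (i : 'I_3) : pt R :=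
  match val i with 0 => z | 1 => a | _ => b end.
(** The coordinate of the end point of edge i: its trace on that edge is the parameter t itself, see
    [kedge_elam]. *)
Definition elam z a b (i : 'I_3) : poly2 R :=
  match val i with 0 => bcp b z a | 1 => bcp z a b | _ => bcp a b z end.

Lemma kedgeE z a b i p s : (kedge z a b i p).[s] = peval p
  (match val i with 0 => a + s *: (b - a) | 1 => b + s *: (z - b) | _ => z + s *: (a - z) end).
Proof. by rewrite /kedge; case: (val i) => [|[|n]]; rewrite horner_seg. Qed.

Lemma kedgeD z a b i p q : kedge z a b i (p + q) = kedge z a b i p + kedge z a b i q.
Proof. by rewrite /kedge; case: (val i) => [|[|n]]; rewrite segD. Qed.
Lemma kedgeM z a b i p q : kedge z a b i (p * q) = kedge z a b i p * kedge z a b i q.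
Proof. by rewrite /kedge; case: (val i) => [|[|n]]; rewrite segM. Qed.
Lemma kedge_cst z a b i (e : R) : kedge z a b i (cst e) = e%:P.
Proof. by rewrite /kedge; case: (val i) => [|[|n]]; rewrite seg_cst. Qed.
Lemma kedge_exp z a b i p n : kedge z a b i (p ^+ n) = kedge z a b i p ^+ n.
Proof. by rewrite /kedge; case: (val i) => [|[|j]]; rewrite seg_exp. Qed.

Lemma kedge_elam z a b i : Det z a b != 0 -> kedge z a b i (elam z a b i) = 'X.
Proof.
move=> D0; have [h1 h2 h3] := bc_at D0.
have D1 : Det a b z != 0 by rewrite Det_rot.
have D2 : Det b z a != 0 by rewrite Det_rot2.
have [k1 k2 k3] := bc_at D1; have [l1 l2 l3] := bc_at D2.
rewrite /kedge /elam; case: (val i) => [|[|n]]; rewrite seg_bcp ?(h1,h2,h3,k1,k2,k3,l1,l2,l3);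
  by rewrite subr0 scale1r add0r.
Qed.

Lemma kedge_pull z a b i p : Det z a b != 0 -> kedge z a b i (pull z a b p) = redge i p.
Proof.
move=> D0; have [h1 h2 h3] := bc_at D0.
have D1 : Det a b z != 0 by rewrite Det_rot.
have D2 : Det b z a != 0 by rewrite Det_rot2.
have [k1 k2 k3] := bc_at D1; have [l1 l2 l3] := bc_at D2.
by rewrite /kedge /redge; case: (val i) => [|[|n]]; rewrite seg_pull ?(h1,h2,h3,k1,k2,k3,l1,l2,l3).
Qed.

Lemma emean_kedge z a b p q i :
  tr3 (emean Lf z a b (fun=> p) q) i = I01 (kedge z a b i (p * q)).
Proof. by rewrite /tr3 /kedge /=; case: (val i) => [|[|n]]. Qed.

Lemma emean_polyE t z a b p q i :
  tr3 (emean t z a b (fun=> p) q) i = I01 (kedge z a b i (p * q)).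
Proof. by rewrite emean_poly /tr3 /kedge /=; case: (val i) => [|[|n]]. Qed.

(** The vertex opposite to edge i as centre isolates the moment on this edge. *)
Lemma Jt_vopp Q t z a b w q i : Det z a b != 0 -> compat Q t z a b w -> Q q ->
  Jt t z a b (fun L => cst 2 * (w L * q) + eul (vopp z a b i) (w L * q)) =
  `|Det z a b| * tr3 (emean t z a b w q) i.
Proof.
move=> D0 cw Qq; rewrite (Jt_div _ D0 cw Qq) (normrEsg (Det z a b)) -mulrA; congr (_ * _).
have e1 (u v : pt R) : Det u u v = 0 by rewrite /Det /det2 /=; ring.
have e2 (u v : pt R) : Det u v u = 0 by rewrite /Det /det2 /=; ring.
rewrite /vopp /tr3; case: (val i) => [|[|n]]; rewrite !(e1, e2) ?mul0r ?add0r ?addr0 //.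
  by rewrite (Det_rot z a b).
by rewrite (Det_rot2 z a b).
Qed.

Lemma emeanDq t z a b w q q' : emean t z a b w (q + q') = emean t z a b w q + emean t z a b w q'.
Proof.
elim: t z a b => [|t1 IH1 t2 IH2] z a b /=; first by rewrite mulrDr !segD !I01D.
rewrite IH1 IH2 /=; congr (_, _, _); rewrite /=; ring.
Qed.

Lemma emeanZq t z a b w (e : R) q : emean t z a b w (cst e * q) =
  (e * (emean t z a b w q).1.1, e * (emean t z a b w q).1.2, e * (emean t z a b w q).2).
Proof.
elim: t z a b => [|t1 IH1 t2 IH2] z a b /=.
  by rewrite mulrCA !segM !seg_cst !mul_polyC !I01Z.
rewrite IH1 IH2 /=; congr (_, _, _); ring.
Qed.

Lemma tr3D e f i : tr3 (e + f) i = tr3 e i + tr3 f i.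
Proof. by rewrite /tr3; case: (val i) => [|[|n]]. Qed.

Lemma emean_vanish t z a b w q :
  [/\ (forall s, peval q (a + s *: (b - a)) = 0) -> (emean t z a b w q).1.1 = 0,
      (forall s, peval q (b + s *: (z - b)) = 0) -> (emean t z a b w q).1.2 = 0 &
      (forall s, peval q (z + s *: (a - z)) = 0) -> (emean t z a b w q).2 = 0].
Proof.
have sg (c d : pt R) (p : poly2 R) : (forall s, peval q (c + s *: (d - c)) = 0) -> I01 (seg c d (p * q)) = 0.
  move=> h; rewrite segM (_ : seg c d q = 0) ?mulr0 ?I010 //.
  by apply: poly_ext => s; rewrite horner_seg h horner0.
elim: t z a b => [|t1 IH1 t2 IH2] z a b /=; first by split; exact: sg.
have [h1 h2 h3] := IH1 (midpt a b) z a; have [k1 k2 k3] := IH2 (midpt a b) b z.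
split=> // h; rewrite h2 ?k3 ?addr0 ?mulr0 // => s.
  rewrite (_ : _ + _ = a + (2^-1 + s * 2^-1) *: (b - a)) ?h //.
  by apply: pt_ext; rewrite /midpt /= /GRing.scale /=; field.
rewrite (_ : _ + _ = a + (s * 2^-1) *: (b - a)) ?h //.
by apply: pt_ext; rewrite /midpt /= /GRing.scale /=; field.
Qed.

Lemma emean_vanishE t z a b w q i : kedge z a b i q = 0 -> tr3 (emean t z a b w q) i = 0.
Proof.
have [h1 h2 h3] := emean_vanish t z a b w q.
move=> h; have {}h s := congr1 (fun r : {poly R} => r.[s]) h.
have {}h s : peval q (match val i with 0 => a + s *: (b - a) | 1 => b + s *: (z - b)
    | _ => z + s *: (a - z) end) = 0 by rewrite -kedgeE h horner0.
by rewrite /tr3; case: (val i) h => [|[|n]].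
Qed.

(** A moment depends on q only through its trace on the edge ([emean_vanishE]), and this trace is
    also that of a polynomial in [elam]. So k moments per edge determine all others. *)
Lemma emean_expand t z a b w q i k : Det z a b != 0 -> (size (kedge z a b i q) <= k)%N ->
  tr3 (emean t z a b w q) i = \sum_(j < k) (kedge z a b i q)`_j * tr3 (emean t z a b w (elam z a b i ^+ j)) i.
Proof.
move=> D0 sq; set s := kedge z a b i q.
pose q' : poly2 R := \sum_(j < k) cst s`_j * elam z a b i ^+ j.
have e0 : emean t z a b w 0 = 0.
  by have := emeanZq t z a b w 0 0; rewrite mulr0 !mul0r.
have tZ (e : R) p : tr3 (emean t z a b w (cst e * p)) i = e * tr3 (emean t z a b w p) i.
  by rewrite emeanZq /tr3; case: (val i) => [|[|n]].
have tS (r : seq 'I_k) (F : 'I_k -> poly2 R) : tr3 (emean t z a b w (\sum_(j <- r) F j)) i =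
    \sum_(j <- r) tr3 (emean t z a b w (F j)) i.
  elim: r => [|j r IH]; first by rewrite !big_nil e0 /tr3; case: (val i) => [|[|n]].
  by rewrite !big_cons emeanDq tr3D IH.
have -> : q = q' + (q - q') by ring.
rewrite emeanDq tr3D (@emean_vanishE _ _ _ _ _ (q - q')) ?addr0.
  by rewrite /q' tS; apply: eq_bigr => j _; rewrite tZ.
have kS (r : seq 'I_k) (F : 'I_k -> poly2 R) : kedge z a b i (\sum_(j <- r) F j) =
    \sum_(j <- r) kedge z a b i (F j).
  elim: r => [|j r IH]; first by rewrite !big_nil -cst0 kedge_cst.
  by rewrite !big_cons kedgeD IH.
have kN p : kedge z a b i (- p) = - kedge z a b i p.
  by apply: (addrI (kedge z a b i p)); rewrite -kedgeD !subrr -cst0 kedge_cst.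
rewrite kedgeD kN -/s /q' kS; under eq_bigr do rewrite kedgeM kedge_cst kedge_exp kedge_elam // mul_polyC.
rewrite -{1}(coefK s) poly_def (big_ord_widen _ (fun j => s`_j *: 'X^j) sq) big_mkcond /=.
apply/eqP; rewrite subr_eq0; apply/eqP; apply: eq_bigr => j _.
by case: ltnP => // /(nth_default 0) ->; rewrite scale0r.
Qed.

End Interpolation.

Section InterpolationOperator.
Variable R : realType.
Implicit Types (z a b x c d v : pt R) (p q : poly2 R) (L : tri R) (t : btree).

Lemma eulD v p q : eul v (p + q) = eul v p + eul v q.
Proof. by rewrite /eul dxD dyD; ring. Qed.
Lemma eulM v p q : eul v (p * q) = eul v p * q + p * eul v q.
Proof. by rewrite /eul dxM dyM; ring. Qed.
Lemma eul_cst v (e : R) : eul v (cst e) = 0.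
Proof. by rewrite /eul dx_cst dy_cst !mulr0 addr0. Qed.
Lemma peval_eul v p x : peval (eul v p) x = peval (dirD (x - v) p) x.
Proof. by rewrite peval_dirD /eul !pevalsE /=. Qed.

Lemma peval_eul_bcp v z a b x : peval (eul v (bcp z a b)) x = bc z a b x - bc z a b v.
Proof.
rewrite peval_eul dirD_bcp peval_cst /bc -mulrBl; congr (_ / _).
by rewrite /Det /det2 /=; ring.
Qed.

Lemma peval_eul_exp v l x n : peval (eul v (l ^+ n)) x =
  n%:R * peval l x ^+ n.-1 * peval (eul v l) x.
Proof.
elim: n => [|n IH]; first by rewrite expr0 -[1]/(cst 1) eul_cst peval0 !mul0r.
rewrite exprS eulM pevalD !pevalM IH pevalXn.
move: (peval l x) (peval (eul v l) x) => y1 y2.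
case: n {IH} => [|n]; rewrite /= ?expr0; first by ring.
by rewrite (exprS _ n) -[n.+2%:R]natr1; ring.
Qed.

Lemma bc_bounds z a b x : Det z a b != 0 -> tset (T3 z a b) x -> 0 <= bc z a b x <= 1.
Proof. by move=> D0 /(tsetP _ D0)[h1 h2 h3]; have := bc_sum x D0; lra. Qed.

Lemma tset_rot z a b : tset (T3 a b z) = tset (T3 z a b).
Proof. by rewrite /tset vertices_rot. Qed.

Lemma tset_vertex z a b : Det z a b != 0 ->
  [/\ tset (T3 z a b) z, tset (T3 z a b) a & tset (T3 z a b) b].
Proof.
move=> D0; have h v w y : Det v w y != 0 -> tset (T3 v w y) v.
  move=> D1; have [h1 h2 h3] := bc_at D1; apply/(tset_DetP _ D1).
  have e1 : Det v y v = 0 by rewrite /Det /det2 /=; ring.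
  have e2 : Det v v w = 0 by rewrite /Det /det2 /=; ring.
  by rewrite divff // e1 e2 mul0r ler01.
have D1 : Det a b z != 0 by rewrite Det_rot.
have D2 : Det b z a != 0 by rewrite Det_rot2.
split; first exact: h.
  by rewrite -(tset_rot z a b); exact: h.
by rewrite -(tset_rot z a b) -(tset_rot a b z); exact: h.
Qed.

Lemma elam_bounds z a b x i j (k : nat) : Det z a b != 0 -> tset (T3 z a b) x -> (j <= k)%N ->
  `|peval (elam z a b i ^+ j) x| <= 1 /\
  `|peval (eul (vopp z a b i) (elam z a b i ^+ j)) x| <= k%:R.
Proof.
move=> D0 Kx jk; have [vz va vb] := tset_vertex D0.
have main v u w y : Det u w y != 0 -> tset (T3 u w y) x -> tset (T3 u w y) v ->
    `|peval (bcp u w y ^+ j) x| <= 1 /\ `|peval (eul v (bcp u w y ^+ j)) x| <= k%:R.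
  move=> D1 Ux Uv; have /andP[b0 b1] := bc_bounds D1 Ux.
  have /andP[c0 c1] := bc_bounds D1 Uv.
  have pw n : `|bc u w y x ^+ n| <= 1 by rewrite normrX ger0_norm // exprn_ile1.
  split; first by rewrite pevalXn peval_bcp.
  rewrite peval_eul_exp peval_bcp peval_eul_bcp !normrM normr_nat.
  have h : `|bc u w y x - bc u w y v| <= 1 by rewrite ler_norml; lra.
  rewrite -[leRHS]mulr1 -[leRHS]mulr1 ler_pM ?mulr_ge0 //.
  by rewrite ler_pM // ler_nat.
have D1 : Det a b z != 0 by rewrite Det_rot.
have D2 : Det b z a != 0 by rewrite Det_rot2.
have t1 := tset_rot z a b; have t2 := tset_rot a b z.
rewrite /vopp /elam; case: (val i) => [|[|n]].
- by apply: main => //; rewrite t2 t1.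
- exact: main.
- by apply: main => //; rewrite t1.
Qed.

Lemma vopp_vertex z a b i : vopp z a b i \in vertices (T3 z a b).
Proof. by rewrite /vopp !inE; case: (val i) => [|[|n]]; rewrite eqxx ?orbT. Qed.

Lemma common_bound (I : finType) (f : I -> poly2 R) : exists2 B, 0 <= B &
  forall i x, box 1 x -> [/\ `|peval (f i) x| <= B, `|peval (dx (f i)) x| <= B &
    `|peval (dy (f i)) x| <= B].
Proof.
have /choice [C hC] i : exists C, forall x, box 1 x -> [/\ `|peval (f i) x| <= C,
    `|peval (dx (f i)) x| <= C & `|peval (dy (f i)) x| <= C].
  have [C1 h1] := peval_bounded (f i) 1; have [C2 h2] := peval_bounded (dx (f i)) 1.
  have [C3 h3] := peval_bounded (dy (f i)) 1.
  exists (`|C1| + `|C2| + `|C3|) => x bx.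
  have := h1 x bx; have := h2 x bx; have := h3 x bx.
  have := ler_norm C1; have := ler_norm C2; have := ler_norm C3.
  have := normr_ge0 C1; have := normr_ge0 C2; have := normr_ge0 C3.
  by split; lra.
exists (\sum_i `|C i|); first by apply: sumr_ge0.
move=> i x bx; have [h1 h2 h3] := hC i x bx.
have h : C i <= \sum_j `|C j|.
  by rewrite (bigD1 i) //= (le_trans (ler_norm _)) // lerDl sumr_ge0.
by split; apply: le_trans h.
Qed.

(** A trace inequality: [Jt_vopp] writes the moment as a mean over the tree of w (2 q + [eul] q) + q
    [eul] w. On the triangle the first factor is at most k + 2 and |q| at most 1; the Poincare bound
    then removes w itself. *)
Lemma moment_bound k Q CP t z a b w i j : (forall n, (n <= k)%N -> Q (elam z a b i ^+ n)) ->
  (j <= k)%N -> Det z a b != 0 -> compat Q t z a b w ->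
  Jt t z a b (fun L => w L ^+ 2) <= CP * Jt t z a b (fun L => gr z a b (w L)) ->
  tr3 (emean t z a b w (elam z a b i ^+ j)) i ^+ 2 <=
  (k%:R + 2) ^+ 2 * CP / `|Det z a b| * Jt t z a b (fun L => gr z a b (w L))
  + 2 / `|Det z a b| * Jt t z a b (fun L => gr z a b (w L)).
Proof.
move=> Qe jk D0 cw hP; have Dp : 0 < `|Det z a b| by rewrite normr_gt0.
set q := elam z a b i ^+ j; set G := Jt t z a b (fun L => gr _ _ _ (w L)) in hP *; set v := vopp z a b i.
pose h L := cst 2 * (w L * q) + eul v (w L * q).
have e : Jt t z a b h = `|Det z a b| * tr3 (emean t z a b w q) i.
  exact: Jt_vopp D0 cw (Qe _ jk).
have h2 : Jt t z a b (fun L => h L ^+ 2) <= 2 * (k%:R + 2) ^+ 2 * (CP * G) + 4 * G.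
  apply: (@le_trans _ _ (Jt t z a b (fun L => cst (2 * (k%:R + 2) ^+ 2) * w L ^+ 2 + cst 4 * gr z a b (w L)))).
    apply: Jt_le => // L _ x _ Kx; rewrite pevalXn.
    have -> : peval (h L) x = peval (w L) x * (2 * peval q x + peval (eul v q) x) + peval q x * peval (eul v (w L)) x.
      by rewrite /h eulM !pevalsE; ring.
    have [q1 q2] := elam_bounds i D0 Kx jk.
    have h3 := eul_bound (w L) D0 Kx (vopp_vertex z a b i).
    rewrite (pevalD (cst (2 * _) * _)) (pevalM (cst (2 * _))) (pevalM (cst 4)) !peval_cst (pevalXn (w L)).
    move: q1 q2 h3; rewrite -/q -/v.
    move: (peval q x) (peval (eul v q) x) (peval (eul v (w L)) x) (peval (w L) x) (peval (gr _ _ _ _) x).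
    move=> y1 y2 y3 y4 y5 q1 q2 h3.
    have kk : 0 <= k%:R :> R by [].
    have s1 : (y4 * (2 * y1 + y2)) ^+ 2 <= (k%:R + 2) ^+ 2 * y4 ^+ 2.
      rewrite exprMn mulrC ler_wpM2r ?sqr_ge0 // -[leLHS]real_normK ?num_real //.
      rewrite ler_pXn2r ?nnegrE ?addr_ge0 //.
      move: q1 q2; rewrite !ler_norml => /andP[? ?] /andP[? ?]; lra.
    have s2 : (y1 * y3) ^+ 2 <= 2 * y5.
      rewrite exprMn; apply: le_trans h3; rewrite -[leRHS]mul1r ler_wpM2r ?sqr_ge0 //.
      by rewrite -[leLHS]real_normK ?num_real // expr_le1.
    have := sqr_ge0 (y4 * (2 * y1 + y2) - y1 * y3).
    move: s1 s2; move: (y4 * (2 * y1 + y2)) (y1 * y3) => u1 u2 s1 s2; nra.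
  rewrite JtD // !JtZ // -/G lerD2r ler_wpM2l // mulr_ge0 ?sqr_ge0 //.
have := Jt_CS t h D0; rewrite e => cs.
have hD : 0 <= 2^-1 * `|Det z a b| by rewrite mulr_ge0 // invr_ge0.
have {cs} := le_trans cs (ler_wpM2l hD h2).
clear hD h2 hP e; move: (tr3 _ _) => E; move: `|_| Dp => D Dp; clearbody G => hE.
have -> : (k%:R + 2) ^+ 2 * CP / D * G + 2 / D * G =
  (D ^+ 2)^-1 * (2^-1 * D * (2 * (k%:R + 2) ^+ 2 * (CP * G) + 4 * G)).
  by field; rewrite gt_eqF.
rewrite -[leLHS](@mulKf _ (D ^+ 2)) ?expf_neq0 ?gt_eqF // -exprMn.
by rewrite ler_wpM2l // invr_ge0 exprn_ge0 // ltW.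
Qed.

Lemma compat_shift Q t z a b w (e : R) : compat Q t z a b w ->
  compat Q t z a b (fun L => w L - cst e).
Proof. by move=> h; apply: (compatD h); exact: compat_poly. Qed.

Lemma pull_bound z a b p x B : Det z a b != 0 -> tset (T3 z a b) x ->
  (forall y, box 1 y -> `|peval p y| <= B) -> `|peval (pull z a b p) x| <= B.
Proof.
move=> D0 Kx h; rewrite peval_pull; apply: h.
have D1 : Det a b z != 0 by rewrite Det_rot.
have D2 : Det b z a != 0 by rewrite Det_rot2.
have /andP[a1 a2] : 0 <= bc a b z x <= 1 by apply: bc_bounds => //; rewrite tset_rot.
have /andP[b1 b2] : 0 <= bc b z a x <= 1.
  by apply: bc_bounds => //; rewrite (tset_rot a b z) tset_rot.
by rewrite /box /=; split; rewrite /= ler_norml; lra.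
Qed.

Lemma dirD_shift v p (e : R) : dirD v (p + cst e) = dirD v p.
Proof. by rewrite /dirD dxD dyD dx_cst dy_cst !addr0. Qed.
Lemma gr_shift z a b p (e : R) : gr z a b (p + cst e) = gr z a b p.
Proof. by rewrite /gr !dirD_shift. Qed.

Lemma dirDD v p q : dirD v (p + q) = dirD v p + dirD v q.
Proof. by rewrite /dirD dxD dyD; ring. Qed.
Lemma dirD_cstM v (e : R) p : dirD v (cst e * p) = cst e * dirD v p.
Proof. by rewrite /dirD dxM dyM dx_cst dy_cst; ring. Qed.
Lemma dirD0 v : dirD v 0 = 0.
Proof. by apply: (addrI (dirD v 0)); rewrite -dirDD !addr0. Qed.
Lemma dirD_sum v (I : Type) (s : seq I) (F : I -> poly2 R) :
  dirD v (\sum_(j <- s) F j) = \sum_(j <- s) dirD v (F j).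
Proof. by elim: s => [|j s IH]; rewrite ?(big_nil, big_cons) ?dirD0 // dirDD IH. Qed.
Lemma kedge_sum z a b i (I : Type) (s : seq I) (F : I -> poly2 R) :
  kedge z a b i (\sum_(j <- s) F j) = \sum_(j <- s) kedge z a b i (F j).
Proof. by elim: s => [|j s IH]; rewrite ?(big_nil, big_cons) -?cst0 ?kedge_cst // kedgeD IH. Qed.

Lemma sum_sqr_bound (I : finType) (e : I -> R) (f : I -> R) (A B : R) :
  0 <= A -> (forall i, e i ^+ 2 <= A) -> (forall i, `|f i| <= B) ->
  (\sum_i e i * f i) ^+ 2 <= #|I|%:R ^+ 2 * B ^+ 2 * A.
Proof.
move=> A0 he hf; apply: le_trans (sqr_sum_le _) _.
have -> : #|I|%:R ^+ 2 * B ^+ 2 * A = #|I|%:R * (\sum_(i : I) A * B ^+ 2).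
  rewrite sumr_const (_ : #|xpredT : pred I| = #|I|) // -mulr_natl; ring.
rewrite ler_wpM2l //; apply: ler_sum => i _; rewrite exprMn ler_pM ?sqr_ge0 //.
by rewrite -[leLHS]real_normK ?num_real // ler_pXn2r // nnegrE ?normr_ge0 // (le_trans _ (hf i)).
Qed.

(** The degree m on the leaves may exceed the degree k of the interpolant. One constant has to serve
    all trees and all triangles. *)
Definition interpolates k m C : Prop := forall t z a b w,
  Det z a b != 0 -> (forall L, L \in leaves t z a b -> Pk m (w L)) ->
  compat (Pk k.-1) t z a b w -> exists p, [/\ Pk k p,
    forall q i, Pk k.-1 q -> I01 (kedge z a b i (p * q)) = tr3 (emean t z a b w q) i,
    Jt t z a b (fun L => (w L - p) ^+ 2) <= C * Jt t z a b (fun L => gr z a b (w L)) &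
    Jt t z a b (fun=> gr z a b p) <= C * Jt t z a b (fun L => gr z a b (w L))].

(** The mean M of w is split off, so that [tree_poincare] bounds the moments of the rest by its
    energy. These moments are lifted by the dual polynomials of [edge_lifting], pulled back from the
    reference triangle, and M is added again. *)
Lemma interpolation k m : odd k -> exists2 C, 0 <= C & interpolates k m C.
Proof.
move=> ok; have Q1 : Pk k.-1 (1 : poly2 R) by rewrite -[1]/(cst 1); exact: (@Pk_cst _ k.-1 1).
have [CP CP0 hP] := tree_poincare m Q1.
have [beta [Pb hb]] := edge_lifting R ok.
have [B B0 hB] := common_bound beta.
pose N : R := #|{: 'I_3 * 'I_k}|%:R.
(* N dual polynomials, bounded with their derivatives by B, times moments whose squares are bounded
   by [moment_bound]. *)
pose Z := N ^+ 2 * B ^+ 2 * ((k%:R + 2) ^+ 2 * CP + 2).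
have Z0 : 0 <= Z by rewrite !mulr_ge0 ?sqr_ge0 ?addr_ge0 ?mulr_ge0 ?sqr_ge0.
exists (2 * CP + Z) => [|t z a b w D0 hw cw]; first by apply: addr_ge0 => //; apply: mulr_ge0.
have Dp : 0 < `|Det z a b| by rewrite normr_gt0.
have {}hP := hP t z a b w D0 hw cw.
set M := 2 / _ * _ in hP; set G := Jt t z a b (fun L => gr z a b (w L)) in hP *.
pose w' L := w L - cst M.
have grw L : gr z a b (w' L) = gr z a b (w L) by rewrite /w' -cstN gr_shift.
have cw' : compat (Pk k.-1) t z a b w' by exact: compat_shift.
have G0 : 0 <= G.
  have := Jt_const t (0 : R) D0; rewrite mulr0 => <-; apply: Jt_le => // L _ x _ _.
  by rewrite peval_cst peval_gr_ge0.
have grG : Jt t z a b (fun L => gr z a b (w' L)) = G by apply: eq_Jt => L _; rewrite grw.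
pose et (ij : 'I_3 * 'I_k) := tr3 (emean t z a b w' (elam z a b ij.1 ^+ ij.2)) ij.1.
pose A := ((k%:R + 2) ^+ 2 * CP + 2) / `|Det z a b| * G.
have A0 : 0 <= A by rewrite !mulr_ge0 ?invr_ge0 ?addr_ge0 ?mulr_ge0 ?sqr_ge0.
have etA ij : et ij ^+ 2 <= A.
  have jk : (ij.2 <= k.-1)%N by have := ltn_ord ij.2; move: (nat_of_ord ij.2) => j; lia.
  have h := @moment_bound k.-1 (Pk k.-1) CP t z a b w' ij.1 ij.2 _ jk D0 cw'.
  have {}h := h _; apply: le_trans (h _ _) _.
  - move=> n nk; apply: Pk_le nk _.
    by have := PkXn (n := n) (_ : Pk 1 (elam z a b ij.1)); rewrite mul1n; apply;
      rewrite /elam; case: (val ij.1) => [|[|?]]; exact: Pk_bcp.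
  - by rewrite grG.
  rewrite grG /A -mulrDl -mulrDl !ler_wpM2r // ?invr_ge0 // lerD2r ler_wpM2r //.
  by rewrite ler_pXn2r ?nnegrE ?addr_ge0 // lerD2r ler_nat leq_pred.
pose p0 := \sum_ij cst (et ij) * pull z a b (beta ij).
have hK (x : pt R) : tset (T3 z a b) x -> [/\ peval (p0 ^+ 2) x <= Z / `|Det z a b| * G &
    peval (gr z a b p0) x <= 2 * (Z / `|Det z a b| * G)].
  move=> Kx; have e : N ^+ 2 * B ^+ 2 * A = Z / `|Det z a b| * G by rewrite /A /Z; ring.
  have hb1 ij : `|peval (pull z a b (beta ij)) x| <= B.
    by apply: pull_bound => // y /(hB ij)[].
  have hb2 ij : `|peval (pull z a b (dx (beta ij))) x| <= B.
    by apply: pull_bound => // y /(hB ij)[].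
  have hb3 ij : `|peval (pull z a b (dy (beta ij))) x| <= B.
    by apply: pull_bound => // y /(hB ij)[].
  have dsum v : dirD v p0 = \sum_ij cst (et ij) * dirD v (pull z a b (beta ij)).
    by rewrite /p0 dirD_sum; apply: eq_bigr => ij _; rewrite dirD_cstM.
  have ps (F : 'I_3 * 'I_k -> poly2 R) : (forall ij, `|peval (F ij) x| <= B) ->
      peval (\sum_ij cst (et ij) * F ij) x ^+ 2 <= Z / `|Det z a b| * G.
    move=> hF; rewrite -e peval_sum; under eq_bigr do rewrite pevalM peval_cst.
    exact: sum_sqr_bound.
  split; first by rewrite pevalXn; exact: ps.
  rewrite peval_gr !dsum mulr_natl mulr2n; apply: lerD; apply: ps => ij.
    by rewrite dirD_pull1.
  by rewrite dirD_pull2.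
have hp0 : Jt t z a b (fun=> p0 ^+ 2) <= 2^-1 * (Z * G).
  have -> : 2^-1 * (Z * G) = 2^-1 * `|Det z a b| * (Z / `|Det z a b| * G).
    by field; rewrite gt_eqF.
  rewrite -(Jt_const t _ D0); apply: Jt_le => // L _ x _ Kx; rewrite peval_cst.
  by have [] := hK x Kx.
exists (p0 + cst M); split.
- apply: PkD; last exact: Pk_cst.
  apply: Pk_sum => ij _; apply: Pk_cstM; rewrite /pull; apply: Pk_psub => //; exact: Pk_bcp.
- move=> q i Pq; have sq : (size (kedge z a b i q) <= k)%N.
    by have := fun c d => size_seg c d Pq; rewrite /kedge; case: (k) ok => // n _ /= h;
      case: (val i) => [|[|?]]; exact: h.
  have -> : tr3 (emean t z a b w q) i = tr3 (emean t z a b w' q) i +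
      I01 (kedge z a b i (cst M * q)).
    rewrite -(emean_polyE t) -tr3D -emeanD; congr (tr3 (emean _ _ _ _ _ _) _).
    by apply/funext => L; rewrite /w' subrK.
  rewrite (emean_expand t w' D0 sq) mulrDl kedgeD I01D; congr (_ + _).
  rewrite kedgeM kedge_sum mulr_suml I01_sum.
  transitivity (\sum_(ij : 'I_3 * 'I_k) et ij * I01 (redge i (beta ij) * kedge z a b i q)).
    by apply: eq_bigr => ij _; rewrite kedgeM kedge_cst kedge_pull // -mulrA mul_polyC I01Z.
  have rE (ij : 'I_3 * 'I_k) : I01 (redge i (beta ij) * kedge z a b i q) =
      \sum_(j < k) (kedge z a b i q)`_j * (ij == (i, j))%:R.
    rewrite -{1}(coefK (kedge z a b i q)) poly_def.
    rewrite (big_ord_widen _ (fun j => (kedge z a b i q)`_j *: 'X^j) sq) big_mkcond /=.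
    rewrite mulr_sumr I01_sum; apply: eq_bigr => j _.
    rewrite -(hb ij (i, j)) /=; case: ltnP => [_|/(nth_default 0) ->].
      by rewrite -scalerAr I01Z.
    by rewrite mulr0 I010 mul0r.
  under eq_bigr => ij _ do rewrite rE mulr_sumr.
  rewrite exchange_big /=; apply: eq_bigr => j _.
  rewrite (bigD1 (i, j)) //= eqxx mulr1 mulrC big1 ?addr0 // => ij /negbTE ->.
  by rewrite !mulr0.
- apply: (@le_trans _ _ (Jt t z a b (fun L => cst 2 * w' L ^+ 2 + cst 2 * p0 ^+ 2))).
    apply: Jt_le => // L _ x _ _.
    rewrite pevalD (pevalM (cst _)) (pevalM (cst _)) !pevalXn !peval_cst.
    have -> : w L - (p0 + cst M) = w' L - p0 by rewrite /w'; ring.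
    rewrite pevalB; have := sqr_ge0 (peval (w' L) x + peval p0 x); nra.
  rewrite JtD // !JtZ //; move: hP hp0; rewrite -/w'; lra.
apply: (@le_trans _ _ (Jt t z a b (fun=> cst (2 * (Z / `|Det z a b| * G))))).
  by apply: Jt_le => // L _ x _ Kx; rewrite peval_cst gr_shift; have [] := hK x Kx.
rewrite Jt_const // (_ : 2^-1 * _ * _ = Z * G); last by field; rewrite gt_eqF.
by rewrite ler_wpM2r // lerDr mulr_ge0.
Qed.

End InterpolationOperator.

(** * The polynomial of degree k + 1 that corrects along edges *)

Section EdgePolynomial.
Variable R : realType.
Implicit Types (q h : {poly R}).

(* A jump that is orthogonal to lower degrees is determined by its end value, which makes
   this polynomial the corrector along the edges. *)
Lemma edge_bubble k : exists chi : {poly R}, [/\ (size chi <= k.+2)%N, chi.[0] = 0, chi.[1] = 1 &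
  forall q, (size q <= k)%N -> I01 (chi * q) = 0].
Proof.
(* The ansatz chi = X g with g of degree at most k ensures chi(0) = 0. The index [None] stands for
   the value at 1, [Some j] for the moment against X^j. *)
pose M (i : 'I_k.+1) (j : option 'I_k) : R :=
  if j is Some j then I01 ('X * 'X^i * 'X^j) else 1.
have inj : forall c : option 'I_k -> R, (forall i, \sum_j M i j * c j = 0) -> forall j, c j = 0.
  move=> c hc; pose s : {poly R} := \sum_j c (Some j) *: 'X^j.
  have hs : (size s <= k)%N by exact: size_sum_Xn.
  have key (h : {poly R}) : (size h <= k.+1)%N -> h.[1] * c None + I01 ('X * h * s) = 0.
    move=> sh; have hE : h = \sum_(i < k.+1) h`_i *: 'X^i.
      rewrite -[LHS]coefK poly_def (big_ord_widen _ (fun j => h`_j *: 'X^j) sh) big_mkcond /=.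
      by apply: eq_bigr => i _; case: ltnP => // /(nth_default 0) ->; rewrite scale0r.
    rewrite {1 2}hE.
    rewrite horner_sum mulr_suml [X in I01 (X * _)]mulr_sumr [X in I01 X]mulr_suml I01_sum -big_split /= big1 // => i _.
    rewrite hornerZ hornerXn expr1n mulr1 -scalerAr -scalerAl I01Z -mulrDr.
    have := hc i; rewrite (bigD1 None) //= mul1r => e.
    rewrite (_ : I01 _ = \sum_(j | j != None) M i j * c j) ?e ?mulr0 //.
    rewrite /s mulr_sumr I01_sum.
    transitivity (\sum_(j : 'I_k) M i (Some j) * c (Some j)).
      by apply: eq_bigr => j _; rewrite /= -scalerAr I01Z mulrC.
    rewrite [RHS](reindex_omap Some id) => [|[]] //=.
    by apply: eq_bigl => j; rewrite eqxx.
  (* The trial function (1 - X) s vanishes at 1 and leaves only a weighted square. *)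
  have sw : I01 (wt R * (s * s)) = 0.
    have := key ((1 - 'X) * s); rewrite hornerM hornerD hornerN hornerX hornerC subrr !mul0r add0r.
    rewrite /wt !mulrA; apply; apply: leq_trans (size_polyMleq _ _) _.
    by rewrite -opprB size_polyN size_XsubC add2n /= ltnS.
  have s0 : s = 0 by apply: (I01_weight_eq0 (wt_neq0 R)) sw => t; exact: wt_ge0.
  move=> [j|]; first by have := congr1 (fun h : {poly R} => h`_j) s0; rewrite /s coef_sum_Xn coef0.
  by have := key 1; rewrite size_poly1 hornerC mul1r s0 mulr0 I010 addr0; apply.
have [x hx] := solve_dual inj (fun j => if j is None then 1 else 0).
pose g : {poly R} := \sum_i x i *: 'X^i.
exists ('X * g); split.
- by rewrite mulrC; apply: leq_trans (size_polyMleq _ _) _; rewrite size_polyX addn2 /= ltnS size_sum_Xn.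
- by rewrite hornerM hornerX mul0r.
- rewrite hornerM hornerX mul1r horner_sum -[RHS](hx None).
  by apply: eq_bigr => i _; rewrite hornerZ hornerXn expr1n.
move=> q sq; rewrite -(coefK q) poly_def (big_ord_widen _ (fun j => q`_j *: 'X^j) sq) big_mkcond /=.
rewrite mulr_sumr I01_sum big1 // => j _; case: ifP => _; last by rewrite mulr0 I010.
rewrite -scalerAr I01Z (_ : I01 _ = 0) ?mulr0 // -[RHS](hx (Some j)).
rewrite /g mulr_sumr mulr_suml I01_sum; apply: eq_bigr => i _.
by rewrite -scalerAr -scalerAl I01Z.
Qed.

Lemma poly_roots01 (s : {poly R}) k : (size s <= k.+2)%N -> s.[0] = 0 -> s.[1] = 0 ->
  exists2 h : {poly R}, (size h <= k)%N & s = wt R * h.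
Proof.
move=> ss /eqP/factor_theorem[s1 e1] s11.
have : s1.[1] = 0 by move: s11; rewrite e1 hornerM hornerXsubC subr0 mulr1.
move=> /eqP/factor_theorem[s2 e2]; exists (- s2); last by rewrite e1 e2 /wt; ring.
rewrite size_polyN; have [->|s20] := eqVneq s2 0; first by rewrite size_poly0.
move: ss; rewrite e1 e2 !size_Mmonic ?monicXsubC ?mulf_neq0 ?polyXsubC_eq0 // !size_XsubC.
by rewrite !addn2.
Qed.

(** The two sides of the first claim have equal end values, so that their difference is [wt] h with
    h of degree below k; being orthogonal to h, it vanishes. For the second claim r(1) = - r(0) by
    antisymmetry, and the squared increment 4 r(t)^2 is at most the integral of the squared
    derivative. *)
Lemma edge_jump k (chi r : {poly R}) : odd k -> (size chi <= k.+2)%N -> chi.[0] = 0 -> chi.[1] = 1 ->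
  (forall q, (size q <= k)%N -> I01 (chi * q) = 0) ->
  (size r <= k.+1)%N -> (forall q, (size q <= k)%N -> I01 (r * q) = 0) ->
  r = r.[0] *: (chi \Po (1 - 'X)) + r.[1] *: chi /\
  forall t, t = 0 \/ t = 1 -> 4 * r.[t] ^+ 2 <= I01 (r^`() ^+ 2).
Proof.
move=> ok sc c0 c1 oc sr or; have anti := odd_edge_antisym ok sr or.
have r10 : r.[1] = - r.[0].
  have := congr1 (fun s : {poly R} => s.[0]) anti.
  by rewrite horner_comp !(hornerD, hornerN, hornerX, hornerC) subr0.
have orev (q : {poly R}) : (size q <= k)%N -> I01 ((chi \Po (1 - 'X)) * q) = 0.
  move=> sq; rewrite -I01_rev comp_polyM -comp_polyA.
  have -> : (1 - 'X : {poly R}) \Po (1 - 'X) = 'X.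
    by rewrite comp_polyB -[1]polyC1 comp_polyC comp_polyX polyC1; ring.
  rewrite comp_polyXr; apply: oc; apply: leq_trans (size_comp_poly_leq _ _) _.
  have -> : size (1 - 'X : {poly R}) = 2%N by rewrite -opprB size_polyN size_XsubC.
  by rewrite /= muln1; case: (size q) sq => // _; exact: odd_gt0.
have srev : (size (chi \Po (1 - 'X))%R <= k.+2)%N.
  apply: leq_trans (size_comp_poly_leq _ _) _.
  have -> : size (1 - 'X : {poly R}) = 2%N by rewrite -opprB size_polyN size_XsubC.
  by rewrite /= muln1; case: (size chi) sc.
split.
  apply/eqP; rewrite -subr_eq0; apply/eqP; set s := _ - _.
  have ev t : s.[t] = r.[t] - (r.[0] * chi.[1 - t] + r.[1] * chi.[t]).
    by rewrite /s !(hornerD, hornerN, hornerZ, horner_comp, hornerX, hornerC).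
  have [||| h sh sE] := @poly_roots01 s k.
  - rewrite /s; apply: leq_trans (size_polyD _ _) _; rewrite geq_max size_polyN (leq_trans sr) //=.
    apply: leq_trans (size_polyD _ _) _; rewrite geq_max.
    by rewrite (leq_trans (size_scale_leq _ _)) // (leq_trans (size_scale_leq _ _)).
  - by rewrite ev subr0 c0 c1; ring.
  - by rewrite ev subrr c0 c1; ring.
  suff h0 : h = 0 by rewrite sE h0 mulr0.
  apply: (I01_weight_eq0 (wt_neq0 R)) => [t|]; first exact: wt_ge0.
  rewrite mulrA -sE /s mulrBl mulrDl -!scalerAl I01B I01D !I01Z or // orev // oc //.
  by rewrite !mulr0 addr0 subr0.
have h := I01_sqr r^`(); rewrite I01_deriv r10 in h.
by move=> t [->|->]; rewrite ?r10 ?sqrrN; apply: le_trans h; rewrite -subr_ge0;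
  have := sqr_ge0 r.[0]; nra.
Qed.

End EdgePolynomial.

(** * Additivity of polynomial integrals and integration by parts on trees *)

Section IntegrationByParts.
Variable R : realType.
Implicit Types (z a b x c d v : pt R) (p q : poly2 R) (L : tri R) (t : btree).

Lemma Pk_exists p : exists m, Pk m p.
Proof.
elim/poly2_ind: p => [c|p q [m hm] [n hn]|p [m hm]|p [m hm]].
- by exists 0%N; exact: (@Pk_cst _ 0 c).
- by exists (m + n)%N; apply: PkD; [apply: Pk_le hm|apply: Pk_le hn]; lia.
- by exists (m + 1)%N; apply: PkM => //; exact: Pk_X.
- by exists (m + 1)%N; apply: PkM => //; exact: Pk_Y.
Qed.

Lemma eul0_mon i j : eul 0 (mon i j : poly2 R) = cst (i + j)%:R * mon i j.
Proof.
have eX n : eul 0 (pX ^+ n : poly2 R) = cst n%:R * pX ^+ n.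
  elim: n => [|n IH]; first by rewrite expr0 -[1 in LHS]/(cst 1) eul_cst cst0 mul0r.
  rewrite exprS eulM IH -[n.+1]add1n natrD cstD cst1 /eul dxX dyX !cst0; ring.
have eY n : eul 0 (pY ^+ n : poly2 R) = cst n%:R * pY ^+ n.
  elim: n => [|n IH]; first by rewrite expr0 -[1 in LHS]/(cst 1) eul_cst cst0 mul0r.
  rewrite exprS eulM IH -[n.+1]add1n natrD cstD cst1 /eul dxY dyY !cst0; ring.
by rewrite /mon eulM eX eY natrD cstD; ring.
Qed.

Lemma eul0_sum (I : Type) (s : seq I) (P : pred I) (F : I -> poly2 R) :
  eul 0 (\sum_(i <- s | P i) F i) = \sum_(i <- s | P i) eul 0 (F i).
Proof.
elim: s => [|i s IH]; first by rewrite !big_nil -cst0 eul_cst.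
by rewrite !big_cons; case: (P i) => //; rewrite eulD IH.
Qed.

(** By Euler's identity the divergence of x q(x) multiplies a monomial of degree i + j by i + j +
    2. *)
Lemma divergence_onto p : exists q, p = cst 2 * q + eul 0 q.
Proof.
have [m /Pk_decomp pE] := Pk_exists p.
exists (\sum_(ij : 'I_m.+1 * 'I_m.+1 | (ij.1 + ij.2 <= m)%N)
  cst (p`_(ij.1)`_(ij.2) / (ij.1 + ij.2 + 2)%:R) * mon ij.1 ij.2).
rewrite eul0_sum mulr_sumr -big_split {1}pE /=; apply: eq_bigr => -[i j] /= _.
rewrite eulM eul_cst mul0r add0r eul0_mon.
set e := p`_i`_j; rewrite -[in LHS](_ : (e / (i + j + 2)%:R) * (2 + (i + j)%:R) = e).
  by rewrite cstM cstD; ring.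
by rewrite [(i + j + 2)%:R]natrD addrC divfK // -natrD pnatr_eq0 addn2.
Qed.

(** With p written as a divergence, both sides are the same flux through the boundary of the
    root. *)
Lemma J_tree t z a b p : Det z a b != 0 -> J z a b p = Jt t z a b (fun=> p).
Proof.
move=> D0; have [q ->] := divergence_onto p.
have := @Jt_div _ (fun=> True) t z a b (fun=> 1) q 0 D0 (compat_poly _ _ _ _ _ _) I.
rewrite emean_poly /= !mul1r => h.
rewrite J_div // -h; apply: eq_Jt => L _; by rewrite mul1r.
Qed.

(** Without outer moments the integral in [Jt_div] vanishes for every centre v; two centres that
    differ by a unit vector isolate one partial derivative. *)
Lemma Jt_d0 Q t z a b w q : Det z a b != 0 -> compat Q t z a b w -> Q q ->
  (forall i, tr3 (emean t z a b w q) i = 0) ->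
  Jt t z a b (fun L => dx (w L * q)) = 0 /\ Jt t z a b (fun L => dy (w L * q)) = 0.
Proof.
move=> D0 cw Qq e0.
have e1 : emean t z a b w q = 0.
  have := e0 (Ordinal (isT : 0 < 3)%N); have := e0 (Ordinal (isT : 1 < 3)%N).
  have := e0 (Ordinal (isT : 2 < 3)%N); rewrite /tr3 /=.
  by case: (emean t z a b w q) => -[x y] s /= -> -> ->.
have e v : Jt t z a b (fun L => cst 2 * (w L * q) + eul v (w L * q)) = 0.
  by rewrite (Jt_div _ D0 cw Qq) e1 /= !mulr0 !addr0 mulr0.
split.
  have := e 0; rewrite (@eq_Jt _ _ _ _ _ _ (fun L => dx (w L * q) +
     (cst 2 * (w L * q) + eul (1, 0) (w L * q)))).
    by rewrite JtD // e addr0.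
  by move=> L _; rewrite /eul /= cst0 cst1; ring.
have := e 0; rewrite (@eq_Jt _ _ _ _ _ _ (fun L => dy (w L * q) +
   (cst 2 * (w L * q) + eul (0, 1) (w L * q)))).
  by rewrite JtD // e addr0.
by move=> L _; rewrite /eul /= cst0 cst1; ring.
Qed.

(** The partial derivatives of u have degree at most k - 1. Against them w has no moments on the
    edges of the root and equal ones from both sides on inner edges, so that no edge term
    remains. *)
Lemma Jt_parts k t z a b w u : Det z a b != 0 -> compat (Pk k.-1) t z a b w -> Pk k u ->
  (forall q i, Pk k.-1 q -> tr3 (emean t z a b w q) i = 0) ->
  Jt t z a b (fun L => dx u * dx (w L) + dy u * dy (w L)) = - Jt t z a b (fun L => lapl u * w L).
Proof.
move=> D0 cw hu e0.
have [h1 _] := Jt_d0 D0 cw (Pk_dx hu) (fun i => e0 _ i (Pk_dx hu)).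
have [_ h2] := Jt_d0 D0 cw (Pk_dy hu) (fun i => e0 _ i (Pk_dy hu)).
apply/eqP; rewrite -subr_eq0 opprK -JtD //; apply/eqP.
rewrite -[RHS](addr0 0) -{1}h1 -h2 -JtD //; apply: eq_Jt => L _.
by rewrite /lapl dxM dyM; ring.
Qed.

End IntegrationByParts.

(** * Splitting integrals of integrable functions over triangles *)

Section SumsOfIntegrals.
Variable R : realType.
Implicit Types (z a b x c d v : pt R) (p q : poly2 R) (L : tri R) (t : btree) (g : pt R -> R).
Local Notation mR := (measurableTypeR R).
Local Notation mP := (mR * mR)%type.
Local Notation mu := (leb2 R).

Lemma integrable_disjointU (A B : set mP) g : measurable A -> measurable B -> A `&` B = set0 ->
  mu.-integrable A (EFin \o g) -> mu.-integrable B (EFin \o g) ->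
  mu.-integrable (A `|` B) (EFin \o g).
Proof.
move=> mA mB AB /integrableP[m1 h1] /integrableP[m2 h2]; apply/integrableP; split.
  exact/measurable_funU.
rewrite ge0_integral_setU //.
- exact: lte_add_pinfty.
- by apply: measurableT_comp => //; exact/measurable_funU.
- by rewrite disj_set2E; exact/eqP.
Qed.

Lemma Rintegral_disjoint (I : eqType) (F : I -> set mP) (s : seq I) g : uniq s ->
  (forall i, i \in s -> measurable (F i)) ->
  (forall i j, i \in s -> j \in s -> i != j -> F i `&` F j = set0) ->
  (forall i, i \in s -> mu.-integrable (F i) (EFin \o g)) ->
  let U := [set x | exists2 i, i \in s & F i x] in
  [/\ measurable U, mu.-integrable U (EFin \o g) &
     Rintegral mu U g = \sum_(i <- s) Rintegral mu (F i) g].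
Proof.
elim: s => [|i s IH] /=.
  move=> _ _ _ _; have -> : [set x | exists2 i, i \in [::] & F i x] = set0.
    by apply/seteqP; split=> x // -[].
  by split=> //; [exact: integrable_set0|rewrite big_nil Rintegral_set0].
move=> /andP[ins us] mF dF iF.
have [|||mU iU eU] := IH us.
- by move=> j js; apply: mF; rewrite inE js orbT.
- by move=> j l js ls; apply: dF; rewrite inE ?js ?ls orbT.
- by move=> j js; apply: iF; rewrite inE js orbT.
set U := [set x | _] in mU iU eU *.
have -> : [set x | exists2 j, j \in i :: s & F j x] = F i `|` U.
  apply/seteqP; split=> x.
    by move=> [j]; rewrite inE => /predU1P[->|js] Fx; [left|right; exists j].
  by move=> [Fx|[j js Fx]]; [exists i; rewrite ?inE ?eqxx|exists j; rewrite ?inE ?js ?orbT].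
have ii : i \in i :: s by rewrite inE eqxx.
have dU : F i `&` U = set0.
  apply/seteqP; split=> x // -[Fx [j js Fj]].
  have ij : i != j by apply: contraNneq ins => ->.
  by rewrite -(dF i j ii _ ij) ?inE ?js ?orbT.
have iFU := integrable_disjointU (mF i ii) mU dU (iF i ii) iU.
split=> //; first exact: measurableU (mF i ii) mU.
rewrite big_cons -eU; apply: Rintegral_setU => //; first exact: mF.
by rewrite disj_set2E; exact/eqP.
Qed.

Lemma measurable_tset z a b : Det z a b != 0 -> measurable (tset (T3 z a b) : set mP).
Proof.
move=> D0; pose f v w y : mP -> mR := peval (bcp v w y).
have -> : (tset (T3 z a b) : set mP) =
   (setT `&` (f z a b @^-1` `[0, +oo[)) `&`
   ((setT `&` f a b z @^-1` `[0, +oo[) `&` (setT `&` f b z a @^-1` `[0, +oo[)).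
  apply/seteqP; split=> x; rewrite /preimage /setI /mkset /f !peval_bcp !in_itv !andbT.
    by move=> /(tsetP _ D0)[].
  by move=> [[_ ?] [[_ ?] [_ ?]]]; apply/(tsetP _ D0).
have mf v w y : measurable (setT `&` f v w y @^-1` `[0, +oo[).
  by apply: (measurable_peval (bcp v w y)).
by apply: measurableI => //; apply: measurableI.
Qed.

Lemma leb2_tset_fin z a b : Det z a b != 0 -> (mu (tset (T3 z a b)) < +oo)%E.
Proof.
move=> D0; have [M hM] := tset_box D0; apply: (@le_lt_trans _ _ (mu (box M))); last exact: leb2_box.
by apply: le_measure => //; rewrite inE; [exact: measurable_tset|exact: measurable_box].
Qed.

Lemma leb2_interior z a b : Det z a b != 0 -> mu (tset (T3 z a b))° = (2^-1 * `|Det z a b|)%:E.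
Proof.
move=> D0; have mK := measurable_interior D0.
have fK : (mu (tset (T3 z a b))° < +oo)%E.
  apply: le_lt_trans (leb2_tset_fin D0).
  by apply: le_measure; rewrite ?inE //; [exact: measurable_tset|exact: interior_subset].
rewrite -(mulr1 (_ * _)) -(J_const 1 D0) /J /intg.
rewrite (_ : peval (cst 1) = (fun=> 1)); last by apply/funext => x; rewrite peval_cst.
by rewrite Rintegral_cst // mul1r fineK // ge0_fin_numE.
Qed.

(** The estimator is weighted by the area of the closed triangle, whereas integrals are over its
    interior; monotonicity links them. *)
Lemma area_ge z a b : Det z a b != 0 -> 2^-1 * `|Det z a b| <= area (tset (T3 z a b)).
Proof.
move=> D0; rewrite /area -lee_fin fineK; last by rewrite ge0_fin_numE // leb2_tset_fin.
rewrite -leb2_interior //; apply: le_measure; rewrite ?inE; [exact: measurable_interior|exact: measurable_tset|exact: interior_subset].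
Qed.

Lemma interior_child z a b : Det z a b != 0 ->
  [/\ (tset (T3 (midpt a b) z a))° `<=` (tset (T3 z a b))°,
      (tset (T3 (midpt a b) b z))° `<=` (tset (T3 z a b))° &
      (tset (T3 (midpt a b) z a))° `&` (tset (T3 (midpt a b) b z))° = set0].
Proof.
move=> D0; split.
- by apply: interiorS => x Kx; apply: tset_child => //; left.
- by apply: interiorS => x Kx; apply: tset_child => //; right.
have D1 := Det_child1_neq0 D0; have D2 := Det_child2_neq0 D0.
apply/seteqP; split=> x // -[].
move=> /(tset_interior _ D1)[_ _ h1] /(tset_interior _ D2)[_ h2 _].
move: h1 h2; rewrite /bc (Det_rot2 (midpt a b) z a) (Det_rot (midpt a b) b z) Det_child1 Det_child2.
by rewrite (Det_flip x (midpt a b) z) mulNr oppr_gt0 => /lt_trans h /h; rewrite ltxx.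
Qed.

(** What the two open halves leave of the open triangle is a null set, because their measures add up
    to the measure of the whole. *)
Lemma Rintegral_child z a b g : Det z a b != 0 -> mu.-integrable (tset (T3 z a b))° (EFin \o g) ->
  intg (tset (T3 z a b))° g =
  intg (tset (T3 (midpt a b) z a))° g + intg (tset (T3 (midpt a b) b z))° g.
Proof.
move=> D0 iK; have D1 := Det_child1_neq0 D0; have D2 := Det_child2_neq0 D0.
have [sA sB AB] := interior_child D0.
have mK := measurable_interior D0; have mA := measurable_interior D1; have mB := measurable_interior D2.
have /eqP dAB : (tset (T3 (midpt a b) z a))° `&` (tset (T3 (midpt a b) b z))° == set0 by rewrite AB.
have lK := leb2_interior D0; have lA := leb2_interior D1; have lB := leb2_interior D2.
set K := (tset (T3 z a b))° in mK lK iK sA sB *.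
set A := (tset (T3 (midpt a b) z a))° in mA lA sA AB dAB *.
set B := (tset (T3 (midpt a b) b z))° in mB lB sB AB dAB *.
have mU : measurable (A `|` B : set mP) by exact: measurableU.
have mN : measurable (K `\` (A `|` B) : set mP) by exact: measurableD.
have sU : A `|` B `<=` K by move=> x [/sA|/sB].
have N0 : mu (K `\` (A `|` B)) = 0.
  have -> : mu (K `\` (A `|` B)) = (mu K - mu (K `&` (A `|` B)))%E.
    by apply: measureD => //; apply: (@le_lt_trans _ _ (2^-1 * `|Det z a b|)%:E); [rewrite -lK|rewrite ltry].
  rewrite (_ : K `&` (A `|` B) = A `|` B); last by apply/setIidPr.
  have -> : mu (A `|` B) = (2^-1 * `|Det z a b|)%:E; last by rewrite lK subee.
  transitivity (mu A + mu B)%E; first exact: measureU.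
  rewrite lA lB Det_child1 Det_child2 -EFinD.
  have h2 : (0 : R) <= 2^-1 by rewrite invr_ge0 ler0n.
  by rewrite !normrM (ger0_norm h2); congr EFin; field.
rewrite /intg -(Rintegral_setU mA mB); first last.
- by rewrite disj_set2E; exact/eqP.
- exact: integrableS iK.
rewrite /Rintegral (negligible_integral mN mK iK N0); congr (fine (integral _ _ _)).
by rewrite setDD; apply/setIidPr.
Qed.

Lemma integrable_leaf t z a b g L : Det z a b != 0 ->
  mu.-integrable (tset (T3 z a b))° (EFin \o g) -> L \in leaves t z a b ->
  mu.-integrable (tset L)° (EFin \o g).
Proof.
elim: t z a b => [|t1 IH1 t2 IH2] z a b D0 iK /=; first by rewrite inE => /eqP ->.
have D1 := Det_child1_neq0 D0; have D2 := Det_child2_neq0 D0.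
have [sA sB _] := interior_child D0; have mK := measurable_interior D0.
rewrite mem_cat => /orP[]; [apply: IH1|apply: IH2] => //; apply: integrableS iK => //;
  exact: measurable_interior.
Qed.

Lemma Rintegral_tree t z a b g : Det z a b != 0 -> mu.-integrable (tset (T3 z a b))° (EFin \o g) ->
  intg (tset (T3 z a b))° g = \sum_(L <- leaves t z a b) intg (tset L)° g.
Proof.
elim: t z a b => [|t1 IH1 t2 IH2] z a b D0 iK /=; first by rewrite big_seq1.
have D1 := Det_child1_neq0 D0; have D2 := Det_child2_neq0 D0.
have [sA sB _] := interior_child D0; have mK := measurable_interior D0.
rewrite big_cat /= Rintegral_child // IH1 ?IH2 //; apply: integrableS iK => //;
  exact: measurable_interior.
Qed.

Lemma Jt_sum t z a b G : Jt t z a b G = \sum_(L <- leaves t z a b) intg (tset L)° (peval (G L)).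
Proof.
elim: t z a b => [|t1 IH1 t2 IH2] z a b /=; first by rewrite big_seq1.
by rewrite big_cat /= IH1 IH2.
Qed.

End SumsOfIntegrals.

(** * Conforming meshes *)

Section Faces.
Variable R : realType.
Implicit Types (z a b x c d v w y : pt R) (K : tri R) (E : edge R).

(** An ordering of the vertices that is not tied to the newest vertex: arguments at an edge cd take
    v as the opposite vertex. *)
Definition spans K v c d : Prop := vertices K = vertices (T3 v c d) /\ Det v c d != 0.

Lemma in_T3 v c d y : (y \in vertices (T3 v c d)) = [|| y == v, y == c | y == d].
Proof. by rewrite !inE. Qed.

Lemma spans_tset K v c d : spans K v c d -> tset K = tset (T3 v c d).
Proof. by move=> [e _]; rewrite /tset e. Qed.

Lemma spans_rot K v c d : spans K v c d -> spans K c d v.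
Proof. by move=> [e D0]; split; [rewrite vertices_rot|rewrite Det_rot]. Qed.

Lemma spans_swap K v c d : spans K v c d -> spans K v d c.
Proof. by move=> [e D0]; split; [rewrite vertices_swap|rewrite Det_flip oppr_eq0]. Qed.

Lemma nondegenerateP K : Defs.nondegenerate K -> exists a b, K = T3 K.1 a b /\ Det K.1 a b != 0.
Proof. by case: K => z e /= [a [b [/= -> D0]]]; exists a, b. Qed.

Lemma spans_ex K : Defs.nondegenerate K -> exists v c d, spans K v c d.
Proof. by move=> /nondegenerateP[a [b [e D0]]]; exists K.1, a, b; split; rewrite // {1}e. Qed.

Lemma spans_mem K v c d : spans K v c d -> [/\ v \in vertices K, c \in vertices K & d \in vertices K].
Proof. by move=> [-> _]; rewrite !in_T3 !eqxx !orbT. Qed.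

Lemma spans_neq K v c d : spans K v c d -> [/\ v != c, v != d & c != d].
Proof. by move=> [_]; exact: Det_neq. Qed.

Lemma spans_edge K c d : Defs.nondegenerate K -> c != d -> c \in vertices K -> d \in vertices K ->
  exists v, spans K v c d.
Proof.
move=> /spans_ex[z [a [b s]]] cd; have s1 := spans_rot s; have s2 := spans_rot s1.
have [t t1 t2] := And3 (spans_swap s) (spans_swap s1) (spans_swap s2).
rewrite (proj1 s) !in_T3 => /or3P[] /eqP ec /or3P[] /eqP ed; move: cd; rewrite ec ed ?eqxx // => _.
- by exists b.
- by exists a.
- by exists b.
- by exists z.
- by exists a.
- by exists z.
Qed.

(** A rotation and a transposition generate all orderings of three vertices. *)
Lemma spans_sym (P : pt R -> pt R -> pt R -> Prop) K z a b v c d :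
  (forall z a b, P z a b -> P a b z) -> (forall z a b, P z a b -> P z b a) ->
  spans K z a b -> spans K v c d -> P z a b -> P v c d.
Proof.
move=> rot swap s s' P0; have [vc vd cd] := spans_neq s'.
have [vK cK dK] := spans_mem s'; move: vK cK dK vc vd cd.
have [P1 P2] := conj (rot _ _ _ P0) (rot _ _ _ (rot _ _ _ P0)).
have [Q0 Q1 Q2] := And3 (swap _ _ _ P0) (swap _ _ _ P1) (swap _ _ _ P2).
rewrite (proj1 s) !in_T3.
by do 3![move=> /or3P[] /eqP ->]; rewrite ?eqxx.
Qed.

Lemma edgesP K E : reflect (exists c d, [/\ c != d, E = [fset c; d]%fset, c \in vertices K &
  d \in vertices K]) (E \in edges K).
Proof.
apply: (iffP idP) => [|[c [d [cd -> cK dK]]]].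
  rewrite !inE fpowersetE => /andP[EK /eqP E2].
  have [c cE] : exists c, c \in E by apply/fset0Pn; rewrite -cardfs_gt0 E2.
  have /eqP/cardfs1P[d Ed] : #|` E `\ c|%fset = 1%N.
    by move: E2; rewrite (cardfsD1 c E) cE => -[].
  have : d \in (E `\ c)%fset by rewrite Ed inE.
  rewrite !inE => /andP[dc dE]; exists c, d; split.
  - by rewrite eq_sym.
  - by rewrite -(fsetD1K cE) Ed.
  - exact: (fsubsetP EK).
  - exact: (fsubsetP EK).
by rewrite !inE fpowersetE fsubUset !fsub1set cK dK cardfs2 cd.
Qed.

Lemma edge_mem K c d : c != d -> ([fset c; d]%fset \in edges K) = (c \in vertices K) && (d \in vertices K).
Proof.
move=> cd; apply/idP/andP => [|[cK dK]]; last by apply/edgesP; exists c, d.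
move=> /edgesP[p [q [_ e pK qK]]].
have: c \in [fset c; d]%fset by rewrite !inE eqxx.
have: d \in [fset c; d]%fset by rewrite !inE eqxx orbT.
by rewrite e => /fset2P[] -> /fset2P[] ->.
Qed.

Lemma bc_ray v c d x w (s : R) :
  bc v c d (x + s *: w) = bc v c d x + s * (bc v c d (x + w) - bc v c d x).
Proof. by rewrite /bc -mulrBl mulrA -mulrDl; congr (_ / _); rewrite /Det /det2 /= /GRing.scale /=; ring. Qed.

Lemma bc_indic K v c d y : spans K v c d -> y \in vertices K -> bc v c d y = (y == v)%:R.
Proof.
move=> s; have [vc vd _] := spans_neq s; have [b1 b2 b3] := bc_at (proj2 s).
rewrite (proj1 s) in_T3 => /or3P[] /eqP ->; rewrite ?eqxx //.
  by rewrite eq_sym (negbTE vc).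
by rewrite eq_sym (negbTE vd).
Qed.

Lemma spans_tsetP K v c d x : spans K v c d -> tset K x <->
  [/\ 0 <= bc v c d x, 0 <= bc c d v x & 0 <= bc d v c x].
Proof. by move=> s; rewrite (spans_tset s); apply: tsetP; case: s. Qed.

Lemma spans_interiorP K v c d x : spans K v c d -> (tset K)° x <->
  [/\ 0 < bc v c d x, 0 < bc c d v x & 0 < bc d v c x].
Proof. by move=> s; rewrite (spans_tset s); apply: tset_interior; case: s. Qed.

Lemma tset_convex K x y (t : R) : Defs.nondegenerate K -> 0 <= t <= 1 -> tset K x -> tset K y ->
  tset K (x + t *: (y - x)).
Proof.
move=> /spans_ex[v [c [d s]]] /andP[t0 t1] /(spans_tsetP _ s)[h1 h2 h3] /(spans_tsetP _ s)[k1 k2 k3].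
have t1' : 0 <= 1 - t by rewrite subr_ge0.
by apply/(spans_tsetP _ s); rewrite !bc_line; split; apply: addr_ge0; apply: mulr_ge0.
Qed.

Lemma vertex_tset K y : Defs.nondegenerate K -> y \in vertices K -> tset K y.
Proof.
move=> /spans_ex[v [c [d s]]] yK; have s1 := spans_rot s; have s2 := spans_rot s1.
by apply/(spans_tsetP _ s); rewrite (bc_indic s yK) (bc_indic s1 yK) (bc_indic s2 yK).
Qed.

Lemma hull2_sub K c d : Defs.nondegenerate K -> tset K c -> tset K d ->
  hull [fset c; d]%fset `<=` tset K.
Proof. by move=> nK Kc Kd x /hull2P[t t01 ->]; exact: tset_convex. Qed.

Lemma hull2_vertex K v c d p q x : spans K v c d -> p \in vertices K -> q \in vertices K ->
  hull [fset p; q]%fset x -> 0 < bc v c d x -> v = p \/ v = q.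
Proof.
move=> s pK qK /hull2P[t /andP[t0 t1] ->]; rewrite bc_line (bc_indic s pK) (bc_indic s qK).
have [->|_] := eqVneq p v; first by left.
have [->|_] := eqVneq q v; first by right.
by rewrite !mulr0 addr0 ltxx.
Qed.

Lemma hull2_collinear p q x y w : hull [fset p; q]%fset x -> hull [fset p; q]%fset y ->
  hull [fset p; q]%fset w -> Det x y w = 0.
Proof.
move=> /hull2P[t _ ->] /hull2P[r _ ->] /hull2P[s _ ->].
by rewrite /Det /det2 /= /GRing.scale /=; ring.
Qed.

(** One form for the two nonempty cases of conformity; p = q when the triangles meet in a vertex
    only. *)
Lemma meet_common K K' x : Defs.nondegenerate K -> meet_conformingly K K' -> tset K x -> tset K' x ->
  exists p q, [/\ [/\ p \in vertices K, q \in vertices K, p \in vertices K' & q \in vertices K'] &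
    tset K `&` tset K' = hull [fset p; q]%fset].
Proof.
move=> nK [e|[z [zK zK' e]]|[E [/edgesP[c [d [cd -> cK dK]]]]]] Kx K'x.
- by have : set0 x by rewrite -e.
- by exists z, z; split=> //; rewrite e fsetUid; apply/seteqP; split=> y;
    rewrite -[in hull _](fsetUid [fset z]%fset) hull2P subrr;
    [move=> ->; exists 0; rewrite ?lexx ?ler01 // scaler0 addr0|move=> [t _ ->]; rewrite scaler0 addr0].
- by move: Kx; rewrite edge_mem // => /andP[cK' dK'] *; exists c, d.
Qed.

End Faces.

Lemma half01 (R : realType) : 0 <= (2^-1 : R) <= 1.
Proof. by apply/andP; split; lra. Qed.

Section ConformingMeshes.
Variable R : realType.
Implicit Types (z a b x c d v w y : pt R) (K L : tri R) (E : edge R).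
Variables (Omega : set (pt R)) (T : {fset tri R}).
Hypothesis tT : triangulation Omega T.

Let nT K : K \in T -> Defs.nondegenerate K := @triang_nondeg _ _ _ tT K.

Lemma mesh_collinear K K' x y w : K \in T -> K' \in T -> K != K' ->
  tset K x -> tset K' x -> tset K y -> tset K' y -> tset K w -> tset K' w -> Det x y w = 0.
Proof.
move=> KT KT' KK' Kx K'x Ky K'y Kw K'w.
have [p [q [_ e]]] := meet_common (nT KT) (triang_conforming tT KT KT' KK') Kx K'x.
by apply: (@hull2_collinear _ p q); rewrite -e.
Qed.

(** A common interior point would provide three common points that are not collinear, against
    [mesh_collinear]. *)
Lemma mesh_disjoint K K' : K \in T -> K' \in T -> K != K' -> (tset K)° `&` (tset K')° = set0.
Proof.
move=> KT KT' KK'; apply/seteqP; split=> x // -[Kx K'x].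
have [v [c [d s]]] := spans_ex (nT KT); have [v' [c' [d' s']]] := spans_ex (nT KT').
have small (w : pt R) : \forall e \near (0 : R)^'+, tset K (x + e *: w) /\ tset K' (x + e *: w).
  have cg : (x + e *: w) @[e --> (0 : R)^'+] --> x.
    apply: cvg_at_right_filter.
    rewrite [X in _ --> X](_ : x = x + 0 *: w); last by rewrite scale0r addr0.
    by apply: cvgD; [exact: cvg_cst|apply: cvgZ; [exact: cvg_id|exact: cvg_cst]].
  by near=> e; split; near: e; [exact: (cg _ Kx)|exact: (cg _ K'x)].
have [e [e0 [k1 k1'] [k2 k2']]] : exists e : R, [/\ 0 < e,
    tset K (x + e *: (1, 0)) /\ tset K' (x + e *: (1, 0)) &
    tset K (x + e *: (0, 1)) /\ tset K' (x + e *: (0, 1))].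
  apply: (@filter_ex _ (0 : R)^'+); near=> e; split; near: e; [exact: nbhs_right_gt|exact: small..].
have := mesh_collinear KT KT' KK' (interior_subset Kx) (interior_subset K'x) k1 k1' k2 k2'.
rewrite /Det /det2 /= /GRing.scale /= => h.
have : e * e = 0 by rewrite -[RHS]h; ring.
by move/eqP; rewrite mulf_eq0 orbb gt_eqF.
Unshelve. all: by end_near.
Qed.

(** There are no hanging nodes: the intersection is spanned by common vertices p, q, and a
    relatively interior point of cd has positive coordinates at both c and d, which must therefore
    be among p, q. *)
Lemma mesh_hanging K K' c d (t : R) : K \in T -> K' \in T -> K != K' -> c != d ->
  c \in vertices K -> d \in vertices K -> 0 < t < 1 -> tset K' (c + t *: (d - c)) ->
  c \in vertices K' /\ d \in vertices K'.
Proof.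
move=> KT KT' KK' cd cK dK /andP[t0 t1] K'x; set x := c + _ in K'x.
have Kx : tset K x.
  by apply: tset_convex; rewrite ?(ltW t0) ?(ltW t1) //; [exact: nT|apply: vertex_tset; [exact: nT|]..].
have [p [q [[pK qK pK' qK'] e]]] := meet_common (nT KT) (triang_conforming tT KT KT' KK') Kx K'x.
have hx : hull [fset p; q]%fset x by rewrite -e.
have [v s] := spans_edge (nT KT) cd cK dK; have s1 := spans_rot s; have s2 := spans_rot s1.
have hc : 0 < bc c d v x.
  by rewrite bc_line (bc_indic s1 cK) (bc_indic s1 dK) eqxx eq_sym (negbTE cd) mulr1 mulr0 addr0 subr_gt0.
have hd : 0 < bc d v c x.
  by rewrite bc_line (bc_indic s2 cK) (bc_indic s2 dK) eqxx (negbTE cd) mulr1 mulr0 add0r.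
by split; [case: (hull2_vertex s1 pK qK hx hc) => ->|case: (hull2_vertex s2 pK qK hx hd) => ->].
Qed.

(** If both triangles lay on the same side of cd, a point slightly off the midpoint towards v would
    belong to both, although it is not collinear with the common points c and d. *)
Lemma mesh_opposite K K' v v' c d : K \in T -> K' \in T -> K != K' ->
  spans K v c d -> spans K' v' c d -> Det v c d * Det v' c d < 0.
Proof.
move=> KT KT' KK' s s'; have [[_ D0] [_ D0']] := conj s s'.
rewrite lt_neqAle mulf_neq0 //= leNgt; apply/negP => pos.
have s1 := spans_rot s'; have s2 := spans_rot s1.
(* At the midpoint the coordinates of K' at c and d are 1/2; B bounds those of v, and r B = 1/4
   keeps them positive on the way. *)
pose m := midpt c d; pose B := 1 + `|bc c d v' v| + `|bc d v' c v|.
have B0 : 0 < B by rewrite !ltr_wpDr.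
pose r := (4 * B)^-1; have r0 : 0 < r by rewrite invr_gt0 mulr_gt0.
have rB : r * B = 4^-1 by rewrite /r invfM -mulrA mulVf ?mulr1 // gt_eqF.
have r1 : r <= 4^-1.
  have B1 : 1 <= B by rewrite /B -addrA lerDl addr_ge0.
  by rewrite -rB -[leLHS]mulr1 ler_wpM2l // ltW.
pose x := m + r *: (v - m).
have cK := vertex_tset (nT KT); have cK' := vertex_tset (nT KT').
have [vK1 cK1 dK1] := spans_mem s; have [vK2 cK2 dK2] := spans_mem s'.
have mE : m = c + 2^-1 *: (d - c).
  by apply: pt_ext; rewrite /m /midpt /= /GRing.scale /=; field.
have h2 := half01 R.
have Km : tset K m by rewrite mE; apply: tset_convex => //; [exact: nT|exact: cK|exact: cK].
have Kx : tset K x by apply: tset_convex => //; [exact: nT|lra|exact: cK].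
have K'x : tset K' x.
  have bm y w u : spans K' y w u -> bc y w u m = 2^-1 * (c == y)%:R + 2^-1 * (d == y)%:R.
    by move=> sy; rewrite mE bc_line (bc_indic sy cK2) (bc_indic sy dK2); field.
  have [n1 n2 n3] := spans_neq s'.
  have bv : bc v' c d v = Det v c d / Det v' c d by [].
  apply/(spans_tsetP _ s'); rewrite !bc_line (bm _ _ _ s') (bm _ _ _ s1) (bm _ _ _ s2).
  rewrite !eqxx [c == v']eq_sym (negbTE n1) [d == v']eq_sym (negbTE n2) [d == c]eq_sym (negbTE n3).
  rewrite !(mulr0, mulr1, addr0, add0r).
  have k1 : - 4^-1 <= r * bc c d v' v.
    rewrite -rB -mulrN; apply: ler_wpM2l; first exact: ltW.
    rewrite /B.
    by have := ler_norm (- bc c d v' v); rewrite normrN; have := normr_ge0 (bc d v' c v); lra.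
  have k2 : - 4^-1 <= r * bc d v' c v.
    rewrite -rB -mulrN; apply: ler_wpM2l; first exact: ltW.
    rewrite /B.
    by have := ler_norm (- bc d v' c v); rewrite normrN; have := normr_ge0 (bc c d v' v); lra.
  split; [|by lra|by lra].
  apply: mulr_ge0; [exact: ltW|rewrite bv ltW //].
  by rewrite -(pmulr_lgt0 _ (_ : 0 < Det v' c d ^+ 2)) ?exprn_even_gt0 // expr2 mulrA divfK.
have := mesh_collinear KT KT' KK' Kx K'x (cK _ cK1) (cK' _ cK2) (cK _ dK1) (cK' _ dK2).
have -> : Det x c d = r * Det v c d.
  by rewrite /x /m /Det /det2 /midpt /= /GRing.scale /=; field.
by move/eqP; rewrite mulf_eq0 gt_eqF //= (negbTE D0).
Qed.

End ConformingMeshes.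

(** * The Lipschitz domain and the mesh at its boundary *)

Section DomainGeometry.
Variable R : realType.
Implicit Types (z a b x c d v w y e : pt R) (K L : tri R) (E : edge R).
Variable Omega : set (pt R).
Hypothesis hO : polygonal_lipschitz_domain Omega.

Lemma peval_near (p : poly2 R) y (eps : R) : 0 < eps ->
  \forall u \near y, `|peval p u - peval p y| < eps.
Proof.
move=> e0; have /cvgrPdist_lt/(_ _ e0) := @continuous_peval _ p y.
by apply: filterS => u; rewrite distrC.
Qed.

Lemma affine_near (al ka : R) : 0 < al -> \forall s \near 0^'+, 0 < al + s * ka.
Proof.
move=> al0; have h : 0 < al / (1 + `|ka|) by rewrite divr_gt0 // ltr_wpDr.
near=> s; have s0 : 0 < s by near: s; exact: nbhs_right_gt.
have : s < al / (1 + `|ka|) by near: s; exact: nbhs_right_lt.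
rewrite ltr_pdivlMr; last by rewrite ltr_wpDr.
rewrite mulrDr mulr1 => sk.
have : - (s * `|ka|) <= s * ka by rewrite -mulrN ler_wpM2l ?(ltW s0) // lerNnormlW.
lra.
Unshelve. all: by end_near.
Qed.

(** The Lipschitz boundary excludes slits: if a boundary point x were interior to the closure, some
    point of [Omega] would lie close to x - de e, below the graph. *)
Lemma domain_regular : (closure Omega)° `<=` Omega.
Proof.
move=> x ix; apply: contrapT => nx.
have bx : bdry Omega x.
  by split; [exact: interior_subset|move=> /interior_subset].
have [e [r [h [L [phi [e1 r0 h0 lip epi]]]]]] := domain_lipschitz hO bx.
have ee : e.1 * e.1 + e.2 * e.2 = 1.
  have := congr1 (fun s => s ^+ 2) e1; rewrite /norm2 sqr_sqrtr ?expr1n //.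
  by rewrite /dot addr_ge0 // -expr2 sqr_ge0.
have phi0 : 0 <= phi 0.
  rewrite leNgt; apply/negP => p0; apply: nx.
  have := (epi 0 0); rewrite !normr0 !scale0r subr0 addr0; move=> /(_ r0 h0) [_]; exact.
have lipE s : `|phi s - phi 0| <= `|L| * `|s|.
  have := lip (s, 0) (conj I I); rewrite /= subr0 => hl; apply: le_trans hl _.
  by rewrite ler_wpM2r // ler_norm.
have [de [d0 dh cd]] : exists de : R, [/\ 0 < de, de < h & closure Omega (x + de *: (- e))].
  apply: (@filter_ex _ (0 : R)^'+).
  have cg : (x + s *: (- e)) @[s --> (0 : R)^'+] --> x.
    apply: cvg_at_right_filter.
    rewrite [X in _ --> X](_ : x = x + 0 *: (- e)); last by rewrite scale0r addr0.
    by apply: cvgD; [exact: cvg_cst|apply: cvgZ; [exact: cvg_id|exact: cvg_cst]].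
  near=> s; split; near: s; [exact: nbhs_right_gt|exact: nbhs_right_lt|exact: (cg _ ix)].
set y := x + _ in cd.
(* The coordinates of the chart at x, written as polynomials so that [peval_near] gives their
   continuity. *)
pose ps : poly2 R := cst e.2 * (pX - cst x.1) - cst e.1 * (pY - cst x.2).
pose pt' : poly2 R := cst e.1 * (pX - cst x.1) + cst e.2 * (pY - cst x.2).
have sy : peval ps y = 0 by rewrite /ps !pevalsE /y /= /GRing.scale /=; ring.
have ty : peval pt' y = - de.
  rewrite /pt' !pevalsE /y /= /GRing.scale /=.
  transitivity (- de * (e.1 * e.1 + e.2 * e.2)); first by ring.
  by rewrite ee mulr1.
have L1 : 0 < 2 * (1 + `|L|) by rewrite mulr_gt0 // ltr_wpDr.
(* [h1] and [h4] keep u inside the chart; [h2] lets the graph drop by at most de / 2 below [phi 0],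
   and [h3] puts u below - de / 2. *)
have [u [Ou [h1 h2 h3 h4]]] : Omega `&` [set u | [/\ `|peval ps u| < r,
    `|peval ps u| < de / (2 * (1 + `|L|)), `|peval pt' u + de| < de / 2 &
    `|peval pt' u + de| < h - de]] !=set0.
  have n1 (ep : R) : 0 < ep -> \forall u \near y, `|peval ps u| < ep.
    by move=> ep0; have := peval_near ps y ep0; rewrite sy; apply: filterS => ?; rewrite subr0.
  have n2 (ep : R) : 0 < ep -> \forall u \near y, `|peval pt' u + de| < ep.
    by move=> ep0; have := peval_near pt' y ep0; rewrite ty; apply: filterS => ?; rewrite opprK.
  apply: cd; near=> u => /=.
  split; near: u; [apply: n1|apply: n1|apply: n2|apply: n2] => //.
  - by rewrite divr_gt0.
  - by rewrite divr_gt0.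
  - by rewrite subr_gt0.
have uE : u = x - peval ps u *: rot90 e + peval pt' u *: e.
  apply: pt_ext; rewrite /ps /pt' !pevalsE /= /GRing.scale /=.
    transitivity (x.1 + (u.1 - x.1) * (e.1 * e.1 + e.2 * e.2)); last by ring.
    by rewrite ee; ring.
  transitivity (x.2 + (u.2 - x.2) * (e.1 * e.1 + e.2 * e.2)); last by ring.
  by rewrite ee; ring.
have := epi (peval ps u) (peval pt' u) h1; rewrite -uE => /(_ _)[].
  by move: h4; rewrite ltr_norml => /andP[? ?]; rewrite ltr_norml; move: dh d0; lra.
move=> /(_ Ou) lt _; have := lipE (peval ps u); rewrite ler_norml => /andP[lp _].
have : `|L| * `|peval ps u| <= de / 2.
  move: h2; rewrite ltr_pdivlMr // => h2.
  have := normr_ge0 (peval ps u); have := normr_ge0 L; move: h2; nra.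
by move: h3; rewrite ltr_norml => /andP[? ?]; lra.
Unshelve. all: by end_near.
Qed.

Lemma open_bdry x : Omega x -> ~ bdry Omega x.
Proof.
move=> Ox [_]; apply; have := domain_open hO; rewrite openE => /(_ _ Ox); exact.
Qed.

Variable T : {fset tri R}.
Hypothesis tT : triangulation Omega T.

Lemma tset_closure K : K \in T -> tset K `<=` closure Omega.
Proof. by move=> KT x Kx; rewrite (triang_cover tT); exists K. Qed.

Lemma interior_domain K : K \in T -> (tset K)° `<=` Omega.
Proof. by move=> KT; apply: subset_trans domain_regular; apply: interiorS; exact: tset_closure. Qed.

(** If x is outside K, some coordinate is negative at x, and it stays negative along a short ray. *)
Lemma near_tset K x w : Defs.nondegenerate K ->
  \forall s \near 0^'+, tset K (x + s *: w) -> tset K x.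
Proof.
move=> /spans_ex[v [c [d s]]]; have [Kx|nKx] := pselect (tset K x); first by near=> t.
have neg p q r : bc p q r x < 0 -> (forall y, tset K y -> 0 <= bc p q r y) ->
    \forall s \near 0^'+, tset K (x + s *: w) -> tset K x.
  move=> lt0 h; near=> t => Kt; have := h _ Kt; rewrite bc_ray leNgt.
  have : 0 < - bc p q r x + t * - (bc p q r (x + w) - bc p q r x).
    by near: t; apply: affine_near; rewrite oppr_gt0.
  by rewrite mulrN -opprD oppr_gt0 => ->.
have [h1|h1] := ltP (bc v c d x) 0.
  by apply: (neg _ _ _ h1) => y /(spans_tsetP _ s)[].
have [h2|h2] := ltP (bc c d v x) 0.
  by apply: (neg _ _ _ h2) => y /(spans_tsetP _ s)[].
have [h3|h3] := ltP (bc d v c x) 0.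
  by apply: (neg _ _ _ h3) => y /(spans_tsetP _ s)[].
by case: nKx; apply/(spans_tsetP _ s).
Unshelve. all: by end_near.
Qed.

Lemma near_mesh x w : \forall s \near 0^'+, forall K, K \in T -> tset K (x + s *: w) -> tset K x.
Proof.
have nT := @triang_nondeg _ _ _ tT.
have h (r : seq (tri R)) : {subset r <= T} ->
    \forall s \near 0^'+, forall K, K \in r -> tset K (x + s *: w) -> tset K x.
  elim: r => [|K r IH] sub; first by near=> s => K; rewrite in_nil.
  have {}IH : \forall s \near 0^'+, forall K, K \in r -> tset K (x + s *: w) -> tset K x.
    by apply: IH => L Lr; apply: sub; rewrite inE Lr orbT.
  have nK : Defs.nondegenerate K by apply: nT; apply: sub; rewrite inE eqxx.
  near=> s => L; rewrite inE => /predU1P[->|Lr].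
    by near: s; exact: near_tset.
  by move: L Lr; near: s.
exact: (h (T : seq _)).
Unshelve. all: by end_near.
Qed.

(** From a point u of the open edge in [Omega] take a short step away from the opposite vertex. The
    triangle that covers the new point is not K, contains u by [near_mesh], and so has c and d as
    vertices by [mesh_hanging]. *)
Lemma edge_neighbour K c d : K \in T -> c != d -> c \in vertices K -> d \in vertices K ->
  ~ bdry_edge Omega [fset c; d]%fset ->
  exists K', [/\ K' \in T, K' != K, c \in vertices K' & d \in vertices K'].
Proof.
move=> KT cd cK dK nb; have nK := triang_nondeg tT KT.
have [x [hx nbx]] : exists x, hull [fset c; d]%fset x /\ ~ bdry Omega x.
  apply: contrapT => H; apply: nb => x hx; apply: contrapT => nbx; by apply: H; exists x.
have [v s] := spans_edge nK cd cK dK.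
have Kx : tset K x by apply: hull2_sub hx => //; exact: vertex_tset.
have Ox : Omega° x.
  by apply: contrapT => nO; apply: nbx; split => //; exact: tset_closure Kx.
have [t0 t01 xE] := (hull2P _ _ _).1 hx.
have ray (u w : pt R) : Omega° u -> \forall r \near 0^'+, Omega (u + r *: w).
  move=> Ou; have cg : (u + r *: w) @[r --> (0 : R)^'+] --> u.
    apply: cvg_at_right_filter.
    rewrite [X in _ --> X](_ : u = u + 0 *: w); last by rewrite scale0r addr0.
    by apply: cvgD; [exact: cvg_cst|apply: cvgZ; [exact: cvg_id|exact: cvg_cst]].
  by near=> r; near: r; exact: (cg _ Ou).
(* The point found off the boundary may be an end of the edge; a short move towards the midpoint
   corrects this. *)
have [t [t01' Ot]] : exists t : R, 0 < t < 1 /\ Omega (c + t *: (d - c)).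
  have [r [s0 s1 Os]] : exists r : R, [/\ 0 < r, r < 1 & Omega (x + r *: (midpt c d - x))].
    apply: (@filter_ex _ (0 : R)^'+); near=> r; split; near: r.
    - exact: nbhs_right_gt.
    - exact: nbhs_right_lt.
    - exact: ray.
  exists (t0 + r * (2^-1 - t0)); split.
    have h2 : (0 : R) < 2^-1 by rewrite invr_gt0.
    have h3 : (2^-1 : R) < 1 by rewrite invf_lt1 ?ltr1n.
    move: t01 => /andP[? ?].
    have e : t0 + r * (2^-1 - t0) = (1 - r) * t0 + r * 2^-1 by ring.
    have e' : 1 - (t0 + r * (2^-1 - t0)) = (1 - r) * (1 - t0) + r * (1 - 2^-1) by ring.
    have r1 : 0 <= 1 - r by rewrite subr_ge0 ltW.
    apply/andP; split; [rewrite e|rewrite -subr_gt0 e'].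
      by apply: ltr_wpDl; [apply: mulr_ge0|apply: mulr_gt0].
    have h4 : 0 < 1 - (2^-1 : R) by rewrite subr_gt0.
    have h5 : 0 <= 1 - t0 by rewrite subr_ge0.
    by apply: ltr_wpDl; [apply: mulr_ge0|apply: mulr_gt0].
  rewrite (_ : c + _ = x + r *: (midpt c d - x)) //.
  by rewrite xE; apply: pt_ext; rewrite /midpt /= /GRing.scale /=; field.
set u := c + t *: (d - c) in Ot *.
have iOt : Omega° u by have := domain_open hO; rewrite openE; apply.
have [r [r0 Or nr]] : exists r : R, [/\ 0 < r, Omega (u + r *: (u - v)) &
    forall K, K \in T -> tset K (u + r *: (u - v)) -> tset K u].
  apply: (@filter_ex _ (0 : R)^'+); near=> r; split.
  - by near: r; exact: nbhs_right_gt.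
  - by near: r; exact: ray.
  - by near: r; exact: near_mesh.
have [K' KT' K'r] : exists2 K', K' \in T & tset K' (u + r *: (u - v)).
  have : closure Omega (u + r *: (u - v)) by exact: subset_closure.
  by rewrite (triang_cover tT) => -[K' /= ? ?]; exists K'.
have ub : bc v c d u = 0.
  by rewrite /u bc_line (bc_indic s cK) (bc_indic s dK); have [n1 n2 _] := spans_neq s;
    rewrite ![_ == v]eq_sym (negbTE n1) (negbTE n2) !mulr0 addr0.
have K'K : K' != K.
  apply/eqP => KE; move: K'r; rewrite KE => /(spans_tsetP _ s)[+ _ _].
  have -> : u + r *: (u - v) = u + (- r) *: (v - u).
    by apply: pt_ext; rewrite /= /GRing.scale /=; ring.
  rewrite bc_line ub mulr0 add0r (bc_indic s) ?eqxx ?mulr1 ?oppr_ge0 ?leNgt ?r0 //.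
  by have [] := spans_mem s.
have KK' : K != K' by rewrite eq_sym.
by have [cK' dK'] := mesh_hanging tT KT KT' KK' cd cK dK t01' (nr _ KT' K'r); exists K'.
Unshelve. all: by end_near.
Qed.

(** The triangles lie on opposite sides and cover a neighbourhood of the point, which is thus
    interior to the closure; [domain_regular] concludes. *)
Lemma shared_edge_inside K K' c d (t : R) : K \in T -> K' \in T -> K != K' -> c != d ->
  c \in vertices K -> d \in vertices K -> c \in vertices K' -> d \in vertices K' ->
  0 < t < 1 -> Omega (c + t *: (d - c)).
Proof.
move=> KT KT' KK' cd cK dK cK' dK' /andP[t0 t1]; set x := c + _.
have [v s] := spans_edge (triang_nondeg tT KT) cd cK dK.
have [v' s'] := spans_edge (triang_nondeg tT KT') cd cK' dK'.
have opp := mesh_opposite tT KT KT' KK' s s'.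
apply: domain_regular.
have pos p q r : 0 < bc p q r x -> \forall u \near x, 0 < bc p q r u.
  move=> h; have := peval_near (bcp p q r) x h; apply: filterS => u.
  by rewrite !peval_bcp ltr_norml => /andP[? _]; lra.
have end1 K0 v0 : spans K0 v0 c d -> 0 < bc c d v0 x /\ 0 < bc d v0 c x.
  move=> s0; have [_ cK0 dK0] := spans_mem s0; have s1 := spans_rot s0; have s2 := spans_rot s1.
  rewrite /x !bc_line (bc_indic s1 cK0) (bc_indic s1 dK0) (bc_indic s2 cK0) (bc_indic s2 dK0).
  by rewrite !eqxx [d == c]eq_sym (negbTE cd) !(mulr1, mulr0, add0r, addr0) subr_gt0.
have [h1 h2] := end1 _ _ s; have [h3 h4] := end1 _ _ s'.
near=> u.
have [k1 k2] : 0 < bc c d v u /\ 0 < bc d v c u by split; near: u; exact: pos.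
have [k3 k4] : 0 < bc c d v' u /\ 0 < bc d v' c u by split; near: u; exact: pos.
have [D0 D0'] := (proj2 s, proj2 s').
have e : bc v' c d u = bc v c d u * (Det v c d / Det v' c d) by rewrite /bc mulrA divfK.
have neg : Det v c d / Det v' c d < 0.
  by rewrite -(pmulr_llt0 _ (_ : 0 < Det v' c d ^+ 2)) ?exprn_even_gt0 // expr2 mulrA divfK.
have [b0|b0] := leP 0 (bc v c d u).
  by apply: (tset_closure KT); apply/(spans_tsetP _ s); split=> //; exact: ltW.
apply: (tset_closure KT'); apply/(spans_tsetP _ s'); split; [|exact: ltW..].
by rewrite e; apply: mulr_le0; exact: ltW.
Unshelve. all: by end_near.
Qed.

Lemma shared_not_bdry K K' c d : K \in T -> K' \in T -> K != K' -> c != d ->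
  c \in vertices K -> d \in vertices K -> c \in vertices K' -> d \in vertices K' ->
  ~ bdry_edge Omega [fset c; d]%fset.
Proof.
move=> KT KT' KK' cd cK dK cK' dK' /(_ (c + 2^-1 *: (d - c))) h.
apply: open_bdry (h _); first by apply: (@shared_edge_inside K K') => //; rewrite invr_gt0 ltr0n invf_lt1 ?ltr1n.
by apply/hull2P; exists 2^-1 => //; exact: half01.
Qed.

End DomainGeometry.

(** * Jumps and Crouzeix-Raviart functions *)

Section Jumps.
Variable R : realType.
Implicit Types (z a b x c d v w y : pt R) (K L : tri R) (E : edge R) (p q : poly2 R).

Lemma norm2_gt0 x : x != 0 -> 0 < norm2 x.
Proof.
move=> x0; rewrite /norm2 sqrtr_gt0 /dot -!expr2 lt_neqAle addr_ge0 ?sqr_ge0 // andbT eq_sym.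
rewrite paddr_eq0 ?sqr_ge0 // !sqrf_eq0; apply: contraNN x0 => /andP[/eqP e1 /eqP e2].
by apply/eqP/pt_ext.
Qed.

Lemma norm2_sqr x : norm2 x ^+ 2 = x.1 ^+ 2 + x.2 ^+ 2.
Proof. by rewrite /norm2 sqr_sqrtr /dot -!expr2 // addr_ge0 // sqr_ge0. Qed.

Section Ordered.
Variable o : edge R -> pt R * pt R.

Lemma edge_intgE E p : edge_intg o E (peval p) = elen o E * I01 (seg (o E).1 (o E).2 p).
Proof.
rewrite /edge_intg -Rintegral_horner; congr (_ * _); apply: eq_Rintegral => t _.
by rewrite horner_seg.
Qed.

Lemma bc_normal K v E t (s : R) : spans K v (o E).1 (o E).2 ->
  bc v (o E).1 (o E).2 (epoint o E t + s *: normal o E) =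
  s * (elen o E / Det v (o E).1 (o E).2).
Proof.
move=> sp; have [_ _ cd] := spans_neq sp.
have l0 : elen o E != 0 by rewrite gt_eqF // norm2_gt0 // subr_eq0 eq_sym.
rewrite /bc mulrA; congr (_ / _); rewrite -[elen o E](mulfK l0) -expr2.
rewrite [in X in X / _]/elen norm2_sqr /normal /tangent /rot90 /epoint /Det /det2 /= /GRing.scale /=.
by field.
Qed.

(** Reduces left and right to the sign of a determinant, by which [mesh_opposite] identifies [K_L]
    and [K_R]. *)
Lemma normal_intoP K v E : spans K v (o E).1 (o E).2 ->
  normal_into o E (tset K) <-> 0 < Det v (o E).1 (o E).2.
Proof.
move=> sp; have [_ _ cd] := spans_neq sp.
have l0 : 0 < elen o E by rewrite norm2_gt0 // subr_eq0 eq_sym.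
set c := (o E).1; set d := (o E).2; have D0 : Det v c d != 0 by case: sp.
have s1 := spans_rot sp; have s2 := spans_rot s1; have [_ cK dK] := spans_mem sp.
split=> [h|D1 t /andP[t0 t1]].
  have h2 : 0 < (2^-1 : R) < 1 by rewrite invr_gt0 ltr0n invf_lt1 ?ltr1n.
  have [s [s0 Ks]] : exists s : R, 0 < s /\ tset K (epoint o E 2^-1 + s *: normal o E).
    apply: (@filter_ex _ (0 : R)^'+); near=> s; split; near: s; [exact: nbhs_right_gt|exact: h].
  have := (spans_tsetP _ sp).1 Ks; rewrite (bc_normal _ _ sp) => -[+ _ _].
  rewrite pmulr_rge0 // pmulr_rge0 // invr_ge0 le_eqVlt eq_sym (negbTE D0); exact.
have n1 : \forall s \near 0^'+, 0 < bc c d v (epoint o E t) +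
    s * (bc c d v (epoint o E t + normal o E) - bc c d v (epoint o E t)).
  apply: affine_near; rewrite bc_line (bc_indic s1 cK) (bc_indic s1 dK) eqxx eq_sym (negbTE cd).
  by rewrite mulr1 mulr0 addr0 subr_gt0.
have n2 : \forall s \near 0^'+, 0 < bc d v c (epoint o E t) +
    s * (bc d v c (epoint o E t + normal o E) - bc d v c (epoint o E t)).
  apply: affine_near; rewrite bc_line (bc_indic s2 cK) (bc_indic s2 dK) eqxx (negbTE cd).
  by rewrite mulr1 mulr0 add0r.
near=> s; apply/(spans_tsetP _ sp); rewrite (bc_normal _ _ sp); split.
- apply: mulr_ge0; first by apply: ltW; near: s; exact: nbhs_right_gt.
  by rewrite divr_ge0 // ltW.
- by rewrite bc_ray; apply: ltW; near: s; exact: n1.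
- by rewrite bc_ray; apply: ltW; near: s; exact: n2.
Unshelve. all: by end_near.
Qed.

Variables (Omega : set (pt R)) (T : {fset tri R}).
Hypotheses (hO : polygonal_lipschitz_domain Omega) (tT : triangulation Omega T)
  (oT : edge_ordering Omega T o).

Let nT K (KT : K \in T) := triang_nondeg tT KT.

Lemma ordered_span K E : K \in T -> E \in edges K ->
  [/\ E = [fset (o E).1; (o E).2]%fset, (o E).1 != (o E).2 & exists v, spans K v (o E).1 (o E).2].
Proof.
move=> KT EK; have [e _] := oT (ex_intro2 _ _ K KT EK).
have cd : (o E).1 != (o E).2.
  have /edgesP[c [d [cd e' _ _]]] := EK; move: (congr1 (fun A : {fset _} => #|` A|%fset) e).
  by rewrite {1}e' !cardfs2 cd; case: eqP.
have : [fset (o E).1; (o E).2]%fset \in edges K by rewrite -e.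
rewrite edge_mem // => /andP[cK dK]; split=> //; exact: spans_edge (nT KT) cd cK dK.
Qed.

Lemma side_unique K K' E v v' : K \in T -> K' \in T -> spans K v (o E).1 (o E).2 ->
  spans K' v' (o E).1 (o E).2 -> 0 < Det v (o E).1 (o E).2 * Det v' (o E).1 (o E).2 -> K = K'.
Proof.
move=> KT KT' s s' pos; apply/eqP; apply: contraTT isT => KK'.
by have := mesh_opposite tT KT KT' KK' s s'; rewrite ltNge (ltW pos).
Qed.

Lemma K_R_eq K v E : K \in T -> E \in edges K -> spans K v (o E).1 (o E).2 ->
  0 < Det v (o E).1 (o E).2 -> K_R T o E = K.
Proof.
move=> KT EK s D1; apply: xget_unique => [|K' [KT' EK' nK']].
  by split=> //; apply/(normal_intoP s).
have [_ _ [v' s']] := ordered_span KT' EK'.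
by apply: (side_unique KT' KT s' s); rewrite mulr_gt0 //; apply/(normal_intoP s').
Qed.

Lemma K_L_eq K v E : K \in T -> E \in edges K -> spans K v (o E).1 (o E).2 ->
  Det v (o E).1 (o E).2 < 0 -> K_L T o E = K.
Proof.
move=> KT EK s D1; apply: xget_unique => [|K' [KT' EK' nK']].
  by split=> //; rewrite (normal_intoP s); apply/negP; rewrite -leNgt ltW.
have [_ _ [v' s']] := ordered_span KT' EK'.
apply: (side_unique KT' KT s' s); rewrite nmulr_lgt0 // lt_neqAle (proj2 s') leNgt /=.
by apply/negP => /(normal_intoP s').
Qed.

(** The exterior normal cannot point into a triangle of the closure, hence [K_L] is K. *)
Lemma jump_bdry (v : tri R -> poly2 R) K E : K \in T -> E \in edges K -> bdry_edge Omega E -> jump Omega T o v E = v K.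
Proof.
move=> KT EK bE; rewrite /jump asboolT //; congr v.
have [e cd [w s]] := ordered_span KT EK; apply: (K_L_eq KT EK s).
rewrite lt_neqAle (proj2 s) leNgt /=; apply/negP => /(normal_intoP s) nK.
have [_ /(_ bE) nO] := oT (ex_intro2 _ _ K KT EK).
have h2 : 0 < (2^-1 : R) < 1 by rewrite invr_gt0 ltr0n invf_lt1 ?ltr1n.
have : \forall t \near (0 : R)^'+, False.
  near=> t.
  have : tset K (epoint o E 2^-1 + t *: normal o E) by near: t; exact: nK.
  move=> /(tset_closure tT KT).
  suff : (~` closure Omega) (epoint o E 2^-1 + t *: normal o E) by [].
  by near: t; exact: nO.
by move=> /filter_ex[].
Unshelve. all: by end_near.
Qed.

(** The sign depends on the ordering of the edge only, hence one alternative holds for all functions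
    v simultaneously. *)
Lemma jump_inner K K' E : K \in T -> K' \in T -> K != K' -> E \in edges K -> E \in edges K' ->
  (forall v : tri R -> poly2 R, jump Omega T o v E = v K - v K') \/
  (forall v : tri R -> poly2 R, jump Omega T o v E = v K' - v K).
Proof.
move=> KT KT' KK' EK EK'.
have [e cd [w s]] := ordered_span KT EK; have [_ _ [w' s']] := ordered_span KT' EK'.
have [_ cK dK] := spans_mem s; have [_ cK' dK'] := spans_mem s'.
have nb : ~ bdry_edge Omega E.
  by rewrite e; exact: (shared_not_bdry hO tT KT KT' KK').
have opp := mesh_opposite tT KT KT' KK' s s'.
have [D1|D1] := ltP 0 (Det w (o E).1 (o E).2).
  right=> v; rewrite /jump asboolF // (K_R_eq KT EK s D1) (K_L_eq KT' EK' s') //.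
  by rewrite -(pmulr_rlt0 _ D1).
have {}D1 : Det w (o E).1 (o E).2 < 0 by rewrite lt_neqAle (proj2 s).
left=> v; rewrite /jump asboolF // (K_L_eq KT EK s D1) (K_R_eq KT' EK' s') //.
by rewrite -(nmulr_rlt0 _ D1).
Qed.

Section CrouzeixRaviart.
Variable k : nat.
Implicit Types u : tri R -> poly2 R.

Lemma CR0_moment u E q : CR0 Omega T o k u -> edges_of T E -> Pk k.-1 q ->
  I01 (seg (o E).1 (o E).2 (jump Omega T o u E * q)) = 0.
Proof.
move=> [_ h] hE Pq; have := h E hE q Pq.
have -> : (fun x => peval (jump Omega T o u E) x * peval q x) = peval (jump Omega T o u E * q).
  by apply/funext => x; rewrite pevalM.
rewrite edge_intgE => /eqP; rewrite mulf_eq0 => /orP[|/eqP //].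
have [K KT EK] := hE; have [_ cd _] := ordered_span KT EK.
by rewrite gt_eqF // norm2_gt0 // subr_eq0 eq_sym.
Qed.

Lemma I01_fset (P : pt R -> pt R -> Prop) c d c' d' : [fset c; d]%fset = [fset c'; d']%fset ->
  c != d -> (forall x y, P x y -> P y x) -> P c d -> P c' d'.
Proof.
move=> e cd sym Pcd; have: c \in [fset c'; d']%fset by rewrite -e !inE eqxx.
have: d \in [fset c'; d']%fset by rewrite -e !inE eqxx orbT.
have: d' \in [fset c; d]%fset by rewrite e !inE eqxx orbT.
have: c' \in [fset c; d]%fset by rewrite e !inE eqxx.
move=> /fset2P[] e1 /fset2P[] e2; subst c' d'; move=> /fset2P[] e3 /fset2P[] e4 //;
  try (by move: cd; rewrite ?e3 ?e4 eqxx); try (by move: cd; rewrite e4 e3 eqxx); exact: sym.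
Qed.

(** The Crouzeix-Raviart condition free of orderings and signs; together with [CR0_bdry] it
    characterises the space, by [CR0_intro]. *)
Lemma CR0_shared u K K' c d q : CR0 Omega T o k u -> K \in T -> K' \in T -> K != K' -> c != d ->
  c \in vertices K -> d \in vertices K -> c \in vertices K' -> d \in vertices K' -> Pk k.-1 q ->
  I01 (seg c d (u K * q)) = I01 (seg c d (u K' * q)).
Proof.
move=> hu KT KT' KK' cd cK dK cK' dK' Pq; set E := [fset c; d]%fset.
have EK : E \in edges K by rewrite edge_mem // cK dK.
have EK' : E \in edges K' by rewrite edge_mem // cK' dK'.
have [e cd' _] := ordered_span KT EK; have := CR0_moment hu (ex_intro2 _ _ K KT EK) Pq.
move=> h; apply: (@I01_fset (fun c d => I01 (seg c d (u K * q)) = I01 (seg c d (u K' * q))) (o E).1 (o E).2) => //.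
  by move=> x y; rewrite !(I01_seg_rev x y).
have [je|je] := jump_inner KT KT' KK' EK EK'; move: h; rewrite je mulrBl segD segN I01B => /eqP.
  by rewrite subr_eq0 => /eqP.
by rewrite subr_eq0 => /eqP.
Qed.

Lemma CR0_bdry u K c d q : CR0 Omega T o k u -> K \in T -> c != d ->
  c \in vertices K -> d \in vertices K -> hull [fset c; d]%fset `<=` bdry Omega -> Pk k.-1 q ->
  I01 (seg c d (u K * q)) = 0.
Proof.
move=> hu KT cd cK dK bE Pq; set E := [fset c; d]%fset in bE.
have EK : E \in edges K by rewrite edge_mem // cK dK.
have [e cd' _] := ordered_span KT EK; have := CR0_moment hu (ex_intro2 _ _ K KT EK) Pq.
rewrite (jump_bdry _ KT EK bE) => h.
apply: (@I01_fset (fun c d => I01 (seg c d (u K * q)) = 0) (o E).1 (o E).2) => //.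
by move=> x y; rewrite (I01_seg_rev x y).
Qed.

Lemma CR0_intro u : PkT k T u ->
  (forall K K' c d q, K \in T -> K' \in T -> K != K' -> c != d -> c \in vertices K ->
     d \in vertices K -> c \in vertices K' -> d \in vertices K' -> Pk k.-1 q ->
     I01 (seg c d (u K * q)) = I01 (seg c d (u K' * q))) ->
  (forall K c d q, K \in T -> c != d -> c \in vertices K -> d \in vertices K ->
     hull [fset c; d]%fset `<=` bdry Omega -> Pk k.-1 q -> I01 (seg c d (u K * q)) = 0) ->
  CR0 Omega T o k u.
Proof.
move=> Pu sh bd; split=> // E [K KT EK] q Pq.
have -> : (fun x => peval (jump Omega T o u E) x * peval q x) = peval (jump Omega T o u E * q).
  by apply/funext => x; rewrite pevalM.
rewrite edge_intgE; have [e cd [w s]] := ordered_span KT EK; have [_ cK dK] := spans_mem s.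
have [bE|nbE] := pselect (bdry_edge Omega E).
  by rewrite (jump_bdry _ KT EK bE) bd ?mulr0 // -e.
have [|K' [KT' KK' cK' dK']] := edge_neighbour hO tT KT cd cK dK; first by rewrite -e.
have EK' : E \in edges K' by rewrite e edge_mem // cK' dK'.
have {}KK' : K != K' by rewrite eq_sym.
have hs := sh K K' _ _ _ KT KT' KK' cd cK dK cK' dK' Pq.
by have [je|je] := jump_inner KT KT' KK' EK EK'; rewrite je mulrBl segD segN I01B hs subrr mulr0.
Qed.

End CrouzeixRaviart.
End Ordered.
End Jumps.

(** * Refinements as forests *)

Section Forest.
Variable R : realType.
Implicit Types (z a b x c d v w y : pt R) (K L : tri R) (t : btree) (T : {fset tri R}).

Fixpoint refine t z a b L : btree :=
  match t with
  | Lf => if T3 z a b == L then Nd Lf Lf else Lf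
  | Nd t1 t2 => Nd (refine t1 (midpt a b) z a L) (refine t2 (midpt a b) b z L)
  end.

Lemma fset2_eq c d c' d' : [fset c; d]%fset = [fset c'; d']%fset ->
  (c = c' /\ d = d') \/ (c = d' /\ d = c').
Proof.
move=> e; have: c \in [fset c'; d']%fset by rewrite -e !inE eqxx.
have: d \in [fset c'; d']%fset by rewrite -e !inE eqxx orbT.
have: d' \in [fset c; d]%fset by rewrite e !inE eqxx orbT.
have: c' \in [fset c; d]%fset by rewrite e !inE eqxx.
move=> /fset2P[] e1 /fset2P[] e2; subst c' d'; move=> /fset2P[] e3 /fset2P[] e4; subst => //;
  by [left|right].
Qed.

Lemma midptC c d : midpt c d = midpt d c.
Proof. by rewrite /midpt addrC. Qed.

Lemma leaves_refine t z a b z0 a0 b0 L' : let L := (z0, [fset a0; b0]%fset) in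
  L' \in leaves (refine t z a b L) z a b <->
  (L' \in leaves t z a b /\ L' != L) \/ (L \in leaves t z a b /\
    (L' = (midpt a0 b0, [fset z0; a0]%fset) \/ L' = (midpt a0 b0, [fset z0; b0]%fset))).
Proof.
move=> L; elim: t z a b => [|t1 IH1 t2 IH2] z a b /=; last first.
  rewrite !mem_cat; split=> [/orP[/IH1|/IH2]|].
  - by move=> [[-> ->]|[-> h]]; [left|right].
  - by move=> [[-> ->]|[-> h]]; rewrite !orbT; [left|right].
  - move=> [[/orP[] h h']|[/orP[] h h']]; apply/orP.
    + by left; apply/IH1; left.
    + by right; apply/IH2; left.
    + by left; apply/IH1; right.
    + by right; apply/IH2; right.
rewrite !inE; case: eqP => [TL|nTL] /=; last first.
  rewrite inE; split=> [/eqP ->|[[] //|[/eqP h]]]; last by case: nTL.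
  by left; split; [|apply/eqP].
have [ez eab] : z = z0 /\ [fset a; b]%fset = [fset a0; b0]%fset by case: TL.
have eU (c d : pt R) : [fset c; d]%fset = [fset d; c]%fset by rewrite fsetUC.
rewrite TL eqxx !inE; subst z0; case: (fset2_eq eab) => -[e1 e2]; subst a0 b0.
- rewrite /T3 (eU b z); split=> [/orP[] /eqP ->|[[-> //]|[_ [] ->]]]; rewrite ?eqxx ?orbT //.
    by right; split=> //; left.
  by right; split=> //; right.
- rewrite /T3 (eU b z) (midptC a b); split=> [/orP[] /eqP ->|[[-> //]|[_ [] ->]]]; rewrite ?eqxx ?orbT //.
    by right; split=> //; right.
  by right; split=> //; left.
Qed.

(** [fa] and [fb] order the unordered edge opposite to the newest vertex; [ft] is the bisection
    history of each coarse triangle. *)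
Record forest T (That : {fset tri R}) (fa fb : tri R -> pt R) (ft : tri R -> btree) : Prop := {
  forest_tri : forall K, K \in T -> K = T3 K.1 (fa K) (fb K) /\ Det K.1 (fa K) (fb K) != 0;
  forest_leaves : forall L, L \in That <->
    exists2 K, K \in T & L \in leaves (ft K) K.1 (fa K) (fb K) }.

Lemma nvb_forest T That : (forall K, K \in T -> Defs.nondegenerate K) -> nvb T That ->
  exists fa fb ft, forest T That fa fb ft.
Proof.
move=> nT hn.
have /choice[ab hab] K : exists ab : pt R * pt R, K \in T ->
    K = T3 K.1 ab.1 ab.2 /\ Det K.1 ab.1 ab.2 != 0.
  have [KT|_] := boolP (K \in T); last by exists (0, 0).
  by have [a [b h]] := nondegenerateP (nT _ KT); exists (a, b).
exists (fst \o ab), (snd \o ab); rewrite /=.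
suff [ft hf] : exists ft, forall L, L \in That <->
    exists2 K, K \in T & L \in leaves (ft K) K.1 (ab K).1 (ab K).2 by exists ft.
elim: hn => [|T' z a b _ [ft hf] LT'].
  exists (fun=> Lf) => L; split=> [LT|[K KT]]; last by rewrite inE -(proj1 (hab _ KT)) => /eqP ->.
  by exists L; rewrite //= inE -(proj1 (hab _ LT)).
(* The bisected triangle is replaced in every tree at once; trees in which it is no leaf stay as
   they are. *)
exists (fun K => refine (ft K) K.1 (ab K).1 (ab K).2 (z, [fset a; b]%fset)) => L'.
rewrite !inE; split.
  move=> /orP[/andP[L'L /hf[K KT KL']]|h].
    by exists K => //; apply/leaves_refine; left.
  have [K KT KL] := (hf _).1 LT'; exists K => //; apply/leaves_refine; right; split=> //.
  by move: h => /orP[] /eqP ->; [left|right].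
move=> [K KT /leaves_refine[[h ->]|[_ [] ->]]]; rewrite ?eqxx ?orbT //=.
by apply/orP; left; apply/hf; exists K.
Qed.

Lemma leaf_nondeg t z a b L : Det z a b != 0 -> L \in leaves t z a b ->
  exists z' a' b', [/\ L = T3 z' a' b', Det z' a' b' != 0 & `|Det z' a' b'| <= `|Det z a b|].
Proof.
elim: t z a b => [|t1 IH1 t2 IH2] z a b D0 /=.
  by rewrite inE => /eqP ->; exists z, a, b.
have le : `|2^-1 * Det z a b| <= `|Det z a b|.
  rewrite normrM ger0_norm ?invr_ge0 // ler_piMl //.
  by have /andP[] := half01 R.
rewrite mem_cat => /orP[/IH1|/IH2].
  case/(_ (Det_child1_neq0 D0)) => z' [a' [b' [-> D1 l]]]; exists z', a', b'; split=> //.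
  by apply: le_trans l _; rewrite Det_child1.
case/(_ (Det_child2_neq0 D0)) => z' [a' [b' [-> D1 l]]]; exists z', a', b'; split=> //.
by apply: le_trans l _; rewrite Det_child2.
Qed.

Lemma interior_ex z a b : Det z a b != 0 -> exists x, (tset (T3 z a b))° x.
Proof.
move=> D0; exists (z + 3^-1 *: (a - z) + 3^-1 *: (b - z)); apply/(tset_interior _ D0).
have [-> [-> ->]] := bc_vertex 3^-1 3^-1 D0; split; lra.
Qed.

Lemma children_disjoint t1 t2 z a b L : Det z a b != 0 ->
  L \in leaves t1 (midpt a b) z a -> L \in leaves t2 (midpt a b) b z -> False.
Proof.
move=> D0 h1 h2; have D1 := Det_child1_neq0 D0; have D2 := Det_child2_neq0 D0.
have [z' [a' [b' [e D' _]]]] := leaf_nondeg D1 h1; have [x] := interior_ex D'.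
rewrite -e => Lx; have [_ _ AB] := interior_child D0.
have: set0 x; last by [].
by rewrite -AB; split; apply: interiorS Lx; [exact: leaves_subset D1 h1|exact: leaves_subset D2 h2].
Qed.

Section ForestMesh.
Variables (Omega : set (pt R)) (T That : {fset tri R}) (fa fb : tri R -> pt R) (ft : tri R -> btree).
Hypotheses (tT : triangulation Omega T) (F : forest T That fa fb ft).

Definition kleaves K : seq (tri R) := leaves (ft K) K.1 (fa K) (fb K).

Lemma kspans K : K \in T -> spans K K.1 (fa K) (fb K).
Proof. by move=> /(forest_tri F)[e D0]; split=> //; rewrite {1}e. Qed.

Lemma kleaf_sub K L : K \in T -> L \in kleaves K -> tset L `<=` tset K.
Proof.
move=> KT LK; rewrite (spans_tset (kspans KT)); apply: leaves_subset LK.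
exact: (proj2 (kspans KT)).
Qed.

Lemma kleaf_That K L : K \in T -> L \in kleaves K -> L \in That.
Proof. by move=> KT LK; apply/(forest_leaves F); exists K. Qed.

Lemma kleaf_nondeg K L : K \in T -> L \in kleaves K -> Defs.nondegenerate L.
Proof.
move=> KT LK; have [z [a [b [-> D0 _]]]] := leaf_nondeg (proj2 (kspans KT)) LK.
by exists a, b.
Qed.

Lemma ancestor_unique K K' L : K \in T -> K' \in T -> L \in kleaves K -> L \in kleaves K' -> K = K'.
Proof.
move=> KT KT' LK LK'; apply/eqP; apply: contraTT isT => KK'; exfalso.
have [z [a [b [e D0 _]]]] := leaf_nondeg (proj2 (kspans KT)) LK.
have [x] := interior_ex D0; rewrite -e => Lx.
have : set0 x by rewrite -(mesh_disjoint tT KT KT' KK'); split; apply: interiorS Lx; exact: kleaf_sub.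
by [].
Qed.

(** As a leaf, K overlaps its ancestor, which is therefore K itself; below the root, leaves have a
    smaller determinant. *)
Lemma unrefined_leaf K : K \in T -> K \in That -> ft K = Lf.
Proof.
move=> KT /(forest_leaves F)[K' KT' KK'].
have D0 := proj2 (kspans KT).
have KE : K = K'.
  apply/eqP; apply: contraTT isT => nKK'; exfalso.
  have [x] := interior_ex D0; rewrite -(proj1 (forest_tri F KT)) => Kx.
  have : set0 x.
    rewrite -(mesh_disjoint tT KT KT' nKK'); split => //; apply: interiorS Kx; exact: kleaf_sub.
  by [].
move: KK'; rewrite -KE; case: (ft K) => // t1 t2 /=.
have dlt : `|2^-1 * Det K.1 (fa K) (fb K)| < `|Det K.1 (fa K) (fb K)|.
  rewrite normrM ger0_norm ?invr_ge0 // gtr_pMl ?normr_gt0 //.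
  by rewrite invf_lt1 // ltr1n.
have key z a b : K = T3 z a b -> Det z a b != 0 -> `|Det z a b| = `|Det K.1 (fa K) (fb K)|.
  move=> e Dz; have s : spans K z a b by split=> //; rewrite e.
  apply: (@spans_sym _ (fun x y w => `|Det x y w| = `|Det K.1 (fa K) (fb K)|) K K.1 (fa K) (fb K)) => //.
  - by move=> x y w; rewrite (Det_rot x y w).
  - by move=> x y w; rewrite (Det_flip x y w) normrN.
  - exact: kspans.
rewrite mem_cat => /orP[] h; exfalso.
  have [z [a [b [e Dz le]]]] := leaf_nondeg (Det_child1_neq0 D0) h.
  by move: le; rewrite Det_child1 key // leNgt dlt.
have [z [a [b [e Dz le]]]] := leaf_nondeg (Det_child2_neq0 D0) h.
by move: le; rewrite Det_child2 key // leNgt dlt.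
Qed.

Lemma leaf_unrefined K : K \in T -> ft K = Lf -> K \in That.
Proof.
move=> KT e; apply: (@kleaf_That K) => //.
by rewrite /kleaves e inE -(proj1 (forest_tri F KT)).
Qed.

End ForestMesh.
End Forest.

(** * Means over coarse edges computed from fine triangles *)

Section Trace.
Variable R : realType.
Implicit Types (z a b x c d v y : pt R) (K L : tri R) (t : btree) (T : {fset tri R}).
Variables (Omega : set (pt R)) (That : {fset tri R}) (o : edge R -> pt R * pt R) (k : nat).
Variable w : tri R -> poly2 R.
Hypotheses (hO : polygonal_lipschitz_domain Omega) (tT : triangulation Omega That)
  (oT : edge_ordering Omega That o) (hw : CR0 Omega That o k w).

(* Leaves on one side of the coarse edge cd induce a partition of cd by successive halving; e is the
   mean of w q over cd that is computed on it. *)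
Inductive dyadic_mean (S : pred (tri R)) (q : poly2 R) : pt R -> pt R -> R -> Prop :=
| mean_leaf L c d : S L -> c \in vertices L -> d \in vertices L ->
    dyadic_mean S q c d (I01 (seg c d (w L * q)))
| mean_node c d e1 e2 : dyadic_mean S q c (midpt c d) e1 -> dyadic_mean S q (midpt c d) d e2 ->
    dyadic_mean S q c d (2^-1 * (e1 + e2)).

Lemma tree_mean (S : pred (tri R)) q t z a b : (forall L, L \in leaves t z a b -> S L) ->
  [/\ dyadic_mean S q a b (emean t z a b w q).1.1, dyadic_mean S q b z (emean t z a b w q).1.2 &
      dyadic_mean S q z a (emean t z a b w q).2].
Proof.
elim: t z a b => [|t1 IH1 t2 IH2] z a b hS /=.
  have SL : S (T3 z a b) by apply: hS; rewrite inE.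
  by split; apply: mean_leaf; rewrite ?in_T3 ?eqxx ?orbT.
have [|h1 h2 h3] := IH1 (midpt a b) z a; first by move=> L hL; apply: hS; rewrite mem_cat hL.
have [|k1 k2 k3] := IH2 (midpt a b) b z; first by move=> L hL; apply: hS; rewrite mem_cat hL orbT.
by split=> //; exact: mean_node.
Qed.

Lemma mean_rev S q c d e : dyadic_mean S q c d e -> dyadic_mean S q d c e.
Proof.
elim=> [L c' d' SL cL dL|c' d' e1 e2 _ h1 _ h2].
  by rewrite -I01_seg_rev; exact: mean_leaf.
by rewrite addrC; apply: mean_node; rewrite (midptC d' c').
Qed.

Lemma mean_end S q c d e : dyadic_mean S q c d e -> exists2 L, S L & d \in vertices L.
Proof. by elim=> [L c' d' SL _ dL|c' d' e1 e2 _ _ _ //]; exists L. Qed.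

Lemma midpt_neq c d : c != d -> c != midpt c d /\ midpt c d != d.
Proof.
move=> cd; split; apply: contraNneq cd => e; apply/eqP/pt_ext;
  have := congr1 fst e; have := congr1 snd e; rewrite /midpt /= /GRing.scale /=; lra.
Qed.

Lemma midptE c d : midpt c d = c + 2^-1 *: (d - c).
Proof. by apply: pt_ext; rewrite /midpt /= /GRing.scale /=; field. Qed.

(** A leaf L' that has the midpoint of cd as a vertex would, by [mesh_hanging], also have c and d as
    vertices and be degenerate. *)
Lemma no_hanging_node (S' : pred (tri R)) q L c d e : {subset S' <= That} -> L \in That ->
  ~~ S' L -> c != d -> c \in vertices L -> d \in vertices L ->
  ~ dyadic_mean S' q c (midpt c d) e.
Proof.
move=> S'T LT nS cd cL dL /mean_end[L' S'L' mL'].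
have LT' := S'T _ S'L'; have LL' : L != L' by apply: contraNneq nS => ->.
have nL' := triang_nondeg tT LT'.
have h2 : 0 < (2^-1 : R) < 1 by rewrite invr_gt0 ltr0n invf_lt1 ?ltr1n.
have [|cL' dL'] := mesh_hanging tT LT LT' LL' cd cL dL h2.
  by rewrite -midptE; exact: vertex_tset.
have [v s] := spans_edge nL' cd cL' dL'; have [m1 m2] := midpt_neq cd.
move: mL'; rewrite (proj1 s) in_T3 [_ == c]eq_sym (negbTE m1) (negbTE m2) !orbF => /eqP mv.
have := proj2 s; rewrite -mv; apply/negP; rewrite negbK; apply/eqP.
by rewrite /Det /det2 /midpt /= /GRing.scale /=; field.
Qed.

Lemma mean_inv (S : pred (tri R)) q c d e : dyadic_mean S q c d e ->
  (exists L, [/\ S L, c \in vertices L, d \in vertices L & e = I01 (seg c d (w L * q))]) \/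
  exists e1 e2, [/\ dyadic_mean S q c (midpt c d) e1, dyadic_mean S q (midpt c d) d e2 &
    e = 2^-1 * (e1 + e2)].
Proof. by case=> [L c' d' *|c' d' e1 e2 *]; [left; exists L|right; exists e1, e2]. Qed.

(** By conformity two disjoint families of leaves halve the edge in the same way, and on the pieces
    the fine function has equal moments from both sides. *)
Lemma mean_unique (S S' : pred (tri R)) q c d e e' : {subset S <= That} -> {subset S' <= That} ->
  (forall L, S L -> ~~ S' L) -> Pk k.-1 q -> c != d ->
  dyadic_mean S q c d e -> dyadic_mean S' q c d e' -> e = e'.
Proof.
move=> ST S'T dis Pq cd h; elim: h e' cd => [L {}c {}d SL cL dL e' cd h'|{}c {}d e1 e2 h1 IH1 h2 IH2 e' cd h'].
  case: (mean_inv h') => [[L' [S'L' cL' dL' ->]]|[f1 [f2 [k1 _ _]]]].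
    have LL' : L != L' by apply: contraNneq (dis _ SL) => ->.
    exact: (CR0_shared hO tT oT hw (ST _ SL) (S'T _ S'L') LL' cd cL dL cL' dL' Pq).
  by case: (no_hanging_node S'T (ST _ SL) (dis _ SL) cd cL dL k1).
have [m1 m2] := midpt_neq cd.
case: (mean_inv h') => [[L' [S'L' cL' dL' _]]|[f1 [f2 [k1 k2 ->]]]].
  have nS : ~~ S L' by apply/negP => /dis; rewrite S'L'.
  by case: (no_hanging_node ST (S'T _ S'L') nS cd cL' dL' h1).
by rewrite (IH1 _ m1 k1) (IH2 _ m2 k2).
Qed.

Lemma mean_bdry (S : pred (tri R)) q c d e : {subset S <= That} -> Pk k.-1 q -> c != d ->
  hull [fset c; d]%fset `<=` bdry Omega -> dyadic_mean S q c d e -> e = 0.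
Proof.
move=> ST Pq cd bE h; elim: h cd bE => [L {}c {}d SL cL dL cd bE|{}c {}d e1 e2 h1 IH1 h2 IH2 cd bE].
  exact: (CR0_bdry tT oT hw (ST _ SL) cd cL dL bE Pq).
have [m1 m2] := midpt_neq cd.
rewrite IH1 // ?IH2 // ?addr0 ?mulr0 // => x /hull2P[t /andP[t0 t1] ->]; apply: bE; apply/hull2P.
  exists (2^-1 + t * 2^-1); first by lra.
  by apply: pt_ext; rewrite /midpt /= /GRing.scale /=; field.
exists (t * 2^-1); first by lra.
by apply: pt_ext; rewrite /midpt /= /GRing.scale /=; field.
Qed.

(** The leaves below the two children form disjoint families, and their means over the inner edge
    agree by [mean_unique]. *)
Lemma tree_compat t z a b : Det z a b != 0 -> {subset leaves t z a b <= That} ->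
  compat (Pk k.-1) t z a b w.
Proof.
elim: t z a b => [|t1 IH1 t2 IH2] z a b D0 //= sub.
have s1 : {subset leaves t1 (midpt a b) z a <= That}.
  by move=> L hL; apply: sub; rewrite mem_cat hL.
have s2 : {subset leaves t2 (midpt a b) b z <= That}.
  by move=> L hL; apply: sub; rewrite mem_cat hL orbT.
split; [apply: IH1 => //; exact: Det_child1_neq0|apply: IH2 => //; exact: Det_child2_neq0|].
move=> q Pq; have [mz _ _] := Det_neq (Det_child1_neq0 D0).
have [_ _ k1] := @tree_mean (mem (leaves t1 (midpt a b) z a)) q t1 (midpt a b) z a (fun _ h => h).
have [_ k2 _] := @tree_mean (mem (leaves t2 (midpt a b) b z)) q t2 (midpt a b) b z (fun _ h => h).
apply: (mean_unique s1 s2 _ Pq mz k1 (mean_rev k2)) => L h1; apply/negP => h2.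
exact: children_disjoint D0 h1 h2.
Qed.

End Trace.

(** * Vertex values and tangential jumps *)

Section Fans.
Variable R : realType.
Implicit Types (z a b x c d v w y : pt R) (K L : tri R) (E : edge R) (q : poly2 R).

Lemma sqr_sum_seq_le (I : eqType) (s : seq I) (f : I -> R) :
  (\sum_(i <- s) f i) ^+ 2 <= (size s)%:R * \sum_(i <- s) f i ^+ 2.
Proof.
case: s => [|i0 s]; first by rewrite !big_nil expr0n mulr0.
by rewrite !(big_nth i0) !big_mkord; have := sqr_sum_le (fun i : 'I_(size (i0 :: s)) => f (nth i0 (i0 :: s) i));
  rewrite card_ord.
Qed.

Lemma ler_sum_subset (I : eqType) (s1 s2 : seq I) (f : I -> R) : uniq s1 -> uniq s2 ->
  {subset s1 <= s2} -> (forall i, i \in s2 -> 0 <= f i) ->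
  \sum_(i <- s1) f i <= \sum_(i <- s2) f i.
Proof.
move=> u1 u2 sub f0; rewrite [leRHS](bigID (mem s1)) /= -[X in _ <= X + _]big_filter.
have pe : perm_eq [seq i <- s2 | i \in s1] s1.
  apply: uniq_perm => [||i]; [exact: filter_uniq|exact: u1|rewrite mem_filter /=].
  by case: (boolP (i \in s1)) => //= /sub ->.
rewrite (perm_big _ pe) /= lerDl big_seq_cond.
by apply: sumr_ge0 => i /andP[/f0].
Qed.

Variables (o : edge R -> pt R * pt R) (Omega : set (pt R)) (T : {fset tri R}) (k : nat).
Variable u : tri R -> poly2 R.
Hypotheses (hO : polygonal_lipschitz_domain Omega) (tT : triangulation Omega T)
  (oT : edge_ordering Omega T o) (ok : odd k) (hu : CR0 Omega T o k u).

(** A test polynomial on [0, 1] is lifted to the plane by [uni] along the coordinate of d, whose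
    trace on cd is the parameter. *)
Lemma seg_orth K v c d p : spans K v c d ->
  (forall q, Pk k.-1 q -> I01 (seg c d (p * q)) = 0) ->
  forall r : {poly R}, (size r <= k)%N -> I01 (seg c d p * r) = 0.
Proof.
move=> s h r sr; have s2 := spans_rot (spans_rot s); have [_ cK dK] := spans_mem s.
have sX : seg c d (bcp d v c) = 'X.
  rewrite seg_bcp (bc_indic s2 cK) (bc_indic s2 dK) eqxx; have [_ _ cd] := spans_neq s.
  by rewrite (negbTE cd) subr0 scale1r add0r.
have := h (uni r (bcp d v c)); rewrite segM seg_uni sX comp_polyXr; apply.
by apply: Pk_uni; [case: (k) ok sr|exact: Pk_bcp].
Qed.

(** In the parametrisation of E each term is |E| times the squared L^2(E) norm of the tangential
    jump, so that it scales like [nu2]. *)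
Definition jump_energy K : R :=
  \sum_(E <- edges K) I01 ((seg (o E).1 (o E).2 (jump Omega T o u E))^`() ^+ 2).

Lemma I01_sqr_ge0 (p : {poly R}) : 0 <= I01 (p ^+ 2).
Proof. by apply: I01_ge0 => t _; rewrite horner_exp sqr_ge0. Qed.

Lemma jump_energy_ge0 K : 0 <= jump_energy K.
Proof. by apply: sumr_ge0 => E _; exact: I01_sqr_ge0. Qed.

Lemma Pk_jump E : edges_of T E -> Pk k (jump Omega T o u E).
Proof.
move=> [K KT EK]; have Pu := proj1 hu.
have [bE|nb] := pselect (bdry_edge Omega E); first by rewrite (jump_bdry tT oT _ KT EK bE); exact: Pu.
have [e cd [v s]] := ordered_span tT oT KT EK; have [_ cK dK] := spans_mem s.
have [|K' [KT' KK' cK' dK']] := edge_neighbour hO tT KT cd cK dK; first by rewrite -e.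
have EK' : E \in edges K' by rewrite e edge_mem // cK' dK'.
rewrite eq_sym in KK'.
by have [->|->] := jump_inner hO tT oT KT KT' KK' EK EK'; apply: PkB; exact: Pu.
Qed.

Lemma jump_end K E z : K \in T -> E \in edges K -> z \in E ->
  4 * peval (jump Omega T o u E) z ^+ 2 <= jump_energy K.
Proof.
move=> KT EK zE; have hE : edges_of T E by exists K.
have [e cd [v s]] := ordered_span tT oT KT EK.
have [chi [sc c0 c1 oc]] := edge_bubble R k.
set r := seg (o E).1 (o E).2 (jump Omega T o u E).
have sr : (size r <= k.+1)%N by apply: size_seg; exact: Pk_jump.
have or : forall q : {poly R}, (size q <= k)%N -> I01 (r * q) = 0.
  by apply: (seg_orth s) => q Pq; exact: (CR0_moment tT oT hu hE Pq).
have [_ h] := edge_jump ok sc c0 c1 oc sr or.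
have {}h : 4 * peval (jump Omega T o u E) z ^+ 2 <= I01 (r^`() ^+ 2).
  move: zE; rewrite {1}e => /fset2P[] zE.
    have := h 0 (or_introl erefl); rewrite /r horner_seg scale0r addr0 zE; exact.
  have := h 1 (or_intror erefl); rewrite /r horner_seg scale1r addrC subrK zE; exact.
apply: le_trans h _; rewrite /jump_energy (big_fsetD1 E) //= lerDl.
by apply: sumr_ge0 => E' _; exact: I01_sqr_ge0.
Qed.

Lemma shared_end K K' z y : K \in T -> K' \in T -> K != K' -> z != y ->
  z \in vertices K -> y \in vertices K -> z \in vertices K' -> y \in vertices K' ->
  4 * (peval (u K) z - peval (u K') z) ^+ 2 <= jump_energy K.
Proof.
move=> KT KT' KK' zy zK yK zK' yK'; set E := [fset z; y]%fset.
have EK : E \in edges K by rewrite edge_mem // zK yK.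
have EK' : E \in edges K' by rewrite edge_mem // zK' yK'.
have := jump_end KT EK (fset21 z y).
have [->|->] := jump_inner hO tT oT KT KT' KK' EK EK'; rewrite pevalB //.
by rewrite -sqrrN opprB.
Qed.

Lemma bdry_end K z y : K \in T -> z != y -> z \in vertices K -> y \in vertices K ->
  bdry_edge Omega [fset z; y]%fset -> 4 * peval (u K) z ^+ 2 <= jump_energy K.
Proof.
move=> KT zy zK yK bE; have EK : [fset z; y]%fset \in edges K by rewrite edge_mem // zK yK.
by have := jump_end KT EK (fset21 z y); rewrite (jump_bdry tT oT _ KT EK bE).
Qed.

(** The second common vertex y forces a shared edge at z; triangles that only touch at z are not
    linked. *)
Definition fan_adj z : rel T := fun K K' : T =>
  [&& z \in vertices (val K), z \in vertices (val K'), val K != val K' &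
   has (fun y => (y != z) && (y \in vertices (val K'))) (vertices (val K))].

Definition fan_bdry z : pred T := fun K : T =>
  (z \in vertices (val K)) && `[< exists y, [/\ z != y, y \in vertices (val K) &
    bdry_edge Omega [fset z; y]%fset] >].

(* Triangles that are linked through shared edges at z get a common value, which is 0 when one of
   these edges lies on the boundary. *)
Definition fan_value z (K : T) : R :=
  if [exists K0, connect (fan_adj z) K K0 && fan_bdry z K0] then 0
  else peval (u (val (fingraph.root (fan_adj z) K))) z.

Definition vertex_value K z : R := oapp (fan_value z) 0 (insub K).

Lemma vertex_valueE K (KT : K \in T) z : vertex_value K z = fan_value z [` KT]%fset.
Proof. by rewrite /vertex_value insubT. Qed.

Lemma fan_adj_sym z : symmetric (fan_adj z).
Proof.
move=> K K'; rewrite /fan_adj [val K' == _]eq_sym.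
case: (_ \in vertices (val K)); case: (_ \in vertices (val K')); case: (_ != _) => //=.
apply/hasP/hasP => -[y y1 /andP[yz y2]]; exists y => //; by rewrite yz.
Qed.

Lemma fan_sym z : connect_sym (fan_adj z).
Proof. exact/sym_connect_sym/fan_adj_sym. Qed.

Lemma vertex_value_shared K K' z y : K \in T -> K' \in T -> K != K' -> z != y ->
  z \in vertices K -> y \in vertices K -> z \in vertices K' -> y \in vertices K' ->
  vertex_value K z = vertex_value K' z.
Proof.
move=> KT KT' KK' zy zK yK zK' yK'; rewrite !vertex_valueE /fan_value.
have adj : fan_adj z [` KT]%fset [` KT']%fset.
  rewrite /fan_adj /= zK zK' KK' /=; apply/hasP; exists y => //; by rewrite eq_sym zy.
have c := connect1 adj; have same := same_connect (@fan_sym z) c.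
have -> : [exists K0, connect (fan_adj z) [` KT]%fset K0 && fan_bdry z K0] =
    [exists K0, connect (fan_adj z) [` KT']%fset K0 && fan_bdry z K0].
  by apply: eq_existsb => K0; rewrite same.
by case: ifP => // _; congr (peval (u (val _)) z); apply/(fingraph.rootP (@fan_sym z)).
Qed.

Lemma vertex_value_bdry K z y : K \in T -> z != y -> z \in vertices K -> y \in vertices K ->
  bdry_edge Omega [fset z; y]%fset -> vertex_value K z = 0.
Proof.
move=> KT zy zK yK bE; rewrite vertex_valueE /fan_value ifT //; apply/existsP; exists [` KT]%fset.
by rewrite connect0 /fan_bdry /= zK; apply/asboolP; exists y.
Qed.

Definition star z : {fset tri R} := [fset K in T | z \in vertices K]%fset.

Lemma in_star K z : (K \in star z) = (K \in T) && (z \in vertices K).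
Proof. by rewrite !inE. Qed.

Lemma fan_path z (K : T) p : path (fan_adj z) K p ->
  2 * `|peval (u (val K)) z - peval (u (val (last K p))) z| <=
  \sum_(K' <- belast K p) Num.sqrt (jump_energy (val K')).
Proof.
elim: p K => [|K' p IH] K /=; first by rewrite subrr normr0 mulr0 big_nil.
move=> /andP[/and4P[zK zK' KK' /hasP[y yK /andP[yz yK']]] /IH {}IH]; rewrite big_cons.
have h : 2 * `|peval (u (val K)) z - peval (u (val K')) z| <= Num.sqrt (jump_energy (val K)).
  rewrite -[leLHS]ger0_norm ?mulr_ge0 // -sqrtr_sqr ler_wsqrtr //.
  rewrite exprMn real_normK ?num_real //; have := shared_end (valP K) (valP K') KK' _ zK yK zK' yK'.
  by rewrite eq_sym => /(_ yz); rewrite (_ : 2 ^+ 2 = 4) // -natrX.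
apply: le_trans (lerD h IH); rewrite -mulrDr ler_wpM2l //.
by rewrite -[X in `|X|](subrKA (peval (u (val K')) z)) ler_normD.
Qed.

(** A simple path leads from K to the triangle that fixes the value of its fan and meets each
    triangle of the star at most once. The differences along it telescope, and Cauchy-Schwarz
    contributes the size of the star. *)
Lemma vertex_value_bound K z : K \in T -> z \in vertices K ->
  4 * (vertex_value K z - peval (u K) z) ^+ 2 <= (size (star z))%:R * \sum_(K' <- star z) jump_energy K'.
Proof.
move=> KT zK; rewrite vertex_valueE; set K1 := [` KT]%fset.
have zpath p : path (fan_adj z) K1 p -> forall K' : T, K' \in K1 :: p -> z \in vertices (val K').
  have zK1 : z \in vertices (val K1) := zK.
  elim: p (K1) zK1 => [|K2 p IH] K0 zK0 /=; first by move=> _ K'; rewrite mem_seq1 => /eqP ->.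
  move=> /andP[/and4P[_ zK2 _ _] /(IH _ zK2) h] K'; rewrite in_cons => /predU1P[-> //|]; exact: h.
have sq0 L : 0 <= Num.sqrt (jump_energy L) by exact: sqrtr_ge0.
(* e is the common value: either that of u at the last triangle, or 0 when this triangle has a
   boundary edge at z. *)
have main p e : path (fan_adj z) K1 p -> uniq (K1 :: p) ->
    2 * `|peval (u (val (last K1 p))) z - e| <= Num.sqrt (jump_energy (val (last K1 p))) ->
    2 * `|e - peval (u K) z| <= \sum_(K' <- star z) Num.sqrt (jump_energy K').
  move=> pp up he; apply: (@le_trans _ _ (\sum_(K' <- map val (K1 :: p)) Num.sqrt (jump_energy K'))); last first.
    apply: ler_sum_subset => //; first by rewrite map_inj_uniq //; exact: val_inj.
    move=> _ /mapP[K' K'p ->]; rewrite in_star (zpath p pp K' K'p) andbT; exact: valP.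
  have h := lerD he (fan_path pp).
  rewrite big_map lastI -cats1 big_cat big_seq1 [leRHS]addrC; apply: le_trans h.
  rewrite -mulrDr ler_wpM2l // [X in _ <= X + _]distrC [X in _ <= _ + X]distrC.
  exact: ler_distD.
have {}main p e : path (fan_adj z) K1 p -> uniq (K1 :: p) ->
    2 * `|peval (u (val (last K1 p))) z - e| <= Num.sqrt (jump_energy (val (last K1 p))) ->
    4 * (e - peval (u K) z) ^+ 2 <= (size (star z))%:R * \sum_(K' <- star z) jump_energy K'.
  move=> pp up he; have {}main := main p e pp up he.
  have -> : 4 * (e - peval (u K) z) ^+ 2 = (2 * `|e - peval (u K) z|) ^+ 2.
    by rewrite exprMn real_normK ?num_real // -natrX.
  apply: (@le_trans _ _ ((\sum_(K' <- star z) Num.sqrt (jump_energy K')) ^+ 2)).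
    by rewrite ler_pXn2r ?nnegrE ?mulr_ge0 // sumr_ge0.
  apply: le_trans (sqr_sum_seq_le _ _) _; rewrite ler_wpM2l //.
  by apply: ler_sum => L _; rewrite sqr_sqrtr // jump_energy_ge0.
rewrite /fan_value; case: ifP => [/existsP[K0 /andP[/connectP[p pp e]]]|_].
  case/shortenP: pp e => p' pp' up' _ e; rewrite e => /andP[zK0 /asboolP[y [zy yK0 bE]]].
  apply: (main p') => //; rewrite subr0 -[leLHS]ger0_norm ?mulr_ge0 // -sqrtr_sqr ler_wsqrtr //.
  rewrite exprMn real_normK ?num_real //.
  have := bdry_end (valP (last K1 p')) zy zK0 yK0 bE; by rewrite (_ : 2 ^+ 2 = 4) // -natrX.
have /connectP[p pp e] := connect_root (fan_adj z) K1.
case/shortenP: pp e => p' pp' up' _ e; rewrite e.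
by apply: (main p') => //; rewrite subrr normr0 mulr0.
Qed.

End Fans.

(** * Consequences of shape regularity for edges and stars *)

Section ShapeRegularity.
Variable R : realType.
Implicit Types (z a b x c d v w y : pt R) (K L : tri R).
Local Notation mR := (measurableTypeR R).
Local Notation mP := (mR * mR)%type.

Lemma norm2_le x : norm2 x <= `|x.1| + `|x.2|.
Proof.
rewrite -[leRHS]ger0_norm ?addr_ge0 // -sqrtr_sqr /norm2 ler_wsqrtr // /dot -!expr2.
rewrite -(real_normK (num_real x.1)) -(real_normK (num_real x.2)).
by have := mulr_ge0 (normr_ge0 x.1) (normr_ge0 x.2); nra.
Qed.

Lemma norm2_ge x : `|x.1| <= norm2 x /\ `|x.2| <= norm2 x.
Proof. by rewrite /norm2 /dot -!expr2 -!sqrtr_sqr !ler_wsqrtr ?lerDl ?lerDr ?sqr_ge0. Qed.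

Lemma diam_ge K c d : Defs.nondegenerate K -> tset K c -> tset K d -> norm2 (d - c) <= diam (tset K).
Proof.
move=> nK Kc Kd; apply: ub_le_sup; last by exists (d, c).
have [v [a [b s]]] := spans_ex nK; have [M hM] := tset_box (proj2 s).
exists (M + M + (M + M)) => _ [[x y] [/= Kx Ky] <-].
have [x1 x2] : box M x by apply: hM; rewrite -(spans_tset s).
have [y1 y2] : box M y by apply: hM; rewrite -(spans_tset s).
apply: le_trans (norm2_le _) _; apply: lerD.
  exact: le_trans (ler_normB _ _) (lerD x1 y1).
exact: le_trans (ler_normB _ _) (lerD x2 y2).
Qed.

(** Along the unit normal of cd the coordinate of v changes at the rate |d - c| / |Det|, and over a
    diameter of the disc it stays in [0, 1]. *)
Lemma inscribed_disc K v c d (r : R) x : spans K v c d -> 0 <= r ->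
  [set y | norm2 (y - x) <= r] `<=` tset K -> 2 * r * norm2 (d - c) <= `|Det v c d|.
Proof.
move=> s r0 disc; have D0 := proj2 s; have Dp : 0 < `|Det v c d| by rewrite normr_gt0.
have [_ _ cd] := spans_neq s.
have l0 : 0 < norm2 (d - c) by rewrite norm2_gt0 // subr_eq0 eq_sym.
have l2 := norm2_sqr (d - c).
pose n := (norm2 (d - c))^-1 *: rot90 (d - c).
have nn (e : R) : norm2 (e *: n) = `|e|.
  rewrite -sqrtr_sqr /norm2; congr Num.sqrt; rewrite /dot /n /rot90 /= /GRing.scale /=.
  transitivity (e ^+ 2 * ((norm2 (d - c))^-1 ^+ 2 * ((d - c).1 ^+ 2 + (d - c).2 ^+ 2))).
    by rewrite /=; ring.
  by rewrite -l2 -exprMn mulVf ?gt_eqF // expr1n mulr1.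
have bcn (e : R) : bc v c d (x + e *: n) = bc v c d x + e * (norm2 (d - c) / Det v c d).
  apply: (canLR (mulfK D0)); rewrite mulrDl /bc divfK // -mulrA divfK //.
  rewrite -[norm2 (d - c) in RHS](mulfK (lt0r_neq0 l0)) -expr2 l2.
  by rewrite /Det /det2 /n /rot90 /= /GRing.scale /=; field; rewrite gt_eqF.
have bnd (e : R) : `|e| <= r -> 0 <= bc v c d (x + e *: n) <= 1.
  move=> er; apply: bc_bounds => //; rewrite -(spans_tset s); apply: disc.
  by rewrite /= addrAC subrr add0r nn.
have rr : `|r| <= r by rewrite ger0_norm.
have rr' : `|- r| <= r by rewrite normrN.
have /andP[h1 h2] := bnd _ rr; have /andP[h3 h4] := bnd _ rr'.
have h : `|2 * r * (norm2 (d - c) / Det v c d)| <= 1.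
  rewrite ler_norml; rewrite !bcn in h1 h2 h3 h4.
  by move: h1 h2 h3 h4; move: (bc v c d x) (norm2 _ / _) => e f; lra.
move: h; rewrite mulrA normrM normfV ler_pdivrMr // mul1r.
by rewrite ger0_norm // !mulr_ge0 // ltW.
Qed.

(** One factor |d - c| is at most the diameter, the other at most |Det| over the inner diameter, by
    [inscribed_disc]. *)
Lemma shape_edge K v c d : Defs.nondegenerate K -> spans K v c d ->
  norm2 (d - c) ^+ 2 <= diam (tset K) / indiam (tset K) * `|Det v c d|.
Proof.
move=> nK s; have D0 := proj2 s; have [_ _ cd] := spans_neq s.
have [_ cK dK] := spans_mem s.
have l0 : 0 < norm2 (d - c) by rewrite norm2_gt0 // subr_eq0 eq_sym.
have hd := diam_ge nK (vertex_tset nK cK) (vertex_tset nK dK).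
set S := [set 2 * r | r in [set r | 0 <= r /\ exists c, [set x | norm2 (x - c) <= r] `<=` tset K]].
have ubS : ubound S (`|Det v c d| / norm2 (d - c)).
  by move=> _ [r [r0 [x disc]] <-]; rewrite ler_pdivlMr //; exact: (inscribed_disc s r0 disc).
have [r r0 Sr] : exists2 r, 0 < r & S (2 * r).
  have [x] := interior_ex D0; rewrite -(spans_tset s) => /nbhs_ballP[e /= e0 be].
  have e2 : 0 < e / 2 by rewrite divr_gt0.
  exists (e / 2) => //; exists (e / 2) => //; split; first exact: ltW.
  exists x => y /= yx; apply: be; have [h1 h2] := norm2_ge (y - x).
  by split=> /=; rewrite /ball /= distrC; [apply: le_lt_trans h1 _|apply: le_lt_trans h2 _];
    apply: le_lt_trans yx _; rewrite ltr_pdivrMr // ltr_pMr // ltr1n.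
have i0 : 0 < indiam (tset K).
  apply: (@lt_le_trans _ _ (2 * r)); first by rewrite mulr_gt0.
  by apply: ub_le_sup => //; exists (`|Det v c d| / norm2 (d - c)).
have hi : indiam (tset K) * norm2 (d - c) <= `|Det v c d|.
  by rewrite -ler_pdivlMr //; apply: ge_sup ubS; exists (2 * r).
rewrite mulrAC ler_pdivlMr // expr2 -mulrA [norm2 _ * indiam _]mulrC.
by apply: ler_pM => //; rewrite ?mulr_ge0 // ltW.
Qed.

Lemma shape_reg_edge (Omega : set (pt R)) (T : {fset tri R}) K v c d :
  triangulation Omega T -> K \in T -> spans K v c d ->
  norm2 (d - c) ^+ 2 <= shape_reg T * `|Det v c d|.
Proof.
move=> tT KT s; apply: le_trans (shape_edge (triang_nondeg tT KT) s) _.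
rewrite ler_wpM2r // /shape_reg.
exact: (@le_bigmax_seq _ _ _ _ 0 K xpredT (fun K => diam (tset K) / indiam (tset K))).
Qed.

Lemma spans_at K z : Defs.nondegenerate K -> z \in vertices K -> exists a b, spans K z a b.
Proof.
move=> /spans_ex[v [c [d s]]]; have s1 := spans_rot s; have s2 := spans_rot s1.
by rewrite (proj1 s) in_T3 => /or3P[] /eqP ->; [exists c, d|exists d, v|exists v, c].
Qed.

(** A packing argument: let rho be at most every edge length at z and shorten these edges to length
    rho. The cut triangles have disjoint interiors, area at least rho^2 / (2 gamma), and lie in a
    square of side 2 rho. *)
Lemma star_size (Omega : set (pt R)) (T : {fset tri R}) (gamma : R) z :
  triangulation Omega T -> 0 < gamma ->
  (forall K v c d, K \in T -> spans K v c d -> norm2 (d - c) ^+ 2 <= gamma * `|Det v c d|) ->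
  (size (star T z))%:R <= 8 * gamma.
Proof.
move=> tT g0 hg.
have /choice[ab hab] K : exists ab : pt R * pt R, K \in star T z -> spans K z ab.1 ab.2.
  have [|_] := boolP (K \in star T z); last by exists (0, 0).
  rewrite in_star => /andP[KT zK].
  by have [a [b s]] := spans_at (triang_nondeg tT KT) zK; exists (a, b).
have [rho rho0 hrho] : exists2 rho : R, 0 < rho & forall K, K \in star T z ->
    rho <= norm2 ((ab K).1 - z) /\ rho <= norm2 ((ab K).2 - z).
  have pos K : K \in star T z -> 0 < norm2 ((ab K).1 - z) /\ 0 < norm2 ((ab K).2 - z).
    by move=> /hab/spans_neq[n1 n2 _]; rewrite !norm2_gt0 // subr_eq0 eq_sym.
  have h (s : seq (tri R)) : {subset s <= star T z} -> exists2 rho : R, 0 < rho &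
      forall K, K \in s -> rho <= norm2 ((ab K).1 - z) /\ rho <= norm2 ((ab K).2 - z).
    elim: s => [|K s IH] sub; first by exists 1.
    have [|rho rho0 hr] := IH; first by move=> L Ls; apply: sub; rewrite inE Ls orbT.
    have [p1 p2] := pos K (sub K (mem_head _ _)).
    exists (Num.min rho (Num.min (norm2 ((ab K).1 - z)) (norm2 ((ab K).2 - z)))).
      by rewrite !lt_min rho0 p1 p2.
    move=> L; rewrite inE => /predU1P[->|/hr[r1 r2]]; rewrite !ge_min ?lexx ?orbT //.
    by rewrite r1 r2.
  exact: (h (star T z : seq _)).
pose sa K := rho / norm2 ((ab K).1 - z); pose sb K := rho / norm2 ((ab K).2 - z).
pose a' K := z + sa K *: ((ab K).1 - z); pose b' K := z + sb K *: ((ab K).2 - z).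
pose Q K := tset (T3 z (a' K) (b' K)).
have facts K : K \in star T z -> [/\ 0 < sa K <= 1, 0 < sb K <= 1,
    Det z (a' K) (b' K) != 0, rho ^+ 2 / gamma <= `|Det z (a' K) (b' K)| & Q K `<=` tset K].
  move=> Ks; have s := hab K Ks; have [h1 h2] := hrho K Ks; have D0 := proj2 s.
  have la : 0 < norm2 ((ab K).1 - z) by exact: lt_le_trans h1.
  have lb : 0 < norm2 ((ab K).2 - z) by exact: lt_le_trans h2.
  have KT : K \in T by move: Ks; rewrite in_star => /andP[].
  have ga := hg K _ _ _ KT (spans_rot (spans_rot s)).
  have gb := hg K _ _ _ KT (spans_swap (spans_rot s)).
  have sa1 : 0 < sa K <= 1 by rewrite divr_gt0 //= ler_pdivrMr // mul1r.
  have sb1 : 0 < sb K <= 1 by rewrite divr_gt0 //= ler_pdivrMr // mul1r.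
  have /andP[x1 _] := sa1; have /andP[x2 _] := sb1.
  have DE : Det z (a' K) (b' K) = sa K * sb K * Det z (ab K).1 (ab K).2.
    by rewrite /a' /b' /Det /det2 /= /GRing.scale /=; ring.
  have DQ : Det z (a' K) (b' K) != 0.
    by rewrite DE; apply: mulf_neq0 => //; apply: mulf_neq0; rewrite gt_eqF.
  split=> //.
    rewrite DE normrM (ger0_norm (mulr_ge0 (ltW x1) (ltW x2))).
    rewrite (Det_rot2 z) in ga; rewrite (Det_flip (ab K).1 (ab K).2 z) normrN in gb.
    rewrite (_ : Det (ab K).1 (ab K).2 z = Det z (ab K).1 (ab K).2) in gb; last by rewrite Det_rot.
    (* The product of the edge lengths at z bounds the sine of the angle from below, and this
       survives the shortening. *)
    have lab : norm2 ((ab K).1 - z) * norm2 ((ab K).2 - z) <= gamma * `|Det z (ab K).1 (ab K).2|.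
      move: ga gb; move: (norm2 _) (norm2 _) (gamma * _) => p q G hp hq.
      by have := sqr_ge0 (p - q); rewrite sqrrB; lra.
    rewrite ler_pdivrMr // /sa /sb.
    have -> : rho / norm2 ((ab K).1 - z) * (rho / norm2 ((ab K).2 - z)) * `|Det z (ab K).1 (ab K).2| * gamma
       = rho ^+ 2 * ((gamma * `|Det z (ab K).1 (ab K).2|) / (norm2 ((ab K).1 - z) * norm2 ((ab K).2 - z))).
      by field; rewrite !gt_eqF.
    by rewrite ler_peMr ?sqr_ge0 // ler_pdivlMr ?mulr_gt0 // mul1r.
  move=> x /(tsetP _ DQ)[k1 k2 k3]; have nK := triang_nondeg tT KT.
  have [zK aK bK] := spans_mem s.
  have xE := bc_comb x DQ; have sm := bc_sum x DQ.
  pose p := bc (a' K) (b' K) z x * sa K; pose q := bc (b' K) z (a' K) x * sb K.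
  have xE' : x = z + p *: ((ab K).1 - z) + q *: ((ab K).2 - z).
    by rewrite [LHS]xE; apply: pt_ext; rewrite /p /q /a' /b' /= /GRing.scale /=; ring.
  rewrite (spans_tset s) xE'.
  have [e1 [e2 e3]] := bc_vertex p q D0; apply/(tsetP _ D0); rewrite e1 e2 e3.
  move/andP: sa1 => [sa0 sa1]; move/andP: sb1 => [sb0 sb1].
  have p1 : p <= bc (a' K) (b' K) z x by rewrite /p ler_piMr.
  have q1 : q <= bc (b' K) z (a' K) x by rewrite /q ler_piMr.
  have p0 : 0 <= p by rewrite mulr_ge0 // ltW.
  have q0 : 0 <= q by rewrite mulr_ge0 // ltW.
  by split=> //; move: p1 q1 sm k1; lra.
have us : uniq (star T z) by exact: fset_uniq.
have mQ K : K \in star T z -> measurable ((Q K)° : set mP).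
  by move=> /facts[_ _ DQ _ _]; exact: measurable_interior.
have dQ K K' : K \in star T z -> K' \in star T z -> K != K' -> (Q K)° `&` (Q K')° = set0.
  move=> Ks Ks' KK'; apply/seteqP; split=> x // -[Qx Q'x].
  have [_ _ _ _ sK] := facts K Ks; have [_ _ _ _ sK'] := facts K' Ks'.
  move: Ks Ks'; rewrite !in_star => /andP[KT _] /andP[KT' _].
  by rewrite -(mesh_disjoint tT KT KT' KK'); split; [exact: interiorS sK _ Qx|exact: interiorS sK' _ Q'x].
have iQ K : K \in star T z -> (leb2 R).-integrable (Q K)° (EFin \o (fun=> (1 : R))).
  move=> /facts[_ _ DQ _ _]; have := integrable_interior (cst 1) DQ.
  by rewrite (_ : peval (cst 1) = fun=> 1) //; apply/funext => y; rewrite peval_cst.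
have [mU _ eU] := Rintegral_disjoint us mQ dQ iQ.
set U := [set x | _] in mU eU.
pose Bx : set mP := `[(z.1 - rho)%R, (z.1 + rho)%R]%classic `*` `[(z.2 - rho)%R, (z.2 + rho)%R]%classic.
have mB : measurable Bx by apply: measurableX.
have lB : leb2 R Bx = (4 * rho ^+ 2)%:E.
  have L (s : R) : @lebesgue_measure R `[(s - rho)%R, (s + rho)%R]%classic = (2 * rho)%:E.
    rewrite lebesgue_measure_itv /= lte_fin ifT; last by lra.
    by rewrite -EFinD; congr EFin; ring.
  transitivity ((2 * rho)%:E * (2 * rho)%:E)%E; last by rewrite -EFinM; congr EFin; ring.
  rewrite /Bx -[X in X = _]/((@lebesgue_measure R \x @lebesgue_measure R)%E _) product_measure1E //.
  by congr (_ * _)%E; exact: L.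
have UB : U `<=` Bx.
  move=> x [K Ks Qx]; have [sa1 sb1 DQ _ _] := facts K Ks; have s := hab K Ks.
  have [k1 k2 k3] := (tsetP _ DQ).1 (interior_subset Qx).
  have xE := bc_comb x DQ; have sm := bc_sum x DQ; rewrite /Bx /= !in_itv /=.
  have crd (c0 d0 u1 : R) (w1 : R) : 0 < d0 -> `|u1| <= d0 -> w1 = rho / d0 * u1 -> `|w1| <= rho.
    move=> d00 ud ->; rewrite normrM ger0_norm ?divr_ge0 ?(ltW rho0) ?(ltW d00) //.
    by rewrite mulrAC ler_pdivrMr // ler_wpM2l // ltW.
  have [n1 n2 _] := spans_neq s.
  have la : 0 < norm2 ((ab K).1 - z) by rewrite norm2_gt0 // subr_eq0 eq_sym.
  have lb : 0 < norm2 ((ab K).2 - z) by rewrite norm2_gt0 // subr_eq0 eq_sym.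
  have [ga1 ga2] := norm2_ge ((ab K).1 - z); have [gb1 gb2] := norm2_ge ((ab K).2 - z).
  have A1 : `|(a' K - z).1| <= rho.
    by apply: (crd 0 _ _ _ la ga1); rewrite /a' /sa /= /GRing.scale /=; ring.
  have A2 : `|(a' K - z).2| <= rho.
    by apply: (crd 0 _ _ _ la ga2); rewrite /a' /sa /= /GRing.scale /=; ring.
  have B1 : `|(b' K - z).1| <= rho.
    by apply: (crd 0 _ _ _ lb gb1); rewrite /b' /sb /= /GRing.scale /=; ring.
  have B2 : `|(b' K - z).2| <= rho.
    by apply: (crd 0 _ _ _ lb gb2); rewrite /b' /sb /= /GRing.scale /=; ring.
  have conv (p q u1 w1 : R) : 0 <= p -> 0 <= q -> p + q <= 1 -> `|u1| <= rho -> `|w1| <= rho ->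
      `|p * u1 + q * w1| <= rho.
    move=> p0 q0 pq hu hw; apply: le_trans (ler_normD _ _) _; rewrite !normrM (ger0_norm p0) (ger0_norm q0).
    have := ler_wpM2l p0 hu; have := ler_wpM2l q0 hw.
    have : (p + q) * rho <= 1 * rho by rewrite ler_wpM2r // ltW.
    lra.
  have pq : bc (a' K) (b' K) z x + bc (b' K) z (a' K) x <= 1 by move: sm k1; lra.
  move: k2 k3 pq xE; move: (bc (a' K) _ _ x) (bc (b' K) _ _ x) => p q k2 k3 pq xE.
  have e1 : p * (a' K - z).1 + q * (b' K - z).1 = x.1 - z.1.
    by rewrite (congr1 fst xE) /= /GRing.scale /=; ring.
  have e2 : p * (a' K - z).2 + q * (b' K - z).2 = x.2 - z.2.
    by rewrite (congr1 snd xE) /= /GRing.scale /=; ring.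
  have := conv _ _ _ _ k2 k3 pq A1 B1; have := conv _ _ _ _ k2 k3 pq A2 B2.
  rewrite e1 e2 !ler_norml !lerBlDl !lerBrDl => /andP[r1 r2] /andP[r3 r4].
  by move: r1 r3; rewrite !lerBlDl => -> ->; rewrite r2 r4.
have hU : (size (star T z))%:R * (2^-1 * (rho ^+ 2 / gamma)) <= 4 * rho ^+ 2.
  apply: (@le_trans _ _ (Rintegral (leb2 R) U (fun=> 1))).
    rewrite eU; set e := 2^-1 * _.
    have -> : (size (star T z))%:R * e = \sum_(K <- star T z) e.
      by rewrite big_const_seq count_predT iter_addr_0 mulr_natl.
    rewrite big_seq [leRHS]big_seq; apply: ler_sum => K Ks.
    have [_ _ DQ le _] := facts K Ks.
    rewrite Rintegral_cst ?mul1r; last exact: mQ.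
    by rewrite leb2_interior //= ler_wpM2l // invr_ge0.
  rewrite Rintegral_cst // mul1r.
  have le : (leb2 R U <= leb2 R Bx)%E by apply: le_measure; rewrite ?inE.
  have fU : leb2 R U \is a fin_num by rewrite ge0_fin_numE // (le_lt_trans le) // lB ltry.
  by rewrite -lee_fin fineK // -lB.
move: hU; have -> : (size (star T z))%:R * (2^-1 * (rho ^+ 2 / gamma)) = (size (star T z))%:R / gamma * (2^-1 * rho ^+ 2) by field; rewrite gt_eqF.
rewrite (_ : 4 * rho ^+ 2 = 8 * (2^-1 * rho ^+ 2)); last by field.
by rewrite ler_pM2r ?mulr_gt0 ?exprn_gt0 // ler_pdivrMr.
Qed.

End ShapeRegularity.

(** * The correction of degree k + 1 and the fine comparison function *)

Section VertexCorrection.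
Variable R : realType.
Implicit Types (z a b x c d v w y : pt R) (K L : tri R) (q p : poly2 R) (dl : pt R -> R).
Variable chi : {poly R}.

(* If chi is orthogonal to P_k on [0, 1] with chi(0) = 0 and chi(1) = 1, this function has the
   vertex values dl and no edge moments up to degree k. *)
Definition corr dl z a b : poly2 R := cst (dl z) * uni chi (bcp z a b) +
  cst (dl a) * uni chi (bcp a b z) + cst (dl b) * uni chi (bcp b z a).

Lemma bcp_swap z a b : bcp z b a = bcp z a b.
Proof. by rewrite /bcp (Det_flip z a b) invrN cstN; ring. Qed.

Lemma corr_rot dl z a b : corr dl a b z = corr dl z a b.
Proof. by rewrite /corr; ring. Qed.
Lemma corr_swap dl z a b : corr dl z b a = corr dl z a b.
Proof. by rewrite /corr (bcp_swap z a b) (bcp_swap b z a) (bcp_swap a b z); ring. Qed.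

Lemma Pk_corr k dl z a b : (size chi <= k.+2)%N -> Pk k.+1 (corr dl z a b).
Proof.
by move=> sc; do 2?apply: PkD; apply: Pk_cstM; apply: Pk_uni => //; exact: Pk_bcp.
Qed.

Lemma seg_corr dl v c d : chi.[0] = 0 -> Det v c d != 0 ->
  seg c d (corr dl v c d) = dl c *: (chi \Po (1 - 'X)) + dl d *: chi.
Proof.
move=> c0 D0; have [b1 b2 b3] := bc_at D0.
have D1 : Det c d v != 0 by rewrite Det_rot.
have D2 : Det d v c != 0 by rewrite Det_rot2.
have [b4 b5 b6] := bc_at D1; have [b7 b8 b9] := bc_at D2.
rewrite /corr !segD !segM !seg_cst !seg_uni !seg_bcp b2 b3 b4 b5 b7 b9 !mul_polyC.
rewrite subrr !scale0r addr0 comp_polyCr c0 scaler0 add0r sub0r scaleN1r subr0 scale1r add0r.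
by rewrite comp_polyXr.
Qed.

(** The coordinates have derivatives 0, 1 or -1 along the frame, and chi' is bounded on [0, 1], so
    that the constant depends on chi alone. *)
Lemma gr_corr_bound : exists2 C, 0 <= C & forall dl z a b, Det z a b != 0 ->
  J z a b (gr z a b (corr dl z a b)) <= C * `|Det z a b| * (dl z ^+ 2 + dl a ^+ 2 + dl b ^+ 2).
Proof.
have [B hB] := peval_bounded (uni chi^`() (pX : poly2 R)) 1.
have hB1 t : 0 <= t <= 1 -> (chi^`()).[t] ^+ 2 <= B ^+ 2.
  move=> /andP[t0 t1]; have := hB (t, 0) _; rewrite peval_uni pevalX /= => h.
  have {}h : `|(chi^`()).[t]| <= B by apply: h; split; rewrite /= ?normr0 // ger0_norm.
  by rewrite -[leLHS]real_normK ?num_real // ler_pXn2r // nnegrE // (le_trans _ h).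
exists (2 * B ^+ 2); first by rewrite mulr_ge0 ?sqr_ge0.
move=> dl z a b D0; have D1 : Det a b z != 0 by rewrite Det_rot.
have D2 : Det b z a != 0 by rewrite Det_rot2.
set S := dl z ^+ 2 + _ + _.
have -> : 2 * B ^+ 2 * `|Det z a b| * S = 2^-1 * `|Det z a b| * (4 * B ^+ 2 * S) by field.
rewrite -(J_const _ D0); apply: J_le => // x Kx; rewrite peval_cst peval_gr.
have n v e1 e2 : v = e1 *: (a - z) + e2 *: (b - z) ->
    peval (dirD v (corr dl z a b)) x = dl z * (chi^`()).[bc z a b x] * - (e1 + e2) +
      dl a * (chi^`()).[bc a b z x] * e1 + dl b * (chi^`()).[bc b z a x] * e2.
  move=> vE; have e3 : (v.2 * (b.1 - a.1) - v.1 * (b.2 - a.2)) / Det z a b = - (e1 + e2).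
    by apply: (canLR (mulfK D0)); rewrite vE /Det /det2 /= /GRing.scale /=; ring.
  have e4 : (v.2 * (z.1 - b.1) - v.1 * (z.2 - b.2)) / Det z a b = e1.
    by apply: (canLR (mulfK D0)); rewrite vE /Det /det2 /= /GRing.scale /=; ring.
  have e5 : (v.2 * (a.1 - z.1) - v.1 * (a.2 - z.2)) / Det z a b = e2.
    by apply: (canLR (mulfK D0)); rewrite vE /Det /det2 /= /GRing.scale /=; ring.
  rewrite /corr !dirDD !dirD_cstM !dirD_uni !dirD_bcp (Det_rot z a b) (Det_rot2 z a b) e3 e4 e5.
  rewrite (pevalD (_ * _ + _ * _)) (pevalD (_ * _)) !(pevalM (cst _)) !pevalM !peval_cst !peval_uni !peval_bcp.
  by rewrite !mulrA.
rewrite (n (a - z) 1 0) ?(n (b - z) 0 1); try by rewrite scale1r scale0r ?addr0 ?add0r.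
have /andP[? ?] := bc_bounds D0 Kx.
have c1 := hB1 _ (bc_bounds D0 Kx).
have c2 : (chi^`()).[bc a b z x] ^+ 2 <= B ^+ 2.
  by apply: hB1; apply: bc_bounds => //; rewrite tset_rot.
have c3 : (chi^`()).[bc b z a x] ^+ 2 <= B ^+ 2.
  by apply: hB1; apply: bc_bounds => //; rewrite (tset_rot a b z) tset_rot.
move: c1 c2 c3; move: (chi^`()).[bc z a b x] (chi^`()).[bc a b z x] (chi^`()).[bc b z a x].
move=> p1 p2 p3 c1 c2 c3.
have m1 := ler_wpM2l (sqr_ge0 (dl z)) c1; have m2 := ler_wpM2l (sqr_ge0 (dl a)) c2.
have m3 := ler_wpM2l (sqr_ge0 (dl b)) c3.
have q1 := sqr_ge0 (dl z * p1 + dl a * p2); have q2 := sqr_ge0 (dl z * p1 + dl b * p3).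
rewrite /S; move: m1 m2 m3 q1 q2; rewrite !(addr0, add0r, mulr1, mulr0, mulrN).
have := mulr_ge0 (sqr_ge0 (dl a)) (sqr_ge0 B); have := mulr_ge0 (sqr_ge0 (dl b)) (sqr_ge0 B).
by lra.
Qed.

End VertexCorrection.

Section Corrector.
Variable R : realType.
Implicit Types (z a b x c d v w y : pt R) (K L : tri R) (q p : poly2 R).
Variables (o : edge R -> pt R * pt R) (Omega : set (pt R)) (T : {fset tri R}) (k : nat).
Variable u : tri R -> poly2 R.
Hypotheses (hO : polygonal_lipschitz_domain Omega) (tT : triangulation Omega T)
  (oT : edge_ordering Omega T o) (ok : odd k) (hu : CR0 Omega T o k u).
Variable chi : {poly R}.
Hypotheses (sc : (size chi <= k.+2)%N) (c0 : chi.[0] = 0) (c1 : chi.[1] = 1)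
  (oc : forall q : {poly R}, (size q <= k)%N -> I01 (chi * q) = 0).

Local Notation V := (vertex_value Omega T u).
Definition vdefect K y : R := V K y - peval (u K) y.

Variables (That : {fset tri R}) (fa fb : tri R -> pt R) (ft : tri R -> btree).
Hypotheses (tH : triangulation Omega That) (oH : edge_ordering Omega That o).
Hypothesis F : forest T That fa fb ft.

Definition defect K : poly2 R := corr chi (vdefect K) K.1 (fa K) (fb K).
Local Notation kl := (kleaves fa fb ft).

Lemma defectE K v c d : K \in T -> spans K v c d -> defect K = corr chi (vdefect K) v c d.
Proof.
move=> KT s; apply: (@spans_sym _ (fun x y w => defect K = corr chi (vdefect K) x y w) K K.1 (fa K) (fb K)) => //.
- by move=> x y w ->; apply/esym; apply: corr_rot.
- by move=> x y w ->; apply/esym; apply: corr_swap.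
- exact: (kspans F).
Qed.

Lemma seg_defect K c d : K \in T -> c != d -> c \in vertices K -> d \in vertices K ->
  seg c d (defect K) = vdefect K c *: (chi \Po (1 - 'X)) + vdefect K d *: chi.
Proof.
move=> KT cd cK dK; have [v s] := spans_edge (triang_nondeg tT KT) cd cK dK.
by rewrite (defectE KT s) seg_corr //; case: s.
Qed.

Lemma defect_orth K c d q : K \in T -> c != d -> c \in vertices K -> d \in vertices K ->
  Pk k.-1 q -> I01 (seg c d (defect K * q)) = 0.
Proof.
move=> KT cd cK dK Pq; rewrite segM seg_defect //.
have sq : (size (seg c d q) <= k)%N by have := size_seg c d Pq; case: (k) ok.
rewrite mulrDl -!scalerAl I01D !I01Z oc // mulr0 addr0.
rewrite -I01_rev comp_polyM -comp_polyA (_ : (1 - 'X) \Po (1 - 'X) = 'X); last first.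
  by rewrite comp_polyB -[1]polyC1 comp_polyC comp_polyX polyC1; ring.
rewrite comp_polyXr seg_rev oc ?mulr0 //.
by have := size_seg d c Pq; case: (k) ok.
Qed.

Lemma edge_expansion v c d K p : spans K v c d -> Pk k p ->
  (forall q, Pk k.-1 q -> I01 (seg c d (p * q)) = 0) ->
  seg c d p = peval p c *: (chi \Po (1 - 'X)) + peval p d *: chi.
Proof.
move=> s hp orth; have [e _] := edge_jump ok sc c0 c1 oc (size_seg c d hp) (seg_orth ok s orth).
by rewrite {1}e !horner_seg scale0r scale1r addr0 (addrC c) subrK.
Qed.

(** The jump of u on a shared edge is fixed by its two end values ([edge_expansion]), and the
    corrections cancel exactly these, since both triangles use the same vertex values. *)
Lemma conforming_shared K K' c d : K \in T -> K' \in T -> K != K' -> c != d ->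
  c \in vertices K -> d \in vertices K -> c \in vertices K' -> d \in vertices K' ->
  seg c d (u K + defect K) = seg c d (u K' + defect K').
Proof.
move=> KT KT' KK' cd cK dK cK' dK'; have dc : d != c by rewrite eq_sym.
have [v s] := spans_edge (triang_nondeg tT KT) cd cK dK.
have e : seg c d (u K - u K') = peval (u K - u K') c *: (chi \Po (1 - 'X)) + peval (u K - u K') d *: chi.
  apply: (edge_expansion s); first by apply: PkB; exact: (proj1 hu).
  move=> q Pq; rewrite mulrBl segD segN I01B.
  by rewrite (CR0_shared hO tT oT hu KT KT' KK' cd cK dK cK' dK' Pq) subrr.
apply/eqP; rewrite -subr_eq0; apply/eqP; move: e.
rewrite (segD c d (u K) (- _)) segN (segD c d (u K)) (segD c d (u K')) !seg_defect // !pevalB => e.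
rewrite (_ : _ - _ = (seg c d (u K) - seg c d (u K')) +
   (vdefect K c - vdefect K' c) *: (chi \Po (1 - 'X)) + (vdefect K d - vdefect K' d) *: chi); last first.
  by rewrite !scalerBl; ring.
rewrite e /vdefect.
rewrite (vertex_value_shared Omega u KT KT' KK' cd cK dK cK' dK').
rewrite (vertex_value_shared Omega u KT KT' KK' dc dK cK dK' cK').
by rewrite !scalerBl; ring.
Qed.

Lemma conforming_bdry K c d : K \in T -> c != d -> c \in vertices K -> d \in vertices K ->
  bdry_edge Omega [fset c; d]%fset -> seg c d (u K + defect K) = 0.
Proof.
move=> KT cd cK dK bE; have dc : d != c by rewrite eq_sym.
have bE' : bdry_edge Omega [fset d; c]%fset by rewrite fsetUC.
have [v s] := spans_edge (triang_nondeg tT KT) cd cK dK.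
have e := edge_expansion s (proj1 hu _ KT) (fun q Pq => CR0_bdry tT oT hu KT cd cK dK bE Pq).
rewrite segD e seg_defect // /vdefect (vertex_value_bdry u KT cd cK dK bE).
by rewrite (vertex_value_bdry u KT dc dK cK bE') !sub0r !scaleNr; ring.
Qed.

Lemma seg_sub c d (s r : R) p p' : seg c d p = seg c d p' ->
  seg (c + s *: (d - c)) (c + r *: (d - c)) p = seg (c + s *: (d - c)) (c + r *: (d - c)) p'.
Proof.
move=> e; apply: poly_ext => t; rewrite !horner_seg.
rewrite (_ : _ + t *: _ = c + (s + t * (r - s)) *: (d - c)); last first.
  by apply: pt_ext; rewrite /= /GRing.scale /=; ring.
by rewrite -!horner_seg e.
Qed.

(** A fine edge between leaves of two coarse triangles lies in the common edge of these triangles,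
    where [conforming_shared] applies. *)
Lemma leaf_edge_shared L L' K K' c d : K \in T -> K' \in T -> L \in kl K -> L' \in kl K' ->
  c != d -> c \in vertices L -> d \in vertices L -> c \in vertices L' -> d \in vertices L' ->
  seg c d (u K + defect K) = seg c d (u K' + defect K').
Proof.
move=> KT KT' LK LK' cd cL dL cL' dL'; have [->//|KK'] := eqVneq K K'.
have nK := triang_nondeg tT KT.
have nL := kleaf_nondeg F KT LK; have nL' := kleaf_nondeg F KT' LK'.
have Kc : tset K c by apply: (kleaf_sub F KT LK); exact: vertex_tset.
have Kd : tset K d by apply: (kleaf_sub F KT LK); exact: vertex_tset.
have Kc' : tset K' c by apply: (kleaf_sub F KT' LK'); exact: vertex_tset.
have Kd' : tset K' d by apply: (kleaf_sub F KT' LK'); exact: vertex_tset.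
have [p [q [[pK qK pK' qK'] e]]] := meet_common nK (triang_conforming tT KT KT' KK') Kc Kc'.
have : hull [fset p; q]%fset c by rewrite -e.
have : hull [fset p; q]%fset d by rewrite -e.
move=> /hull2P[r _ dE] /hull2P[s _ cE].
have pq : p != q by apply: contraNneq cd => pq; rewrite cE dE pq subrr !scaler0.
by rewrite cE dE; apply: seg_sub; exact: conforming_shared.
Qed.

(** The midpoint of cd is on the boundary, hence not interior to K, and some coordinate vanishes
    there. This coordinate is nonnegative at c and d, so both lie on one edge pq of K, which is a
    boundary edge because the midpoint would otherwise be in [Omega]. *)
Lemma leaf_edge_bdry L K c d : K \in T -> L \in kl K -> c != d ->
  c \in vertices L -> d \in vertices L -> hull [fset c; d]%fset `<=` bdry Omega ->
  seg c d (u K + defect K) = 0.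
Proof.
move=> KT LK cd cL dL bE; have nK := triang_nondeg tT KT; have nL := kleaf_nondeg F KT LK.
have Kc : tset K c by apply: (kleaf_sub F KT LK); exact: vertex_tset.
have Kd : tset K d by apply: (kleaf_sub F KT LK); exact: vertex_tset.
pose m := c + 2^-1 *: (d - c).
have bm : bdry Omega m by apply: bE; apply/hull2P; exists 2^-1 => //; exact: half01.
have face v (p q : pt R) : spans K v p q -> bc v p q m <= 0 -> seg c d (u K + defect K) = 0.
  move=> s; have [h1 h2 h3] := (spans_tsetP _ s).1 Kc; have [k1 k2 k3] := (spans_tsetP _ s).1 Kd.
  rewrite /m bc_line => m0; have {}h1 : bc v p q c = 0 by lra.
  have {}k1 : bc v p q d = 0 by lra.
  have D0 := proj2 s; have [_ pK qK] := spans_mem s; have [_ _ pq] := spans_neq s.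
  have on y : bc v p q y = 0 -> y = p + bc q v p y *: (q - p).
    move=> y0; rewrite [LHS](bc_comb y D0); have := bc_sum y D0; rewrite y0 add0r => e.
    have -> : bc p q v y = 1 - bc q v p y by rewrite -e; ring.
    by apply: pt_ext; rewrite /= /GRing.scale /=; ring.
  have cE := on _ h1; have dE := on _ k1.
  have sm1 := bc_sum c D0; have sm2 := bc_sum d D0; rewrite h1 in sm1; rewrite k1 in sm2.
  have [bpq|nbpq] := pselect (bdry_edge Omega [fset p; q]%fset).
    have e := conforming_bdry KT pq pK qK bpq.
    by rewrite cE dE (seg_sub _ _ (p' := 0)) ?seg0 // e seg0.
  have [K' [KT' KK' pK' qK']] := edge_neighbour hO tT KT pq pK qK nbpq.
  exfalso; apply: (open_bdry hO _ bm).
  have -> : m = p + (2^-1 * (bc q v p c + bc q v p d)) *: (q - p).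
    by rewrite /m {1 2}cE {1}dE; apply: pt_ext; rewrite /= /GRing.scale /=; field.
  have KK'' : K != K' by rewrite eq_sym.
  apply: (shared_edge_inside hO tT KT KT' KK'' pq pK qK pK' qK').
  have ne : bc q v p c != bc q v p d by apply: contraNneq cd => e; rewrite cE dE e.
  have b1 : bc q v p c <= 1 by lra.
  have b2 : bc q v p d <= 1 by lra.
  by move: ne; rewrite neq_lt => /orP[] ne; apply/andP; split; lra.
have [v [p [q s]]] := spans_ex nK.
have [m1|m1] := lerP (bc v p q m) 0; first exact: face s m1.
have [m2|m2] := lerP (bc p q v m) 0; first exact: face (spans_rot s) m2.
have [m3|m3] := lerP (bc q v p m) 0; first exact: face (spans_rot (spans_rot s)) m3.
exfalso; apply: (open_bdry hO _ bm); apply: (interior_domain hO tT KT).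
exact/(spans_interiorP _ s).
Qed.

End Corrector.

Section FineCorrector.
Variable R : realType.
Implicit Types (z a b x c d v w y : pt R) (K L : tri R) (q p : poly2 R) (t : btree).

(** The factor s is a power of 1/2, whatever the shape of the leaf; it cancels from inequalities
    between forms. *)
Lemma leaf_scaled t z a b L : Det z a b != 0 -> L \in leaves t z a b ->
  exists z' a' b' (s : R), [/\ L = T3 z' a' b', Det z' a' b' != 0, 0 < s &
    forall p, gr z' a' b' p = cst s * gr z a b p].
Proof.
elim: t z a b => [|t1 IH1 t2 IH2] z a b D0 /=.
  rewrite inE => /eqP ->; exists z, a, b, 1; split=> // p.
  by rewrite cst1 mul1r.
have h2 : (0 : R) < 2^-1 by rewrite invr_gt0.
rewrite mem_cat => /orP[/IH1|/IH2].
  case/(_ (Det_child1_neq0 D0)) => z' [a' [b' [s [-> D1 s0 e]]]]; exists z', a', b', (s * 2^-1).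
  by split=> // [|p]; [rewrite mulr_gt0|rewrite e gr_child1 cstM mulrA].
case/(_ (Det_child2_neq0 D0)) => z' [a' [b' [s [-> D1 s0 e]]]]; exists z', a', b', (s * 2^-1).
by split=> // [|p]; [rewrite mulr_gt0|rewrite e gr_child2 cstM mulrA].
Qed.

Lemma kedge_edge (P : pt R -> pt R -> Prop) z a b c d : (forall x y, P x y -> P y x) ->
  P a b -> P b z -> P z a -> c != d -> c \in vertices (T3 z a b) -> d \in vertices (T3 z a b) ->
  P c d.
Proof.
move=> sym p1 p2 p3 cd; have [q1 q2 q3] := And3 (sym _ _ p1) (sym _ _ p2) (sym _ _ p3).
rewrite !in_T3 => /or3P[] /eqP ec /or3P[] /eqP ed; move: cd; rewrite ec ed ?eqxx //.
Qed.

Lemma kedge_moment z a b c d p p' :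
  (forall i, I01 (kedge z a b i p) = I01 (kedge z a b i p')) ->
  c != d -> c \in vertices (T3 z a b) -> d \in vertices (T3 z a b) ->
  I01 (seg c d p) = I01 (seg c d p').
Proof.
move=> h cd cK dK; apply: (@kedge_edge (fun c d => I01 (seg c d p) = I01 (seg c d p')) z a b c d _ _ _ _ cd cK dK).
- by move=> x y; rewrite !(I01_seg_rev x y).
- exact: (h (Ordinal (isT : 0 < 3)%N)).
- exact: (h (Ordinal (isT : 1 < 3)%N)).
- exact: (h (Ordinal (isT : 2 < 3)%N)).
Qed.

Variables (o : edge R -> pt R * pt R) (Omega : set (pt R)) (T : {fset tri R}) (k : nat).
Variable u : tri R -> poly2 R.
Hypotheses (hO : polygonal_lipschitz_domain Omega) (tT : triangulation Omega T)
  (oT : edge_ordering Omega T o) (ok : odd k) (hu : CR0 Omega T o k u).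
Variable chi : {poly R}.
Hypotheses (sc : (size chi <= k.+2)%N) (c0 : chi.[0] = 0) (c1 : chi.[1] = 1)
  (oc : forall q : {poly R}, (size q <= k)%N -> I01 (chi * q) = 0).
Variables (That : {fset tri R}) (fa fb : tri R -> pt R) (ft : tri R -> btree).
Hypotheses (tH : triangulation Omega That) (oH : edge_ordering Omega That o).
Hypothesis F : forest T That fa fb ft.
Variable C : R.
Hypothesis hC : interpolates k k.+1 C.

Local Notation kl := (kleaves fa fb ft).
Local Notation df := (defect Omega T u chi fa fb).
Definition kgr K p := gr K.1 (fa K) (fb K) p.

(** The interpolation on the one-leaf tree, applied to the correction of degree k + 1. Its energy
    bound is in the frame of the leaf and passes to the frame of K by [leaf_scaled]. *)
Lemma leaf_correction K L : K \in T -> L \in kl K -> exists p, [/\ Pk k p,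
  forall c d q, c != d -> c \in vertices L -> d \in vertices L -> Pk k.-1 q ->
    I01 (seg c d (p * q)) = I01 (seg c d (df K * q)) &
  intg (tset L)° (peval (kgr K p)) <= C * intg (tset L)° (peval (kgr K (df K)))].
Proof.
move=> KT LK; have [z [a [b [s [e D0 s0 hs]]]]] := leaf_scaled (proj2 (kspans F KT)) LK.
have [|p [Pp mom _ bnd]] := @hC Lf z a b (fun=> df K) D0 _ I.
  by move=> L' _; exact: Pk_corr.
exists p; split; first exact: Pp.
  move=> c d q cd; rewrite e => cL dL Pq; apply: kedge_moment cd cL dL => i.
  by rewrite mom // emean_kedge.
by move: bnd; rewrite /= !hs !(JZ D0) /J -e mulrCA ler_pM2l.
Qed.

(** On the fine mesh only the edge moments of the corrected function matter: these agree along fine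
    edges, and [leaf_correction] realises them in degree k. *)
Lemma fine_corrector : exists us : tri R -> poly2 R, [/\ CR0 Omega That o k us,
  forall K, K \in T -> ft K = Lf -> us K = u K &
  forall K L, K \in T -> L \in kl K -> ft K <> Lf ->
    intg (tset L)° (peval (kgr K (us L - u K))) <= C * intg (tset L)° (peval (kgr K (df K)))].
Proof.
pose P K L p := [/\ Pk k p,
  forall c d q, c != d -> c \in vertices L -> d \in vertices L -> Pk k.-1 q ->
    I01 (seg c d (p * q)) = I01 (seg c d ((u K + df K) * q)),
  (ft K = Lf -> p = u K) &
  (ft K <> Lf -> intg (tset L)° (peval (kgr K (p - u K))) <= C * intg (tset L)° (peval (kgr K (df K))))].
have ex K L : K \in T -> L \in kl K -> exists p, P K L p.
  move=> KT LK; have Pu := proj1 hu _ KT.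
  (* On an unrefined triangle u itself has the required moments, since the correction has none by
     [defect_orth]. *)
  have [e|ne] := pselect (ft K = Lf).
    exists (u K); split=> // c d q cd cL dL Pq.
    have LE : L = K by move: LK; rewrite /kleaves e inE -(proj1 (forest_tri F KT)) => /eqP.
    rewrite LE in cL dL; rewrite (mulrDl (u K)) (segD c d (u K * q)) I01D.
    by rewrite (defect_orth u tT ok c0 oc F KT cd cL dL Pq) addr0.
  have [p [Pp mom bnd]] := leaf_correction KT LK; exists (u K + p); split=> //.
  - exact: PkD.
  - move=> c d q cd cL dL Pq; rewrite !(mulrDl (u K)) !(segD c d (u K * q)) !I01D mom //.
  - by move=> _; rewrite addrAC subrr add0r.
have /choice[us hus] L : exists p, forall K, K \in T -> L \in kl K -> P K L p.
  have [[K [KT LK]]|nex] := pselect (exists K, K \in T /\ L \in kl K).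
    have [p Pp] := ex K L KT LK; exists p => K' KT' LK'.
    by rewrite (ancestor_unique tT F KT' KT LK' LK).
  by exists 0 => K KT LK; case: nex; exists K.
exists us; split; last 2 first.
- move=> K KT e; have KK : K \in kl K by rewrite /kleaves e inE -(proj1 (forest_tri F KT)).
  by have [_ _ h _] := hus K K KT KK; exact: h.
- by move=> K L KT LK; have [_ _ _ h] := hus L K KT LK.
apply: (CR0_intro hO tH oH).
- by move=> L /(forest_leaves F)[K KT LK]; have [] := hus L K KT LK.
- move=> L L' c d q /(forest_leaves F)[K KT LK] /(forest_leaves F)[K' KT' LK'] LL' cd cL dL cL' dL' Pq.
  have [_ h _ _] := hus L K KT LK; have [_ h' _ _] := hus L' K' KT' LK'.
  rewrite (h _ _ _ cd cL dL Pq) (h' _ _ _ cd cL' dL' Pq).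
  rewrite (segM c d (u K + df K)) (segM c d (u K' + df K')).
  by rewrite (leaf_edge_shared hO tT oT ok hu sc c0 c1 oc F KT KT' LK LK' cd cL dL cL' dL').
- move=> L c d q /(forest_leaves F)[K KT LK] cd cL dL bE Pq; have [_ h _ _] := hus L K KT LK.
  rewrite h // (segM c d (u _ + _)).
  by rewrite (leaf_edge_bdry hO tT oT ok hu sc c0 c1 oc F KT LK cd cL dL bE) mul0r I010.
Qed.

End FineCorrector.

(** * Discrete reliability *)

Section PiecewiseIntegrals.
Variable R : realType.
Implicit Types (z a b x c d v w y : pt R) (K L : tri R) (q p : poly2 R).
Local Notation mR := (measurableTypeR R).
Local Notation mP := (mR * mR)%type.
Local Notation mu := (leb2 R).

(** A class that contains piecewise polynomials, is closed under sums and products, and is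
    integrable on every triangle. *)
Definition tame (h : pt R -> R) : Prop := measurable_fun setT (h : mP -> mR) /\
  forall M, exists C, forall x, box M x -> `|h x| <= C.

Lemma tame_poly p : tame (peval p).
Proof. by split; [exact: measurable_peval|move=> M; exact: peval_bounded]. Qed.

Lemma tameD h h' : tame h -> tame h' -> tame (fun x => h x + h' x).
Proof.
move=> [m1 b1] [m2 b2]; split; first exact: measurable_funD.
move=> M; have [C1 h1] := b1 M; have [C2 h2] := b2 M; exists (C1 + C2) => x bx.
by apply: le_trans (ler_normD _ _) (lerD (h1 _ bx) (h2 _ bx)).
Qed.

Lemma tameM h h' : tame h -> tame h' -> tame (fun x => h x * h' x).
Proof.
move=> [m1 b1] [m2 b2]; split; first exact: measurable_funM.
move=> M; have [C1 h1] := b1 M; have [C2 h2] := b2 M; exists (C1 * C2) => x bx.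
by rewrite normrM ler_pM ?h1 ?h2.
Qed.

Lemma tameN h : tame h -> tame (fun x => - h x).
Proof.
move=> th; have := tameM (tame_poly (cst (-1) : poly2 R)) th.
by congr tame; apply/funext => x; rewrite peval_cst mulN1r.
Qed.

Lemma tame_restrict z a b h : Det z a b != 0 -> tame h ->
  tame (fun x => if `[< (tset (T3 z a b))° x >] then h x else 0).
Proof.
move=> D0 [mh bh]; split; last first.
  move=> M; have [C hC] := bh M; exists `|C| => x bx; case: ifP => _; last by rewrite normr0.
  exact: le_trans (hC _ bx) (ler_norm _).
have mK := measurable_interior D0.
have := (measurable_restrictT (h : mP -> mR) mK).1 (measurable_funTS mh).
congr measurable_fun; apply/funext => x; rewrite /patch.
Qed.

Lemma measurable_poly_ge0 p : measurable ([set x | 0 <= peval p x] : set mP).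
Proof.
rewrite (_ : [set x | _] = setT `&` (peval p : mP -> mR) @^-1` `[0, +oo[); first exact: measurable_peval.
by rewrite setTI; apply/seteqP; split=> x; rewrite /preimage /= in_itv /= andbT.
Qed.

Lemma measurable_hull2 a b : measurable (hull [fset a; b]%fset : set mP).
Proof.
(* A degenerate segment is the set where minus the squared distance is nonnegative; otherwise four
   affine inequalities describe it. *)
have [->|ab] := eqVneq a b.
  rewrite (_ : hull _ = [set x | 0 <= peval (- ((pX - cst b.1) ^+ 2 + (pY - cst b.2) ^+ 2)) x]).
    exact: measurable_poly_ge0.
  apply/seteqP; split=> x; rewrite /= !pevalsE.
    by move=> /hull2P[t _ ->]; rewrite subrr scaler0 addr0 !subrr expr0n addr0 oppr0.
  move=> h; apply/hull2P; exists 0; rewrite ?lexx ?ler01 // scale0r addr0.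
  have h1 := sqr_ge0 (x.1 - b.1); have h2 := sqr_ge0 (x.2 - b.2).
  have e1 : (x.1 - b.1) ^+ 2 = 0 by lra.
  have e2 : (x.2 - b.2) ^+ 2 = 0 by lra.
  apply: pt_ext; apply/eqP; rewrite -subr_eq0 -sqrf_eq0 ?e1 ?e2 //.
pose e := b - a; pose l := e.1 ^+ 2 + e.2 ^+ 2.
have l0 : 0 < l by rewrite /l -norm2_sqr exprn_gt0 // norm2_gt0 // subr_eq0 eq_sym.
pose D : poly2 R := cst e.1 * (pY - cst a.2) - cst e.2 * (pX - cst a.1).
pose P : poly2 R := cst e.1 * (pX - cst a.1) + cst e.2 * (pY - cst a.2).
rewrite (_ : hull _ = [set x | 0 <= peval D x] `&` [set x | 0 <= peval (- D) x] `&`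
    ([set x | 0 <= peval P x] `&` [set x | 0 <= peval (cst l - P) x])).
  by do !apply: measurableI; exact: measurable_poly_ge0.
have DE x : peval D x = e.1 * (x.2 - a.2) - e.2 * (x.1 - a.1) by rewrite /D !pevalsE.
have PE x : peval P x = e.1 * (x.1 - a.1) + e.2 * (x.2 - a.2) by rewrite /P !pevalsE.
apply/seteqP; split=> x /=; rewrite (pevalN D) (pevalB (cst l)) peval_cst DE PE.
  move=> /hull2P[t /andP[t0 t1] ->]; rewrite -/e /= /GRing.scale /=.
  have -> : e.1 * (a.2 + t * e.2 - a.2) - e.2 * (a.1 + t * e.1 - a.1) = 0 by ring.
  have -> : e.1 * (a.1 + t * e.1 - a.1) + e.2 * (a.2 + t * e.2 - a.2) = t * l by rewrite /l; ring.
  rewrite oppr0 lexx subr_ge0 mulr_ge0 ?(ltW l0) //; split=> //; split=> //.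
  by rewrite ler_piMl // ltW.
move=> [[d1 d2] [p1 p2]].
have d0 : e.1 * (x.2 - a.2) - e.2 * (x.1 - a.1) = 0 by lra.
apply/hull2P; exists ((e.1 * (x.1 - a.1) + e.2 * (x.2 - a.2)) / l).
  by rewrite divr_ge0 ?(ltW l0) //= ler_pdivrMr // mul1r -subr_ge0.
rewrite -/e; apply: pt_ext; rewrite /= /GRing.scale /=.
  have -> : (e.1 * (x.1 - a.1) + e.2 * (x.2 - a.2)) / l * e.1 =
      ((x.1 - a.1) * l + e.2 * (e.1 * (x.2 - a.2) - e.2 * (x.1 - a.1))) / l.
    by rewrite /l; field; rewrite gt_eqF.
  by rewrite d0 mulr0 addr0 mulfK ?gt_eqF // addrC subrK.
have -> : (e.1 * (x.1 - a.1) + e.2 * (x.2 - a.2)) / l * e.2 =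
    ((x.2 - a.2) * l - e.1 * (e.1 * (x.2 - a.2) - e.2 * (x.1 - a.1))) / l.
  by rewrite /l; field; rewrite gt_eqF.
by rewrite d0 mulr0 subr0 mulfK ?gt_eqF // addrC subrK.
Qed.

Lemma tame_integrable z a b h : Det z a b != 0 -> tame h ->
  mu.-integrable (tset (T3 z a b))° (EFin \o h).
Proof.
move=> D0 [mh bh]; have [M hM] := tset_box D0; have [C hC] := bh M.
apply: measurable_bounded_integrable.
- exact: measurable_interior.
- by rewrite leb2_interior // ltry.
- exact: measurable_funTS.
- exists C; split=> [|D CD x /interior_subset/hM/hC h1]; first exact: num_real.
  exact: le_trans h1 (ltW CD).
Qed.

Section Mesh.
Variables (Omega : set (pt R)) (T : {fset tri R}).
Hypotheses (hO : polygonal_lipschitz_domain Omega) (tT : triangulation Omega T).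

Lemma pw_interior (v : tri R -> poly2 R) K x : K \in T -> (tset K)° x -> pw T v x = peval (v K) x.
Proof.
move=> KT Kx; rewrite /pw big_mkcond (big_fsetD1 K) //= ifT; last exact/asboolP.
rewrite big_seq big1 ?addr0 // => K'; rewrite !inE => /andP[K'K KT']; case: asboolP => // K'x.
have : set0 x by rewrite -(mesh_disjoint tT KT' KT K'K).
by [].
Qed.

Lemma pw_outside (v : tri R -> poly2 R) x : (forall K, K \in T -> ~ (tset K)° x) -> pw T v x = 0.
Proof.
by move=> h; rewrite /pw big_seq_cond big1 // => K /andP[KT /asboolP]; move/(h _ KT).
Qed.

Lemma tame_pw (v : tri R -> poly2 R) : tame (pw T v).
Proof.
have -> : pw T v = fun x => \sum_(K <- [seq K <- T | K \in T]) (if `[< (tset K)° x >] then peval (v K) x else 0).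
  by apply/funext => x; rewrite /pw big_mkcond [RHS]big_filter [LHS]big_seq.
have h (s : seq (tri R)) : {subset s <= T} ->
    tame (fun x => \sum_(K <- s) (if `[< (tset K)° x >] then peval (v K) x else 0)).
  elim: s => [|K s IH] sub.
    have := tame_poly 0; congr tame; apply/funext => x; by rewrite peval0 big_nil.
  have [|a [b [eK D0]]] := @nondegenerateP _ K; first by apply: (triang_nondeg tT); apply: sub; rewrite inE eqxx.
  have t1 : tame (fun x => if `[< (tset K)° x >] then peval (v K) x else 0).
    by rewrite eK; apply: tame_restrict => //; exact: tame_poly.
  have t2 := IH (fun L Ls => sub L (mem_behead (s := K :: s) Ls)).
  by have := tameD t1 t2; congr tame; apply/funext => x; rewrite big_cons.
by apply: h => K; rewrite mem_filter => /andP[].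
Qed.

(** Off the open triangles g is 0, as piecewise functions are by definition of [pw], so that the
    skeleton contributes nothing. *)
Lemma intg_mesh (g : pt R -> R) :
  (forall x, (forall K, K \in T -> ~ (tset K)° x) -> g x = 0) ->
  (forall K, K \in T -> mu.-integrable (tset K)° (EFin \o g)) ->
  intg Omega g = \sum_(K <- T) intg (tset K)° g.
Proof.
move=> g0 ig; have uT : uniq T by exact: fset_uniq.
have mK K : K \in T -> measurable ((tset K)° : set mP).
  move=> KT; have [a [b [-> D0]]] := nondegenerateP (triang_nondeg tT KT).
  exact: measurable_interior.
have [_ _ <-] := @Rintegral_disjoint R _ (fun K => (tset K)°) T g uT mK (mesh_disjoint tT) ig.
set U := [set x | _]; have sU : U `<=` Omega by move=> x [K KT]; exact: (interior_domain hO tT KT).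
have -> : U = Omega `&` U by apply/seteqP; split=> x; [move=> Ux; split=> //; exact: sU|case].
rewrite Rintegral_mkcondr; apply: eq_Rintegral => x _; rewrite /patch; case: ifPn => // /negP nU.
by rewrite g0 // => K KT Kx; apply: nU; rewrite inE; exists K.
Qed.

(** An open set is its closure minus its boundary: here finitely many triangles minus finitely many
    segments. *)
Lemma measurable_domain : measurable (Omega : set mP).
Proof.
have mU (I : choiceType) (s : seq I) (B : I -> set mP) : (forall i, i \in s -> measurable (B i)) ->
    measurable (\bigcup_(i in [set` s]) B i).
  move=> mB; rewrite bigcup_seq; elim: s mB => [|i s IH] mB; first by rewrite big_nil.
  rewrite big_cons; apply: measurableU; first by apply: mB; rewrite inE eqxx.
  by apply: IH => j js; apply: mB; rewrite inE js orbT.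
have [s sE] := domain_polygonal hO.
have -> : Omega = closure Omega `\` bdry Omega.
  have oO := domain_open hO; apply/seteqP; split=> x.
    by move=> Ox; split; [exact: subset_closure|exact: open_bdry].
  move=> [cx nb]; apply: contrapT => nO; apply: nb; split=> // /interior_subset; exact: nO.
apply: measurableD; last by rewrite sE; apply: mU => ab _; exact: measurable_hull2.
rewrite (triang_cover tT); apply: (mU _ (T : seq (tri R))) => K KT.
have [a [b [-> D0]]] := nondegenerateP (triang_nondeg tT KT); exact: measurable_tset.
Qed.

(** Both integrands are dominated by 2 (f^2 + h^2). *)
Lemma L2_integrable f h K : L2 Omega f -> tame h -> K \in T ->
  mu.-integrable (tset K)° (EFin \o (fun x => f x * h x)) /\
  mu.-integrable (tset K)° (EFin \o (fun x => (f x + h x) ^+ 2)).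
Proof.
move=> [mf if2] th KT; have mO := measurable_domain.
have [a [b [eK D0]]] := nondegenerateP (triang_nondeg tT KT).
have mK : measurable ((tset K)° : set mP) by rewrite eK; exact: measurable_interior.
have sK := interior_domain hO tT KT.
have mfK : measurable_fun ((tset K)° : set mP) (f : mP -> mR) by exact: measurable_funS mf.
have mhK : measurable_fun ((tset K)° : set mP) (h : mP -> mR) by exact: measurable_funTS (proj1 th).
have i1 : mu.-integrable (tset K)° (fun x => (f x ^+ 2)%:E) by exact: integrableS if2.
have i2 : mu.-integrable (tset K)° (fun x => (h x * h x)%:E).
  by rewrite eK; apply: (tame_integrable D0); exact: tameM.
have i3 : mu.-integrable (tset K)° (fun x => (2 * (f x ^+ 2 + h x * h x))%:E).
  have := integrableZl mK 2 (integrableD mK i1 i2); congr (_.-integrable _ _).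
split; apply: le_integrable i3 => //.
- by apply/measurable_EFinP; exact: measurable_funM.
- move=> x _ /=; rewrite lee_fin [leRHS]ger0_norm; last by have := sqr_ge0 (f x); have := sqr_ge0 (h x); nra.
  rewrite ler_norml; have := sqr_ge0 (f x + h x); have := sqr_ge0 (f x - h x).
  have := sqr_ge0 (f x); have := sqr_ge0 (h x); nra.
- by apply/measurable_EFinP; apply: measurable_funX; exact: measurable_funD.
- move=> x _ /=; rewrite lee_fin !ger0_norm ?sqr_ge0 //; last by have := sqr_ge0 (f x); have := sqr_ge0 (h x); nra.
  by have := sqr_ge0 (f x - h x); nra.
Qed.

End Mesh.
End PiecewiseIntegrals.

(** * Interpolation of fine functions in the coarse space *)

Section CoarseInterpolant.
Variable R : realType.
Implicit Types (z a b x c d v w y : pt R) (K L : tri R) (q p : poly2 R) (t : btree).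
Variables (o : edge R -> pt R * pt R) (Omega : set (pt R)) (T : {fset tri R}) (k : nat).
Hypotheses (hO : polygonal_lipschitz_domain Omega) (tT : triangulation Omega T)
  (oT : edge_ordering Omega T o) (ok : odd k).
Variables (That : {fset tri R}) (fa fb : tri R -> pt R) (ft : tri R -> btree).
Hypotheses (tH : triangulation Omega That) (oH : edge_ordering Omega That o).
Hypothesis F : forest T That fa fb ft.

Local Notation kl := (kleaves fa fb ft).
Definition kJ K (G : tri R -> poly2 R) : R := Jt (ft K) K.1 (fa K) (fb K) G.

Lemma CR0_sub (u u' : tri R -> poly2 R) : CR0 Omega That o k u -> CR0 Omega That o k u' ->
  CR0 Omega That o k (fun L => u L - u' L).
Proof.
move=> hu hu'; apply: (CR0_intro hO tH oH).
- by move=> L LT; apply: PkB; [exact: (proj1 hu)|exact: (proj1 hu')].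
- move=> L L' c d q LT LT' LL' cd cL dL cL' dL' Pq; rewrite !mulrBl !segD !segN !I01B.
  by rewrite (CR0_shared hO tH oH hu LT LT' LL' cd cL dL cL' dL' Pq)
    (CR0_shared hO tH oH hu' LT LT' LL' cd cL dL cL' dL' Pq).
- move=> L c d q LT cd cL dL bE Pq; rewrite mulrBl segD segN I01B.
  by rewrite (CR0_bdry tH oH hu LT cd cL dL bE Pq) (CR0_bdry tH oH hu' LT cd cL dL bE Pq) subrr.
Qed.

Variables (w : tri R -> poly2 R) (C : R).
Hypotheses (hw : CR0 Omega That o k w) (hC : interpolates k k.+1 C) (C0 : 0 <= C).

Lemma kl_That K L : K \in T -> L \in kl K -> L \in That.
Proof. exact: (kleaf_That F). Qed.

Lemma kcompat K : K \in T -> compat (Pk k.-1) (ft K) K.1 (fa K) (fb K) w.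
Proof.
move=> KT; apply: (tree_compat hO tH oH hw); first exact: (proj2 (kspans F KT)).
by move=> L LK; exact: kl_That LK.
Qed.

Lemma kJ_sum K G : kJ K G = \sum_(L <- kl K) intg (tset L)° (peval (G L)).
Proof. exact: Jt_sum. Qed.

Lemma kJ_ge0 K G : K \in T -> (forall L x, 0 <= peval (G L) x) -> 0 <= kJ K G.
Proof.
move=> KT G0; have D0 := proj2 (kspans F KT).
have := Jt_const (ft K) (0 : R) D0; rewrite mulr0 => <-; apply: Jt_le => // L _ x _ _.
by rewrite peval_cst.
Qed.

(** The moments of p on a coarse edge are dyadic means of w. By [mean_unique] they do not depend on
    the side and by [mean_bdry] they vanish on the boundary, which puts p into the coarse space. *)
Lemma coarse_interpolant : exists p : tri R -> poly2 R, [/\ CR0 Omega T o k p,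
  forall K, K \in T -> ft K = Lf -> p K = w K,
  forall K q i, K \in T -> Pk k.-1 q ->
    tr3 (emean (ft K) K.1 (fa K) (fb K) (fun L => w L - p K) q) i = 0 &
  forall K, K \in T -> kJ K (fun L => (w L - p K) ^+ 2) <=
    C * kJ K (fun L => gr K.1 (fa K) (fb K) (w L))].
Proof.
have Pw := proj1 hw.
have /choice[p hp] K : exists p, K \in T -> [/\ Pk k p, (ft K = Lf -> p = w K),
    (forall q i, Pk k.-1 q -> I01 (kedge K.1 (fa K) (fb K) i (p * q)) =
       tr3 (emean (ft K) K.1 (fa K) (fb K) w q) i) &
    kJ K (fun L => (w L - p) ^+ 2) <= C * kJ K (fun L => gr K.1 (fa K) (fb K) (w L))].
  have [KT|_] := boolP (K \in T); last by exists 0.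
  have KE := proj1 (forest_tri F KT); have D0 := proj2 (kspans F KT).
  (* On an unrefined triangle p is w itself, which localises the residual to refined triangles. *)
  have [e|ne] := pselect (ft K = Lf).
    have KH := leaf_unrefined F KT e; exists (w K) => _; split=> //.
    - exact: Pw.
    - by move=> q i _; rewrite e -emean_kedge /= -KE.
    - rewrite [leLHS](_ : _ = 0); last first.
        rewrite /kJ e /= -KE subrr expr0n /=; have := J_const (0 : R) D0; rewrite mulr0.
        by congr (_ = _); congr J; rewrite /cst /= polyC0.
      rewrite mulr_ge0 //; have := @kJ_ge0 K (fun L => gr K.1 (fa K) (fb K) (w L)) KT; rewrite /kJ e /= -KE; apply.
      by move=> L x; exact: peval_gr_ge0.
  have [|p [Pp mom bnd _]] := @hC (ft K) K.1 (fa K) (fb K) w D0 _ (kcompat KT).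
    by move=> L LK; apply: Pk_le (leqnSn k) _; apply: Pw; exact: kl_That LK.
  by exists p.
have mean K c d q : K \in T -> c != d -> c \in vertices K -> d \in vertices K -> Pk k.-1 q ->
    dyadic_mean w (mem (kl K)) q c d (I01 (seg c d (p K * q))).
  move=> KT cd cK dK Pq; have [_ _ mom _] := hp K KT.
  have KE := proj1 (forest_tri F KT).
  have [h1 h2 h3] := @tree_mean _ w (mem (kl K)) q (ft K) K.1 (fa K) (fb K) (fun _ h => h).
  have e1 := mom q (Ordinal (isT : 0 < 3)%N) Pq; have e2 := mom q (Ordinal (isT : 1 < 3)%N) Pq.
  have e3 := mom q (Ordinal (isT : 2 < 3)%N) Pq; rewrite /kedge /tr3 /= in e1 e2 e3.
  rewrite KE in cK dK.
  apply: (@kedge_edge _ (fun c d => dyadic_mean w (mem (kl K)) q c d (I01 (seg c d (p K * q))))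
    K.1 (fa K) (fb K) c d _ _ _ _ cd cK dK); rewrite ?e1 ?e2 ?e3 //.
  by move=> x y h; rewrite -I01_seg_rev; exact: mean_rev.
exists p; split.
- apply: (CR0_intro hO tT oT).
  + by move=> K KT; have [] := hp K KT.
  + move=> K K' c d q KT KT' KK' cd cK dK cK' dK' Pq.
    apply: (mean_unique hO tH oH hw _ _ _ Pq cd (mean _ _ _ _ KT cd cK dK Pq) (mean _ _ _ _ KT' cd cK' dK' Pq)).
    * by move=> L; exact: kl_That.
    * by move=> L; exact: kl_That.
    * move=> L LK; apply/negP => LK'; move: KK'; rewrite (ancestor_unique tT F KT KT' LK LK').
      by rewrite eqxx.
  + move=> K c d q KT cd cK dK bE Pq.
    apply: (mean_bdry tH oH hw _ Pq cd bE (mean _ _ _ _ KT cd cK dK Pq)).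
    by move=> L; exact: kl_That.
- by move=> K KT; have [] := hp K KT.
- move=> K q i KT Pq; have [_ _ mom _] := hp K KT.
  have := tr3D (emean (ft K) K.1 (fa K) (fb K) (fun L => w L - p K) q)
    (emean (ft K) K.1 (fa K) (fb K) (fun=> p K) q) i.
  rewrite -emeanD emean_polyE mom //.
  rewrite (_ : (fun L => w L - p K + p K) = w); last by apply/funext => L; rewrite subrK.
  by move/eqP; rewrite -[X in X == _]add0r (inj_eq (addIr _)) eq_sym => /eqP.
- by move=> K KT; have [] := hp K KT.
Qed.

End CoarseInterpolant.

Section FineIntegrals.
Variable R : realType.
Implicit Types (z a b x c d v y : pt R) (K L : tri R) (q p : poly2 R) (t : btree).
Local Notation mu := (leb2 R).
Variables (Omega : set (pt R)) (T : {fset tri R}).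
Hypotheses (hO : polygonal_lipschitz_domain Omega) (tT : triangulation Omega T).
Variables (That : {fset tri R}) (fa fb : tri R -> pt R) (ft : tri R -> btree).
Hypotheses (tH : triangulation Omega That).
Hypothesis F : forest T That fa fb ft.
Local Notation kl := (kleaves fa fb ft).

Lemma intg_fine (g : pt R -> R) (G : tri R -> tri R -> pt R -> R) :
  (forall x, (forall K, K \in T -> ~ (tset K)° x) -> g x = 0) ->
  (forall K, K \in T -> mu.-integrable (tset K)° (EFin \o g)) ->
  (forall K L x, K \in T -> L \in kl K -> (tset L)° x -> g x = G K L x) ->
  intg Omega g = \sum_(K <- T) \sum_(L <- kl K) intg (tset L)° (G K L).
Proof.
move=> g0 ig gG; rewrite (intg_mesh hO tT g0 ig) big_seq [RHS]big_seq; apply: eq_bigr => K KT.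
have [KE D0] := forest_tri F KT; have iK := ig K KT; rewrite {1}KE in iK.
rewrite {1}KE (Rintegral_tree (ft K) D0 iK) big_seq [RHS]big_seq; apply: eq_bigr => L LK.
by apply: eq_Rintegral => x; rewrite inE => Lx; exact: gG.
Qed.

Lemma pw_fine (v : tri R -> poly2 R) K L x : K \in T -> L \in kl K -> (tset L)° x ->
  pw That v x = peval (v L) x.
Proof. by move=> KT LK Lx; rewrite (pw_interior tH _ (kleaf_That F KT LK) Lx). Qed.

Lemma pw_coarse (v : tri R -> poly2 R) K L x : K \in T -> L \in kl K -> (tset L)° x ->
  pw T v x = peval (v K) x.
Proof.
move=> KT LK Lx; apply: (pw_interior tT _ KT); apply: interiorS Lx; exact: (kleaf_sub F KT LK).
Qed.

Lemma pw_fine_outside (v : tri R -> poly2 R) x :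
  (forall K, K \in T -> ~ (tset K)° x) -> pw That v x = 0.
Proof.
move=> h; apply: pw_outside => L /(forest_leaves F)[K KT LK] Lx; apply: (h K KT).
by apply: interiorS Lx; exact: (kleaf_sub F KT LK).
Qed.

Lemma tame_integrableK K h : K \in T -> tame h -> mu.-integrable (tset K)° (EFin \o h).
Proof.
move=> KT th; have [a [b [-> D0]]] := nondegenerateP (triang_nondeg tT KT).
exact: tame_integrable.
Qed.

End FineIntegrals.

(** * Comparison with the estimator *)

Section Estimator.
Variable R : realType.
Implicit Types (z a b x c d v y : pt R) (K L : tri R) (q p r : poly2 R).

Lemma dxB p q : dx (p - q) = dx p - dx q.
Proof. by apply: (addIr (dx q)); rewrite -dxD !subrK. Qed.

Lemma dyB p q : dy (p - q) = dy p - dy q.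
Proof. by apply: (addIr (dy q)); rewrite -dyD !subrK. Qed.

Definition gdot p q : poly2 R := dx p * dx q + dy p * dy q.

Lemma peval_gdot p q x : peval (gdot p q) x =
  peval (dx p) x * peval (dx q) x + peval (dy p) x * peval (dy q) x.
Proof. by rewrite /gdot pevalD !pevalM. Qed.

Lemma gdotBl p q r : gdot (p - q) r = gdot p r - gdot q r.
Proof. by rewrite /gdot dxB dyB; ring. Qed.

Lemma gdotBr p q r : gdot p (q - r) = gdot p q - gdot p r.
Proof. by rewrite /gdot dxB dyB; ring. Qed.

Lemma gdot_ge0 p x : 0 <= peval (gdot p p) x.
Proof. by rewrite peval_gdot -!expr2 addr_ge0 // sqr_ge0. Qed.

Lemma gr_le_gdot (g : R) z a b p x : norm2 (a - z) ^+ 2 <= g * `|Det z a b| ->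
  norm2 (b - z) ^+ 2 <= g * `|Det z a b| ->
  peval (gr z a b p) x <= 2 * g * `|Det z a b| * peval (gdot p p) x.
Proof.
move=> ha hb; rewrite peval_gr peval_gdot !peval_dirD.
set X := peval (dx p) x; set Y := peval (dy p) x.
have CS v : (v.1 * X + v.2 * Y) ^+ 2 <= norm2 v ^+ 2 * (X * X + Y * Y).
  by rewrite norm2_sqr; have := sqr_ge0 (v.1 * Y - v.2 * X); nra.
have S0 : 0 <= X * X + Y * Y by rewrite -!expr2 addr_ge0 // sqr_ge0.
have h1 := CS (a - z); have h2 := CS (b - z).
have h3 := ler_wpM2r S0 ha; have h4 := ler_wpM2r S0 hb.
apply: le_trans (lerD h1 h2) _; apply: le_trans (lerD h3 h4) _.
by rewrite le_eqVlt; apply/orP; left; apply/eqP; ring.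
Qed.

(** Cramer's rule recovers the gradient from the derivatives along the two sides. *)
Lemma gdot_le_gr (g : R) z a b p x : Det z a b != 0 -> norm2 (a - z) ^+ 2 <= g * `|Det z a b| ->
  norm2 (b - z) ^+ 2 <= g * `|Det z a b| ->
  `|Det z a b| * peval (gdot p p) x <= 2 * g * peval (gr z a b p) x.
Proof.
move=> D0 ha hb; have Dp : 0 < `|Det z a b| by rewrite normr_gt0.
rewrite peval_gr peval_gdot !peval_dirD -(ler_pM2l Dp) mulrA -expr2 real_normK ?num_real //.
set X := peval (dx p) x; set Y := peval (dy p) x.
set A := (a - z).1 * X + (a - z).2 * Y; set B := (b - z).1 * X + (b - z).2 * Y.
have e1 : Det z a b * X = (b - z).2 * A - (a - z).2 * B by rewrite /Det /det2 /A /B; ring.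
have e2 : Det z a b * Y = (a - z).1 * B - (b - z).1 * A by rewrite /Det /det2 /A /B; ring.
have -> : Det z a b ^+ 2 * (X * X + Y * Y) = (Det z a b * X) ^+ 2 + (Det z a b * Y) ^+ 2 by ring.
rewrite e1 e2.
have h1 : ((b - z).2 * A - (a - z).2 * B) ^+ 2 + ((a - z).1 * B - (b - z).1 * A) ^+ 2 <=
    2 * (norm2 (b - z) ^+ 2 * A ^+ 2 + norm2 (a - z) ^+ 2 * B ^+ 2).
  rewrite !norm2_sqr; have := sqr_ge0 ((b - z).2 * A + (a - z).2 * B).
  by have := sqr_ge0 ((a - z).1 * B + (b - z).1 * A); nra.
apply: le_trans h1 _; have h3 := ler_wpM2r (sqr_ge0 B) ha; have h4 := ler_wpM2r (sqr_ge0 A) hb.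
have -> : `|Det z a b| * (2 * g * (A ^+ 2 + B ^+ 2)) =
  2 * (g * `|Det z a b| * A ^+ 2 + g * `|Det z a b| * B ^+ 2) by ring.
by rewrite ler_pM2l // lerD.
Qed.

Variables (o : edge R -> pt R * pt R) (Omega : set (pt R)) (T : {fset tri R}).
Variable u : tri R -> poly2 R.
Hypotheses (tT : triangulation Omega T) (oT : edge_ordering Omega T o).
Variable g : R.
Hypotheses (g0 : 0 < g) (hg : forall K v c d, K \in T -> spans K v c d ->
  norm2 (d - c) ^+ 2 <= g * `|Det v c d|).

Lemma area_span K v c d : spans K v c d -> 2^-1 * `|Det v c d| <= area (tset K).
Proof. by move=> s; rewrite (spans_tset s); apply: area_ge; case: s. Qed.

Lemma area_ge0 K : 0 <= area (tset K).
Proof. by rewrite /area fine_ge0. Qed.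

Lemma edge_intg_ge0 E (h : pt R -> R) : (forall x, 0 <= h x) -> 0 <= edge_intg o E h.
Proof.
move=> h0; apply: mulr_ge0; first by rewrite /elen sqrtr_ge0.
by apply: Rintegral_ge0 => t _; exact: h0.
Qed.

Lemma nu2_ge0 K : 0 <= nu2 Omega T o u K.
Proof.
apply: mulr_ge0; first exact: sqrtr_ge0.
by apply: sumr_ge0 => E _; apply: edge_intg_ge0 => x; exact: sqr_ge0.
Qed.

Lemma mu2_volume K f : area (tset K) * intg (tset K)° (fun x => (f x + peval (lapl (u K)) x) ^+ 2)
  <= mu2 Omega T o u K f.
Proof.
rewrite lerDl; apply: mulr_ge0; first exact: sqrtr_ge0.
by apply: sumr_ge0 => E _; apply: edge_intg_ge0 => x; exact: sqr_ge0.
Qed.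

Lemma mu2_ge0 K f : 0 <= mu2 Omega T o u K f.
Proof.
apply: le_trans (mu2_volume K f); apply: mulr_ge0; first exact: area_ge0.
by apply: Rintegral_ge0 => x _; exact: sqr_ge0.
Qed.

Lemma tangential_jump E x : dot (grad_jump Omega T o u E x) (tangent o E) =
  (elen o E)^-1 * peval (dirD ((o E).2 - (o E).1) (jump Omega T o u E)) x.
Proof.
have -> : grad_jump Omega T o u E x = (peval (dx (jump Omega T o u E)) x, peval (dy (jump Omega T o u E)) x).
  by rewrite /grad_jump /jump; case: ifP => _; rewrite ?dxB ?dyB.
by rewrite peval_dirD /dot /tangent /= /GRing.scale /=; ring.
Qed.

(** The weights are |E| on the left and the square root of the area in [nu2]; shape regularity gives
    |E|^2 <= 2 g area. *)
Lemma jump_energy_nu2 K : K \in T -> jump_energy o Omega T u K <= Num.sqrt (2 * g) * nu2 Omega T o u K.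
Proof.
move=> KT; rewrite /nu2 mulrA -sqrtrM; last by rewrite mulr_ge0 // ltW.
rewrite mulr_sumr /jump_energy big_seq [leRHS]big_seq; apply: ler_sum => E EK.
have [_ cd [v s]] := ordered_span tT oT KT EK.
have l0 : 0 < elen o E by rewrite norm2_gt0 // subr_eq0 eq_sym.
have le : elen o E <= Num.sqrt (2 * g * area (tset K)).
  rewrite -(ger0_norm (ltW l0)) -sqrtr_sqr ler_wsqrtr //; apply: le_trans (hg KT s) _.
  by have := ler_wpM2l (ltW g0) (area_span s); lra.
have -> : I01 ((seg (o E).1 (o E).2 (jump Omega T o u E))^`() ^+ 2) = elen o E *
    edge_intg o E (fun x => dot (grad_jump Omega T o u E x) (tangent o E) ^+ 2).
  rewrite (_ : (fun x => _) = peval (cst ((elen o E)^-1 ^+ 2) *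
      dirD ((o E).2 - (o E).1) (jump Omega T o u E) ^+ 2)); last first.
    by apply/funext => x; rewrite tangential_jump pevalM peval_cst pevalXn exprMn.
  rewrite edge_intgE segM seg_cst seg_exp mul_polyC I01Z deriv_seg; field.
  by rewrite gt_eqF.
by apply: ler_wpM2r le; apply: edge_intg_ge0 => x; exact: sqr_ge0.
Qed.

(** Exchange of summation: K' is counted once for each of its three vertices y and each triangle of
    S at y, and a star has at most 8 g triangles. *)
Lemma star_sum (psi : tri R -> R) (S S1 : {fset tri R}) : (forall K, 0 <= psi K) ->
  {subset S <= T} -> {subset S1 <= T} ->
  (forall K K' y, K \in S -> K' \in T -> y \in vertices K -> y \in vertices K' -> K' \in S1) ->
  \sum_(K <- S) \sum_(y <- vertices K) \sum_(K' <- star T y) psi K' <=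
  24 * g * \sum_(K <- S1) psi K.
Proof.
move=> psi0 sS sS1 adj.
pose m K K' : R := \sum_(y <- vertices K' | y \in vertices K) 1.
have m0 K K' : 0 <= m K K' by apply: sumr_ge0.
have e1 K : K \in S -> \sum_(y <- vertices K) \sum_(K' <- star T y) psi K' <=
    \sum_(K' <- S1) psi K' * m K K'.
  move=> KS.
  have -> : \sum_(y <- vertices K) \sum_(K' <- star T y) psi K' =
      \sum_(y <- vertices K) \sum_(K' <- S1) (if y \in vertices K' then psi K' else 0).
    rewrite big_seq [RHS]big_seq; apply: eq_bigr => y yK.
    rewrite -big_mkcond -[RHS]big_filter; apply: perm_big; apply: uniq_perm.
    - exact: fset_uniq.
    - by rewrite filter_uniq.
    move=> K'; rewrite mem_filter in_star andbC; case: (boolP (y \in vertices K')) => //= yK'.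
    apply/idP/idP => [K'T|]; last exact: sS1.
    exact: adj yK yK'.
  rewrite exchange_big /=; apply: ler_sum => K' _.
  rewrite -big_mkcond /= -[leLHS]mulr1 mulr_suml /m mulr_sumr.
  under eq_bigr do rewrite mulr1.
  under [leRHS]eq_bigr do rewrite mulr1.
  rewrite -big_filter -[leRHS]big_filter le_eqVlt; apply/orP; left; apply/eqP.
  apply: perm_big; apply: uniq_perm; try (apply: filter_uniq; exact: fset_uniq).
  by move=> y; rewrite !mem_filter andbC.
rewrite big_seq; apply: le_trans (ler_sum _ e1) _; rewrite -big_seq exchange_big /= mulr_sumr.
rewrite big_seq [leRHS]big_seq; apply: ler_sum => K' K'S1; have K'T := sS1 _ K'S1.
rewrite -mulr_sumr mulrC; apply: ler_wpM2r; first exact: psi0.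
rewrite /m; under eq_bigr do rewrite big_mkcond.
rewrite exchange_big /=; have [z [a [b s]]] := spans_ex (triang_nondeg tT K'T).
apply: (@le_trans _ _ (\sum_(y <- vertices K') 8 * g)); last first.
  by rewrite (proj1 s) sum_vertices; [lra|exact: (proj2 s)].
apply: ler_sum => y _; apply: le_trans (star_size y tT g0 hg).
rewrite -big_mkcond -big_filter big_const_seq count_predT iter_addr_0 ler_nat.
apply: uniq_leq_size; first by apply: filter_uniq; exact: fset_uniq.
by move=> K; rewrite mem_filter in_star => /andP[-> /sS ->].
Qed.

End Estimator.

(** * The energy estimate and the proof of the bound *)

Section Reliability.
Variable R : realType.
Implicit Types (z a b x c d v y : pt R) (K L : tri R) (q p : poly2 R).
Local Notation mR := (measurableTypeR R).
Local Notation mP := (mR * mR)%type.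
Local Notation mu := (leb2 R).
Variables (o : edge R -> pt R * pt R) (Omega : set (pt R)) (T : {fset tri R}) (k : nat).
Hypotheses (hO : polygonal_lipschitz_domain Omega) (tT : triangulation Omega T)
  (oT : edge_ordering Omega T o) (ok : odd k).
Variables (That : {fset tri R}) (fa fb : tri R -> pt R) (ft : tri R -> btree).
Hypotheses (tH : triangulation Omega That) (oH : edge_ordering Omega That o).
Hypothesis F : forest T That fa fb ft.
Variables (f : pt R -> R) (u uhat : tri R -> poly2 R).
Hypotheses (hf : L2 Omega f) (du : discrete_solution Omega T o k f u)
  (dh : discrete_solution Omega That o k f uhat).

Local Notation kl := (kleaves fa fb ft).
Local Notation kJ := (kJ fa fb ft).
Local Notation Dt K := `|Det K.1 (fa K) (fb K)|.

Lemma integrable_kleaf K L (h : pt R -> R) : K \in T -> L \in kl K ->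
  mu.-integrable (tset K)° (EFin \o h) -> mu.-integrable (tset L)° (EFin \o h).
Proof.
move=> KT LK ih; have [KE D0] := forest_tri F KT; rewrite KE in ih.
exact: (integrable_leaf D0 ih LK).
Qed.

Lemma measurable_kleaf K L : K \in T -> L \in kl K -> measurable ((tset L)° : set mP).
Proof.
move=> KT LK; have [a [b [-> D0]]] := nondegenerateP (kleaf_nondeg F KT LK).
exact: measurable_interior.
Qed.

Lemma integrable_load K L p : K \in T -> L \in kl K ->
  mu.-integrable (tset L)° (EFin \o (fun x => f x * peval p x)).
Proof.
move=> KT LK; apply: (integrable_kleaf KT LK).
by have [] := L2_integrable hO tT hf (tame_poly p) KT.
Qed.

Lemma integrable_kpoly K L p : K \in T -> L \in kl K ->
  mu.-integrable (tset L)° (EFin \o peval p).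
Proof.
move=> KT LK; apply: (integrable_kleaf KT LK).
exact: (tame_integrableK tT KT (tame_poly p)).
Qed.

Lemma tame_pwgrad (T1 T2 : {fset tri R}) (v w : tri R -> poly2 R) :
  triangulation Omega T1 -> triangulation Omega T2 ->
  tame (fun x => dot (pwgrad T1 v x) (pwgrad T2 w x)).
Proof.
by move=> t1 t2; apply: tameD; apply: tameM;
  [exact: (tame_pw t1)|exact: (tame_pw t2)|exact: (tame_pw t1)|exact: (tame_pw t2)].
Qed.

Lemma fine_equation (w : tri R -> poly2 R) : CR0 Omega That o k w ->
  \sum_(K <- T) kJ K (fun L => gdot (uhat L) (w L)) =
  \sum_(K <- T) \sum_(L <- kl K) intg (tset L)° (fun x => f x * peval (w L) x).
Proof.
move=> hw; under eq_bigr do rewrite kJ_sum.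
transitivity (intg Omega (fun x => dot (pwgrad That uhat x) (pwgrad That w x))).
  apply/esym; apply: (intg_fine hO tT F (G := fun _ L => peval (gdot (uhat L) (w L)))).
  - by move=> x h; rewrite /dot /= !(pw_fine_outside F _ h) !mul0r addr0.
  - by move=> K KT; apply: (tame_integrableK tT KT); exact: tame_pwgrad.
  - by move=> K L x KT LK Lx; rewrite peval_gdot /dot /= !(pw_fine tH F _ KT LK Lx).
rewrite (proj2 dh w hw); apply: (intg_fine hO tT F (G := fun _ L x => f x * peval (w L) x)).
- by move=> x h; rewrite (pw_fine_outside F _ h) mulr0.
- by move=> K KT; have [] := L2_integrable hO tT hf (tame_pw tH w) KT.
- by move=> K L x KT LK Lx; rewrite (pw_fine tH F _ KT LK Lx).
Qed.

Lemma coarse_equation (p : tri R -> poly2 R) : CR0 Omega T o k p ->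
  \sum_(K <- T) kJ K (fun L => gdot (u K) (p K)) =
  \sum_(K <- T) \sum_(L <- kl K) intg (tset L)° (fun x => f x * peval (p K) x).
Proof.
move=> hp; under eq_bigr do rewrite kJ_sum.
transitivity (intg Omega (fun x => dot (pwgrad T u x) (pwgrad T p x))).
  apply/esym; apply: (intg_fine hO tT F (G := fun K _ => peval (gdot (u K) (p K)))).
  - by move=> x h; rewrite /dot /= !(pw_outside _ h) !mul0r addr0.
  - by move=> K KT; apply: (tame_integrableK tT KT); exact: tame_pwgrad.
  - by move=> K L x KT LK Lx; rewrite peval_gdot /dot /= !(pw_coarse tT F _ KT LK Lx).
rewrite (proj2 du p hp); apply: (intg_fine hO tT F (G := fun K _ x => f x * peval (p K) x)).
- by move=> x h; rewrite (pw_outside _ h) mulr0.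
- by move=> K KT; have [] := L2_integrable hO tT hf (tame_pw tT p) KT.
- by move=> K L x KT LK Lx; rewrite (pw_coarse tT F _ KT LK Lx).
Qed.

Lemma error_split : intg Omega (fun x => norm2 (pwgrad That uhat x - pwgrad T u x) ^+ 2) =
  \sum_(K <- T) kJ K (fun L => gdot (uhat L - u K) (uhat L - u K)).
Proof.
under eq_bigr do rewrite kJ_sum.
apply: (intg_fine hO tT F (G := fun K L => peval (gdot (uhat L - u K) (uhat L - u K)))).
- by move=> x h; rewrite norm2_sqr /= !(pw_outside _ h) !(pw_fine_outside F _ h) subr0 expr0n addr0.
- move=> K KT; apply: (tame_integrableK tT KT).
  have -> : (fun x => norm2 (pwgrad That uhat x - pwgrad T u x) ^+ 2) =
      fun x => (pw That (fun L => dx (uhat L)) x - pw T (fun L => dx (u L)) x) *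
        (pw That (fun L => dx (uhat L)) x - pw T (fun L => dx (u L)) x) +
        (pw That (fun L => dy (uhat L)) x - pw T (fun L => dy (u L)) x) *
        (pw That (fun L => dy (uhat L)) x - pw T (fun L => dy (u L)) x).
    by apply/funext => x; rewrite norm2_sqr /= !expr2.
  have tB (v v' : tri R -> poly2 R) : tame (fun x => pw That v x - pw T v' x) by apply: tameD (tame_pw tH v) (tameN (tame_pw tT v')).
  by apply: tameD; apply: tameM; exact: tB.
- move=> K L x KT LK Lx; rewrite norm2_sqr peval_gdot -!expr2 dxB dyB !pevalB /=.
  by rewrite !(pw_coarse tT F _ KT LK Lx) !(pw_fine tH F _ KT LK Lx).
Qed.

(* Young's inequality with weight s |D|: the scaling in D turns the L2 norm of the interpolation error
   into its energy. *)
Lemma residual_bound K (r : tri R -> poly2 R) (s : R) : K \in T -> 0 < s ->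
  \sum_(L <- kl K) intg (tset L)° (fun x => f x * peval (r L) x) +
    kJ K (fun L => lapl (u K) * r L) <=
  s * Dt K * intg (tset K)° (fun x => (f x + peval (lapl (u K)) x) ^+ 2) +
  (4 * s * Dt K)^-1 * kJ K (fun L => r L ^+ 2).
Proof.
move=> KT s0; have [KE D0] := forest_tri F KT; have Dp : 0 < Dt K by rewrite normr_gt0.
have i2 : mu.-integrable (tset K)° (EFin \o (fun x => (f x + peval (lapl (u K)) x) ^+ 2)).
  by have [] := L2_integrable hO tT hf (tame_poly (lapl (u K))) KT.
have -> : intg (tset K)° (fun x => (f x + peval (lapl (u K)) x) ^+ 2) =
    \sum_(L <- kl K) intg (tset L)° (fun x => (f x + peval (lapl (u K)) x) ^+ 2).
  by rewrite {1}KE; apply: (Rintegral_tree (ft K) D0); rewrite -KE.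
rewrite !kJ_sum !mulr_sumr -!big_split /= big_seq [leRHS]big_seq; apply: ler_sum => L LK.
have mL := measurable_kleaf KT LK; have j2 := integrable_kleaf KT LK i2.
have i1 := integrable_load (r L) KT LK; have i3 := integrable_kpoly (lapl (u K) * r L) KT LK.
have i4 := integrable_kpoly (r L ^+ 2) KT LK.
have j5 : mu.-integrable (tset L)° (EFin \o (fun x => s * Dt K * (f x + peval (lapl (u K)) x) ^+ 2)).
  by have := integrableZl mL (s * Dt K) j2; congr (_.-integrable _ _).
have j6 : mu.-integrable (tset L)° (EFin \o (fun x => (4 * s * Dt K)^-1 * peval (r L ^+ 2) x)).
  by have := integrableZl mL (4 * s * Dt K)^-1 i4; congr (_.-integrable _ _).
rewrite /intg -(RintegralD mL i1 i3) -(RintegralZl _ mL j2) -(RintegralZl _ mL i4).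
rewrite -(RintegralD mL j5 j6); apply: le_Rintegral => //.
- by have := integrableD mL i1 i3; congr (_.-integrable _ _).
- by have := integrableD mL j5 j6; congr (_.-integrable _ _).
move=> x _; rewrite pevalM pevalXn; set G := f x; set l := peval (lapl _) x; set y := peval (r L) x.
have c0 : 0 < s * Dt K by rewrite mulr_gt0.
have -> : (4 * s * Dt K)^-1 * y ^+ 2 = (s * Dt K)^-1 * (2^-1 * y) ^+ 2 by field; rewrite !gt_eqF.
rewrite -mulrDl -subr_ge0.
have -> : s * Dt K * (G + l) ^+ 2 + (s * Dt K)^-1 * (2^-1 * y) ^+ 2 - (G + l) * y =
    (s * Dt K)^-1 * (s * Dt K * (G + l) - 2^-1 * y) ^+ 2 by field; rewrite !gt_eqF.
by rewrite mulr_ge0 ?sqr_ge0 // invr_ge0 ltW.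
Qed.

Variable g : R.
Hypotheses (g0 : 0 < g) (hg : forall K v c d, K \in T -> spans K v c d ->
  norm2 (d - c) ^+ 2 <= g * `|Det v c d|).

Lemma kedge_bounds K : K \in T -> norm2 (fa K - K.1) ^+ 2 <= g * Dt K /\
  norm2 (fb K - K.1) ^+ 2 <= g * Dt K.
Proof.
move=> KT; have s := kspans F KT; split.
  have := hg KT (spans_rot (spans_rot s)); by rewrite Det_rot2.
have := hg KT (spans_swap (spans_rot s)); rewrite Det_flip normrN Det_rot.
congr (_ <= _); rewrite -opprB /norm2 /dot /=; congr (Num.sqrt _ ^+ 2); ring.
Qed.

Lemma kJ_gr K w : K \in T ->
  kJ K (fun L => gr K.1 (fa K) (fb K) (w L)) <= 2 * g * Dt K * kJ K (fun L => gdot (w L) (w L)).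
Proof.
move=> KT; have [ha hb] := kedge_bounds KT; have D0 := proj2 (kspans F KT).
rewrite /kJ -(JtZ _ _ _ D0); apply: (Jt_le D0) => L _ x _ _; rewrite pevalM peval_cst.
exact: gr_le_gdot.
Qed.

Lemma kJ_gdot K w : K \in T ->
  Dt K * kJ K (fun L => gdot (w L) (w L)) <= 2 * g * kJ K (fun L => gr K.1 (fa K) (fb K) (w L)).
Proof.
move=> KT; have [ha hb] := kedge_bounds KT; have D0 := proj2 (kspans F KT).
rewrite /kJ -!(JtZ _ _ _ D0); apply: (Jt_le D0) => L _ x _ _; rewrite !pevalM !peval_cst.
exact: gdot_le_gr.
Qed.

Variables (C : R).
Hypotheses (hC : interpolates k k.+1 C) (C0 : 0 <= C).
Local Notation Rf K := (K \notin That).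

Lemma element_residual K (w : tri R -> poly2 R) (p : tri R -> poly2 R) : K \in T ->
  (ft K = Lf -> p K = w K) ->
  kJ K (fun L => (w L - p K) ^+ 2) <= C * kJ K (fun L => gr K.1 (fa K) (fb K) (w L)) ->
  \sum_(L <- kl K) intg (tset L)° (fun x => f x * peval (w L - p K) x) +
    kJ K (fun L => lapl (u K) * (w L - p K)) <=
  (if Rf K then 4 * (C + 1) * g * mu2 Omega T o u K f else 0) + 4^-1 * kJ K (fun L => gdot (w L) (w L)).
Proof.
move=> KT pE bnd; have [KE D0] := forest_tri F KT.
have G0 : 0 <= kJ K (fun L => gdot (w L) (w L)).
  by apply: (kJ_ge0 F KT) => L x; exact: gdot_ge0.
case: ifPn => [nK|/negbNE /(unrefined_leaf tT F KT) e]; last first.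
  rewrite add0r [leLHS](_ : _ = 0); first by rewrite mulr_ge0.
  have KK : K \in kl K by rewrite /kleaves e inE -KE.
  have s0 : intg (tset K)° (fun=> 0) = 0 :> R.
    by rewrite /intg Rintegral_cst ?mul0r //; exact: measurable_kleaf KK.
  rewrite kJ_sum /kleaves e /= !big_seq1 -KE pE // subrr mulr0.
  rewrite (_ : (fun x => f x * _) = fun=> 0); last by apply/funext => x; rewrite peval0 mulr0.
  by rewrite (_ : peval 0 = fun=> 0) ?s0 ?addr0 //; apply/funext => x; rewrite peval0.
have Dp : 0 < Dt K by rewrite normr_gt0.
have C1 : 0 < C + 1 by exact: ltr_wpDl.
(* This weight makes the interpolation term at most 1/4 of the energy, because of the bound 2 C g
   |D| for the squared error; C + 1 in place of C keeps it positive. *)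
apply: le_trans (residual_bound (fun L => w L - p K) (s := 2 * (C + 1) * g) KT _) _.
  by rewrite !mulr_gt0.
apply: lerD.
  have h1 := area_span (kspans F KT); have h2 := mu2_volume o Omega T u K f.
  set I2 := intg _ _ in h2 *; have I0 : 0 <= I2 by apply: Rintegral_ge0 => x _; exact: sqr_ge0.
  have h3 := ler_wpM2r I0 h1; have h4 := le_trans h3 h2.
  have -> : 2 * (C + 1) * g * Dt K * I2 = 4 * (C + 1) * g * (2^-1 * Dt K * I2) by field.
  by apply: ler_wpM2l h4; rewrite !mulr_ge0 // ltW.
have h := ler_wpM2l C0 (kJ_gr w KT); have {h} := le_trans bnd h.
set I := kJ K _; set I1 := kJ K _ in G0 *; move=> h.
have P0 : 0 < 4 * (2 * (C + 1) * g) * Dt K by rewrite !mulr_gt0.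
rewrite mulrC ler_pdivrMr //; apply: le_trans h _.
have -> : 4^-1 * I1 * (4 * (2 * (C + 1) * g) * Dt K) = (C + 1) * (2 * g * Dt K * I1) by field.
by apply: ler_wpM2r; [rewrite !mulr_ge0 // ltW|lra].
Qed.

(** With r = us - u, the energy of w is the difference of the two discrete equations, tested with w
    and p, minus the integrals of grad u . grad (w - p) and grad r . grad w. The residual and the
    product with r each leave a quarter of the energy; absorbing both gives the factor 2. *)
Lemma energy_bound (us : tri R -> poly2 R) : CR0 Omega That o k us ->
  \sum_(K <- T) kJ K (fun L => gdot (uhat L - us L) (uhat L - us L)) <=
  2 * (\sum_(K <- T) (if Rf K then 4 * (C + 1) * g * mu2 Omega T o u K f else 0) +
       \sum_(K <- T) kJ K (fun L => gdot (us L - u K) (us L - u K))).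
Proof.
move=> hus; pose w L := uhat L - us L; pose r K L := us L - u K.
have hw : CR0 Omega That o k w := CR0_sub hO tH oH (proj1 dh) hus.
have [p [hp pE mom bnd]] := coarse_interpolant hO tT oT tH oH F hw hC C0.
have key : \sum_(K <- T) (kJ K (fun L => gdot (uhat L) (w L)) - kJ K (fun L => gdot (u K) (p K))) =
    \sum_(K <- T) \sum_(L <- kl K) intg (tset L)° (fun x => f x * peval (w L - p K) x).
  rewrite big_split /= sumrN fine_equation // coarse_equation // -sumrN -big_split /=.
  rewrite big_seq [RHS]big_seq; apply: eq_bigr => K KT; rewrite -sumrN -big_split /=.
  rewrite big_seq [RHS]big_seq; apply: eq_bigr => L LK.
  have mL := measurable_kleaf KT LK.
  rewrite /intg -(RintegralB mL (integrable_load (w L) KT LK) (integrable_load (p K) KT LK)).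
  by apply: eq_Rintegral => x _; rewrite pevalB mulrBr.
have loc K : K \in T -> kJ K (fun L => gdot (w L) (w L)) <=
    (kJ K (fun L => gdot (uhat L) (w L)) - kJ K (fun L => gdot (u K) (p K))) +
    (kJ K (fun L => lapl (u K) * (w L - p K)) + (kJ K (fun L => gdot (r K L) (r K L)) +
    4^-1 * kJ K (fun L => gdot (w L) (w L)))).
  move=> KT; have D0 := proj2 (kspans F KT).
  have parts : kJ K (fun L => gdot (u K) (w L - p K)) = - kJ K (fun L => lapl (u K) * (w L - p K)).
    apply: (@Jt_parts _ k); first exact: D0.
    - by apply: compatD; [exact: (kcompat hO tH oH F hw KT)|exact: compat_poly].
    - exact: (proj1 (proj1 du) K KT).
    - by move=> q i; exact: mom.
  have e1 : kJ K (fun L => gdot (uhat L) (w L)) = kJ K (fun L => gdot (w L) (w L)) +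
      (kJ K (fun L => gdot (u K) (p K)) + kJ K (fun L => gdot (u K) (w L - p K)) +
       kJ K (fun L => gdot (r K L) (w L))).
    rewrite /kJ -!(JtD _ _ _ D0); apply: eq_Jt => L _.
    by rewrite gdotBr {1}/w !gdotBl; ring.
  have e2 : 0 <= kJ K (fun L => gdot (r K L) (r K L)) + (kJ K (fun L => gdot (r K L) (w L)) +
      4^-1 * kJ K (fun L => gdot (w L) (w L))).
    rewrite /kJ -(JtZ _ _ _ D0) -!(JtD _ _ _ D0); apply: (kJ_ge0 F KT) => L x.
    rewrite (pevalD (gdot _ _)) (pevalD (gdot _ _)) pevalM peval_cst !peval_gdot.
    set X := peval (dx (r K L)) x; set Y := peval (dy (r K L)) x.
    set X' := peval (dx (w L)) x; set Y' := peval (dy (w L)) x.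
    have := sqr_ge0 (X + 2^-1 * X'); have := sqr_ge0 (Y + 2^-1 * Y'); lra.
  by rewrite e1 parts; lra.
set E := \sum_(K <- T) kJ K (fun L => gdot (w L) (w L)).
set S := \sum_(K <- T) kJ K (fun L => gdot (us L - u K) _).
set M := \sum_(K <- T) (if _ then _ else _).
have h1 : E <= \sum_(K <- T) (kJ K (fun L => gdot (uhat L) (w L)) - kJ K (fun L => gdot (u K) (p K))) +
    (\sum_(K <- T) kJ K (fun L => lapl (u K) * (w L - p K)) + (S + 4^-1 * E)).
  by rewrite mulr_sumr -!big_split /= /E big_seq [leRHS]big_seq; apply: ler_sum => K; exact: loc.
have h2 : \sum_(K <- T) \sum_(L <- kl K) intg (tset L)° (fun x => f x * peval (w L - p K) x) +
    \sum_(K <- T) kJ K (fun L => lapl (u K) * (w L - p K)) <= M + 4^-1 * E.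
  rewrite mulr_sumr -!big_split /= big_seq [leRHS]big_seq; apply: ler_sum => K KT.
  apply: element_residual; [exact: KT|exact: pE|exact: bnd].
by move: h1; rewrite key; lra.
Qed.

Variable chi : {poly R}.
Hypotheses (sc : (size chi <= k.+2)%N) (c0 : chi.[0] = 0) (c1 : chi.[1] = 1)
  (oc : forall q : {poly R}, (size q <= k)%N -> I01 (chi * q) = 0).
Variable C2 : R.
Hypotheses (C20 : 0 <= C2) (hchi : forall dl z a b, Det z a b != 0 ->
  J z a b (gr z a b (corr chi dl z a b)) <= C2 * `|Det z a b| * (dl z ^+ 2 + dl a ^+ 2 + dl b ^+ 2)).

Local Notation je := (jump_energy o Omega T u).

Lemma corrector_bound : exists2 us, CR0 Omega That o k us &
  \sum_(K <- T) kJ K (fun L => gdot (us L - u K) (us L - u K)) <=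
  \sum_(K <- T) (if Rf K then 4 * g ^+ 2 * C * C2 *
    \sum_(y <- vertices K) \sum_(K' <- star T y) je K' else 0).
Proof.
have hu := proj1 du.
have [us [hus usE bnd]] := fine_corrector hO tT oT ok hu sc c0 c1 oc tH oH F hC.
exists us; first exact: hus.
rewrite big_seq [leRHS]big_seq; apply: ler_sum => K KT; have [KE D0] := forest_tri F KT.
case: ifPn => [nK|/negbNE /(unrefined_leaf tT F KT) e]; last first.
  rewrite kJ_sum /kleaves e /= big_seq1 -KE usE // subrr.
  have KK : K \in kl K by rewrite /kleaves e inE -KE.
  have -> : gdot 0 0 = 0 :> poly2 R by have := gdotBl (0 : poly2 R) 0 0; rewrite !subrr.
  rewrite (_ : peval 0 = fun=> 0); last by apply/funext => x; rewrite peval0.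
  by rewrite /intg Rintegral_cst ?mul0r //; exact: measurable_kleaf KK.
have Dp : 0 < Dt K by rewrite normr_gt0.
have ne : ft K <> Lf by move=> e; move: nK; rewrite (leaf_unrefined F KT e).
have h1 := kJ_gdot (fun L => us L - u K) KT.
have h2 : kJ K (fun L => gr K.1 (fa K) (fb K) (us L - u K)) <=
    C * (C2 * Dt K * \sum_(y <- vertices K) vdefect Omega T u K y ^+ 2).
  apply: (@le_trans _ _ (C * kJ K (fun=> kgr fa fb K (defect Omega T u chi fa fb K)))).
    rewrite !kJ_sum mulr_sumr big_seq [leRHS]big_seq; apply: ler_sum => L LK.
    exact: bnd.
  apply: ler_wpM2l; first exact: C0.
  rewrite /kJ -(J_tree _ _ D0); apply: le_trans (hchi _ D0) _.
  by rewrite (proj1 (kspans F KT)) sum_vertices.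
(* 2 g is the bound 8 g for the size of a star, divided by the 4 in [vertex_value_bound]. *)
have h3 : \sum_(y <- vertices K) vdefect Omega T u K y ^+ 2 <=
    2 * g * \sum_(y <- vertices K) \sum_(K' <- star T y) je K'.
  rewrite mulr_sumr big_seq [leRHS]big_seq; apply: ler_sum => y yK.
  have h := vertex_value_bound hO tT oT ok hu KT yK.
  have j0 : 0 <= \sum_(K' <- star T y) je K' by apply: sumr_ge0 => K' _; exact: jump_energy_ge0.
  have := ler_wpM2r j0 (star_size y tT g0 hg); rewrite /vdefect; lra.
rewrite -(ler_pM2l Dp); apply: le_trans h1 _.
set Sg := \sum_(y <- _) \sum_(K' <- _) _ in h3 *; set Sd := \sum_(y <- _) _ in h2 h3.
have g2 : 0 <= 2 * g by rewrite mulr_ge0 // ltW.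
have h4 := ler_wpM2l g2 h2.
apply: le_trans h4 _.
have -> : 2 * g * (C * (C2 * Dt K * Sd)) = 2 * g * C * C2 * Dt K * Sd by ring.
have -> : Dt K * (4 * g ^+ 2 * C * C2 * Sg) = 2 * g * C * C2 * Dt K * (2 * g * Sg) by ring.
by apply: ler_wpM2l h3; rewrite !mulr_ge0 // ltW.
Qed.

Lemma refined_sum (h : tri R -> R) :
  \sum_(K <- T) (if Rf K then h K else 0) = \sum_(K <- refined T That) h K.
Proof.
rewrite -big_mkcond -big_filter; apply: perm_big; apply: uniq_perm.
- by apply: filter_uniq; exact: fset_uniq.
- exact: fset_uniq.
- by move=> K; rewrite mem_filter in_fsetD.
Qed.

Lemma in_refined1 K K' y : K \in refined T That -> K' \in T -> y \in vertices K ->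
  y \in vertices K' -> K' \in refined1 T That.
Proof.
move=> KR KT' yK yK'; rewrite in_fset /= inE KT'; apply/asboolP; exists K => //.
have KT : K \in T by move: KR; rewrite in_fsetD => /andP[].
by exists y; split; apply: vertex_tset => //; exact: (triang_nondeg tT).
Qed.

Lemma refined_sub : {subset refined T That <= refined1 T That}.
Proof.
move=> K KR; have KT : K \in T by move: KR; rewrite in_fsetD => /andP[].
by have [KK _ _] := spans_mem (kspans F KT); exact: (in_refined1 KR KT KK KK).
Qed.

Lemma refined1_sub : {subset refined1 T That <= T}.
Proof. by move=> K; rewrite in_fset /= inE => /andP[]. Qed.

(** The squared error is at most 2 E + 2 S, and E at most twice the residual part plus S, which
    gives 4 residual parts and 6 S. Hence 16 = 4 . 4 and 576 = 6 . 4 . 24, with 24 g from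
    [star_sum]. *)
Lemma reliability : intg Omega (fun x => norm2 (pwgrad That uhat x - pwgrad T u x) ^+ 2) <=
  (16 * (C + 1) * g + 576 * g ^+ 3 * C * C2 * Num.sqrt (2 * g)) *
  \sum_(K <- refined1 T That) eta2 Omega T o u K f.
Proof.
have [us hus Sbnd] := corrector_bound; have Ebnd := energy_bound hus.
rewrite error_split; move: Sbnd Ebnd; rewrite !refined_sum -!mulr_sumr.
set S := \sum_(K <- T) kJ K (fun L => gdot (us L - u K) _).
set E := \sum_(K <- T) kJ K (fun L => gdot (uhat L - us L) _).
set B := \sum_(K <- T) _ => Sbnd Ebnd.
have h1 : B <= 2 * E + 2 * S.
  rewrite !mulr_sumr -big_split /= /B big_seq [leRHS]big_seq; apply: ler_sum => K KT.
  have D0 := proj2 (kspans F KT); rewrite /kJ -!(JtZ _ _ _ D0) -(JtD _ _ _ D0).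
  apply: (Jt_le D0) => L _ x _ _; rewrite (pevalD (cst _ * _)) !(pevalM (cst _)) !peval_cst !peval_gdot.
  rewrite !dxB !dyB !pevalB.
  set a := peval (dx (uhat L)) x; set b := peval (dx (us L)) x; set c := peval (dx (u K)) x.
  set a' := peval (dy (uhat L)) x; set b' := peval (dy (us L)) x; set c' := peval (dy (u K)) x.
  have := sqr_ge0 (a - b - (b - c)); have := sqr_ge0 (a' - b' - (b' - c')); nra.
set Mu := \sum_(K <- refined _ _) mu2 _ _ _ _ _ _ in Ebnd.
set J0 := \sum_(K <- refined _ _) _ in Sbnd.
set Eta := \sum_(K <- _) _.
have hMu : Mu <= Eta.
  apply: le_trans (_ : \sum_(K <- refined1 T That) mu2 Omega T o u K f <= _).
    apply: ler_sum_subset; [exact: fset_uniq|exact: fset_uniq|exact: refined_sub|].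
    by move=> K _; exact: mu2_ge0.
  by apply: ler_sum => K _; rewrite lerDl nu2_ge0.
have hJ : J0 <= 24 * g * (Num.sqrt (2 * g) * Eta).
  apply: le_trans (star_sum tT g0 hg (S1 := refined1 T That) (@jump_energy_ge0 _ o Omega T u) _ refined1_sub _) _.
  - by move=> K; rewrite in_fsetD => /andP[].
  - exact: in_refined1.
  apply: ler_wpM2l; first by rewrite mulr_ge0 // ltW.
  rewrite mulr_sumr big_seq [leRHS]big_seq; apply: ler_sum => K /refined1_sub KT.
  apply: le_trans (jump_energy_nu2 u tT oT g0 hg KT) _; apply: ler_wpM2l; first exact: sqrtr_ge0.
  by rewrite lerDr mu2_ge0.
have C1 : 0 <= 4 * (C + 1) * g by rewrite !mulr_ge0 ?addr_ge0 // ltW.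
have C3 : 0 <= 4 * g ^+ 2 * C * C2 by apply: mulr_ge0 C20; apply: mulr_ge0 C0; apply: mulr_ge0 (sqr_ge0 g); exact: ler0n.
have h2 := ler_wpM2l C1 hMu; have h3 := ler_wpM2l C3 hJ.
apply: le_trans (_ : 4 * (4 * (C + 1) * g * Eta) + 6 * (4 * g ^+ 2 * C * C2 * (24 * g * (Num.sqrt (2 * g) * Eta))) <= _).
  lra.
by rewrite le_eqVlt; apply/orP; left; apply/eqP; ring.
Qed.

End Reliability.

Theorem theorem3p2 (R : realType) (k : nat) (hk : odd k) (gamma : R) :
  exists2 C : R, 0 < C &
  forall (Omega : set (pt R)), polygonal_lipschitz_domain Omega ->
  forall (T : {fset tri R}), triangulation Omega T -> shape_reg T = gamma ->
  forall (That : {fset tri R}), admissible Omega T That ->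
  forall (o : edge R -> pt R * pt R),
    edge_ordering Omega T o -> edge_ordering Omega That o ->
  forall (f : pt R -> R), L2 Omega f ->
  forall u uhat : tri R -> poly2 R,
    discrete_solution Omega T o k f u ->
    discrete_solution Omega That o k f uhat ->
  Num.sqrt (intg Omega
    (fun x => norm2 (pwgrad That uhat x - pwgrad T u x) ^+ 2))
  <= C * eta Omega T o u (refined1 T That) f.
Proof.
have [C C0 hC] := interpolation R k.+1 hk.
have [chi [sc c0 c1 oc]] := edge_bubble R k.
have [C2 C20 hchi] := gr_corr_bound chi.
(* The constant is fixed before the triangulation, for an arbitrary real gamma; this g is positive
   in all cases and at least gamma. *)
pose g := `|gamma| + 1; have g0 : 0 < g by rewrite ltr_wpDl.
pose A := 16 * (C + 1) * g + 576 * g ^+ 3 * C * C2 * Num.sqrt (2 * g).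
have A0 : 0 < A.
  have h1 : 0 < 16 * (C + 1) * g.
    by apply: mulr_gt0 g0; apply: mulr_gt0; [exact: ltr0n|exact: ltr_wpDl].
  apply: ltr_wpDr h1; apply: mulr_ge0; last exact: sqrtr_ge0.
  apply: mulr_ge0 C20; apply: mulr_ge0 C0; apply: mulr_ge0; first exact: ler0n.
  by apply: exprn_ge0; exact: ltW.
exists (Num.sqrt A); first by rewrite sqrtr_gt0.
move=> Omega hO T tT sT That [hn tH] o oT oH f hf u uhat du dh.
have [fa [fb [ft F]]] := nvb_forest (triang_nondeg tT) hn.
have hg K v c d : K \in T -> spans K v c d -> norm2 (d - c) ^+ 2 <= g * `|Det v c d|.
  move=> KT s; apply: le_trans (shape_reg_edge tT KT s) _; rewrite sT.
  apply: ler_wpM2r; first exact: normr_ge0.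
  by rewrite /g (le_trans (ler_norm _)) // lerDl.
rewrite /eta -sqrtrM ?(ltW A0) // ler_wsqrtr //.
exact: (reliability hO tT oT hk tH oH F hf du dh g0 hg hC C0 sc c0 c1 oc C20 hchi).
Qed.
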